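(* Let $(W_\Pi,\Pi)$ be a Coxeter system and let $J\subseteq\Pi$ be a spherical subdiagram. Let $\Gamma_{\min}^\vee$ be the group defined in the context (the subgroup, acting trivially on $J$, of the non-reflection part $\Gamma_{\min}$ of $N_{W_\Pi}(W_J)$). Then $\Gamma_{\min}^\vee$ acts freely on a contractible cell complex of dimension at most $$\#A_1+\#D_{m>4}+\#E_6+\#I_2(5)+2\bigl(\#A_{m>1}+\#D_4\bigr),$$ where $\#X_m$ means the number of components of $J$ isomorphic to the Coxeter diagram $X_m$ (so $\#D_{m>4}$ is the number of components of $J$ of type $D_m$ for some $m>4$, and $\#A_{m>1}$ is the number of components of type $A_m$ for some $m>1$). In particular, the cohomological dimension of $\Gamma_{\min}^\vee$ is at most this number.
   Context: Setting. $(W_\Pi,\Pi)$ is a Coxeter system; its Coxeter diagram has node set $\Pi$, with an edge between $s_i,s_j\in\Pi$ labeled by the order $m_{ij}$ of $s_is_j$ when $m_{ij}>2$. A subdiagram is a subset of $\Pi$ with the induced diagram; it is spherical if the subgroup of $W_\Pi$ it generates is finite. For $J\subseteq\Pi$, $W_J$ is the subgroup generated by $J$. $V_\Pi$ is the real vector space with basis $\Pi$ (the simple roots $\alpha_s$, identified with the generators $s$), with the symmetric bilinear form $(\alpha_{s_i},\alpha_{s_j})=-\cos(\pi/m_{ij})$ ($=1$ if $i=j$, $=-1$ if $m_{ij}=\infty$); $W_\Pi$ acts on $V_\Pi$ isometrically with $s$ acting by the reflection in $\alpha_s$, and acts dually on $V_\Pi^*$. A root is a $W_\Pi$-image of a simple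 root; a reflection in $W_\Pi$ is a conjugate of an element of $\Pi$. The fundamental chamber is $C_\Pi=\{f\in V_\Pi^*: f(\alpha)\ge 0 \text{ for all }\alpha\in\Pi,\ \{\alpha\in\Pi: f(\alpha)=0\}\text{ is spherical}\}$, and $K=W_\Pi\cdot C_\Pi$ is the (open) Tits cone, an open convex subset of $V_\Pi^*$ on which $W_\Pi$ acts properly discontinuously with fundamental chamber $C_\Pi$. For a root $\alpha$, $\alpha^\perp$ is the fixed-point set in $K$ of the reflection associated to $\alpha$ (its mirror). Let $J\subseteq\Pi$ be spherical, regarded also as a set of simple roots, with span $V_J\subseteq V_\Pi$. Put $J^\perp=\bigcap_{\alpha\in J}\alpha^\perp\subseteq K$. $W_{\min}$ is the subgroup of $W_\Pi$ generated by the reflections in $W_\Pi$ that act trivially on $V_J$. $C_{\min}^\circ$ is a chosen component of the complement in $J^\perp$ of the mirrors of $W_{\min}$, and $C_{\min}$ is its closure in $J^\perp$. $\Gamma_{\min}$ is the subgroup of $W_\Pi$ of elements that preserve $J$ (as a set of roots) and send $C_{\min}$ to itself. $\Gamma_{\min}^\vee$ is the subgroup of $\Gamma_{\min}$ acting trivially on $J$ (equivalently, on $V_J$). Types of components are the standard irreducible spherical Coxeter diagrams: $A_m$ ($m\ge1$), $D_m$ ($m\ge4$), $E_6$, and $I_2(5)$ (two nodes joined by an edge labeled $5$). *)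

(* Defs.v *)
From HB Require Import structures.
From mathcomp Require Import all_boot all_order all_algebra finmap.
From mathcomp Require Import all_classical all_reals all_analysis.
(* Only the canonical instances of monalg are imported: its notations clash
   with those of analysis. *)
From mathcomp.multinomials Require monalg.
Import (canonicals) monalg.

Set Implicit Arguments.
Unset Strict Implicit.
Unset Printing Implicit Defensive.

Import Order.TTheory GRing.Theory Num.Theory.
Import numFieldNormedType.Exports.

Local Open Scope classical_set_scope.
Local Open Scope ring_scope.

Definition is_subgroup (G : groupType) (A : set G) : Prop :=
  group_closed (fun x => x \in A).

Definition generated (G : groupType) (A : set G) : set G :=
  smallest (@is_subgroup G) A.

Definition subgroup_type (G : groupType) (A : set G) (hA : is_subgroup A) :=
  {x : G | x \in A}.

Section SubgroupType.
Variables (G : groupType) (A : set G) (hA : is_subgroup A).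

HB.instance Definition _ := SubChoice.on (subgroup_type hA).
HB.instance Definition _ :=
  SubChoice_isSubGroup.Build G (fun x => x \in A) (subgroup_type hA) hA.

End SubgroupType.

(* The order of [x], with the convention that 0 stands for infinite order. *)
Definition elt_order (G : groupType) (x : G) : nat :=
  xget 0%N [set n | [/\ (0 < n)%N, (x ^+ n = 1)%g &
                      forall k, (0 < k < n)%N -> (x ^+ k <> 1)%g]].

Section Coxeter.
Variables (Pi : choiceType) (W : groupType) (gen : Pi -> W).

(* 0 stands for the label infinity. *)
Definition cox_m (i j : Pi) : nat := elt_order (gen i * gen j)%g.

(* The last clause is the universal property of the presentation
   < Pi | (s_i s_j)^m_ij = 1 >; for m_ij = 0, i.e. infinity, the relation
   x ^+ 0 = 1 is void. *)
Definition coxeter_system : Prop :=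
  [/\ injective gen,
      forall i, elt_order (gen i) = 2%N,
      generated (range gen) = setT
    & forall (G : groupType) (f : Pi -> G),
        (forall i j, ((f i * f j) ^+ cox_m i j = 1)%g) ->
        exists phi : {multiplicative W -> G}, forall i, phi (gen i) = f i].

Definition parabolic (J : set Pi) : set W := generated (gen @` J).

Definition spherical (J : set Pi) : Prop := finite_set (parabolic J).

Definition cox_edge (i j : Pi) : bool := (cox_m i j == 0%N) || (2 < cox_m i j)%N.

Definition component_of (J : set Pi) (i : Pi) : set Pi :=
  [set j | exists p : seq Pi,
     path (fun a b => cox_edge a b && (b \in J)) i p /\ last i p = j].

Definition is_component (J X : set Pi) : Prop :=
  exists2 i, J i & X = component_of J i.

(* [X], with the induced diagram, is isomorphic to the diagram with nodes
   0, ..., n-1 and labels [M i j]. *)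
Definition diagram_iso (n : nat) (M : nat -> nat -> nat) (X : set Pi) : Prop :=
  exists f : 'I_n -> Pi,
    [/\ injective f, range f = X & forall i j, cox_m (f i) (f j) = M i j].

(* The set is finite for spherical J, as J is then finite; [fset_set] would
   otherwise return the empty set. *)
Definition num_components (J : set Pi) (P : set Pi -> Prop) : nat :=
  #|` fset_set [set X | is_component J X /\ P X] |%fset.

End Coxeter.

Definition labels (lab : nat) (e : rel nat) (i j : nat) : nat :=
  (if i == j then 1 else if e i j || e j i then lab else 2)%N.

Definition chain (i j : nat) : bool := i.+1 == j.

Section Types.
Variables (Pi : choiceType) (W : groupType) (gen : Pi -> W).

Definition type_A (m : nat) := diagram_iso gen m (labels 3 chain).

(* The chain 0 - ... - (m-2), and m-1 attached to m-3. *)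
Definition type_D (m : nat) := diagram_iso gen m (labels 3 (fun i j =>
  (chain i j && (j < m.-1)%N) || ((i == (m - 3)%N) && (j == m.-1)))).

(* The chain 0 - ... - 4, and 5 attached to 2. *)
Definition type_E6 := diagram_iso gen 6 (labels 3 (fun i j =>
  (chain i j && (j < 5)%N) || ((i == 2%N) && (j == 5%N)))).

Definition type_I2_5 := diagram_iso gen 2 (labels 5 chain).

Definition dim_bound (J : set Pi) : nat :=
  (num_components gen J (type_A 1)
   + num_components gen J (fun X => exists2 m, (4 < m)%N & type_D m X)
   + num_components gen J type_E6
   + num_components gen J type_I2_5
   + 2 * (num_components gen J (fun X => exists2 m, (1 < m)%N & type_A m X)
          + num_components gen J (type_D 4)))%N.

End Types.

(* V_Pi, realized as the finitely supported functions Pi -> R. *)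
Definition rootspace (R : realType) (Pi : choiceType) : lmodType R :=
  monalg.malg Pi R.

(* All functions V_Pi -> R, with the topology of pointwise convergence; the dual
   V_Pi^* is the subspace [dual] of linear ones. For finite Pi this induces the
   usual topology of the finite-dimensional space V_Pi^*. *)
Definition functionals (R : realType) (Pi : choiceType) : topologicalType :=
  {ptws rootspace R Pi -> R}.

Section Geometry.
Variables (R : realType) (Pi : choiceType) (W : groupType) (gen : Pi -> W).

Let V := rootspace R Pi.
Let F := functionals R Pi.

Definition simple_root (i : Pi) : V := monalg.mkmalgU i 1.

Definition cox_form (i j : Pi) : R :=
  if cox_m gen i j == 0%N then -1 else - cos (pi / (cox_m gen i j)%:R).

Definition form (u v : V) : R :=
  \sum_(i <- monalg.msupp u) \sum_(j <- monalg.msupp v)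
    monalg.mcoeff i u * monalg.mcoeff j v * cox_form i j.

Definition simple_reflection (i : Pi) (v : V) : V :=
  v - (2 * form v (simple_root i)) *: simple_root i.

Definition is_action (rho : W -> V -> V) : Prop :=
  rho 1%g = id /\ forall x y, rho (x * y)%g = rho x \o rho y.

(* The action of W on V in which every [gen i] acts by [simple_reflection i].
   In a Coxeter system it exists and is unique; the default value of [xget] is
   the trivial action. *)
Definition geom_rep : W -> V -> V :=
  xget ((fun _ => id) : W -> V -> V)
    [set rho | is_action rho /\ forall i, rho (gen i) = simple_reflection i].

Definition dual_act (w : W) (f : F) : F := fun v : V => f (geom_rep w^-1%g v).

Lemma geom_rep_action : is_action geom_rep.
Proof. by rewrite /geom_rep; case: xgetP => [rho _ []|]. Qed.

Definition dual : set F := [set f : F | scalar (f : V -> R)].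

Definition chamber : set F :=
  [set f : F | [/\ dual f, forall i, 0 <= f (simple_root i) :> R
                 & spherical gen [set i | f (simple_root i) = 0 :> R]]].

Definition tits_cone : set F :=
  [set f | exists w f0, chamber f0 /\ f = dual_act w f0].

Definition is_reflection (r : W) : Prop :=
  exists w i, r = (w * gen i * w^-1)%g.

(* For r the reflection associated to a root alpha, this is alpha^perp. *)
Definition mirror (r : W) : set F := [set f | tits_cone f /\ dual_act r f = f].

Variable J : set Pi.

Definition V_J : set V := [set v | forall i, i \in monalg.msupp v -> J i].

Definition J_perp : set F :=
  [set f | tits_cone f /\ forall i, J i -> mirror (gen i) f].

Definition W_min : set W :=
  generated [set r | is_reflection r /\ forall v, V_J v -> geom_rep r v = v].

Definition W_min_complement : set F :=
  J_perp `\` \bigcup_(r in [set r | is_reflection r /\ W_min r]) mirror r.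

Definition is_C_min_open (C : set F) : Prop :=
  exists2 f, W_min_complement f & C = connected_component W_min_complement f.

Definition C_min (Co : set F) : set F := closure Co `&` J_perp.

Definition gamma_min (Co : set F) : set W :=
  [set w | geom_rep w @` (simple_root @` J) = simple_root @` J
           /\ dual_act w @` C_min Co = C_min Co].

Definition gamma_min_vee (Co : set F) : set W :=
  [set w | gamma_min Co w
           /\ forall i, J i -> geom_rep w (simple_root i) = simple_root i].

Lemma dual_act1 f : dual_act 1%g f = f.
Proof.
by apply/funext => v; rewrite /dual_act invg1 geom_rep_action.1.
Qed.

Lemma dual_actM x y f : dual_act (x * y)%g f = dual_act x (dual_act y f).
Proof.
by apply/funext => v; rewrite /dual_act invgM geom_rep_action.2.
Qed.

Lemma gamma_min_vee_subgroup (Co : set F) : is_subgroup (gamma_min_vee Co).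
Proof.
have [r1 rM] := geom_rep_action.
have im_inv T (h : W -> T -> T) (B : set T) y : (forall t, h 1%g t = t) ->
    (forall a b t, h (a * b)%g t = h a (h b t)) ->
    h y @` B = B -> h y^-1%g @` B = B.
  move=> h1 hM hy; rewrite -[in LHS]hy image_comp.
  rewrite (_ : _ \o _ = id) ?image_id//.
  by apply/funext => t /=; rewrite -hM mulVg.
have im_mul T (h : W -> T -> T) (B : set T) x y :
    (forall a b t, h (a * b)%g t = h a (h b t)) ->
    h x @` B = B -> h y @` B = B -> h (x * y)%g @` B = B.
  move=> hM hx hy; rewrite -[RHS]hx -[in RHS]hy image_comp.
  by congr (_ @` _); apply/funext => t /=.
have r1' t : geom_rep 1%g t = t by rewrite r1.
have rM' a b t : geom_rep (a * b)%g t = geom_rep a (geom_rep b t) by rewrite rM.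
split.
  rewrite inE; split=> //; split.
    by rewrite r1 image_id.
  by rewrite (_ : dual_act 1 = id) ?image_id//; apply/funext/dual_act1.
move=> x y; rewrite !inE => -[[xJ xC] xf] [[yJ yC] yf]; split.
  split; first by apply: im_mul => //; apply: im_inv.
  apply: im_mul => //; first exact: dual_actM.
  by apply: im_inv => //; [exact: dual_act1|exact: dual_actM].
by move=> i Ji; rewrite rM' -[in LHS](yf i Ji) -(rM' y^-1%g y) mulVg r1' xf.
Qed.

Definition Gamma_min_vee (Co : set F) : groupType :=
  subgroup_type (gamma_min_vee_subgroup Co).

End Geometry.

Definition disk (R : realType) (n : nat) : set 'rV[R]_n :=
  [set x | \sum_i x 0 i ^+ 2 <= 1].

Definition open_disk (R : realType) (n : nat) : set 'rV[R]_n :=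
  [set x | \sum_i x 0 i ^+ 2 < 1].

Definition sphere (R : realType) (n : nat) : set 'rV[R]_n :=
  [set x | \sum_i x 0 i ^+ 2 = 1].

(* Candidate cells of a complex on X: the characteristic map of a cell [e] is
   the restriction of [char_map e] to the closed disk. *)
Record cells (R : realType) (X : topologicalType) := Cells {
  cell :> Type;
  cell_dim : cell -> nat;
  char_map : forall e : cell, 'rV[R]_(cell_dim e) -> X }.

Arguments char_map {R X} c e _ : rename.

Section CellComplex.
Variables (R : realType) (X : topologicalType) (K : cells R X).

Definition open_cell (e : K) : set X := char_map K e @` @open_disk R (cell_dim e).

Definition closed_cell (e : K) : set X := char_map K e @` @disk R (cell_dim e).

(* CW complex, in the sense of Whitehead. As X is Hausdorff and the disks are
   compact, the characteristic maps restrict to homeomorphisms from the open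
   disks to the open cells. *)
Definition is_cell_complex : Prop :=
  [/\ hausdorff_space X,
      forall e : K, {within @disk R (cell_dim e), continuous (char_map K e)}
        /\ set_inj (@open_disk R (cell_dim e)) (char_map K e),
      forall x : X, exists! e : K, open_cell e x,
      forall e : K, exists2 S : set K, finite_set S &
        (forall e', S e' -> (cell_dim e' < cell_dim e)%N) /\
        char_map K e @` @sphere R (cell_dim e) `<=` \bigcup_(e' in S) open_cell e'
    & forall A : set X, (forall e : K, closed (A `&` closed_cell e)) ->
        closed A].

Definition dim_at_most (n : nat) : Prop := forall e : K, (cell_dim e <= n)%N.

Definition is_cellular_action (G : groupType) (act : G -> X -> X) : Prop :=
  [/\ act 1%g = id,
      forall g h, act (g * h)%g = act g \o act h,
      forall g, continuous (act g)
    & forall g (e : K), exists2 e' : K, cell_dim e' = cell_dim e &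
        act g @` open_cell e = open_cell e'].

End CellComplex.

Definition contractible (R : realType) (X : topologicalType) : Prop :=
  exists H : X * R -> X,
    [/\ {within [set: X] `*` `[0, 1], continuous H},
        forall x, H (x, 0) = x
      & exists x0, forall x, H (x, 1) = x0].

Definition acts_freely (G : groupType) (X : Type) (act : G -> X -> X) : Prop :=
  forall g x, act g x = x -> g = 1%g.

(* A module over the integral group ring of G. *)
Record gmodule (G : groupType) := GModule {
  gmod_sort :> zmodType;
  gmod_act : G -> gmod_sort -> gmod_sort;
  gmod_actD : forall g, {morph gmod_act g : x y / x + y};
  gmod_act1 : forall x, gmod_act 1%g x = x;
  gmod_actM : forall g h x, gmod_act (g * h)%g x = gmod_act g (gmod_act h x) }.

Definition trivial_gmodule (G : groupType) : gmodule G :=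
  @GModule G int (fun _ x => x) (fun _ _ _ => erefl) (fun=> erefl)
    (fun _ _ _ => erefl).

Definition is_ghom (G : groupType) (M N : gmodule G) (f : M -> N) : Prop :=
  {morph f : x y / x + y} /\
  forall g x, f (gmod_act g x) = gmod_act g (f x).

Definition projective (G : groupType) (P : gmodule G) : Prop :=
  forall (M N : gmodule G) (p : M -> N) (f : P -> N),
    is_ghom p -> is_ghom f -> (forall y, exists x, p x = y) ->
    exists2 k : P -> M, is_ghom k & forall x, p (k x) = f x.

(* The trivial module Z has a projective resolution
   0 -> P_n -> ... -> P_0 -> Z -> 0 over the integral group ring of G. *)
Definition cd_at_most (G : groupType) (n : nat) : Prop :=
  exists (P : nat -> gmodule G) (d : forall k, P k.+1 -> P k)
    (eps : P 0 -> trivial_gmodule G),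
    [/\ forall k, projective (P k) /\ is_ghom (@d k),
        is_ghom eps /\ (forall z, exists x, eps x = z),
        forall x, eps x = 0 <-> exists y, d 0 y = x,
        forall k (x : P k.+1), d k x = 0 <-> exists y, d k.+1 y = x
      & forall k, (n < k)%N -> forall x : P k, x = 0].

(* Main.v *)
(* The chamber of W_min containing C_min is cut by the mirrors into strata, the
   classes of points at which every root has the same sign; the complex is the
   order complex of this poset.  It collapses to a vertex along an acyclic
   perfect matching of its simplices, built from the gallery distance to a fixed
   stratum; this gives both contractibility and exactness of the chain complex.
   Stabilizers are trivial, since an element fixing a stratum lies in a spherical
   parabolic subgroup containing W_J and fixes J and a point off the mirrors of
   all roots orthogonal to J.
   A chain of strata lies in the star of a stratum, where the roots vanishing form
   the root system of a spherical T containing J up to conjugacy, and its length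
   is at most #|T| - #|J| + 1.  No root of T is orthogonal to J, and removing the
   components X of J one at a time from a configuration of roots with the angles
   of a Coxeter diagram, replacing the neighbours of X by roots orthogonal to X,
   costs at most the weight of X: an irreducible spherical diagram can absorb only
   few neighbours. *)
From HB Require Import structures.
Require Import Defs.
From mathcomp Require Import all_boot all_order all_algebra finmap.
From mathcomp Require Import all_classical all_reals all_analysis.
From mathcomp.multinomials Require monalg.
From mathcomp Require Import zify ring lra.
Import (canonicals) monalg.

Set Implicit Arguments.
Unset Strict Implicit.
Unset Printing Implicit Defensive.

Import Order.TTheory GRing.Theory Num.Theory.
Import numFieldNormedType.Exports.

Local Open Scope classical_set_scope.
Local Open Scope ring_scope.

(** One acyclic matching does two jobs: read topologically it is a collapse of the order complex,
    read algebraically it proves the augmented chain complex exact. Both readings see it only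
    through a rank function on simplices. It can be built because strata compose like covectors of
    an oriented matroid: each stratum determines a chamber on its far side from the base, the strata
    with the same far chamber have a largest member, and the strata below a given one have a unique
    nearest member. The dimension count cannot stay among simple roots: when a component X of J is
    removed, neighbours of X are traded for roots orthogonal to X, which are combinations of several
    simple roots. Hence the induction runs over sets of roots in a pointed cone where the form is
    positive. The weight of X bounds the surplus of neighbours over orthogonal roots gained. A_1 may
    have three neighbours, but in the resulting D_4 two orthogonal roots come back; a neighbour of
    E_7 completes E_8, whose highest root is orthogonal to E_7, so E_7 is free. The types missing
    from the bound cost nothing for this reason or because they admit no neighbour. *)

Section Matching.
Variables (P : choiceType) (simp : {fset P} -> Prop).
Variables (mu : {fset P} -> {fset P}) (rk : {fset P} -> nat).
Local Open Scope fset_scope.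

(** If the empty simplex satisfies [simp], it is matched too, with a vertex, so that nothing stays
    critical. Acyclicity is [pm_rk_lt]: [rk] is constant on pairs and drops on each facet of an
    upper simplex other than its partner. *)
Record perfect_matching : Prop := PerfectMatching {
  pm_face : forall s t, simp t -> s `<=` t -> simp s;
  pm_simp : forall s, simp s -> simp (mu s);
  pmK : forall s, simp s -> mu (mu s) = s;
  pm_toggle : forall s, simp s -> exists v,
    (v \notin s /\ mu s = v |` s) \/ (v \in s /\ mu s = s `\ v);
  pm_rk : forall s, simp s -> rk (mu s) = rk s;
  pm_rk_lt : forall t u, simp t -> mu t `<=` t -> u \in t -> t `\ u <> mu t ->
    (rk (t `\ u) < rk t)%N }.

Hypothesis pm : perfect_matching.

Lemma pm_upper_or_lower s : simp s ->
  (exists2 v, v \notin s & mu s = v |` s) \/ (exists2 v, v \in s & mu s = s `\ v).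
Proof. by move=> /(pm_toggle pm)[v [[h1 h2]|[h1 h2]]]; [left|right]; exists v. Qed.

(** Extends [pm_rk_lt] to all faces: the upper one of [t] and [mu t] has a facet that contains [s]
    and is not its partner, hence is of smaller rank, and induction on the rank continues from that
    facet. *)
Lemma rk_face_lt s t : simp t -> s `<=` t -> s <> t -> s <> mu t -> (rk s < rk t)%N.
Proof.
have [n] := ubnP (rk t); elim: n => // n IH in s t *.
rewrite ltnS => rkn st sst snt snm.
have mono t' : (rk t' < rk t)%N -> simp t' -> s `<=` t' -> (rk s < rk t)%N.
  move=> lt' st' ss'; apply: leq_ltn_trans (lt').
  have [->//|/eqP n1] := eqVneq s t'.
  have [->|/eqP n2] := eqVneq s (mu t'); first by rewrite (pm_rk pm).
  by apply/ltnW; apply: IH => //; apply: leq_trans rkn.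
have [u ut us] : exists2 u, u \in t & u \notin s.
  by apply/fsubsetPn/negP => tss; apply: snt; apply/eqP; rewrite eqEfsubset sst.
have fs w : simp (t `\ w) by apply: (pm_face pm) st _; exact: fsubD1set.
have [[v vt mut]|[v vt mut]] := pm_upper_or_lower st.
  have mutu : mu t `\ u <> mu (mu t).
    rewrite (pmK pm)// => /fsetP/(_ u); rewrite !inE eqxx/= ut => /esym; discriminate.
  apply: (mono (mu t `\ u)).
  - rewrite -(pm_rk pm st); apply: (pm_rk_lt pm) => //.
    + exact: (pm_simp pm).
    + by rewrite (pmK pm)// mut fsubsetUr.
    + by rewrite mut !inE ut orbT.
  - by apply: (pm_face pm) (pm_simp pm st) _; exact: fsubD1set.
  - by rewrite fsubsetD1 us andbT mut (fsubset_trans sst) ?fsubsetU1.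
have up : mu t `<=` t by rewrite mut fsubD1set.
have [vu|/eqP vu] := eqVneq (t `\ u) (mu t).
  have [w wt ws] : exists2 w, w \in t `\ u & w \notin s.
    apply/fsubsetPn/negP => tss; apply: snm; rewrite -vu; apply/eqP.
    by rewrite eqEfsubset tss fsubsetD1 sst us.
  have [wu wt'] : w != u /\ w \in t by move: wt; rewrite !inE => /andP[].
  apply: (mono (t `\ w)) => //.
    apply: (pm_rk_lt pm) => //; rewrite -vu => /fsetP/(_ u).
    by rewrite !inE ut eqxx eq_sym wu.
  by rewrite fsubsetD1 ws andbT.
by apply: (mono (t `\ u)); [exact: (pm_rk_lt pm)|exact: fs|rewrite fsubsetD1 us andbT].
Qed.

Lemma rk_face s t : simp t -> s `<=` t -> (rk s <= rk t)%N.
Proof.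
move=> st sst; have [->//|/eqP n1] := eqVneq s t.
have [->|/eqP n2] := eqVneq s (mu t); first by rewrite (pm_rk pm).
by apply/ltnW; apply: rk_face_lt.
Qed.

Lemma rk_face_eq s t : simp t -> s `<=` t -> (rk t <= rk s)%N -> s <> t -> s = mu t.
Proof.
move=> st sst le snt; have [//|/eqP n] := eqVneq s (mu t).
by have := rk_face_lt st sst snt n; rewrite ltnNge le.
Qed.

End Matching.

(** * Free abelian groups, as finitely supported integer functions *)

Section FreeAbelian.
Variables (K : choiceType).
Local Notation A := (monalg.malg K int).
Local Notation "x @_ k" := (monalg.mcoeff k x) (at level 3, k at level 2).
Implicit Types (x y : A) (M : zmodType).

Definition free_gen (k : K) : A := monalg.mkmalgU k 1.

Definition free_ext M (f : K -> M) x : M :=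
  \sum_(k <- monalg.msupp x) f k *~ x@_k.

Lemma free_extEw M (f : K -> M) x (d : {fset K}) :
  (monalg.msupp x `<=` d)%fset -> free_ext f x = \sum_(k <- d) f k *~ x@_k.
Proof.
move=> h; apply: big_fset_incl => // k _ kx.
by rewrite monalg.mcoeff_outdom.
Qed.

Lemma free_ext_is_additive M (f : K -> M) : {morph free_ext f : x y / x - y}.
Proof.
move=> x y; pose d := (monalg.msupp x `|` monalg.msupp y)%fset.
rewrite !(@free_extEw _ _ _ d) ?fsubsetUl ?fsubsetUr ?monalg.msuppB_le//.
rewrite -sumrB; apply: eq_bigr => k _ /=; by rewrite monalg.mcoeffB mulrzBr.
Qed.

HB.instance Definition _ M (f : K -> M) :=
  GRing.isZmodMorphism.Build A M (free_ext f) (free_ext_is_additive f).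

Lemma free_ext_gen M (f : K -> M) k : free_ext f (free_gen k) = f k.
Proof. by rewrite /free_ext monalg.msuppU oner_eq0 big_seq_fset1 monalg.mcoeffUU. Qed.

Lemma free_genE x : x = \sum_(k <- monalg.msupp x) free_gen k *~ x@_k.
Proof.
rewrite {1}[x]monalg.monalgE; apply: eq_bigr => k _.
by rewrite -[RHS](raddfMz (monalg.mkmalgU k)) intz.
Qed.

Lemma coef_free_gen k l : (free_gen k)@_l = (k == l)%:R :> int.
Proof. by rewrite /free_gen monalg.mcoeffU; case: eqP. Qed.

Lemma free_additive_eq M (f g : A -> M) x :
  {morph f : x y / x - y} -> {morph g : x y / x - y} ->
  {in monalg.msupp x, forall k, f (free_gen k) = g (free_gen k)} -> f x = g x.
Proof.
move=> fD gD fg.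
pose F : {additive A -> M} := HB.pack f (GRing.isZmodMorphism.Build A M f fD).
pose G : {additive A -> M} := HB.pack g (GRing.isZmodMorphism.Build A M g gD).
rewrite -[f]/(F : A -> M) -[g]/(G : A -> M) [x]free_genE !raddf_sum.
by apply: eq_big_seq => k kx; rewrite !raddfMz /= fg.
Qed.

End FreeAbelian.

(** * The simplicial boundary *)

Section Boundary.
Variables (P : choiceType) (lt : rel P).
Local Notation A := (monalg.malg {fset P} int).
Local Notation "x @_ k" := (monalg.mcoeff k x) (at level 3, k at level 2).
Local Open Scope fset_scope.
Implicit Types (s t : {fset P}) (x y z : A).

(** The vertices are ordered by a global relation instead of an orientation chosen for each simplex;
    a group that preserves the relation then acts on chains without signs. *)
Definition bd_sign s v : int := (-1) ^+ #|` [fset u in s | lt u v]|.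

Definition bd_gen s : A := \sum_(v <- s) free_gen (s `\ v) *~ bd_sign s v.

Definition bd : A -> A := free_ext bd_gen.

HB.instance Definition _ := GRing.Additive.on bd.

Lemma bd_sign2 s v : bd_sign s v * bd_sign s v = 1.
Proof. by rewrite /bd_sign -expr2 sqrr_sign. Qed.

Lemma coef_bd_gen s t :
  (bd_gen s)@_t = \sum_(v <- s | s `\ v == t) bd_sign s v.
Proof.
rewrite raddf_sum [RHS]big_mkcond /=; apply: eq_bigr => v _.
by rewrite raddfMz /= coef_free_gen; case: eqP => _; rewrite ?mul0rz// intz.
Qed.

Lemma coef_bd_gen_face s v : v \in s -> (bd_gen s)@_(s `\ v) = bd_sign s v.
Proof.
move=> vs; rewrite coef_bd_gen big_mkcond (big_fsetD1 v)//= eqxx big1_fset ?addr0// => u.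
rewrite !inE => /andP[uv us] _; case: eqP => // /fsetP/(_ u).
by rewrite !inE eqxx uv us.
Qed.

Lemma coef_bd_gen_eq0 s t : (forall v, v \in s -> s `\ v <> t) -> (bd_gen s)@_t = 0.
Proof.
by move=> h; rewrite coef_bd_gen big1_fset// => v vs /eqP /(h v vs).
Qed.

(** Exchanging the two deleted vertices changes the sign of a term, so the double sum equals its own
    opposite, and there is no 2-torsion. *)
Lemma bd_bd_gen s :
  {in s &, forall u v, u != v -> lt u v = ~~ lt v u} -> bd (bd_gen s) = 0.
Proof.
move=> tour; rewrite raddf_sum /=.
pose T v u : A := free_gen (s `\ v `\ u) *~ (bd_sign (s `\ v) u * bd_sign s v).
have rw v : bd (free_gen (s `\ v) *~ bd_sign s v) = \sum_(u <- s | u != v) T v u.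
  rewrite raddfMz /= /bd free_ext_gen /bd_gen.
  rewrite mulrz_suml; transitivity (\sum_(u <- s `\ v) T v u).
    by apply: eq_bigr => u _; rewrite /T mulrzA.
  by apply: eq_fbigl_cond => u; rewrite !inE/= andbT andbC.
under eq_bigr => v _ do rewrite rw.
have TN u v : u \in s -> v \in s -> u != v -> T u v = - T v u.
  move=> us vs uv; rewrite /T; have -> : s `\ u `\ v = s `\ v `\ u.
    by apply/fsetP => w; rewrite !inE; case: (w == u); case: (w == v).
  rewrite -mulrNz; congr (_ *~ _).
  have card a b : a \in s -> a != b ->
     #|` [fset w in s | lt w b]| = (lt a b + #|` [fset w in s `\ a | lt w b]|)%N.
    move=> as_ ab; case: (boolP (lt a b)) => lab.
      rewrite (cardfsD1 a) !inE/= as_ lab; congr (1 + _)%N; congr #|` _|.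
      by apply/fsetP => w; rewrite !inE/= andbA.
    rewrite add0n; congr #|` _|; apply/fsetP => w; rewrite !inE/=.
    by case: eqP => // ->; rewrite (negbTE lab) andbF.
  rewrite /bd_sign (card v u vs) ?(card u v us)// 1?eq_sym// -!exprD.
  rewrite (tour u v)//; case: (lt v u) => /=; rewrite ?add0n ?add1n.
    by rewrite addnS exprS mulN1r addnC.
  by rewrite addnS exprS mulN1r opprK addnC.
set S := \sum_(v <- s) _; suff SN : S = - S.
  apply/monalg.malgP => k; move/(congr1 (monalg.mcoeff k)): SN.
  by rewrite monalg.mcoeffN monalg.mcoeff0; lia.
rewrite {1}/S (exchange_big_dep xpredT)//= -sumrN; apply: eq_big_seq => v vs.
rewrite -sumrN big_seq_cond [RHS]big_seq_cond.
rewrite (eq_bigl (fun i => (i \in s) && (i != v))); last first.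
  by move=> i; rewrite eq_sym.
by apply: eq_bigr => u /andP[us uv]; exact: TN.
Qed.

End Boundary.

(** * Exactness of the augmented chain complex of a matched complex *)

Section Exactness.
Variables (P : choiceType) (lt : rel P) (simp : {fset P} -> Prop).
Variables (mu : {fset P} -> {fset P}) (rk : {fset P} -> nat).
Hypothesis pm : perfect_matching simp mu rk.
Hypothesis tour : forall s, simp s ->
  {in s &, forall u v, u != v -> lt u v = ~~ lt v u}.
Local Notation A := (monalg.malg {fset P} int).
Local Notation "x @_ k" := (monalg.mcoeff k x) (at level 3, k at level 2).
Local Notation bd := (@bd P lt).
Local Notation bd_gen := (@bd_gen P lt).
Local Open Scope fset_scope.

(** The degree counts vertices, not dimension: degree 0 is the augmentation term, spanned by the
    empty simplex. *)
Definition is_chain n (x : A) : Prop :=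
  forall s, s \in monalg.msupp x -> simp s /\ #|` s| = n.

Lemma msupp_sum (I : choiceType) (r : seq I) (p : pred I) (F : I -> A) s :
  s \in monalg.msupp (\sum_(i <- r | p i) F i) ->
  exists2 i, (i \in r) && p i & s \in monalg.msupp (F i).
Proof.
move=> h; apply: contrapT => no; move: h; rewrite -monalg.mcoeff_neq0 raddf_sum.
rewrite big_seq_cond big1 ?eqxx// => i ip /=.
apply/eqP; rewrite monalg.mcoeff_eq0; apply/negP => is_; apply: no; by exists i.
Qed.

Lemma msuppMz (x : A) n s : s \in monalg.msupp (x *~ n) -> s \in monalg.msupp x.
Proof.
rewrite -!monalg.mcoeff_neq0 raddfMz /=; apply: contra => /eqP ->.
by rewrite mul0rz.
Qed.

Lemma msupp_free_gen (k s : {fset P}) : s \in monalg.msupp (free_gen k) -> s = k.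
Proof. by rewrite monalg.msuppU oner_eq0 inE => /eqP. Qed.

Lemma msupp_bd_gen s t : t \in monalg.msupp (bd_gen s) -> exists2 v, v \in s & t = s `\ v.
Proof.
by move=> /msupp_sum[v]; rewrite andbT => vs /msuppMz/msupp_free_gen ->; exists v.
Qed.

Lemma coef_bd x t : (bd x)@_t = \sum_(s <- monalg.msupp x) x@_s * (bd_gen s)@_t.
Proof.
rewrite raddf_sum; apply: eq_bigr => s _ /=.
by rewrite raddfMz /= -mulrzl intz.
Qed.

Lemma bd_bd n x : is_chain n x -> bd (bd x) = 0.
Proof.
move=> cx; pose z (x : A) : A := 0.
rewrite (_ : bd (bd x) = (bd \o bd) x)//.
apply: (@free_additive_eq _ _ (bd \o bd) z).
- by move=> u v /=; rewrite !raddfB.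
- by move=> u v; rewrite /z subr0.
- by move=> s /cx[ss _] /=; rewrite [bd (free_gen s)]free_ext_gen bd_bd_gen //; exact: tour.
Qed.

Lemma is_chainB n x y : is_chain n x -> is_chain n y -> is_chain n (x - y).
Proof.
move=> cx cy s /(fsubsetP (monalg.msuppB_le _ _)); rewrite in_fsetU => /orP[]; [exact: cx|exact: cy].
Qed.

Lemma is_chain_bd n x : is_chain n.+1 x -> is_chain n (bd x).
Proof.
move=> cx t /msupp_sum[s]; rewrite andbT => /cx[ss sn] /msuppMz/msupp_bd_gen[v vs ->].
split; first by apply: (pm_face pm) ss _; exact: fsubD1set.
by move: sn; rewrite (cardfsD1 v) vs add1n => -[].
Qed.

Lemma lower_mu s : simp s -> s `<=` mu s ->
  exists v, [/\ v \notin s, mu s = v |` s & mu s `\ v = s].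
Proof.
move=> ss sm; have [[v vs e]|[v vs e]] := pm_upper_or_lower pm ss.
  by exists v; split; rewrite // e fsetU1K.
by move: sm; rewrite e => /fsubsetP/(_ _ vs); rewrite !inE eqxx.
Qed.

Lemma upper_mu s : simp s -> ~~ (s `<=` mu s) ->
  exists2 v, v \in s & mu s = s `\ v.
Proof.
move=> ss sm; have [[v vs e]|//] := pm_upper_or_lower pm ss.
by move: sm; rewrite e fsubsetUr.
Qed.

(** Clears the top rank of a cycle. Each lower simplex of rank [N] is cancelled by the boundary of
    its partner. An upper simplex [t] of rank [N] can then no longer occur: [mu t] would appear in
    the boundary with the coefficient of [t], up to sign. *)
Lemma exact_step N n z : is_chain n z -> bd z = 0 ->
  (forall s, s \in monalg.msupp z -> (rk s < N.+1)%N) ->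
  exists y, [/\ is_chain n.+1 y, is_chain n (z - bd y) &
    forall s, s \in monalg.msupp (z - bd y) -> (rk s < N)%N].
Proof.
move=> cz z0 rz; pose low s := (rk s == N) && (s `<=` mu s).
(* The incidence number of a lower simplex in its partner; being a sign, it is its own inverse. *)
pose c s : int := (bd_gen (mu s))@_s.
have c2 s : simp s -> s `<=` mu s -> c s * c s = 1.
  move=> ss /(lower_mu ss)[v [vs e e']].
  have := @coef_bd_gen_face _ lt (mu s) v; rewrite e' {1}e fset1U1 => /(_ isT) ce.
  by rewrite /c ce bd_sign2.
pose y : A := \sum_(s <- monalg.msupp z | low s) free_gen (mu s) *~ (z@_s * c s).
have cy : is_chain n.+1 y.
  move=> t /msupp_sum[s /andP[/cz[ss sn] /andP[_ sm]] /msuppMz/msupp_free_gen ->].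
  split; first exact: (pm_simp pm).
  by have [v [vs e _]] := lower_mu ss sm; rewrite e cardfsU1 vs sn.
have cz' : is_chain n (z - bd y) by apply: is_chainB => //; exact: is_chain_bd.
exists y; split => //.
have bdy t : (bd y)@_t = \sum_(s <- monalg.msupp z | low s)
    z@_s * c s * (bd_gen (mu s))@_t.
  have -> : bd y = \sum_(s <- monalg.msupp z | low s) bd (free_gen (mu s) *~ (z@_s * c s)) by exact: raddf_sum.
  rewrite raddf_sum; apply: eq_bigr => s _ /=.
  by rewrite raddfMz /= [bd _]free_ext_gen raddfMz /= -mulrzl intz.
(* The faces of [mu s] that share its rank are only [s] and [mu s], so the boundaries subtracted for
   different lower simplices of rank [N] do not disturb each other. *)
have uniq_lower s t : simp s -> low s -> rk t = N -> s <> t -> t `<=` mu t ->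
    (bd_gen (mu s))@_t = 0.
  move=> ss /andP[/eqP rs sm] rt st tm; apply: coef_bd_gen_eq0 => v vs e.
  have tms : t `<=` mu s by rewrite -e fsubD1set.
  have tns : t <> mu s by move=> h; move: vs; rewrite -h -e !inE eqxx.
  have := rk_face_eq pm (pm_simp pm ss) tms _ tns.
  by rewrite (pmK pm)// (pm_rk pm)// rs rt => /(_ (leqnn _)) /esym.
have rz' s : s \in monalg.msupp (z - bd y) -> (rk s <= N)%N.
  move=> /(fsubsetP (monalg.msuppB_le _ _)); rewrite in_fsetU => /orP[/rz//|].
  rewrite -monalg.mcoeff_neq0 bdy => nz.
  have [s' /andP[s'z /andP[/eqP rs' _]] sm] : exists2 s', (s' \in monalg.msupp z) && low s' &
      s \in monalg.msupp (bd_gen (mu s')).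
    apply: contrapT => no; move: nz; rewrite big_seq_cond big1 ?eqxx// => i ip.
    suff /eqP -> : (bd_gen (mu i))@_s == 0 by rewrite mulr0.
    by rewrite monalg.mcoeff_eq0; apply/negP => is_; apply: no; exists i.
  have [v _ ->] := msupp_bd_gen sm; have [ss' _] := cz _ s'z.
  rewrite -rs' -(pm_rk pm ss'); apply: (rk_face pm); first exact: (pm_simp pm).
  exact: fsubD1set.
have z'0 : bd (z - bd y) = 0 by rewrite raddfB /= z0 (bd_bd cy) subr0.
have lowz' s : low s -> (z - bd y)@_s = 0.
  move=> ls; case: (boolP (s \in monalg.msupp z)) => sz.
    have [ss _] := cz _ sz; move: (ls) => /andP[/eqP rs sm].
    rewrite monalg.mcoeffB bdy big_mkcond (big_fsetD1 s)//= ls big1_fset; last first.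
      move=> t; rewrite !inE => /andP[/eqP ts tz] _; case: ifP => // lt_.
      by rewrite uniq_lower ?mulr0//; have [] := cz _ tz.
    by rewrite addr0 -mulrA c2// mulr1 subrr.
  move: (ls) => /andP[/eqP rs sm]; rewrite monalg.mcoeffB (monalg.mcoeff_outdom sz) sub0r bdy.
  rewrite big_seq_cond big1 ?oppr0// => t /andP[tz lt_].
  by rewrite uniq_lower ?mulr0//; [have [] := cz _ tz|move=> ts; move: sz; rewrite -ts tz].
move=> t tz'; have := rz' _ tz'; rewrite leq_eqVlt => /orP[/eqP rt|//]; exfalso.
have [st tn] := cz' _ tz'.
case: (boolP (t `<=` mu t)) => tm.
  by move: tz'; rewrite -monalg.mcoeff_neq0 lowz' ?eqxx// /low rt eqxx.
have [v vt e] := upper_mu st tm.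
(* At the face [mu t] only [t] contributes: any other simplex of the cycle has rank at most [N], and
   if it contained [mu t] it would have to be the partner of [mu t]. *)
have := congr1 (monalg.mcoeff (mu t)) z'0.
rewrite coef_bd monalg.mcoeff0 (big_fsetD1 t)//= big1_fset.
  rewrite addr0 e coef_bd_gen_face// => /eqP.
  rewrite mulf_eq0 /bd_sign signr_eq0 orbF => h.
  by move: tz'; rewrite -monalg.mcoeff_neq0 h.
move=> s; rewrite !inE => /andP[/eqP nst sz'] _; have [ss sn] := cz' _ sz'.
rewrite coef_bd_gen_eq0 ?mulr0// => u us eu; apply: nst.
have tms : mu t `<=` s by rewrite -eu fsubD1set.
have tns : mu t <> s by move=> h; move: us; rewrite -h -eu !inE eqxx.
have := rk_face_eq pm ss tms; rewrite (pm_rk pm)// rt => /(_ (rz' _ sz') tns).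
by move=> /(congr1 mu); rewrite !(pmK pm).
Qed.

Lemma chain_exact n z : is_chain n z -> bd z = 0 ->
  exists2 y, is_chain n.+1 y & bd y = z.
Proof.
have [N rz] : exists N, forall s, s \in monalg.msupp z -> (rk s < N)%N.
  exists (\max_(s <- monalg.msupp z) rk s).+1 => s sz; rewrite ltnS.
  by rewrite (big_fsetD1 s)//= leq_maxl.
elim: N z rz => [|N IH] z rz cz z0.
  exists 0; first by move=> s; rewrite monalg.msupp0 inE.
  rewrite raddf0; apply/monalg.malgP => s; rewrite monalg.mcoeff0.
  by apply/esym/monalg.mcoeff_outdom/negP => /rz.
have [y [cy cz' rz']] := exact_step cz z0 rz.
have z'0 : bd (z - bd y) = 0 by rewrite raddfB /= z0 (bd_bd cy) subr0.
have [y' cy' e] := IH _ rz' cz' z'0.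
exists (y + y')%R; last by rewrite raddfD /= e addrC subrK.
move=> s /(fsubsetP (monalg.msuppD_le _ _)); rewrite in_fsetU => /orP[]; [exact: cy|exact: cy'].
Qed.

End Exactness.

(** * From an invariant matched complex to a projective resolution *)

Section Resolution.
Variables (P : choiceType) (lt : rel P) (simp : {fset P} -> Prop).
Variables (mu : {fset P} -> {fset P}) (rk : {fset P} -> nat).
Hypothesis pm : perfect_matching simp mu rk.
Hypothesis tour : forall s, simp s ->
  {in s &, forall u v, u != v -> lt u v = ~~ lt v u}.
Variables (G : groupType) (av : G -> P -> P) (dim : nat).
Hypotheses (av1 : forall v, av 1%g v = v).
Hypothesis avM : forall g h v, av (g * h)%g v = av g (av h v).
Hypothesis av_lt : forall g u v, lt (av g u) (av g v) = lt u v.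
Hypothesis av_simp : forall g s, simp s -> simp [fset av g v | v in s]%fset.
Hypothesis av_free : forall g s, simp s -> s != fset0 ->
  [fset av g v | v in s]%fset = s -> g = 1%g.
Hypothesis simp0 : simp fset0.
Hypothesis simp_dim : forall s, simp s -> (#|` s| <= dim.+1)%N.

Local Notation A := (monalg.malg {fset P} int).
Local Notation "x @_ k" := (monalg.mcoeff k x) (at level 3, k at level 2).
Local Notation is_chain := (is_chain simp).

Definition as_ g (s : {fset P}) : {fset P} := [fset av g v | v in s]%fset.

Lemma av_inj g : injective (av g).
Proof. by move=> u v e; rewrite -(av1 u) -(av1 v) -(mulVg g) !avM e. Qed.

Lemma as1 s : as_ 1%g s = s.
Proof.
apply/fsetP => v; apply/imfsetP/idP => [[u us ->]|vs]; first by rewrite av1.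
by exists v; rewrite ?av1.
Qed.

Lemma asM g h s : as_ (g * h)%g s = as_ g (as_ h s).
Proof.
apply/fsetP => v; apply/imfsetP/imfsetP => [[u us ->]|[w /imfsetP[u us ->] ->]].
  by exists (av h u); rewrite ?avM// in_imfset.
by exists u; rewrite ?avM.
Qed.

Lemma card_as g s : #|` as_ g s| = #|` s|.
Proof. by rewrite card_imfset//; exact: av_inj. Qed.

Definition actA g : A -> A := free_ext (fun s => free_gen (as_ g s)).

HB.instance Definition _ g := GRing.Additive.on (actA g).

Lemma actA_gen g s : actA g (free_gen s) = free_gen (as_ g s).
Proof. exact: free_ext_gen. Qed.

Lemma additive_fun_eq (f h : {additive A -> A}) :
  (forall s, f (free_gen s) = h (free_gen s)) -> f =1 h.
Proof.
by move=> e x; apply: free_additive_eq; [exact: raddfB|exact: raddfB|move=> s _].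
Qed.

Lemma actA1 x : actA 1%g x = x.
Proof.
have := @additive_fun_eq (actA 1%g) idfun; apply => s /=.
by rewrite actA_gen as1.
Qed.

Lemma actAM g h x : actA (g * h)%g x = actA g (actA h x).
Proof.
have := @additive_fun_eq (actA (g * h)%g) (actA g \o actA h); apply => s /=.
by rewrite !actA_gen asM.
Qed.

Lemma bd_actA g x : bd lt (actA g x) = actA g (bd lt x).
Proof.
have := @additive_fun_eq (bd lt \o actA g) (actA g \o bd lt); apply => s /=.
rewrite actA_gen /bd !free_ext_gen /bd_gen raddf_sum big_imfset/=; last first.
  by move=> u v _ _; exact: av_inj.
apply: eq_bigr => v _.
rewrite raddfMz /= actA_gen; apply: (congr2 (fun (x : {fset P}) (n : int) => free_gen x *~ n)).
  apply/fsetP => w; rewrite !inE; apply/andP/imfsetP => [[wv /imfsetP[u us e]]|].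
    by exists u; rewrite // !inE us andbT; apply: contra wv => /eqP <-; rewrite e.
  move=> [u]; rewrite !inE => /andP[uv us] ->; rewrite in_imfset//; split => //.
  by apply: contra uv => /eqP /av_inj ->.
congr (_ ^+ _); rewrite -[RHS](card_as g); congr #|` _|.
apply/fsetP => w; rewrite !inE; apply/andP/imfsetP => [[/imfsetP[u us ->]]|[u]].
  by rewrite av_lt => luv; exists u; rewrite // !inE us.
by rewrite !inE => /andP[us luv] ->; rewrite av_lt in_imfset.
Qed.

Lemma is_chain_actA n g x : is_chain n x -> is_chain n (actA g x).
Proof.
move=> cx s /msupp_sum[t]; rewrite andbT => /cx[st tn] /msuppMz/msupp_free_gen ->.
by split; [exact: av_simp|rewrite card_as].
Qed.

Definition chain_pred n : pred A := fun x => `[< is_chain n x >].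

Lemma chain_pred_closed n : zmod_closed (chain_pred n).
Proof.
split; first by apply/asboolP => s; rewrite monalg.msupp0 inE.
by move=> x y /asboolP cx /asboolP cy; apply/asboolP; exact: is_chainB.
Qed.

Definition chain_mod n := {x : A | chain_pred n x}.

HB.instance Definition _ n := SubChoice.on (chain_mod n).
HB.instance Definition _ n := GRing.SubChoice_isSubZmodule.Build A (chain_pred n)
  (chain_mod n) (chain_pred_closed n).

Lemma chain_modP n (x : chain_mod n) : is_chain n (val x).
Proof. exact/asboolP/(valP x). Qed.
Arguments chain_modP [n] x [s] _.

Definition mk_chain n (x : A) (h : is_chain n x) : chain_mod n :=
  Sub x (asboolT h).

Definition act_mod n g (x : chain_mod n) : chain_mod n :=
  mk_chain (@is_chain_actA _ g _ (chain_modP x)).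

Lemma act_modD n g : {morph @act_mod n g : x y / x + y}.
Proof. by move=> x y; apply: val_inj; rewrite /= !raddfD. Qed.

Lemma act_mod1 n (x : chain_mod n) : act_mod 1%g x = x.
Proof. by apply: val_inj; rewrite /= actA1. Qed.

Lemma act_modM n g h (x : chain_mod n) : act_mod (g * h)%g x = act_mod g (act_mod h x).
Proof. by apply: val_inj; rewrite /= actAM. Qed.

Definition chain_gmod n : gmodule G := GModule (@act_modD n) (@act_mod1 n) (@act_modM n).

Lemma morphD_B (M N : zmodType) (f : M -> N) :
  {morph f : x y / x + y} -> {morph f : x y / x - y}.
Proof.
move=> fD x y; apply: (addIr (f y)); rewrite -fD !subrK //.
Qed.

Definition ghom_additive (M N : zmodType) (f : M -> N) (fD : {morph f : x y / x + y}) :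
  {additive M -> N} := HB.pack f (GRing.isZmodMorphism.Build M N f (morphD_B fD)).

Definition chain_gen n (s : {fset P}) : chain_mod n := insubd 0 (free_gen s).

Lemma chain_genK n s : simp s -> #|` s| = n -> val (chain_gen n s) = free_gen s.
Proof.
move=> ss sn; rewrite /chain_gen insubdK//; apply/asboolP => t /msupp_free_gen ->//.
Qed.

Definition orbit_rep (s : {fset P}) : {fset P} :=
  xget fset0 [set t | exists g, t = as_ g s].

Lemma orbit_repP s : exists g, s = as_ g (orbit_rep s).
Proof.
rewrite /orbit_rep; case: xgetP => [t _ [g ->]|/(_ s) []].
  by exists g^-1%g; rewrite -asM mulVg as1.
by exists 1%g; rewrite as1.
Qed.

Lemma orbit_rep_as g s : orbit_rep (as_ g s) = orbit_rep s.
Proof.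
congr (xget _ _); apply/seteqP; split => [t [h ->]|t [h ->]] /=.
  by exists (h * g)%g; rewrite asM.
by exists (h * g^-1)%g; rewrite -asM mulgVK.
Qed.

Definition orbit_elt s : G := xget 1%g [set g | s = as_ g (orbit_rep s)].

Lemma orbit_eltP s : s = as_ (orbit_elt s) (orbit_rep s).
Proof. by rewrite /orbit_elt; case: xgetP => [g _ //|no]; have [g /no] := orbit_repP s. Qed.

(** Freeness makes the element that carries the representative to [s] unique; this turns an
    arbitrary choice into an equivariant one. *)
Lemma orbit_elt_as g s : simp s -> s != fset0 ->
  orbit_elt (as_ g s) = (g * orbit_elt s)%g.
Proof.
move=> ss s0; set h := orbit_elt (as_ g s); set h' := orbit_elt s.
have e : as_ h (orbit_rep s) = as_ g s by rewrite -(orbit_rep_as g s) -orbit_eltP.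
have : as_ (g^-1 * h * h'^-1)%g s = s.
  by rewrite {1}(orbit_eltP s) -asM mulgVK asM e -asM mulVg as1.
move/(av_free ss s0) => e1; apply: (mulgI g^-1%g).
by apply: (mulIg h'^-1%g); rewrite e1 mulgA mulVg mul1g mulgV.
Qed.

(** The simplices with at least one vertex form free orbits, so the module is free on orbit
    representatives; a lift is chosen there and transported. The empty simplex, fixed by the whole
    group, is excluded by the degree [n.+1]. *)
Lemma chain_projective n : projective (chain_gmod n.+1).
Proof.
move=> M N p f [pD pG] [fD fG] ps.
pose q y := xget (0 : M) [set x | p x = y].
have qP y : p (q y) = y.
  by rewrite /q; case: xgetP => [x _ //|no]; have [x /no] := ps y.
pose k s : M := gmod_act (orbit_elt s) (q (f (chain_gen n.+1 (orbit_rep s)))).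
have simp_nz (s : {fset P}) : #|` s| = n.+1 -> s != fset0.
  by move=> sn; apply/eqP => s0; move: sn; rewrite s0 cardfs0.
have kG g s : simp s -> #|` s| = n.+1 -> k (as_ g s) = gmod_act g (k s).
  by move=> ss sn; rewrite /k orbit_elt_as ?simp_nz// orbit_rep_as gmod_actM.
have pk s : simp s -> #|` s| = n.+1 -> p (k s) = f (chain_gen n.+1 s).
  move=> ss sn; rewrite /k pG qP -fG; congr f; apply: val_inj => /=.
  have sr : simp (orbit_rep s).
    have [g e] := orbit_repP s; have -> : orbit_rep s = as_ g^-1%g s.
      by rewrite {2}e -asM mulVg as1.
    exact: av_simp.
  rewrite !chain_genK// ?actA_gen -?orbit_eltP//.
  by rewrite -sn {2}(orbit_eltP s) card_as.
exists (fun x => free_ext k (val x)); first split.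
- by move=> x y /=; rewrite raddfD.
- move=> g x /=; pose F := ghom_additive (@gmod_actD _ M g).
  have := @free_additive_eq _ _ (free_ext k \o actA g) (F \o free_ext k) (val x); apply.
  + by move=> u v /=; rewrite !raddfB.
  + by move=> u v; rewrite !raddfB.
  + move=> s /(chain_modP x)[ss sn]; rewrite /= actA_gen !free_ext_gen.
    exact: kG.
- move=> x; pose p' := ghom_additive pD; pose f' := ghom_additive fD.
  have -> : x = \sum_(s <- monalg.msupp (val x)) chain_gen n.+1 s *~ (val x)@_s.
    apply: val_inj; rewrite raddf_sum {1}[val x]free_genE.
    apply: eq_big_seq => s /(chain_modP x)[ss sn].
    by rewrite raddfMz /= chain_genK.
  rewrite raddf_sum /= raddf_sum -[p]/(p' : _ -> _) -[f]/(f' : _ -> _) !raddf_sum.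
  apply: eq_big_seq => s /(chain_modP x)[ss sn].
  have vE z : val (chain_gen n.+1 s *~ z) = free_gen s *~ z.
    by rewrite raddfMz /= chain_genK.
  change (p' (free_ext k (val (chain_gen n.+1 s *~ (val x)@_s))) =
    f' (chain_gen n.+1 s *~ (val x)@_s)).
  by rewrite vE (raddfMz f') !raddfMz /= free_ext_gen pk.
Qed.

Definition bd_mod n (x : chain_mod n.+1) : chain_mod n :=
  mk_chain (is_chain_bd (lt := lt) pm (chain_modP x)).

Definition augment (x : chain_mod 1) : trivial_gmodule G := (bd lt (val x))@_fset0.

(** The term in degree k of the resolution consists of chains on k+1 vertices, and the augmentation
    is the boundary component at the empty simplex. *)
Lemma matched_complex_cd : cd_at_most G dim.
Proof.
exists (fun k => chain_gmod k.+1), (fun k => @bd_mod k.+1), augment; split.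
- move=> k; split; [exact: chain_projective|split => /=].
    by move=> x y; apply: val_inj; rewrite /= !raddfD.
  by move=> g x; apply: val_inj; rewrite /= bd_actA.
- split.
    split; first by move=> x y; rewrite /augment !raddfD.
    move=> g x; rewrite /= /augment bd_actA /=.
    have := @free_additive_eq _ _ (monalg.mcoeff fset0 \o actA g)
      (monalg.mcoeff fset0) (bd lt (val x)); apply.
    + by move=> u v /=; rewrite !raddfB.
    + by move=> u v; rewrite !raddfB.
    + move=> s _; rewrite /= actA_gen !coef_free_gen.
      by rewrite -!cardfs_eq0 card_as.
  (* A multiple of the empty simplex is a cycle, so exactness in degree 0 provides a preimage under
     the augmentation. *)
  move=> z; pose x : A := free_gen fset0 *~ z.
  have cx : is_chain 0 x by move=> s /msuppMz/msupp_free_gen ->; rewrite cardfs0.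
  have bx : bd lt x = 0.
    by rewrite raddfMz /= /bd free_ext_gen /bd_gen big_seq_fset0 mul0rz.
  have [y cy e] := chain_exact pm tour cx bx.
  exists (mk_chain cy); rewrite /augment /= e raddfMz /= coef_free_gen eqxx.
  exact: intz.
- move=> x; split => [e|[y <-]]; last first.
    by rewrite /augment /= (bd_bd tour (chain_modP y)) monalg.mcoeff0.
  have bx : bd lt (val x) = 0.
    apply/monalg.malgP => s; rewrite monalg.mcoeff0.
    have cb := is_chain_bd (lt := lt) pm (chain_modP x).
    case: (boolP (s \in monalg.msupp (bd lt (val x)))) => [/cb[_ /cardfs0_eq ->]//|].
    exact: monalg.mcoeff_outdom.
  have [y cy e'] := chain_exact pm tour (chain_modP x) bx.
  by exists (mk_chain cy); apply: val_inj.
- move=> k x; split => [/(congr1 val) /= bx|[y <-]]; last first.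
    by apply: val_inj => /=; rewrite (bd_bd tour (chain_modP y)).
  have [y cy e'] := chain_exact pm tour (chain_modP x) bx.
  by exists (mk_chain cy); apply: val_inj.
- move=> k nk x; apply: val_inj; apply/monalg.malgP => s /=; rewrite monalg.mcoeff0.
  apply: monalg.mcoeff_outdom; apply/negP => /(chain_modP x)[/simp_dim].
  by move=> + e; rewrite e ltnS leqNgt nk.
Qed.
End Resolution.

(** * A continuous parametrization of the simplex by the disk *)

Section Barycentric.
Variable R : realType.

Section ContinuousR.
Variable T : topologicalType.
Implicit Types (f g : T -> R) (x : T).

Lemma contD_at f g x : {for x, continuous f} -> {for x, continuous g} ->
  {for x, continuous (fun x => f x + g x)}.
Proof. by move=> cf cg; exact: (@continuousD _ R^o _ f g x cf cg). Qed.

Lemma contM_at f g x : {for x, continuous f} -> {for x, continuous g} ->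
  {for x, continuous (fun x => f x * g x)}.
Proof. by move=> cf cg; exact: (@continuousM _ _ f g x cf cg). Qed.

Lemma contD f g : continuous f -> continuous g -> continuous (fun x => f x + g x).
Proof. by move=> cf cg x; exact: (contD_at (cf x) (cg x)). Qed.

Lemma contM f g : continuous f -> continuous g -> continuous (fun x => f x * g x).
Proof. by move=> cf cg x; exact: (contM_at (cf x) (cg x)). Qed.

Lemma contN f : continuous f -> continuous (fun x => - f x).
Proof. by move=> cf x; exact: (@continuousN _ R^o _ f x (cf x)). Qed.

Lemma contmin f g : continuous f -> continuous g -> continuous (fun x => Num.min (f x) (g x)).
Proof. by move=> cf cg x; exact: (@continuous_min _ _ f g x (cf x) (cg x)). Qed.

Lemma contmax f g : continuous f -> continuous g -> continuous (fun x => Num.max (f x) (g x)).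
Proof. by move=> cf cg x; exact: (@continuous_max _ _ f g x (cf x) (cg x)). Qed.

Lemma contC (a : R) : continuous (fun _ : T => a).
Proof. by move=> x; exact: cvg_cst. Qed.

Variables (I : Type) (r : seq I) (F : I -> T -> R).
Hypothesis cF : forall i, continuous (F i).

Lemma contsum (p : pred I) : continuous (fun x => \sum_(i <- r | p i) F i x).
Proof.
elim: r => [|i s IH].
  by under eq_fun do rewrite big_nil; exact: contC.
under eq_fun do rewrite big_cons.
case: (p i) => //; apply: contD; [exact: cF|exact: IH].
Qed.

Lemma contbigmax (a : R) : continuous (fun x => \big[Num.max/a]_(i <- r) F i x).
Proof.
elim: r => [|i s IH].
  by under eq_fun do rewrite big_nil; exact: contC.
under eq_fun do rewrite big_cons.
by apply: contmax; [exact: cF|exact: IH].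
Qed.

Lemma contbigmin (a : R) : continuous (fun x => \big[Num.min/a]_(i <- r) F i x).
Proof.
elim: r => [|i s IH].
  by under eq_fun do rewrite big_nil; exact: contC.
under eq_fun do rewrite big_cons.
by apply: contmin; [exact: cF|exact: IH].
Qed.

End ContinuousR.

Variable n : nat.
Implicit Types (x : 'rV[R]_n) (i : 'I_n.+1).

Definition sqnorm x : R := \sum_i x 0 i ^+ 2.

(** The point is completed by one more coordinate to a vector with sum zero, that is, a direction in
    the affine span of the simplex. *)
Definition zsum x i : R :=
  if unlift ord_max i is Some j then x 0 j else - \sum_j x 0 j.

Definition depth x : R := \big[Num.max/0]_i - zsum x i.

(* The disk is mapped radially onto the simplex: the ray through [x] leaves the
   simplex, centered at its barycenter, where the most negative of the
   coordinates [zsum x i] reaches the boundary. *)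
Definition bary x i : R :=
  (1 + Num.min (sqnorm x) 1 * (zsum x i / depth x)) / n.+1%:R.

Lemma sum_zsum x : \sum_i zsum x i = 0.
Proof.
rewrite big_ord_recr /=; rewrite /zsum unlift_none.
apply/eqP; rewrite subr_eq0; apply/eqP; apply: eq_bigr => j _.
by rewrite (_ : widen_ord _ j = lift ord_max j) ?liftK//; apply: val_inj; rewrite /= /bump leqNgt ltn_ord.
Qed.

Lemma depth_ge0 x : 0 <= depth x.
Proof. exact: bigmax_ge_id. Qed.

Lemma zsum_ge x i : - depth x <= zsum x i.
Proof. by rewrite lerNl; apply: le_bigmax. Qed.

Lemma depth_eq0 x : depth x = 0 -> x = 0.
Proof.
move=> d0; have z0 i : 0 <= zsum x i by rewrite -(@opprK _ 0) oppr0 -[X in - X]d0 zsum_ge.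
have z : forall i, true -> zsum x i = 0 by exact/psumr_eq0P/sum_zsum.
apply/rowP => j; rewrite mxE; have := z (lift ord_max j) isT.
by rewrite /zsum liftK.
Qed.

Lemma depth_gt0 x : x != 0 -> 0 < depth x.
Proof.
by move=> x0; rewrite lt_neqAle depth_ge0 andbT eq_sym; apply: contra x0 => /eqP/depth_eq0 ->.
Qed.

Lemma zsum_le x i : zsum x i <= n%:R * depth x.
Proof.
have /eqP := sum_zsum x; rewrite (bigD1 i)//= addr_eq0 => /eqP ->.
rewrite -sumrN (le_trans (ler_sum _ (G := fun=> depth x) _))//.
  by move=> j _; rewrite lerNl zsum_ge.
by rewrite sumr_const cardC1 card_ord mulr_natl.
Qed.

Lemma zsum0 i : zsum 0 i = 0.
Proof.
rewrite /zsum; case: unlift => [j|]; rewrite ?mxE// big1 ?oppr0// => j _.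
by rewrite mxE.
Qed.

Lemma zsum_quot_ge x i : -1 <= zsum x i / depth x.
Proof.
have [->|x0] := eqVneq x 0; first by rewrite zsum0 mul0r lerN10.
by rewrite ler_pdivlMr ?depth_gt0// mulN1r zsum_ge.
Qed.

Lemma zsum_quot_norm x i : `|zsum x i / depth x| <= n%:R + 1.
Proof.
rewrite ler_norml; apply/andP; split.
  by apply: le_trans (zsum_quot_ge x i); rewrite lerNl opprK lerDr.
have [->|x0] := eqVneq x 0; first by rewrite zsum0 mul0r addr_ge0.
rewrite ler_pdivrMr ?depth_gt0// (le_trans (zsum_le x i))//.
by rewrite ler_wpM2r ?depth_ge0// lerDl.
Qed.

Lemma sqnorm_ge0 x : 0 <= sqnorm x.
Proof. by apply: sumr_ge0 => j _; exact: sqr_ge0. Qed.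

Lemma sqnorm0 : sqnorm 0 = 0.
Proof. by rewrite /sqnorm big1// => j _; rewrite mxE expr0n. Qed.

Lemma sqnorm_eq0 x : sqnorm x = 0 -> x = 0.
Proof.
move=> /psumr_eq0P h; apply/rowP => j; rewrite mxE; apply/eqP.
by rewrite -sqrf_eq0 h// => k _; exact: sqr_ge0.
Qed.

Lemma minQ_ge0 x : 0 <= Num.min (sqnorm x) 1.
Proof. by rewrite le_min sqnorm_ge0 ler01. Qed.

Lemma bary_ge0 x i : 0 <= bary x i.
Proof.
rewrite /bary divr_ge0// -lerBlDl sub0r.
apply: (@le_trans _ _ (- Num.min (sqnorm x) 1)); first by rewrite lerN2 ge_min lexx orbT.
by rewrite -[X in X <= _]mulrN1 ler_wpM2l ?minQ_ge0// zsum_quot_ge.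
Qed.

Lemma sum_bary x : \sum_i bary x i = 1.
Proof.
rewrite /bary -mulr_suml big_split /= sumr_const card_ord -mulr_sumr -mulr_suml.
by rewrite sum_zsum mul0r mulr0 addr0 divff// pnatr_eq0.
Qed.

Lemma bary_gt0 x i : sqnorm x < 1 -> 0 < bary x i.
Proof.
move=> x1; rewrite /bary divr_gt0 ?ltr0n// -ltrBlDl sub0r.
apply: (@lt_le_trans _ _ (- Num.min (sqnorm x) 1)); first by rewrite ltrN2 gt_min x1.
by rewrite -[X in X <= _]mulrN1 ler_wpM2l ?minQ_ge0// zsum_quot_ge.
Qed.

Lemma bary_boundary x : sqnorm x = 1 -> exists i, bary x i = 0.
Proof.
move=> x1; have x0 : x != 0.
  by apply/eqP => x0; move/eqP: x1; rewrite x0 sqnorm0 eq_sym oner_eq0.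
have d0 := depth_gt0 x0.
have [i di] : exists i, depth x = - zsum x i.
  apply: contrapT => no; suff : depth x < depth x by rewrite ltxx.
  rewrite {1}/depth bigmax_lt// => i _; rewrite lt_neqAle (le_bigmax _ (fun i => - zsum x i)).
  by rewrite andbT; apply/eqP => e; apply: no; exists i.
exists i; rewrite /bary x1 minxx mul1r; have -> : zsum x i = - depth x by rewrite di opprK.
by rewrite mulNr divff ?gt_eqF// subrr mul0r.
Qed.

Lemma zsumZ a x i : zsum (a *: x) i = a * zsum x i.
Proof.
rewrite /zsum; case: unlift => [j|]; rewrite ?mxE// mulrN mulr_sumr; congr (- _).
by apply: eq_bigr => j _; rewrite mxE.
Qed.

Lemma depthZ a x : 0 <= a -> depth (a *: x) = a * depth x.
Proof.
move=> a0; rewrite /depth; under eq_bigr do rewrite zsumZ -mulrN.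
elim/big_ind2: _ => [|u v u' v' -> ->|//]; first by rewrite mulr0.
by rewrite maxr_pMr.
Qed.

Lemma sqnormZ a x : sqnorm (a *: x) = a ^+ 2 * sqnorm x.
Proof. by rewrite /sqnorm mulr_sumr; apply: eq_bigr => j _; rewrite mxE exprMn. Qed.

Lemma zsum_inj x y : zsum x =1 zsum y -> x = y.
Proof. by move=> e; apply/rowP => j; have := e (lift ord_max j); rewrite /zsum liftK. Qed.

(** Equal images force [y = m *: x] with [m] positive. Since [sqnorm] is quadratic and [depth]
    linear along a ray, comparing [sqnorm / depth] yields [m ^+ 2 = 1]. *)
Lemma bary_inj x y : sqnorm x < 1 -> sqnorm y < 1 -> bary x =1 bary y -> x = y.
Proof.
move=> x1 y1 e.
have {}e i : sqnorm x * (zsum x i / depth x) = sqnorm y * (zsum y i / depth y).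
  move/(congr1 (fun z => z * n.+1%:R)): (e i); rewrite /bary !divfK ?pnatr_eq0//.
  by move/addrI; rewrite !min_l ?ltW.
have key u v : v = 0 -> (forall i, sqnorm u * (zsum u i / depth u) =
    sqnorm v * (zsum v i / depth v)) -> u = v.
  move=> -> {}e; apply/eqP/negPn/negP => u0; have d0 := depth_gt0 u0.
  have q0 : sqnorm u != 0 by apply: contra u0 => /eqP/sqnorm_eq0 ->.
  move/eqP: u0; apply; apply: zsum_inj => i; rewrite zsum0; apply/eqP.
  have /eqP := e i; rewrite sqnorm0 mul0r !mulf_eq0 invr_eq0 (negbTE q0) (gt_eqF d0).
  by rewrite orbF.
have [y0|y0] := eqVneq y 0; first exact: key.
have [x0|x0] := eqVneq x 0; first by apply/esym/key => // i; rewrite e.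
have dx := depth_gt0 x0; have dy := depth_gt0 y0.
have qx : 0 < sqnorm x.
  by rewrite lt_neqAle sqnorm_ge0 andbT eq_sym; apply: contra x0 => /eqP/sqnorm_eq0 ->.
have qy : 0 < sqnorm y.
  by rewrite lt_neqAle sqnorm_ge0 andbT eq_sym; apply: contra y0 => /eqP/sqnorm_eq0 ->.
pose m := (sqnorm x / depth x) / (sqnorm y / depth y).
have m0 : 0 < m by rewrite !divr_gt0.
have yx : y = m *: x.
  apply: zsum_inj => i; rewrite zsumZ /m.
  have := e i; move: (zsum x i) (zsum y i) => a b h.
  apply: (mulfI (lt0r_neq0 qy)); apply: (mulIf (invr_neq0 (lt0r_neq0 dy))).
  by rewrite -mulrA -h; field; rewrite !gt_eqF.
have : m ^+ 2 = 1.
  have : m * (sqnorm y / depth y) = sqnorm x / depth x.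
    by rewrite /m divfK// mulf_neq0 ?invr_eq0 ?gt_eqF.
  rewrite yx sqnormZ depthZ ?ltW// => h.
  apply: (mulIf (_ : sqnorm x / depth x != 0)); first by rewrite gt_eqF ?divr_gt0.
  by rewrite mul1r -{2}h; field; rewrite !gt_eqF.
move=> /eqP; rewrite sqrf_eq1 => /orP[] /eqP m1; first by rewrite yx m1 scale1r.
by move: m0; rewrite m1 ltr0N1.
Qed.

Lemma bary_surj (b : 'I_n.+1 -> R) : (forall i, 0 <= b i) -> \sum_i b i = 1 ->
  exists x, [/\ sqnorm x <= 1, bary x =1 b & (forall i, 0 < b i) -> sqnorm x < 1].
Proof.
move=> b0 b1; pose c i := n.+1%:R * b i - 1; pose u : 'rV[R]_n := \row_j c (lift ord_max j).
have sc : \sum_i c i = 0.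
  by rewrite /c sumrB -mulr_sumr b1 mulr1 sumr_const card_ord subrr.
have zu i : zsum u i = c i.
  rewrite /zsum; case: unliftP => [j ->|->]; first by rewrite mxE.
  have := sc; rewrite big_ord_recr /= => /eqP; rewrite addrC addr_eq0 => /eqP ->.
  congr (- _); apply: eq_bigr => j _; rewrite mxE; congr c.
  by apply: val_inj; rewrite /= /bump leqNgt ltn_ord.
have bE i : b i = (1 + zsum u i) / n.+1%:R.
  by rewrite zu /c addrC subrK mulrAC divff ?mul1r// pnatr_eq0.
have [u0|u0] := eqVneq u 0.
  exists 0; split; rewrite ?sqnorm0 ?ler01 ?ltr01//.
  by move=> i; rewrite /bary bE u0 zsum0 mul0r mulr0.
have du := depth_gt0 u0.
have qu : 0 < sqnorm u.
  by rewrite lt_neqAle sqnorm_ge0 andbT eq_sym; apply: contra u0 => /eqP/sqnorm_eq0 ->.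
(* Scaled so that [sqnorm (a *: u) = depth u]; in the formula of [bary] this factor cancels the
   division by the depth and leaves [1 + zsum u i]. *)
pose a := Num.sqrt (depth u / sqnorm u).
have a0 : 0 < a by rewrite sqrtr_gt0 divr_gt0.
have qa : sqnorm (a *: u) = depth u.
  by rewrite sqnormZ sqr_sqrtr ?divr_ge0 ?ltW// divfK ?gt_eqF.
have d1 : depth u <= 1.
  apply: bigmax_le => // i _; rewrite zu /c opprB lerBlDl lerDr.
  by rewrite mulr_ge0.
exists (a *: u); split; rewrite ?qa//.
  move=> i; rewrite /bary qa min_l// zsumZ depthZ ?ltW// bE; congr (_ / _).
  by congr (_ + _); field; rewrite !gt_eqF.
move=> bp; apply: bigmax_lt => // i _; rewrite zu /c opprB ltrBlDl ltrDr.
by rewrite mulr_gt0 ?ltr0n.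
Qed.

Lemma zsum_continuous i : continuous (zsum^~ i).
Proof.
rewrite /zsum; case: unlift => [j|]; first exact: coord_continuous.
by apply: contN; apply: contsum => j; exact: coord_continuous.
Qed.

Lemma depth_continuous : continuous depth.
Proof. by apply: contbigmax => i; apply: contN; exact: zsum_continuous. Qed.

Lemma sqnorm_continuous : continuous sqnorm.
Proof.
apply: contsum => j; under eq_fun do rewrite expr2.
by apply: contM; exact: coord_continuous.
Qed.

Lemma minQ_continuous : continuous (fun x => Num.min (sqnorm x) 1).
Proof. by apply: contmin; [exact: sqnorm_continuous|exact: contC]. Qed.

Lemma bary_continuous i : continuous (bary^~ i).
Proof.
move=> x; pose g (x : 'rV[R]_n) := Num.min (sqnorm x) 1 * (zsum x i / depth x).
suff cg : {for x, continuous g}.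
  apply: (@contM_at _ (fun x => 1 + g x) (fun=> n.+1%:R^-1)); last exact: contC.
  by apply: (@contD_at _ (fun=> 1) g) => //; exact: contC.
(* The quotient [zsum / depth] is continuous away from the origin only; at the origin it is merely
   bounded, and the factor [Num.min (sqnorm x) 1] tends to zero. *)
have [->|x0] := eqVneq x 0; last first.
  apply: (@contM_at _ (fun x => Num.min (sqnorm x) 1)); first exact: minQ_continuous.
  apply: (@contM_at _ (zsum^~ i) (fun x => (depth x)^-1)); first exact: zsum_continuous.
  apply: (@continuousV _ _ depth); last exact: depth_continuous.
  by rewrite gt_eqF// depth_gt0.
have g0 : g 0 = 0 by rewrite /g zsum0 mul0r mulr0.
suff : g y @[y --> (0 : 'rV[R]_n)] --> g 0 by [].
rewrite g0.
apply/(@cvgr0Pnorm_le _ _ _ (nbhs (0 : 'rV[R]_n)) _ g) => e e0.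
have n1 : 0 < n%:R + 1 :> R by rewrite natr1 ltr0n.
have : \forall y \near (0 : 'rV[R]_n), `|Num.min (sqnorm y) 1| <= e / (n%:R + 1).
  have : Num.min (sqnorm y) 1 @[y --> (0 : 'rV[R]_n)] --> (0 : R).
    have := @minQ_continuous 0.
    have <- : Num.min (sqnorm 0) 1 = 0 by rewrite sqnorm0 min_l.
    exact.
  move=> /(@cvgr0Pnorm_le _ _ _ (nbhs (0 : 'rV[R]_n)) _ (fun y => Num.min (sqnorm y) 1)).
  by apply; rewrite divr_gt0.
apply: filterS => y; rewrite ler_pdivlMr// => ye.
rewrite normrM; apply: le_trans ye; apply: ler_wpM2l => //.
exact: zsum_quot_norm.
Qed.

End Barycentric.

Lemma ptws_continuous (R : realType) (P : choiceType) (Z : topologicalType)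
    (f : Z -> (P -> R)) :
  (forall v, continuous (fun z => f z v)) -> continuous (f : Z -> {ptws P -> R}).
Proof.
move=> cf z; apply/cvg_sup => v A /= [B [[C oC <-]] Bz BA].
have : nbhs z ((f^~ v) @^-1` C) by apply: cf; apply: open_nbhs_nbhs; split.
by apply: filterS => y /= Cy; exact: BA.
Qed.

(** * The geometric realization as a CW complex *)

Section Realization.
Variables (R : realType) (P : choiceType) (simp : {fset P} -> Prop).
Hypothesis simp_face : forall s t, simp t -> (s `<=` t)%fset -> simp s.
Implicit Types (s : {fset P}) (v : P).

Definition in_realization (g : P -> R) : Prop := exists s, [/\ simp s,
  forall v, v \notin s -> g v = 0, forall v, 0 <= g v & \sum_(v <- s) g v = 1].

Definition realization := {g : P -> R | `[< in_realization g >]}.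

HB.instance Definition _ := gen_eqMixin realization.
HB.instance Definition _ := gen_choiceMixin realization.

Definition pt (x : realization) : P -> R := proj1_sig x.

Lemma ptP x : in_realization (pt x).
Proof. by apply/asboolP; case: x. Qed.

Definition mk_pt g (h : in_realization g) : realization := exist _ g (asboolT h).

Lemma pt_inj : injective pt.
Proof.
move=> [g gP] [h hP] /= e; move: gP hP; rewrite /pt /= in e; rewrite e => gP hP.
by congr exist; exact: Prop_irrelevance.
Qed.

Lemma pt_ge0 x v : 0 <= pt x v.
Proof. by have [s [_ _ + _]] := ptP x; apply. Qed.

Definition supp x : {fset P} :=
  [fset v in projT1 (cid (ptP x)) | pt x v != 0]%fset.

Lemma in_supp x v : (v \in supp x) = (pt x v != 0).
Proof.
rewrite /supp; case: (cid _) => s /= [_ s0 _ _]; rewrite !inE /=.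
by case: (boolP (v \in s)) => //= /s0 ->; rewrite eqxx.
Qed.

Lemma sum_supp x s : (forall v, v \notin s -> pt x v = 0) -> \sum_(v <- s) pt x v = 1.
Proof.
move=> s0; have [t [_ t0 _ <-]] := ptP x.
rewrite (big_fset_incl _ (fsubsetUl s t)); last by move=> v _ /s0.
by rewrite [RHS](big_fset_incl _ (fsubsetUr s t)) // => v _ /t0.
Qed.

Lemma supp_simp x : simp (supp x).
Proof.
have [s [ss s0 _ _]] := ptP x; apply: simp_face ss _; apply/fsubsetP => v.
by rewrite in_supp; apply: contraR => /s0 ->; rewrite eqxx.
Qed.

Lemma supp_out x v : v \notin supp x -> pt x v = 0.
Proof. by rewrite in_supp negbK => /eqP. Qed.

Lemma supp_neq0 x : supp x != fset0.
Proof.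
apply/eqP => s0; have := @sum_supp x fset0; rewrite big_seq_fset0 => /(_ _)/eqP.
by rewrite eq_sym oner_eq0 => h; apply: notF; apply: h => v _; apply: supp_out; rewrite s0 inE.
Qed.

Lemma pt_le1 x v : pt x v <= 1.
Proof.
case: (boolP (v \in supp x)) => [vs|/supp_out ->]; last exact: ler01.
rewrite -(sum_supp (@supp_out x)) (big_fsetD1 v)//= lerDl.
by apply: sumr_ge0 => u _; exact: pt_ge0.
Qed.

Definition bary_pt s (d : 'rV[R]_(#|` s|.-1)) : P -> R :=
  fun v => if v \in s then bary d (inord (index v s)) else 0.

Lemma cardfs_pred s : s != fset0 -> #|` s| = #|` s|.-1.+1.
Proof. by move=> s0; rewrite prednK// cardfs_gt0. Qed.

Lemma ltn_ord_card s (i : 'I_(#|` s|.-1.+1)) : s != fset0 -> (i < size s)%N.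
Proof. by move=> s0; rewrite (leq_trans (ltn_ord i))// -cardfs_pred. Qed.

Lemma sum_nth s (F : P -> R) v0 : s != fset0 ->
  \sum_(v <- s) F v = \sum_(i < #|` s|.-1.+1) F (nth v0 s i).
Proof. by move=> s0; rewrite (big_nth v0) big_mkord (cardfs_pred s0). Qed.

Lemma bary_pt_in s d : simp s -> s != fset0 -> in_realization (@bary_pt s d).
Proof.
move=> ss s0; exists s; split => //.
- by move=> v vs; rewrite /bary_pt (negbTE vs).
- by move=> v; rewrite /bary_pt; case: ifP => // _; exact: bary_ge0.
have [v0 _] := fset0Pn _ s0; rewrite (sum_nth _ v0)// -(sum_bary d).
apply: eq_bigr => i _; have li := ltn_ord_card i s0.
by rewrite /bary_pt mem_nth// index_uniq ?fset_uniq// inord_val.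
Qed.

Definition rcell := {s : {fset P} | simp s /\ s != fset0}.

Lemma rcell_inj (e e' : rcell) : sval e = sval e' -> e = e'.
Proof.
case: e e' => [s h] [s' h'] /= e; move: h h'; rewrite e => h h'.
by congr exist; exact: Prop_irrelevance.
Qed.

Definition rcell_dim (e : rcell) := #|` sval e|.-1.

Definition rchar (e : rcell) (d : 'rV[R]_(rcell_dim e)) : realization :=
  mk_pt (bary_pt_in d (svalP e).1 (svalP e).2).

(** The weak topology. The minimum with 1 in [bary] lets the characteristic maps be defined and
    continuous on the whole vector space, so they are used here without restriction to the disk. *)
Definition ropen : set_system realization :=
  [set U | forall e, open (@rchar e @^-1` U)].

Lemma ropenT : ropen setT. Proof. by move=> e; rewrite preimage_setT; exact: openT. Qed.

Lemma ropenI : setI_closed ropen.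
Proof. by move=> A B oA oB e; rewrite preimage_setI; apply: openI; [exact: oA|exact: oB]. Qed.

Lemma ropenU (I : Type) (f : I -> set realization) :
  (forall i, ropen (f i)) -> ropen (\bigcup_i f i).
Proof. by move=> of_ e; rewrite preimage_bigcup; apply: bigcup_open => i _; exact: of_. Qed.

HB.instance Definition _ := isOpenTopological.Build realization ropenT ropenI ropenU.

Lemma open_realE (U : set realization) : open U = ropen U.
Proof. by []. Qed.

Lemma rchar_continuous e : continuous (@rchar e).
Proof. by apply/continuousP => A; rewrite open_realE; exact. Qed.

Lemma continuous_from_real (T : topologicalType) (f : realization -> T) :
  (forall e, continuous (fun d => f (@rchar e d))) -> continuous f.
Proof.
move=> cf; apply/continuousP => A oA; rewrite open_realE => e.
exact: (iffLR (@continuousP _ _ _) (cf e) A oA).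
Qed.

Lemma bary_pt_continuous s v : continuous (fun d => @bary_pt s d v).
Proof. by rewrite /bary_pt; case: (v \in s); [exact: bary_continuous|exact: contC]. Qed.

Lemma pt_continuous v : continuous (pt^~ v).
Proof. by apply: continuous_from_real => e; exact: bary_pt_continuous. Qed.

Lemma realization_hausdorff : hausdorff_space realization.
Proof.
move=> x y xy; apply: pt_inj; apply/funext => v.
apply: (@Rhausdorff R) => A B nA nB.
have [z [Az Bz]] := xy _ _ (pt_continuous nA) (pt_continuous nB).
by exists (pt z v).
Qed.

Lemma supp_rchar e d : (supp (@rchar e d) `<=` sval e)%fset.
Proof.
apply/fsubsetP => v; rewrite in_supp /= /bary_pt; case: ifP => //.
by rewrite eqxx.
Qed.

Lemma supp_rchar_open e d : sqnorm d < 1 -> supp (@rchar e d) = sval e.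
Proof.
move=> d1; apply/eqP; rewrite eqEfsubset supp_rchar; apply/fsubsetP => v ve.
by rewrite in_supp /= /bary_pt ve gt_eqF// bary_gt0.
Qed.

Lemma rchar_surj x e : (supp x `<=` sval e)%fset ->
  exists d, [/\ sqnorm d <= 1, @rchar e d = x & supp x = sval e -> sqnorm d < 1].
Proof.
move=> xe; have [se e0] := svalP e.
have [v0 _] := fset0Pn _ e0.
have out v : v \notin sval e -> pt x v = 0.
  by move=> h; apply: supp_out; apply: contra h; exact/fsubsetP.
pose b (i : 'I_(rcell_dim e).+1) := pt x (nth v0 (sval e) i).
have lt_i (i : 'I_(rcell_dim e).+1) : (i < size (sval e))%N.
  exact: ltn_ord_card.
have [||d [d1 bd dp]] := @bary_surj R _ b.
- by move=> i; exact: pt_ge0.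
- by rewrite -(sum_supp out) (sum_nth _ v0).
exists d; split => //.
  apply: pt_inj; apply/funext => v /=; rewrite /bary_pt; case: ifPn => [ve|/out ->//].
  rewrite bd /b inordK ?nth_index//.
  by rewrite -(cardfs_pred e0) index_mem.
move=> xe'; apply: dp => i; rewrite /b lt_neqAle pt_ge0 andbT eq_sym -in_supp xe'.
by rewrite mem_nth.
Qed.

(** Over a finite vertex set weak and pointwise topology agree: a closed set meets each simplex in
    the image of a compact part of a disk, which is compact, hence closed, for pointwise
    convergence, and only finitely many simplices are involved. *)
Lemma continuous_to_real (Z : topologicalType) (f : Z -> realization) (S : {fset P}) :
  (forall z, (supp (f z) `<=` S)%fset) -> (forall v, continuous (fun z => pt (f z) v)) ->
  continuous f.
Proof.
move=> fS cf; apply/continuous_closedP => A cA.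
pose C s : set {ptws P -> R} := [set g | exists (e : rcell) d,
  [/\ sval e = s, sqnorm d <= 1, A (@rchar e d) & g = pt (@rchar e d)]].
have closedC s : closed (C s).
  have [[e es]|no] := pselect (exists e : rcell, sval e = s); last first.
    rewrite (_ : C s = set0); first exact: closed0.
    by apply/seteqP; split => // g [e [d [es _ _ _]]]; apply: no; exists e.
  pose D := [set d : 'rV[R]_(rcell_dim e) | sqnorm d <= 1 /\ A (@rchar e d)].
  have -> : C s = (fun d => pt (@rchar e d) : {ptws P -> R}) @` D.
    apply/seteqP; split => g.
      move=> [e' [d [es' d1 Ad ->]]].
      have ee : e' = e by apply: rcell_inj; rewrite es'.
      by subst e'; exists d.
    by move=> [d [d1 Ad] <-]; exists e, d.
  apply: compact_closed; first by apply: hausdorff_product => v; exact: Rhausdorff.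
  apply: continuous_compact.
    by apply: continuous_subspaceT; apply: ptws_continuous => v; exact: bary_pt_continuous.
  apply: bounded_closed_compact.
    exists 1; split; first by rewrite realE ler01.
    move=> M M1 d [d1 _]; rewrite /Num.norm /= mx_normrE; apply: bigmax_le => [|[i j] _ /=].
      by apply: le_trans (ltW M1).
    apply: le_trans (ltW M1); rewrite (ord1 i).
    rewrite -(@ler_pXn2r _ 2)// ?nnegrE// expr1n real_normK ?num_real//.
    apply: le_trans d1; rewrite /sqnorm (bigD1 j)//= lerDl.
    by apply: sumr_ge0 => k _; exact: sqr_ge0.
  have -> : D = [set d | sqnorm d <= 1] `&` (@rchar e @^-1` A) by [].
  apply: closedI.
    rewrite (_ : mkset _ = (@sqnorm R (rcell_dim e)) @^-1` [set x | x <= 1])//.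
    by apply: (iffLR (@continuous_closedP _ _ _)); [exact: sqnorm_continuous|exact: closed_le].
  by apply: (iffLR (@continuous_closedP _ _ _)); [exact: rchar_continuous|].
have -> : f @^-1` A = \bigcup_(s in [set` fpowerset S]) ((fun z => pt (f z) : {ptws P -> R}) @^-1` C s).
  apply/seteqP; split => z.
    move=> Az; pose e : rcell := exist _ (supp (f z)) (conj (supp_simp (f z)) (supp_neq0 (f z))).
    have [d [d1 ed _]] := @rchar_surj (f z) e (fsubset_refl _).
    exists (supp (f z)); first by rewrite /= fpowersetE; exact: fS.
    by exists e, d; rewrite ed.
  by move=> [s _ [e [d [_ _ Ad /pt_inj e']]]]; rewrite /preimage /= e'.
apply: closed_bigcup => [|s _]; first exact: finite_fset.
by apply: (iffLR (@continuous_closedP _ _ _)) => //; apply: ptws_continuous.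
Qed.

(** The product of the complex with the line again carries the weak topology, because the line is
    locally compact: around the given time a compact interval [N] is chosen, and the tube lemma on
    each cell shows that the points good for all of [N] form an open set. *)
Lemma continuous_from_realR (T : topologicalType) (H : realization * R -> T) :
  (forall e, continuous (fun p : 'rV[R]_(rcell_dim e) * R => H (@rchar e p.1, p.2))) ->
  continuous H.
Proof.
move=> cH; apply/continuousP => O oO; rewrite openE => -[x0 t0] Hx0.
have cHe e (d0 : 'rV[R]_(rcell_dim e)) t : O (H (@rchar e d0, t)) ->
    \forall t' \near t & d \near d0, O (H (@rchar e d, t')).
  move=> Od; have nO : nbhs (H (@rchar e d0, t)) O by apply: open_nbhs_nbhs; split.
  have /= [[A B] /= [nA nB] AB] := cH e (d0, t) _ nO.
  exists (B, A); first by split.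
  by move=> [t' d'] /= [Bt Ad]; exact: (AB (d', t')).
pose e0 : rcell := exist _ (supp x0) (conj (supp_simp x0) (supp_neq0 x0)).
have [d0 [_ ed0 _]] := @rchar_surj x0 e0 (fsubset_refl _).
have [eps eps0 Heps] : exists2 eps : R, 0 < eps & forall t, `|t0 - t| < eps -> O (H (x0, t)).
  have := cHe e0 d0 t0; rewrite ed0 => /(_ Hx0)[[A B] /= [nA nB] AB].
  have [eps /= eps0 epsA] := iffLR (nbhs_ballP _ _) nA.
  exists eps => // t tt; rewrite -ed0; apply: (AB (t, d0)); split => /=; first exact: epsA.
  exact: nbhs_singleton.
pose N := `[t0 - eps / 2, t0 + eps / 2]%classic.
pose U := [set x | N `<=` [set t | O (H (x, t))]].
have cN : compact N by exact: segment_compact.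
have oU : open U.
  suff : ropen U by [].
  move=> e; rewrite openE => d Nd.
  have := iffLR (compact_near_coveringP N) cN _ (nbhs d)
    (fun d t => O (H (@rchar e d, t))) _; apply.
  by move=> t Nt; exact/cHe/Nd.
exists (U, N) => [/=|[x t] /= [Ux Nt]]; last exact: Ux.
split.
  apply: open_nbhs_nbhs; split => // t; rewrite /N /= in_itv /= => /andP[t1 t2].
  apply: Heps; apply: (@le_lt_trans _ _ (eps / 2)); last by rewrite gtr_pMr// invf_lt1// ltr1n.
  by rewrite ler_norml; apply/andP; split; lra.
apply/nbhs_ballP; exists (eps / 2) => /=; first by rewrite divr_gt0.
move=> t; rewrite /ball /= ltr_norml => /andP[h1 h2]; rewrite /N /= in_itv /=.
by apply/andP; split; lra.
Qed.

Definition rcells : cells R realization := @Cells R realization rcell rcell_dim rchar.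

Lemma open_rcellE (e : rcells) : open_cell e = [set x | supp x = sval e].
Proof.
apply/seteqP; split => [x [d d1 <-]|x /= xe].
  by apply: (supp_rchar_open (e := e)).
have [|d [_ ed /(_ xe) d1]] := @rchar_surj x e; first by rewrite xe.
by exists d.
Qed.

Lemma rcells_complex : is_cell_complex rcells.
Proof.
have suppE (x : realization) : exists e : rcells, supp x = sval e.
  by exists (exist _ (supp x) (conj (supp_simp x) (supp_neq0 x))).
split.
- exact: realization_hausdorff.
- move=> e; split; first exact/continuous_subspaceT/rchar_continuous.
  move=> d d'; rewrite !inE => d1 d1' ee; apply: bary_inj => //= i.
  have [_ e0] := svalP e; have [v0 _] := fset0Pn _ e0.
  have li := ltn_ord_card i e0.
  have := congr1 (fun x => pt x (nth v0 (sval e) i)) ee.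
  by rewrite /= /bary_pt mem_nth// index_uniq// ?fset_uniq// inord_val.
- move=> x; have [e xe] := suppE x; exists e; split; first by rewrite open_rcellE.
  by move=> e'; rewrite open_rcellE /= xe => /rcell_inj.
- move=> e; exists [set e' : rcell | (sval e' `<` sval e)%fset].
    apply: (@sub_finite_set _ _ (sval @^-1` [set` fpowerset (sval e)])).
      by move=> e' /= /fproper_sub; rewrite fpowersetE.
    apply: finite_preimage; last exact: finite_fset.
    by move=> e1 e2 _ _; exact: rcell_inj.
  have [_ e0] := svalP e.
  split=> [e' /= lt|x [d d1 <-]].
    rewrite /rcell_dim -ltnS -!cardfs_pred//; first exact: fproper_ltn_card.
    by have [] := svalP e'.
  have [e' xe'] := suppE (@rchar e d); exists e' => /=; last by rewrite open_rcellE.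
  rewrite -xe' fproperEneq supp_rchar andbT; apply/eqP => se.
  have [i bi] := bary_boundary d1; have [v0 _] := fset0Pn _ e0.
  have li := ltn_ord_card i e0.
  have : nth v0 (sval e) i \in supp (@rchar e d) by rewrite se mem_nth.
  by rewrite in_supp /= /bary_pt mem_nth// index_uniq ?fset_uniq// inord_val bi eqxx.
- move=> A cA; rewrite -openC open_realE => e; rewrite preimage_setC openC.
  have := iffLR (@continuous_closedP _ _ _) (@rchar_continuous e) _ (cA e).
  rewrite (_ : _ @^-1` _ = @rchar e @^-1` A)//; apply/seteqP; split => d /=.
    by case.
  move=> Ad; split => //.
  have [d' [d1 <- _]] := @rchar_surj (@rchar e d) e (supp_rchar d).
  by exists d'.
Qed.

End Realization.

(** * The collapse of a matched complex to a vertex *)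

Section Collapse.
Variables (R : realType) (P : choiceType) (simp : {fset P} -> Prop).
Variables (mu : {fset P} -> {fset P}) (rk : {fset P} -> nat).
Hypothesis pm : perfect_matching simp mu rk.
Hypothesis simp0 : simp fset0.
Local Notation X := (realization R simp).
Local Notation face := (pm_face pm).
Implicit Types (s S : {fset P}) (v : P) (x : X) (g : P -> R) (t : R).

(** The lower members of the pairs. Leaving out the empty one lets its partner, a single vertex,
    survive as the end of the collapse. *)
Definition free_face s := (s `<=` mu s)%fset && (s != fset0).

Definition min_on s g : R := \big[Num.min/1]_(v <- s) g v.

(* Pushes the free face [s] across the simplex [mu s], by moving an equal weight
   from every vertex of [s] to the opposite vertex. *)
Definition push s g v : R :=
  min_on s g * (if v \in s then -1 else if v \in mu s then #|` s|%:R else 0).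

Definition collapse S k t g v : R :=
  g v + t * \sum_(s <- fpowerset S | free_face s && (rk s == k)) push s g v.

Lemma min_on_le s g v : v \in s -> min_on s g <= g v.
Proof. by move=> vs; apply: ge_bigmin_seq. Qed.

Lemma min_on_ge0 s g : (forall v, 0 <= g v) -> 0 <= min_on s g.
Proof. by move=> g0; apply: le_bigmin => //; rewrite ler01. Qed.

Lemma min_on_eq s x : s != fset0 -> exists2 v, v \in s & pt x v = min_on s (pt x).
Proof.
move=> s0; apply: contrapT => no.
have lt v : v \in s -> min_on s (pt x) < pt x v.
  move=> vs; rewrite lt_neqAle min_on_le// andbT; apply/eqP => e.
  by apply: no; exists v.
have m1 : min_on s (pt x) < 1.
  have [v vs] := fset0Pn _ s0; exact: lt_le_trans (lt v vs) (pt_le1 _ _).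
suff : min_on s (pt x) < min_on s (pt x) by rewrite ltxx.
by rewrite {2}/min_on big_seq_cond; apply: lt_bigmin => // v; rewrite andbT; exact: lt.
Qed.

Lemma min_on_out s x v : v \in s -> v \notin supp x -> min_on s (pt x) = 0.
Proof.
move=> vs vx; apply/eqP; rewrite eq_le min_on_ge0 ?andbT; last exact: pt_ge0.
by rewrite -(supp_out vx) min_on_le.
Qed.

(** A face not contained in the support has minimal weight zero and pushes nothing. So one formula
    with a fixed finite [S] serves all points of a closed simplex, as continuity requires. *)
Lemma pushE S k x v : (supp x `<=` S)%fset ->
  \sum_(s <- fpowerset S | free_face s && (rk s == k)) push s (pt x) v =
  \sum_(s <- fpowerset (supp x) | free_face s && (rk s == k)) push s (pt x) v.
Proof.
move=> xS; rewrite [LHS]big_mkcond [RHS]big_mkcond /=; apply/esym.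
apply: big_fset_incl; first by rewrite fpowersetS.
move=> s _; rewrite fpowersetE => /fsubsetPn[u us ux].
by case: ifP => // _; rewrite /push (min_on_out us ux) mul0r.
Qed.

Definition lower s := if (s `<=` mu s)%fset then s else mu s.

Lemma mu_neq s : simp s -> mu s <> s.
Proof.
move=> ss; have [[v vs ->]|[v vs ->]] := pm_upper_or_lower pm ss.
  by move=> /fsetP/(_ v); rewrite !inE eqxx (negbTE vs).
by move=> /fsetP/(_ v); rewrite !inE eqxx vs.
Qed.

Lemma mu_upper s : simp s -> ~~ (s `<=` mu s)%fset -> (mu s `<=` s)%fset.
Proof.
move=> ss; have [[v vs ->]|[v vs ->]] := pm_upper_or_lower pm ss.
  by rewrite fsubsetUr.
by rewrite fsubD1set.
Qed.

Lemma lower_free s : simp s -> lower s != fset0 -> free_face (lower s).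
Proof.
move=> ss; rewrite /free_face /lower => ->; rewrite andbT; case: ifPn => // h.
by rewrite (pmK pm)// mu_upper.
Qed.

Lemma lower_rk s : simp s -> rk (lower s) = rk s.
Proof. by move=> ss; rewrite /lower; case: ifP => // _; rewrite (pm_rk pm). Qed.

Lemma lower_sub s : simp s -> (lower s `<=` s)%fset.
Proof. by move=> ss; rewrite /lower; case: ifPn => // h; exact: mu_upper. Qed.

Lemma sub_upper s : simp s -> (s `<=` mu (lower s))%fset.
Proof. by move=> ss; rewrite /lower; case: ifPn => // h; rewrite (pmK pm). Qed.

Lemma free_face_lower s r : simp s -> (r `<=` s)%fset -> free_face r ->
  (rk s <= rk r)%N -> r = lower s.
Proof.
move=> ss rs /andP[rm _] le; rewrite /lower.
have [e|/eqP e] := eqVneq r s; first by rewrite -e rm.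
have {}e := rk_face_eq pm ss rs le e; case: ifPn => // h.
by move: rm; rewrite e (pmK pm)// => hs; case: (mu_neq ss); apply/eqP; rewrite eqEfsubset hs h.
Qed.

Lemma push_sum_lt k x v : (rk (supp x) < k)%N ->
  \sum_(s <- fpowerset (supp x) | free_face s && (rk s == k)) push s (pt x) v = 0.
Proof.
move=> lt; rewrite big_seq_cond big1// => s /andP[]; rewrite fpowersetE => sx /andP[_ /eqP rs].
by have := rk_face pm (supp_simp (face) x) sx; rewrite rs leqNgt lt.
Qed.

(** The support has at most one free face of its own rank, by [rk_face_eq], so the simultaneous
    pushes of rank [k] do not interfere. *)
Lemma push_sum_eq k x v : rk (supp x) = k ->
  \sum_(s <- fpowerset (supp x) | free_face s && (rk s == k)) push s (pt x) v =
  if lower (supp x) == fset0 then 0 else push (lower (supp x)) (pt x) v.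
Proof.
move=> rx; have ss := supp_simp (face) x; set l := lower _.
have only s : s \in fpowerset (supp x) -> free_face s && (rk s == k) -> s = l.
  rewrite fpowersetE => sx /andP[fs /eqP rs]; apply: free_face_lower => //.
  by rewrite rs rx.
case: eqP => l0.
  rewrite big_seq_cond big1// => s /andP[sx h].
  by move: (h); rewrite (only s)// /free_face l0 eqxx andbF.
rewrite big_mkcond (big_fsetD1 l)/=; last by rewrite fpowersetE lower_sub.
rewrite lower_free ?lower_rk ?rx ?eqxx//=; last exact/eqP.
rewrite big1_fset ?addr0// => s; rewrite !inE => /andP[/eqP sl sx] _.
by case: ifP => // h; case: sl; exact: only.
Qed.

Lemma collapse_in k t x : (rk (supp x) <= k)%N -> 0 <= t <= 1 ->
  in_realization simp (collapse (supp x) k t (pt x)).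
Proof.
move=> le /andP[t0 t1]; have ss := supp_simp (face) x.
have trivial : (forall v, \sum_(s <- fpowerset (supp x) | free_face s && (rk s == k))
    push s (pt x) v = 0) -> in_realization simp (collapse (supp x) k t (pt x)).
  move=> h; rewrite (_ : collapse _ _ _ _ = pt x); first exact: ptP.
  by apply/funext => v; rewrite /collapse h mulr0 addr0.
move: le; rewrite leq_eqVlt => /orP[/eqP rx|lt]; last first.
  by apply: trivial => v; exact: push_sum_lt.
have [l0|l0] := eqVneq (lower (supp x)) fset0.
  by apply: trivial => v; rewrite push_sum_eq// l0 eqxx.
set l := lower (supp x) in l0; have lf := lower_free ss l0.
have sl : simp l := face ss (lower_sub ss).
have [w [wl e _]] := lower_mu pm sl (proj1 (andP lf)).
have xu : (supp x `<=` mu l)%fset := sub_upper ss.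
have m0 : 0 <= min_on l (pt x) by apply: min_on_ge0; exact: pt_ge0.
have cE v : collapse (supp x) k t (pt x) v = pt x v + t * push l (pt x) v.
  by rewrite /collapse push_sum_eq// (negbTE l0).
exists (mu l); split; first exact: (pm_simp pm).
- move=> v vl; rewrite cE /push (negbTE vl) (negbTE (_ : v \notin l)).
    by rewrite !mulr0 addr0; apply: supp_out; apply: contra vl; exact/fsubsetP.
  by apply: contra vl; exact/fsubsetP/(proj1 (andP lf)).
- move=> v; rewrite cE /push; case: ifPn => [vl|_].
    rewrite mulrN1 mulrN subr_ge0; apply: le_trans (min_on_le _ vl).
    by rewrite -[X in _ <= X]mul1r ler_wpM2r.
  by rewrite addr_ge0 ?pt_ge0// mulr_ge0// mulr_ge0//; case: ifP.
- under eq_bigr do rewrite cE; rewrite big_split /= (sum_supp (x := x)); last first.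
    by move=> v vu; apply: supp_out; apply: contra vu; exact/fsubsetP.
  rewrite -mulr_sumr /push -mulr_sumr e big_fsetU1//= (negbTE wl) !inE eqxx /=.
  rewrite (eq_big_seq (fun=> -1)); last by move=> v ->.
  by rewrite big_const_seq count_predT iter_addr_0 mulNrn subrr !mulr0 addr0.
Qed.

Lemma collapse0 S k g : collapse S k 0 g = g.
Proof. by apply/funext => v; rewrite /collapse mul0r addr0. Qed.

Lemma collapse_supp S k t x : (supp x `<=` S)%fset ->
  collapse S k t (pt x) = collapse (supp x) k t (pt x).
Proof. by move=> xS; apply/funext => v; rewrite /collapse pushE. Qed.

(** By [collapse_in] the default is never taken when the support has rank at most [k] and [t] lies
    in the unit interval. *)
Definition collapse_pt k t x : X :=
  if pselect (in_realization simp (collapse (supp x) k t (pt x))) is left h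
  then mk_pt h else x.

Lemma collapse_ptE S k t x : (supp x `<=` S)%fset -> 0 <= t <= 1 ->
  (rk (supp x) <= k)%N \/ t = 0 -> pt (collapse_pt k t x) = collapse S k t (pt x).
Proof.
move=> xS t01 h; rewrite /collapse_pt collapse_supp//; case: pselect => // no.
case: h => [h|->]; last by rewrite collapse0.
by case: no; exact: collapse_in.
Qed.

Lemma collapse_pt0 k x : collapse_pt k 0 x = x.
Proof.
apply: pt_inj; rewrite (@collapse_ptE (supp x)) ?collapse0 ?lexx ?ler01//; by right.
Qed.

Lemma collapse_pt_lt k t x : (rk (supp x) < k)%N -> 0 <= t <= 1 -> collapse_pt k t x = x.
Proof.
move=> lt t01; apply: pt_inj; rewrite (@collapse_ptE (supp x))//; last by left; exact: ltnW.
by apply/funext => v; rewrite /collapse push_sum_lt// mulr0 addr0.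
Qed.

Lemma collapse_base k t x : supp x = mu fset0 -> collapse (supp x) k t (pt x) = pt x.
Proof.
move=> xb; apply/funext => v /=; rewrite /collapse big_seq_cond big1 ?mulr0 ?addr0// => s.
rewrite fpowersetE xb => /andP[sm /andP[/andP[ss s0] _]]; exfalso.
have [[w _ e]|[w]] := pm_upper_or_lower pm simp0; last by rewrite inE.
have es : s = mu fset0.
  apply/eqP; rewrite eqEfsubset sm e fsetU0 fsub1set.
  by have [u us] := fset0Pn _ s0; have := fsubsetP sm _ us; rewrite e fsetU0 inE => /eqP <-.
by move: ss s0; rewrite es (pmK pm)// fsubset0 => /eqP ->; rewrite eqxx.
Qed.

Lemma collapse_pt_base k t x : supp x = mu fset0 -> collapse_pt k t x = x.
Proof.
move=> xb; rewrite /collapse_pt; case: pselect => // h; apply: pt_inj.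
exact: collapse_base.
Qed.

(** A vertex [u] of the free face where the minimum is attained ends with weight zero. The new
    support lies in [mu l] without [u], a facet different from [l], and such a facet has smaller
    rank. *)
Lemma collapse_pt1 k x : (rk (supp x) <= k)%N -> supp x <> mu fset0 ->
  (rk (supp (collapse_pt k 1 x)) < k)%N.
Proof.
have t01 : 0 <= (1 : R) <= 1 by rewrite ler01 lexx.
rewrite leq_eqVlt => /orP[/eqP rx xb|lt _]; last by rewrite (collapse_pt_lt lt t01).
have ss := supp_simp (face) x; set l := lower (supp x).
have l0 : l != fset0.
  apply/eqP; rewrite /l /lower; case: ifP => _ l0.
    by have := supp_neq0 x; rewrite l0 eqxx.
  by apply: xb; rewrite -l0 (pmK pm).
have lf := lower_free ss l0.
have sl : simp l := face ss (lower_sub ss).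
have [w [wl e _]] := lower_mu pm sl (proj1 (andP lf)).
have [u ul um] := min_on_eq x l0.
have su : simp (mu l) := pm_simp pm sl.
have uu : u \in mu l by apply: (fsubsetP (proj1 (andP lf))).
have sub : (supp (collapse_pt k 1 x) `<=` mu l `\ u)%fset.
  apply/fsubsetP => v; rewrite in_supp (@collapse_ptE (supp x)) ?rx//; last by left.
  rewrite /collapse push_sum_eq// (negbTE l0) mul1r /push !inE -/l.
  have [->|_] /= := eqVneq v u; first by rewrite ul um mulrN1 subrr eqxx.
  move=> nz; apply: contraT => vl; move: nz.
  rewrite (negbTE vl) (negbTE (_ : v \notin l)); last first.
    by apply: contra vl; exact/fsubsetP/(proj1 (andP lf)).
  rewrite mulr0 addr0 supp_out ?eqxx//; apply: contra vl.
  by apply: (fsubsetP (sub_upper ss)).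
apply: leq_ltn_trans (rk_face pm _ sub) _.
  by apply: face su _; exact: fsubD1set.
rewrite -rx -(lower_rk ss) -/l -(pm_rk pm sl); apply: (pm_rk_lt pm) => //.
  by rewrite (pmK pm)//; exact: (proj1 (andP lf)).
by rewrite (pmK pm)// => /fsetP/(_ u); rewrite !inE eqxx ul.
Qed.

(* The collapses of rank [k] take place during the interval
   [1/(k+2), 1/(k+1)], hence in decreasing order of rank. *)
Definition clock k t : R :=
  Num.max 0 (Num.min 1 (k.+1%:R * k.+2%:R * t - k.+1%:R)).

Lemma clock01 k t : 0 <= clock k t <= 1.
Proof. by rewrite /clock le_max lexx /= ge_max ler01 ge_min lexx. Qed.

Lemma clock_continuous k : continuous (clock k).
Proof.
apply: contmax; first exact: contC.
apply: contmin; first exact: contC.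
apply: contD; last exact: contC.
by apply: contM; [exact: contC|move=> t; exact: cvg_id].
Qed.

Lemma clock_at0 k : clock k 0 = 0.
Proof.
rewrite /clock max_l// ge_min mulr0 sub0r oppr_le0 ler0n orbT //.
Qed.

Lemma clock_at1 k : clock k 1 = 1.
Proof.
have h : 1 <= k.+1%:R * k.+2%:R * 1 - k.+1%:R :> R.
  have : 1 <= k.+1%:R :> R by rewrite ler1n.
  by rewrite mulr1 -[k.+2%:R]natr1; nra.
by rewrite /clock min_l// max_r// ler01.
Qed.

(** Rank [j] starts at 1/(j+2), which is not before the end 1/(k+1) of rank [k]. *)
Lemma clock_prev j k t : (j < k)%N -> clock k t < 1 -> clock j t = 0.
Proof.
move=> jk; rewrite /clock gt_max ltr01 gt_min ltxx /= ltrBlDr => h.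
rewrite max_l// ge_min; apply/orP; right; rewrite subr_le0.
have tk : k.+1%:R * t <= 1.
  have e : 1 + k.+1%:R = k.+2%:R :> R by rewrite addrC natr1.
  have : k.+2%:R * (k.+1%:R * t) < k.+2%:R * 1 by rewrite mulr1 -e; nra.
  by rewrite ltr_pM2l ?ltr0n// => /ltW.
have [t0|t0] := leP t 0.
  by apply: (@le_trans _ _ 0) => //; rewrite mulr_ge0_le0 ?mulr_ge0.
rewrite -mulrA -[X in _ <= X]mulr1 ler_wpM2l//; apply: le_trans tk.
by apply: ler_wpM2r; [exact: ltW|rewrite ler_nat].
Qed.

Fixpoint descend k t x : X :=
  if k is k'.+1 then descend k' t (collapse_pt k' (clock k' t) x) else x.

(** Ranks are unbounded over the whole complex, but each point starts at its own rank; by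
    [descend_stable] starting higher changes nothing, which gives one formula on each closed
    simplex. *)
Definition contraction (p : X * R) : X := descend (rk (supp p.1)).+1 p.2 p.1.

Lemma descend_stable k t x : (rk (supp x) < k)%N ->
  descend k t x = descend (rk (supp x)).+1 t x.
Proof.
elim: k => // k IH; rewrite ltnS leq_eqVlt => /orP[/eqP -> //|lt].
by rewrite [LHS]/= collapse_pt_lt ?clock01// IH.
Qed.

(** The invariant that keeps [collapse_pt] away from its default value: either the rank has already
    dropped below [k], or the collapses still to come have not started. *)
Definition ready k t x :=
  (rk (supp x) < k)%N \/ forall j, (j < k)%N -> clock j t = 0.

Lemma ready_collapse k t x : ready k.+1 t x -> supp x = mu fset0 \/
  ready k t (collapse_pt k (clock k t) x).
Proof.
move=> [lt|z]; last by right; right => j jk; apply: z; exact: leq_trans jk _.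
have [c1|c1] := ltP (clock k t) 1; first by right; right => j jk; exact: clock_prev c1.
have -> : clock k t = 1.
  by apply/eqP; rewrite eq_le c1 andbT; have /andP[] := clock01 k t.
have [->|/eqP xb] := eqVneq (supp x) (mu fset0); first by left.
by right; left; exact: collapse_pt1.
Qed.

Lemma descend_base k t x : supp x = mu fset0 -> descend k t x = x.
Proof. by move=> xb; elim: k => //= k; rewrite collapse_pt_base. Qed.

Lemma contraction0 x : contraction (x, 0) = x.
Proof.
suff h k : descend k 0 x = x by exact: h.
by elim: k => //= k IH; rewrite clock_at0 collapse_pt0.
Qed.

Lemma supp_contraction1 x : supp (contraction (x, 1)) = mu fset0.
Proof.
suff h k y : (rk (supp y) < k)%N -> supp (descend k 1 y) = mu fset0 by exact: h.
elim: k y => // k IH y yk /=.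
have [yb|/eqP yb] := eqVneq (supp y) (mu fset0).
  by rewrite descend_base collapse_pt_base.
by rewrite clock_at1; apply: IH; apply: collapse_pt1.
Qed.

Lemma contraction1 x y : contraction (x, 1) = contraction (y, 1).
Proof.
have [[w _ e]|[w]] := pm_upper_or_lower pm simp0; last by rewrite inE.
have ptE (z : X) v : supp z = mu fset0 -> pt z v = (v == w)%:R.
  rewrite e fsetU0 => sz; case: eqP => [->|/eqP vw]; last first.
    by apply: supp_out; rewrite sz inE.
  have := @sum_supp _ _ _ z [fset w]%fset; rewrite big_seq_fset1; apply => u uw.
  by apply: supp_out; rewrite sz.
by apply: pt_inj; apply/funext => v; rewrite !ptE// supp_contraction1.
Qed.

Lemma push_continuous (Z : topologicalType) (g : Z -> X) s v :
  (forall v, continuous (fun z => pt (g z) v)) -> continuous (fun z => push s (pt (g z)) v).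
Proof.
move=> cg; rewrite /push; apply: contM; last exact: contC.
by apply: contbigmin => u; exact: cg.
Qed.

(** As long as the supports stay in one finite vertex set, continuity is a matter of coordinates by
    [continuous_to_real]; each collapse enlarges that set by the partners of its subsets, still
    finitely many vertices. *)
Lemma descend_continuous (Z : topologicalType) (k : nat) (T : Z -> R) :
  continuous T -> forall (g : Z -> X) (S : {fset P}),
  (forall z, (supp (g z) `<=` S)%fset) -> (forall v, continuous (fun z => pt (g z) v)) ->
  (forall z, supp (g z) = mu fset0 \/ ready k (T z) (g z)) ->
  continuous (fun z => descend k (T z) (g z)).
Proof.
move=> cT; elim: k => [|k IH] g S gS cg gr; first exact: (continuous_to_real (face) gS cg).
pose S' := (S `|` \bigcup_(s <- fpowerset S) mu s)%fset.
have gE z v : pt (collapse_pt k (clock k (T z)) (g z)) v =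
    collapse S k (clock k (T z)) (pt (g z)) v.
  have [gb|gr'] := gr z; last first.
    rewrite (@collapse_ptE S) ?clock01//; case: gr' => [lt|z0]; first by left.
    by right; apply: z0.
  rewrite collapse_pt_base// collapse_supp//.
  by rewrite collapse_base.
apply: (IH _ S').
- move=> z; apply/fsubsetP => v; rewrite in_supp gE /collapse.
  apply: contraR; rewrite in_fsetU negb_or => /andP[vS vm].
  rewrite supp_out ?add0r; last by apply: contra vS; exact/fsubsetP.
  rewrite big_seq_cond big1 ?mulr0// => s; rewrite fpowersetE => /andP[sS _].
  rewrite /push (negbTE (_ : v \notin s)); last by apply: contra vS; exact/fsubsetP.
  rewrite (negbTE (_ : v \notin mu s)) ?mulr0//; apply: contra vm => vm.
  by apply/bigfcupP; exists s => //; rewrite fpowersetE sS.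
- move=> v; under eq_fun do rewrite gE /collapse.
  apply: contD; first exact: cg.
  apply: contM.
    move=> z; apply: (@continuous_comp _ _ _ T (clock k)); first exact: cT.
    exact: clock_continuous.
  by apply: contsum => s; exact: push_continuous.
- move=> z; have [gb|gr'] := gr z; first by left; rewrite collapse_pt_base.
  have [gb|] := ready_collapse gr'; last by right.
  by left; rewrite collapse_pt_base.
Qed.

Lemma contraction_continuous : continuous contraction.
Proof.
apply: (continuous_from_realR (face)) => e.
pose N := (rk (sval e)).+1.
have se := (svalP e).1.
rewrite (_ : (fun p => _) = fun p : 'rV[R]_(rcell_dim e) * R =>
    descend N p.2 (rchar p.1)); last first.
  apply/funext => p; apply/esym; apply: (@descend_stable N p.2 (rchar p.1)).
  by rewrite ltnS; apply: (rk_face pm se); exact: supp_rchar.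
apply: (@descend_continuous _ _ (fun p => p.2) _ _ (sval e)).
- by move=> p; exact: cvg_snd.
- by move=> p; exact: supp_rchar.
- move=> v p; apply: (@continuous_comp _ _ _ (fun p => p.1) (fun d => pt (rchar d) v)).
    exact: cvg_fst.
  exact: bary_pt_continuous.
- move=> p; right; left; rewrite ltnS; apply: (rk_face pm se); exact: supp_rchar.
Qed.

Lemma matched_contractible : contractible R X.
Proof.
have [[w _ e]|[w]] := pm_upper_or_lower pm simp0; last by rewrite inE.
have e1 : simp [fset w]%fset by rewrite -[[fset w]%fset]fsetU0 -e; apply: (pm_simp pm).
have e0 : [fset w]%fset != fset0 by apply/fset0Pn; exists w; rewrite inE.
pose c : rcell simp := exist _ [fset w]%fset (conj e1 e0).
exists contraction; split; first exact/continuous_subspaceT/contraction_continuous.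
  exact: contraction0.
exists (contraction (@rchar R _ _ c 0, 1)) => x; exact: contraction1.
Qed.

End Collapse.

(** * The induced action on the realization *)

Section CellularAction.
Variables (R : realType) (P : choiceType) (simp : {fset P} -> Prop).
Hypothesis simp_face : forall s t, simp t -> (s `<=` t)%fset -> simp s.
Variables (G : groupType) (av : G -> P -> P).
Hypotheses (av1 : forall v, av 1%g v = v).
Hypothesis avM : forall g h v, av (g * h)%g v = av g (av h v).
Hypothesis av_simp : forall g s, simp s -> simp [fset av g v | v in s]%fset.
Hypothesis av_free : forall g s, simp s -> s != fset0 ->
  [fset av g v | v in s]%fset = s -> g = 1%g.
Local Notation X := (realization R simp).

Lemma avK g v : av g (av g^-1%g v) = v.
Proof. by rewrite -avM mulgV av1. Qed.

Lemma avVK g v : av g^-1%g (av g v) = v.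
Proof. by rewrite -avM mulVg av1. Qed.

Lemma ract_in g (x : X) : in_realization simp (pt x \o av g^-1%g).
Proof.
have [s [ss s0 sp s1]] := ptP x.
exists [fset av g v | v in s]%fset; split; first exact: av_simp.
- move=> v vs /=; apply: s0; apply: contra vs => vs.
  by rewrite -(avK g v) in_imfset.
- by move=> v /=.
- rewrite big_imfset /= => [|u v _ _ e]; last by rewrite -(avVK g u) e avVK.
  by under eq_bigr do rewrite avVK.
Qed.

Definition ract g x : X := mk_pt (ract_in g x).

Lemma supp_ract g x : supp (ract g x) = [fset av g v | v in supp x]%fset.
Proof.
apply/fsetP => v; rewrite in_supp /=; apply/idP/imfsetP => [h|[u /= us ->]].
  by exists (av g^-1%g v); rewrite /= ?in_supp ?avK.
by rewrite avVK -in_supp.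
Qed.

Lemma ractM g h : ract (g * h)%g = ract g \o ract h.
Proof.
apply/funext => x; apply: pt_inj; apply/funext => v /=.
by rewrite invgM avM.
Qed.

Lemma ract1 : ract 1%g = id.
Proof. by apply/funext => x; apply: pt_inj; apply/funext => v /=; rewrite invg1 av1. Qed.

Lemma ract_continuous g : continuous (ract g).
Proof.
apply: continuous_from_real => e.
apply: (continuous_to_real simp_face (S := [fset av g v | v in sval e]%fset)).
  move=> d; rewrite supp_ract; apply/fsubsetP => v /imfsetP[u /= us ->].
  by rewrite in_imfset//; exact: (fsubsetP (supp_rchar d)).
by move=> v; exact: bary_pt_continuous.
Qed.

Lemma ract_cellular : is_cellular_action (rcells R simp) ract.
Proof.
split; [exact: ract1|exact: ractM|exact: ract_continuous|move=> g e].
have [se e0] := svalP e.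
have ge0 : [fset av g v | v in sval e]%fset != fset0.
  by have [v ve] := fset0Pn _ e0; apply/fset0Pn; exists (av g v); rewrite in_imfset.
pose e' : rcell simp := exist _ [fset av g v | v in sval e]%fset (conj (av_simp g se) ge0).
exists e'.
  by rewrite /= /rcell_dim /= card_imfset// => u v uv; rewrite -(avVK g u) uv avVK.
rewrite !open_rcellE//; apply/seteqP; split => [_ [x /= xe <-]|y /= ye].
  by rewrite supp_ract xe.
exists (ract g^-1%g y); last by rewrite -[LHS]/((ract g \o ract g^-1%g) y) -ractM mulgV ract1.
rewrite /= supp_ract ye; apply/fsetP => v; apply/imfsetP/idP => [[u /= /imfsetP[w /= we ->] ->]|ve].
  by rewrite avVK.
by exists (av g v); rewrite ?avVK//= in_imfset.
Qed.

Lemma ract_free : acts_freely ract.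
Proof.
move=> g x gx; apply: (@av_free g (supp x)); [exact: supp_simp|exact: supp_neq0|].
by rewrite -supp_ract gx.
Qed.

End CellularAction.

(** [D n y] says that descending sequences from [y] have fewer than [n] steps. Finite branching
    makes such a bound exist by well-founded induction, and the rank is the least one; without it
    only an ordinal rank would result. *)
Lemma wf_rank (T : Type) (r : T -> T -> Prop) : well_founded r ->
  (forall y, exists l : seq T, forall x, r x y -> List.In x l) ->
  exists rk : T -> nat, forall x y, r x y -> (rk x < rk y)%N.
Proof.
move=> wf fin; pose D := fix D n y := if n is n'.+1 then forall x, r x y -> D n' x else False.
have Dle n k y : (n <= k)%N -> D n y -> D k y.
  elim: n k y => [|n IH] [|k] y //=; rewrite ltnS => nk h x rxy.
  by apply: (IH k x nk); exact: h.
have Dex y : exists n, D n y.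
  elim/(well_founded_induction wf): y => y IH; have [l lP] := fin y.
  have [n nP] : exists n, forall x, List.In x l -> r x y -> D n x.
    elim: l {lP} => [|a l [n nP]]; first by exists 0%N.
    have [ray|nray] := pselect (r a y); last first.
      by exists n => x [<-//|]; exact: nP.
    have [k kP] := IH a ray; exists (maxn n k) => x [<- _|xl rxy].
      by apply: Dle kP; exact: leq_maxr.
    by apply: Dle (nP x xl rxy); exact: leq_maxl.
  by exists n.+1 => x rxy; apply: nP => //; exact: lP.
have hmin y : exists n, D n y /\ forall k, D k y -> (n <= k)%N.
  have ex : exists n, `[< D n y >] by have [n nP] := Dex y; exists n; exact/asboolP.
  case: (ex_minnP ex) => n /asboolP nP nmin; exists n; split => // k kP.
  by apply: nmin; exact/asboolP.
pose rk y := projT1 (cid (hmin y)); have rkP y : D (rk y) y /\ forall n, D n y -> (rk y <= n)%N.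
  exact: projT2 (cid (hmin y)).
exists rk => x y rxy; have [+ _] := rkP y; case: (rk y) => [//|n] /= /(_ x rxy) h.
by rewrite ltnS; have [_] := rkP x; apply.
Qed.

(** * An acyclic matching on the chains of a levelled poset *)

Section LevelMatching.
Variables (P : choiceType) (le : rel P) (lev dim : P -> nat).
Variables (m : option P -> P -> P) (cmin : option P -> P).
Hypotheses (le_refl : reflexive le) (le_anti : antisymmetric le) (le_trans : transitive le).
Hypothesis lev_mono : forall F G, le F G -> (lev F <= lev G)%N.
Hypothesis dim_mono : forall F G, le F G -> F != G -> (dim F < dim G)%N.

(** In the application [lev] is the distance from the base, [m b F] is the largest stratum within
    the bound [b] that has the same far chamber as [F], and [cmin b] is the stratum within [b]
    nearest to the base. *)
Definition below (b : option P) F : bool :=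
  if b is Some G then le F G && (lev F < lev G)%N else true.

Hypothesis m_ge : forall b F, below b F -> le F (m b F).
Hypothesis m_below : forall b F, below b F -> below b (m b F).
Hypothesis m_lev : forall b F, below b F -> lev (m b F) = lev F.
Hypothesis m_eq : forall b F F', below b F -> below b F' -> le F F' -> lev F = lev F' ->
  m b F = m b F'.
Hypothesis cmin_uniq : forall b F, below b F -> (lev F <= lev (cmin b))%N -> F = cmin b.
Hypothesis cmin_le : forall G, le (cmin (Some G)) G.
Hypothesis cmin_below : forall b F, below b F -> m b F = F -> F <> cmin b ->
  below (Some F) (cmin (Some F)).

Definition gt_ : rel P := fun x y => le y x && (y != x).

Lemma gt_trans : transitive gt_.
Proof.
move=> y x z /andP[yx nyx] /andP[zy nzy]; apply/andP; split; first exact: le_trans zy yx.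
apply/eqP => zx; subst z; move/eqP: nyx; apply; apply: le_anti; exact/andP.
Qed.

Definition chain b (s : seq P) := sorted gt_ s && all (below b) s.

(** Chains are listed from the largest element down. If the head is not the largest of its class,
    that largest element is added; if it is and the next element is of the same level, hence of the
    same class, the head is removed; a lone [cmin b] is paired with the empty chain; any other lone
    head is kept and the rest is matched below it. *)
Fixpoint match_ (b : option P) (s : seq P) : seq P :=
  if s is F :: s' then
    if m b F != F then m b F :: s
    else if (if s' is F' :: _ then lev F' == lev F else false) then s'
    else if F == cmin b then s' else F :: match_ (Some F) s'
  else [:: cmin b].

(** The condition under which the empty chain below [b] has a partner. *)
Definition good b := below b (cmin b).

Lemma below_good b F : below b F -> good b.
Proof.
case: b => // G /[dup] bF /andP[FG lt]; rewrite /good /= cmin_le /=.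
have [|lt'] := leqP (lev F) (lev (cmin (Some G))); last exact: ltn_trans lt' lt.
by move=> /(cmin_uniq bF) <-.
Qed.

Lemma m_cmin b : good b -> m b (cmin b) = cmin b.
Proof. by move=> g; apply: cmin_uniq; [exact: m_below|rewrite m_lev]. Qed.

Lemma m_idem b F : below b F -> m b (m b F) = m b F.
Proof.
by move=> bF; apply/esym/m_eq; rewrite ?m_lev//; [exact: m_below|exact: m_ge].
Qed.

Lemma chain_cons b F s : chain b (F :: s) = [&& below b F, all (gt_ F) s & chain b s].
Proof.
rewrite /chain /= (path_sortedE gt_trans); case: (below b F) => /=; last by rewrite !andbF.
by rewrite -andbA.
Qed.

Lemma chain_critical b F s : chain b (F :: s) ->
  (if s is F' :: _ then lev F' == lev F else false) = false -> chain (Some F) s.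
Proof.
rewrite chain_cons => /and3P[bF /allP Fs /andP[ss sb]] h; rewrite /chain ss /=.
apply/allP => G Gs; have /andP[GF nGF] := Fs _ Gs; rewrite /= GF /=.
case: s ss sb Fs h Gs => // F' s /= ss sb Fs h Gs.
have lt : (lev F' < lev F)%N.
  have /andP[F'F _] := Fs F' (mem_head _ _).
  by rewrite ltn_neqAle h /= lev_mono.
move: Gs; rewrite inE => /orP[/eqP -> //|Gs]; apply: leq_ltn_trans lt; apply: lev_mono.
by have := allP (order_path_min gt_trans ss) _ Gs; case/andP.
Qed.

Lemma chain_consS b F s : below b F -> chain (Some F) s -> chain b (F :: s).
Proof.
move=> bF /andP[ss /allP sF]; rewrite chain_cons bF /chain ss /=.
apply/andP; split; apply/allP => G /sF /andP[GF lt].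
  by rewrite /gt_ GF; apply/eqP => e; rewrite e ltnn in lt.
case: b bF => //= G0 /andP[FG lt']; rewrite (le_trans GF FG) /=.
exact: ltn_trans lt lt'.
Qed.

Lemma critical_head F s : chain (Some F) s ->
  (if s is F' :: _ then lev F' == lev F else false) = false.
Proof. by case: s => // F' s /andP[_ /= /andP[/andP[_ lt] _]]; rewrite ltn_eqF. Qed.

Lemma cmin_nil b F s : chain b (F :: s) -> F = cmin b -> s = [::].
Proof.
rewrite chain_cons => /and3P[bF Fs /andP[_ sb]] e; case: s Fs sb => // G s /=.
move=> /andP[/andP[GF /eqP nGF] _] /andP[bG _]; case: nGF.
by rewrite e; apply: cmin_uniq => //; rewrite -e lev_mono.
Qed.

Lemma matchP b s : good b -> chain b s ->
  [/\ chain b (match_ b s), match_ b (match_ b s) = s &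
    exists v, (v \notin s /\ match_ b s =i v :: s) \/
              (v \notin match_ b s /\ s =i v :: match_ b s)].
Proof.
elim: s b => [|F s IH] b g c /=.
  split; last by exists (cmin b); left.
    by rewrite chain_cons; apply/and3P; split.
  by rewrite /= m_cmin// eqxx.
have := c; rewrite chain_cons => /and3P[bF Fs cs].
case: eqP => [mF|/eqP mF] /=; last first.
  have mFF : gt_ (m b F) F by rewrite /gt_ m_ge// eq_sym.
  have ms : all (gt_ (m b F)) (F :: s).
    by rewrite /= mFF; apply: sub_all Fs => G; exact: gt_trans.
  split.
  - by rewrite chain_cons m_below//= -/(all _ (F :: s)) ms c.
  - by rewrite m_idem// eqxx /= m_lev// eqxx.
  - exists (m b F); left; split => //; apply/negP => /(allP ms).
    by rewrite /gt_ eqxx andbF.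
case: ifP => h.
  have Fns : F \notin s by apply/negP => /(allP Fs); rewrite /gt_ eqxx andbF.
  split => //; last by exists F; right.
  case: s Fs cs h Fns {IH c} => // F' s /= /andP[/andP[F'F nF'F] _] cs /eqP h _.
  move: cs; rewrite chain_cons => /and3P[bF' _ _].
  by rewrite (m_eq bF' bF F'F h) mF eq_sym nF'F.
case: eqP => [e|ne].
  have -> := cmin_nil c e; split => //=; first by rewrite e.
  by exists F; right; split => // G; rewrite inE.
have cF := chain_critical c h; have gF := cmin_below bF mF ne.
have [c' mm [v v'P]] := IH (Some F) gF cF; split.
- exact: chain_consS.
- by rewrite /= mF eqxx /= critical_head//; case: eqP => // _; rewrite mm.
- have Fn s' : chain (Some F) s' -> F \notin s'.
    by move=> /andP[_ /allP h']; apply/negP => /h' /andP[_]; rewrite ltnn.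
  case: v'P => [[vs e]|[vs e]]; exists v; [left|right]; split.
  + by rewrite inE negb_or vs andbT; apply/eqP => vF; have := Fn _ c'; rewrite e vF mem_head.
  + by move=> G; rewrite !inE e inE orbCA.
  + by rewrite inE negb_or vs andbT; apply/eqP => vF; have := Fn _ cF; rewrite e vF mem_head.
  + by move=> G; rewrite !inE e inE orbCA.
Qed.

Lemma chain_uniq b s : chain b s -> uniq s.
Proof.
move=> /andP[ss _]; apply: (sorted_uniq gt_trans) ss => x.
by rewrite /gt_ eqxx andbF.
Qed.

Definition is_upper b s := (size (match_ b s) < size s)%N.

Definition upper_of b s := if is_upper b s then s else match_ b s.

(** One step of a gradient path among upper chains: delete a vertex other than the matched one and
    pass to the upper member of the pair reached. Well-foundedness of this relation is the
    acyclicity of the matching. *)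
Definition smaller b (x y : seq P) : Prop := [/\ chain b y, is_upper b y &
  exists2 u, u \in y & rem u y <> match_ b y /\ x = upper_of b (rem u y)].

Lemma chain_rem b u s : chain b s -> chain b (rem u s).
Proof.
move=> c; have us := chain_uniq c; move: c => /andP[ss sb]; apply/andP; split.
  by apply: subseq_sorted ss; [exact: gt_trans|exact: rem_subseq].
by apply/allP => x /mem_rem; exact: (allP sb).
Qed.

Definition head_lt n (s : seq P) := if s is F :: _ then (lev F < n)%N else true.

Lemma head_lt_match b n s : s != [::] -> chain b s -> head_lt n s -> head_lt n (match_ b s).
Proof.
case: s => // F s _ c /= lt; have := c; rewrite chain_cons => /and3P[bF Fs cs].
case: eqP => mF /=; last by rewrite m_lev.
have hs : head_lt n s.
  case: s Fs {c cs} => //= F' s /andP[/andP[F'F _] _].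
  by apply: leq_ltn_trans lt; exact: lev_mono.
by case: ifP => // _; case: ifP.
Qed.

Lemma match_critical b F s : m b F = F -> F <> cmin b -> chain (Some F) s ->
  match_ b (F :: s) = F :: match_ (Some F) s.
Proof. by move=> mF ne c; rewrite /= mF eqxx /= critical_head//; case: eqP. Qed.

Lemma head_lt_below F s : chain (Some F) s -> head_lt (lev F) s.
Proof. by case: s => //= G y /andP[_ /= /andP[/andP[]]]. Qed.

Lemma chain_of_below b F s : below b F -> chain (Some F) s -> chain b s.
Proof. by move=> bF cs; have := chain_consS bF cs; rewrite chain_cons => /and3P[]. Qed.

(** Behind a lone head [F] the matching is that of the tail with bound [F]. Steps that keep [F] are
    steps of the tail; the step that deletes [F] leads to heads of lower level, which are accessible
    by assumption. *)
Lemma acc_critical b F s : below b F -> m b F = F -> F <> cmin b ->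
  (forall y, chain b y -> head_lt (lev F) y -> Acc (smaller b) y) ->
  chain (Some F) s -> Acc (smaller (Some F)) s -> Acc (smaller b) (F :: s).
Proof.
move=> bF mF ne low c acc; elim: acc c => {}s _ IH c.
constructor => x [_ up [u us [nmu ->]]].
have gF := cmin_below bF mF ne; have gb := below_good bF.
have [cm _ _] := matchP gF c.
have upE y : chain (Some F) y -> is_upper b (F :: y) = is_upper (Some F) y.
  by move=> cy; rewrite /is_upper (match_critical mF ne cy).
rewrite (upE _ c) in up.
have s0 : s != [::] by apply/eqP => s0; move: up; rewrite s0.
move: us nmu; rewrite [rem u _]/= inE eq_sym.
have [Fu _ _|nFu /= us nmu] := eqVneq F u.
  have cb := chain_of_below bF c.
  rewrite /upper_of; case: ifP => _.
    by apply: low => //; exact: head_lt_below.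
  have [cmb _ _] := matchP gb cb.
  by apply: low => //; apply: head_lt_match => //; exact: head_lt_below.
have cr := chain_rem u c.
have -> : upper_of b (F :: rem u s) = F :: upper_of (Some F) (rem u s).
  rewrite /upper_of upE//; case: ifP => // _; exact: match_critical.
apply: IH; last first.
  by rewrite /upper_of; case: ifP => // _; have [] := matchP gF cr.
split => //; exists u => //; split => //; move=> e; apply: nmu.
by have := match_critical mF ne c; rewrite /= => ->; rewrite e.
Qed.

(** Induction on the level of the head, then on the length. An upper chain whose first two elements
    have equal level either keeps such a pair and becomes shorter, or acquires a lone head and falls
    under [acc_critical]. *)
Lemma acc_smaller b : (forall F, below b F -> well_founded (smaller (Some F))) ->
  well_founded (smaller b).
Proof.
move=> wf.
have small n : forall y, chain b y -> head_lt n y -> Acc (smaller b) y.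
  elim: n => [|n IHn] y.
    case: y => [_ _|F y _ /=]; last by rewrite ltn0.
    by constructor => x [_]; rewrite /is_upper ltn0.
  have [k] := ubnP (size y); elim: k y => [y|k IHk y]; first by rewrite ltn0.
  rewrite ltnS => yk c hy.
  case: y yk c hy => [|F s] yk c hy.
    by constructor => x [_]; rewrite /is_upper ltn0.
  have := c; rewrite chain_cons => /and3P[bF Fs cs].
  have [lt|ge] := boolP (lev F < n)%N; first exact: IHn.
  have {hy ge} levF : lev F = n by move: hy ge; rewrite /= ltnS -leqNgt => h1 h2; apply/eqP; rewrite eqn_leq h1.
  constructor => x [_ up [u us [nmu ->]]].
  have crit G z : lev G = n -> below b G -> m b G = G -> chain (Some G) z -> Acc (smaller b) (G :: z).
    move=> lG bG mG cz; have [e|ne] := eqVneq G (cmin b).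
      have z0 : z = [::] by apply: (cmin_nil (chain_consS bG cz) e).
      subst z; constructor => y [_ _ [w]]; rewrite inE => /eqP ->.
      by rewrite /= mG e eqxx /= => -[/(_ erefl) []].
    apply: (acc_critical bG mG _ _ cz (wf G bG z)); first exact/eqP.
    rewrite lG; exact: IHn.
  move: up us nmu; rewrite /is_upper /=.
  case: eqP => [mF|_] /=; last by rewrite ltnNge leqnSn.
  case: ifP => h.
    move=> _; rewrite inE eq_sym; have [_ _ /(_ erefl) []|nFu /= us _] := eqVneq F u.
    have cr := chain_rem u c; rewrite /= (negbTE nFu) in cr.
    have [h'|/negbTE h'] := boolP (if rem u s is F' :: _ then lev F' == lev F else false).
      have -> : upper_of b (F :: rem u s) = F :: rem u s.
        by rewrite /upper_of /is_upper /= mF eqxx /= h' ltnSn.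
      apply: IHk; [|exact: cr|by rewrite /= levF].
      by rewrite /= size_rem//; move: yk us; clear; case: s => //= x s; rewrite ltnS.
    have cz := chain_critical cr h'.
    have nc : F <> cmin b by move=> e; have s0 := cmin_nil c e; rewrite s0 in us.
    have -> : upper_of b (F :: rem u s) = F :: upper_of (Some F) (rem u s).
      by rewrite /upper_of /is_upper (match_critical mF nc cz) /= ltnS; case: ifP.
    apply: crit; [exact: levF|exact: bF|exact: mF|].
    rewrite /upper_of; case: ifP => _; first exact: cz.
    by have [] := matchP (cmin_below bF mF nc) cz.
  have cz := chain_critical c h.
  case: eqP => [e _|nc up].
    have s0 := cmin_nil c e; subst s; rewrite inE => /eqP ->.
    by rewrite /= eqxx => /(_ erefl) [].
  move=> us nmu; have := crit F s levF bF mF cz; case=> /(_ _); apply; split.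
  - exact: c.
  - by rewrite /is_upper match_critical.
  - by exists u => //; split => //; rewrite match_critical.
move=> y; constructor => x [cy up [u uy [nmu ->]]].
have cr := chain_rem u cy.
have : chain b (upper_of b (rem u y)).
  rewrite /upper_of; case: ifP => // _.
  have gb : good b by case: (y) uy cy => // F s _; rewrite chain_cons => /and3P[/below_good].
  by have [] := matchP gb cr.
move: (upper_of _ _) => z cz.
by apply: (small (if z is F :: _ then (lev F).+1 else 0%N)) => //; case: (z) => //= F s.
Qed.

(** Every new bound lies strictly below the old one, so induction on [dim] discharges the hypothesis
    of [acc_smaller]. *)
Lemma smaller_wf b : well_founded (smaller b).
Proof.
apply: acc_smaller => F _; have [n] := ubnP (dim F).
elim: n F => [F|n IH F]; first by rewrite ltn0.
rewrite ltnS => Fn; apply: acc_smaller => G /andP[GF lt].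
apply: IH; apply: leq_trans Fn; apply: dim_mono => //.
by apply/eqP => e; rewrite e ltnn in lt.
Qed.

Definition comparable_fset (s : {fset P}) : Prop :=
  {in s &, forall u v, le u v || le v u}.

Definition chain_seq (s : {fset P}) : seq P := sort (fun x y => le y x) s.

Lemma chain_seqP (s : {fset P}) : comparable_fset s ->
  chain None (chain_seq s) /\ [fset x in chain_seq s]%fset = s.
Proof.
move=> cs; split; last by apply/fsetP => x; rewrite inE mem_sort.
rewrite /chain; apply/andP; split; last exact/allP.
have h : sorted (fun x y => le y x) (chain_seq s).
  apply: (sort_sorted_in (P := mem s)); last by apply/allP.
  by move=> x y xs ys; rewrite orbC; exact: cs.
have u : uniq (chain_seq s) by rewrite sort_uniq fset_uniq.
move: h u; rewrite !sorted_pairwise; [|exact: gt_trans|]; last first.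
  by move=> y x z xy yz; exact: le_trans yz xy.
rewrite uniq_pairwise => h1 h2; have := conj h1 h2 => /andP.
rewrite -pairwise_relI; apply: sub_pairwise => x y /=.
by rewrite /gt_ eq_sym.
Qed.

Lemma chain_fset (s : seq P) : chain None s ->
  comparable_fset [fset x in s]%fset /\ chain_seq [fset x in s]%fset = s.
Proof.
move=> c; have us := chain_uniq c; have /andP[ss _] := c.
have ls : sorted (fun x y => le y x) s.
  by apply: sub_sorted ss => x y /andP[].
have lt : transitive (fun x y => le y x) by move=> y x z xy yz; exact: le_trans yz xy.
have cmp : comparable_fset [fset x in s]%fset.
  move=> x y; rewrite !inE /= => xs ys.
  have [->|nxy] := eqVneq x y; first by rewrite le_refl.
  have := ls; rewrite (sorted_pairwise lt) => /(pairwiseP x) pw.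
  have xi : index x s \in gtn (size s) by rewrite inE index_mem.
  have yi : index y s \in gtn (size s) by rewrite inE index_mem.
  have [lt'|lt'|e] := ltngtP (index x s) (index y s).
  - by have := pw _ _ xi yi lt'; rewrite !nth_index// => ->; rewrite orbT.
  - by have := pw _ _ yi xi lt'; rewrite !nth_index// => ->.
  - by move: nxy; rewrite -(nth_index x xs) e nth_index// eqxx.
split => //; have [cs es] := chain_seqP cmp.
apply: (irr_sorted_eq gt_trans) => //.
- by move=> x; rewrite /gt_ eqxx andbF.
- by have /andP[] := cs.
- by move=> x; move/fsetP/(_ x): es; rewrite !inE.
Qed.

Definition mu_fset (s : {fset P}) : {fset P} :=
  [fset x in match_ None (chain_seq s)]%fset.

Lemma level_matching : exists rk : {fset P} -> nat,
  perfect_matching comparable_fset mu_fset rk.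
Proof.
have g : good None by [].
have [|rk rkP] := wf_rank (smaller_wf None).
  move=> y; exists [seq upper_of None (rem u y) | u <- y] => x [_ _ [u uy [_ ->]]].
  elim: {1 4}y uy => //= v z IH; rewrite inE => /orP[/eqP ->|uz]; first by left.
  by right; exact: IH.
(* Ranking a chain by the upper member of its pair makes the rank constant on pairs by
   construction. *)
exists (fun s => rk (upper_of None (chain_seq s))).
have seqK s : comparable_fset s -> chain_seq (mu_fset s) = match_ None (chain_seq s).
  move=> /chain_seqP[c _]; have [c' _ _] := matchP g c.
  by have [] := chain_fset c'.
have mem_seq_ s x : (x \in chain_seq s) = (x \in s) by rewrite mem_sort.
have upper_match s : chain None s -> upper_of None (match_ None s) = upper_of None s.
  move=> c; have [c' mm [v h]] := matchP g c; rewrite /upper_of /is_upper mm.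
  have us := chain_uniq c; have us' := chain_uniq c'.
  have : size s <> size (match_ None s).
    case: h => [[vs e]|[vs e]].
      have := perm_size (uniq_perm us' (_ : uniq (v :: s)) e) => /= ->; last by rewrite vs.
      by move=> /n_Sn.
    have := perm_size (uniq_perm us (_ : uniq (v :: _)) e) => /= ->; last by rewrite vs.
    by move=> /esym/n_Sn.
  by move=> /eqP; rewrite neq_ltn => /orP[] lt; rewrite lt ltnNge ltnW.
split.
- by move=> s t ct /fsubsetP st u v /st us /st vs; exact: ct.
- move=> s /chain_seqP[c _]; have [c' _ _] := matchP g c.
  by have [] := chain_fset c'.
- move=> s cs; have [c e] := chain_seqP cs; have [c' mm _] := matchP g c.
  by rewrite {1}/mu_fset seqK// mm.
- move=> s cs; have [c e] := chain_seqP cs; have [c' mm [v h]] := matchP g c.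
  exists v; case: h => [[vs em]|[vs em]]; [left|right].
    split; first by rewrite -mem_seq_.
    by apply/fsetP => x; rewrite !inE /= em inE mem_seq_.
  split; first by rewrite -mem_seq_ em mem_head.
  apply/fsetP => x; rewrite !inE /= -mem_seq_ em inE.
  by have [->|_ /=] := eqVneq x v; first exact/negbTE.
- move=> s cs; have [c e] := chain_seqP cs; rewrite seqK//.
  by rewrite upper_match.
- move=> t u ct mt ut nmu; have [c e] := chain_seqP ct.
  have [c' mm [v h]] := matchP g c.
  have us := chain_uniq c; have us' := chain_uniq c'.
  have up : is_upper None (chain_seq t).
    case: h => [[vs em]|[vs em]].
      have : v \in mu_fset t by rewrite inE /= em mem_head.
      by move/(fsubsetP mt); rewrite -mem_seq_ (negbTE vs).
    rewrite /is_upper; have := perm_size (uniq_perm us (_ : uniq (v :: _)) em) => /= -> //.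
    by rewrite vs.
  have er : chain_seq (t `\ u)%fset = rem u (chain_seq t).
    have cr := chain_rem u c; have [_ <-] := chain_fset cr; congr chain_seq.
    by apply/fsetP => x; rewrite !inE /= mem_rem_uniq// inE mem_seq_.
  apply: rkP; rewrite {2}/upper_of up er; split => //.
  exists u; first by rewrite mem_seq_.
  split => // e'; apply: nmu; rewrite /mu_fset -e' -er.
  have [] := @chain_seqP (t `\ u)%fset => //.
  by move=> x y; rewrite !inE => /andP[_ xt] /andP[_ yt]; exact: ct.
Qed.

End LevelMatching.

(** * Chebyshev polynomials at cosines of rational angles *)

Section Chebyshev.
Variable R : realType.
Implicit Types (c theta : R) (k : nat).

(* The values sin (k theta) / sin theta, as polynomials in c = cos theta. *)
Fixpoint cheb_rec c k : R :=
  match k with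
  | 0 => 0
  | k'.+1 => match k' with 0 => 1 | k''.+1 => 2 * c * cheb_rec c k' - cheb_rec c k'' end
  end.

Definition cheb c k := cheb_rec c k.

Lemma cheb_0 c : cheb c 0 = 0. Proof. by []. Qed.
Lemma cheb_1 c : cheb c 1 = 1. Proof. by []. Qed.
Lemma chebSS c k : cheb c k.+2 = 2 * c * cheb c k.+1 - cheb c k.
Proof. by []. Qed.

Lemma cheb_sin theta k : cheb (cos theta) k * sin theta = sin (k%:R * theta).
Proof.
have [//] : cheb (cos theta) k * sin theta = sin (k%:R * theta) /\
  cheb (cos theta) k.+1 * sin theta = sin (k.+1%:R * theta).
elim: k => [|k [IH IH1]]; first by rewrite cheb_0 cheb_1 !mul0r sin0 !mul1r.
split => //; rewrite chebSS mulrBl IH -[_ * _ * _ * _]mulrA IH1.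
have -> : k.+2%:R * theta = k.+1%:R * theta + theta by rewrite -[k.+2%:R]natr1; ring.
rewrite sinD.
rewrite (_ : k%:R * theta = k.+1%:R * theta - theta); last by rewrite -natr1; ring.
by rewrite sinB; ring.
Qed.

Lemma cheb1 k : cheb 1 k = k%:R.
Proof.
have [//] : cheb 1 k = k%:R /\ cheb 1 k.+1 = k.+1%:R.
elim: k => [//|k [IH IH1]]; split => //; rewrite chebSS IH IH1.
by rewrite -[k.+2%:R]natr1 -[k.+1%:R]natr1; ring.
Qed.

Variable m : nat.
Hypothesis m2 : (2 <= m)%N.
Let theta : R := pi / m%:R.

Lemma m_gt0 : 0 < m%:R :> R.
Proof. by rewrite ltr0n (leq_trans _ m2). Qed.

Lemma pidiv_gt0 : 0 < theta < pi.
Proof.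
rewrite /theta divr_gt0 ?pi_gt0 ?m_gt0//= ltr_pdivrMr ?m_gt0//.
by rewrite ltr_pMr ?pi_gt0// ltr1n.
Qed.

Lemma sin_pidiv_gt0 : 0 < sin theta.
Proof. by rewrite sin_gt0_pi// pidiv_gt0. Qed.

Lemma cheb_pidiv_ge0 k : (k <= m)%N -> 0 <= cheb (cos theta) k.
Proof.
move=> km; rewrite -(pmulr_lge0 _ sin_pidiv_gt0) cheb_sin.
apply: sin_ge0_pi; have /andP[t0 t1] := pidiv_gt0.
apply/andP; split; first by rewrite mulr_ge0// ltW.
rewrite /theta mulrCA ger_pMr ?pi_gt0//.
by rewrite ler_pdivrMr ?m_gt0// mul1r ler_nat.
Qed.

Lemma theta_m2 : m.*2%:R * theta = pi *+ 2.
Proof.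
by rewrite /theta -muln2 natrM -mulr_natr; field; rewrite gt_eqF// m_gt0.
Qed.

Lemma cheb_pidiv_2m : cheb (cos theta) m.*2 = 0.
Proof.
apply: (mulIf (lt0r_neq0 sin_pidiv_gt0)).
by rewrite cheb_sin theta_m2 sin2pi mul0r.
Qed.

Lemma cheb_pidiv_2m1 : cheb (cos theta) m.*2.+1 = 1.
Proof.
apply: (mulIf (lt0r_neq0 sin_pidiv_gt0)).
by rewrite cheb_sin -natr1 mulrDl mul1r theta_m2 addrC sinD2pi mul1r.
Qed.

Lemma cos_pidiv_sqr_neq1 : 1 - cos theta ^+ 2 != 0.
Proof. by rewrite -sin2cos2 expf_neq0// gt_eqF// sin_pidiv_gt0. Qed.

End Chebyshev.

Arguments cheb : simpl never.

(** * The bilinear form and the braid relations for reflections *)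

Section Form.
Variables (R : realType) (Pi : choiceType) (W : groupType) (gen : Pi -> W).
Local Notation V := (rootspace R Pi).
Local Notation "v @_ i" := (monalg.mcoeff i v) (at level 3, i at level 2).
Local Notation sr := (@simple_root R Pi).
Local Notation form := (@Defs.form R Pi W gen).
Local Notation refl := (@simple_reflection R Pi W gen).
Implicit Types (u v : V) (i j : Pi) (f g : Pi -> R).

Definition lin f v : R := \sum_(i <- monalg.msupp v) v@_i * f i.

Lemma linEw f v (d : {fset Pi}) : (monalg.msupp v `<=` d)%fset ->
  lin f v = \sum_(i <- d) v@_i * f i.
Proof.
move=> h; apply: big_fset_incl => // k _ kx.
by rewrite monalg.mcoeff_outdom// mul0r.
Qed.

Lemma lin_scalar f : scalar (lin f).
Proof.
move=> a u v; pose d := (monalg.msupp u `|` monalg.msupp v)%fset.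
have hd : (monalg.msupp (a *: u + v) `<=` d)%fset.
  apply: fsubset_trans (monalg.msuppD_le _ _) _.
  by apply: fsetSU; exact: monalg.msuppZ_le.
rewrite !(@linEw _ _ d) ?fsubsetUl ?fsubsetUr//= mulr_sumr -big_split.
by apply: eq_bigr => k _ /=; rewrite monalg.mcoeffD monalg.mcoeffZ mulrDl mulrA.
Qed.

Lemma lin_root f i : lin f (sr i) = f i.
Proof. by rewrite /lin monalg.msuppU oner_eq0 big_seq_fset1 monalg.mcoeffUU mul1r. Qed.

Lemma coef_root i j : (sr i)@_j = (i == j)%:R :> R.
Proof. by rewrite /simple_root monalg.mcoeffU; case: eqP. Qed.

Lemma rootE v : v = \sum_(i <- monalg.msupp v) v@_i *: sr i.
Proof.
rewrite {1}[v]monalg.monalgE; apply: eq_bigr => i _.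
apply/monalg.malgP => j; rewrite monalg.mcoeffZ coef_root monalg.mcoeffU.
by case: eqP; rewrite ?mulr1 ?mulr0.
Qed.

Lemma scalar_lin (h : V -> R) : scalar h -> forall v, h v = lin (h \o sr) v.
Proof.
move=> hs v; have h0 : h 0 = 0.
  by have := hs (-1) 0 0; rewrite scaler0 addr0 mulN1r addNr.
have hsum r (c : Pi -> R) : h (\sum_(i <- r) c i *: sr i) = \sum_(i <- r) c i * h (sr i).
  by elim: r => [|i r IH]; rewrite ?big_nil// !big_cons hs IH.
by rewrite {1}[v]rootE hsum.
Qed.

Lemma scalarD (h : V -> R) : scalar h -> {morph h : u v / u + v}.
Proof. by move=> hs u v; have := hs 1 u v; rewrite scale1r mul1r. Qed.

Lemma scalar0 (h : V -> R) : scalar h -> h 0 = 0.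
Proof. by move=> hs; have := hs (-1) 0 0; rewrite scaler0 addr0 mulN1r addNr. Qed.

Lemma scalarZ (h : V -> R) a u : scalar h -> h (a *: u) = a * h u.
Proof. by move=> hs; have := hs a u 0; rewrite !addr0 (scalar0 hs) addr0. Qed.

Lemma scalarN (h : V -> R) : scalar h -> {morph h : u / - u}.
Proof. by move=> hs u; rewrite -scaleN1r (scalarZ _ _ hs) mulN1r. Qed.

Lemma scalarB (h : V -> R) : scalar h -> {morph h : u v / u - v}.
Proof. by move=> hs u v; rewrite (scalarD hs) (scalarN hs). Qed.

Lemma formE u v : form u v = lin (fun i => lin (cox_form R gen i) v) u.
Proof.
rewrite /Defs.form /lin; apply: eq_bigr => i _; rewrite mulr_sumr.
by apply: eq_bigr => j _; rewrite mulrA.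
Qed.

Lemma form_scalarl v : scalar (form^~ v).
Proof. by move=> a u w; rewrite !formE lin_scalar. Qed.

Lemma form_scalarr u : scalar (form u).
Proof.
move=> a v w; rewrite !formE /lin mulr_sumr -big_split; apply: eq_bigr => i _ /=.
by rewrite -/(lin _ _) lin_scalar mulrDr mulrCA.
Qed.

Definition formDl u v w : form (u + v) w = form u w + form v w := scalarD (form_scalarl w) u v.
Definition formDr u v w : form u (v + w) = form u v + form u w := scalarD (form_scalarr u) v w.
Definition formBl u v w : form (u - v) w = form u w - form v w := scalarB (form_scalarl w) u v.
Definition formBr u v w : form u (v - w) = form u v - form u w := scalarB (form_scalarr u) v w.
Definition formNl u w : form (- u) w = - form u w := scalarN (form_scalarl w) u.
Definition formNr u v : form u (- v) = - form u v := scalarN (form_scalarr u) v.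
Definition formZl a u w : form (a *: u) w = a * form u w := scalarZ a u (form_scalarl w).
Definition formZr a u v : form u (a *: v) = a * form u v := scalarZ a v (form_scalarr u).
Definition form0l w : form 0 w = 0 := scalar0 (form_scalarl w).
Definition form0r u : form u 0 = 0 := scalar0 (form_scalarr u).

Lemma form_roots i j : form (sr i) (sr j) = cox_form R gen i j.
Proof. by rewrite formE !lin_root. Qed.

Definition bilinE := (formDl, formDr, formBl, formBr, formNl, formNr, formZl, formZr).

Lemma form_suml (I : Type) (r : seq I) (p : pred I) (F : I -> V) v :
  form (\sum_(k <- r | p k) F k) v = \sum_(k <- r | p k) form (F k) v.
Proof. by apply: (big_morph (form^~ v)) => [x y|]; rewrite ?formDl ?form0l. Qed.

Lemma form_sumr (I : Type) (r : seq I) (p : pred I) (F : I -> V) v :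
  form v (\sum_(k <- r | p k) F k) = \sum_(k <- r | p k) form v (F k).
Proof. by apply: (big_morph (form v)) => [x y|]; rewrite ?formDr ?form0r. Qed.

Lemma refl_linear i : linear (refl i).
Proof.
move=> a u v; rewrite /simple_reflection (form_scalarl _ a u v) mulrDr scalerDl.
by rewrite scalerBr scalerA mulrCA opprD addrACA -!scalerA.
Qed.

Hypothesis cs : coxeter_system gen.

Lemma gen_inj : injective gen. Proof. by case: cs. Qed.

Lemma elt_orderP (G : groupType) (x : G) : (x ^+ elt_order x = 1)%g.
Proof. by rewrite /elt_order; case: xgetP => [n _ []|_]; rewrite ?expg0. Qed.

Lemma gen2 i : (gen i * gen i = 1)%g.
Proof. by have := elt_orderP (gen i); have [_ -> _ _] := cs. Qed.

Lemma genV i : (gen i)^-1%g = gen i.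
Proof. by apply: (mulgI (gen i)); rewrite mulgV gen2. Qed.

Lemma elt_order1 (G : groupType) : elt_order (1%g : G) = 1%N.
Proof.
rewrite /elt_order; case: xgetP => [n _ [n0 _ min]|/(_ 1%N)[]].
  by case: n n0 min => // -[//|n] _ /(_ 1%N isT); rewrite expg1n.
by split; rewrite ?expg1n// => -[|[]].
Qed.

Lemma elt_orderV (G : groupType) (x : G) : elt_order x^-1%g = elt_order x.
Proof.
congr xget; apply/seteqP; split => n /= [n0 e min]; split => //.
- by apply: invg_inj; rewrite -expVgn e invg1.
- by move=> k kn xk; apply: (min k kn); rewrite expVgn xk invg1.
- by rewrite expVgn e invg1.
- by move=> k kn xk; apply: (min k kn); apply: invg_inj; rewrite -expVgn xk invg1.
Qed.

Lemma cox_m_sym i j : cox_m gen i j = cox_m gen j i.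
Proof. by rewrite /cox_m -elt_orderV invgM !genV. Qed.

Lemma cox_m_diag i : cox_m gen i i = 1%N.
Proof. by rewrite /cox_m gen2 elt_order1. Qed.

Lemma cox_m_neq1 i j : i != j -> cox_m gen i j <> 1%N.
Proof.
move=> ij e; have := elt_orderP (gen i * gen j)%g.
rewrite -/(cox_m gen i j) e expg1 => h; move/eqP: ij; apply; apply: gen_inj.
by rewrite -[LHS]mulg1 -(gen2 j) mulgA h mul1g.
Qed.

Lemma cox_m_ge2 i j : i != j -> cox_m gen i j != 0%N -> (2 <= cox_m gen i j)%N.
Proof. by move=> /cox_m_neq1; case: cox_m => [|[]]. Qed.

Lemma cox_form_sym i j : cox_form R gen i j = cox_form R gen j i.
Proof. by rewrite /cox_form cox_m_sym. Qed.

Lemma form_root1 i : form (sr i) (sr i) = 1.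
Proof. by rewrite form_roots /cox_form cox_m_diag /= divr1 cospi opprK. Qed.

Lemma form_sym u v : form u v = form v u.
Proof.
rewrite !formE /lin; under eq_bigr do rewrite mulr_sumr.
under [RHS]eq_bigr do rewrite mulr_sumr.
rewrite exchange_big; apply: eq_bigr => i _; apply: eq_bigr => j _ /=.
by rewrite mulrCA cox_form_sym.
Qed.

Lemma refl_isom i u v : form (refl i u) (refl i v) = form u v.
Proof.
rewrite /simple_reflection !bilinE form_root1 (form_sym (sr i) v).
ring.
Qed.

Lemma reflK i : involutive (refl i).
Proof.
move=> v; rewrite /simple_reflection !bilinE form_root1.
rewrite -addrA -opprD -scalerDl [X in X *: _](_ : _ = 0) ?scale0r ?subr0//.
ring.
Qed.

Lemma refl_root i : refl i (sr i) = - sr i.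
Proof.
rewrite /simple_reflection form_root1 mulr1 -{1}[sr i]scale1r -scalerBl.
by rewrite (_ : 1 - 2 = -1) ?scaleN1r//; ring.
Qed.

(* [dihedral_vec k] is the image of the simple root of [i] under the alternating
   word of length [k] whose first acting letter is [j]. *)
Definition dihedral_vec c i j k : V :=
  if odd k then cheb c k *: sr i + cheb c k.+1 *: sr j
  else cheb c k.+1 *: sr i + cheb c k *: sr j.

Lemma dihedral_vecS i j k :
  refl (if odd k then i else j) (dihedral_vec (- cox_form R gen i j) i j k) =
  dihedral_vec (- cox_form R gen i j) i j k.+1.
Proof.
set c := - _; have fc : form (sr i) (sr j) = - c by rewrite form_roots opprK.
have fc' : form (sr j) (sr i) = - c by rewrite form_sym.
rewrite /dihedral_vec [odd k.+1]/=; case: (odd k) => /=;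
  rewrite /simple_reflection !bilinE !form_root1 ?fc ?fc' chebSS.
  rewrite addrAC -scalerBl; congr (_ *: _ + _); ring.
rewrite -addrA -scalerBl; congr (_ + _ *: _); ring.
Qed.

Lemma refl_pow_i i j m : (2 <= m)%N -> cox_form R gen i j = - cos (pi / m%:R) ->
  iter m (refl i \o refl j) (sr i) = sr i.
Proof.
move=> m2 e.
have it k : iter k (refl i \o refl j) (sr i) = dihedral_vec (- cox_form R gen i j) i j k.*2.
  elim: k => [|k IH]; first by rewrite /dihedral_vec /= cheb_0 cheb_1 scale1r scale0r addr0.
  rewrite iterS IH doubleS -dihedral_vecS /= odd_double /=.
  by rewrite -dihedral_vecS odd_double.
rewrite it e opprK /dihedral_vec odd_double cheb_pidiv_2m// cheb_pidiv_2m1//.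
by rewrite scale1r scale0r addr0.
Qed.

(** For a finite label the form is nondegenerate on the plane of the two roots. A vector splits into
    a part in the plane, where the Chebyshev values show that the product of reflections has the
    right order, and a part fixed by both reflections. *)
Lemma refl_pow i j v : iter (cox_m gen i j) (refl i \o refl j) v = v.
Proof.
have [->|ij] := eqVneq i j; first by rewrite cox_m_diag /= reflK.
have [-> //|m0] := eqVneq (cox_m gen i j) 0%N.
have m2 := cox_m_ge2 ij m0; set m := cox_m gen i j in m0 m2 *.
set c := cos (pi / m%:R : R).
have cE : cox_form R gen i j = - c by rewrite /cox_form -/m (negbTE m0).
have cE' : cox_form R gen j i = - c by rewrite cox_form_sym.
have D0 := @cos_pidiv_sqr_neq1 R _ m2; rewrite -/c in D0.
pose L := iter m (refl i \o refl j); rewrite -/(L v).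
have Llin : linear L.
  rewrite /L; elim: m {m0 m2 c cE cE' D0 L} => [//|k IH] a x y.
  by rewrite !iterS IH /= !refl_linear.
have Li : L (sr i) = sr i by exact: refl_pow_i cE.
have Lj : L (sr j) = sr j.
  have inv k x : iter k (refl i \o refl j) (iter k (refl j \o refl i) x) = x.
    elim: k x => [//|k IH] x; rewrite iterSr iterS /=.
    by rewrite !reflK IH.
  by rewrite -{1}(refl_pow_i m2 cE') /L inv.
(* The solution of the 2 by 2 Gram system whose off-diagonal entry is [- c], so that [u] is
   orthogonal to both roots. *)
pose a := (form v (sr i) + c * form v (sr j)) / (1 - c ^+ 2).
pose b := (form v (sr j) + c * form v (sr i)) / (1 - c ^+ 2).
pose u := v - (a *: sr i + b *: sr j).
have fij : form (sr i) (sr j) = - c by rewrite form_roots.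
have fji : form (sr j) (sr i) = - c by rewrite form_roots.
have ui : form u (sr i) = 0.
  by rewrite /u !bilinE form_root1 fji /a /b; field.
have uj : form u (sr j) = 0.
  by rewrite /u !bilinE form_root1 fij /a /b; field.
have Lu : L u = u.
  rewrite /L; elim: m {m0 m2 c cE cE' D0 L Llin Li Lj a b fij fji} u ui uj => //= k IH u ui uj.
  by rewrite IH// /simple_reflection uj mulr0 scale0r subr0 ui mulr0 scale0r subr0.
have -> : v = u + (a *: sr i + b *: sr j) by rewrite /u subrK.
have LD x y : L (x + y) = L x + L y by have := Llin 1 x y; rewrite !scale1r.
have LZ t x : L (t *: x) = t *: L x.
  have L0 : L 0 = 0 by have := Llin (-1) 0 0; rewrite scaler0 addr0 scaleN1r addNr.
  by have := Llin t x 0; rewrite !addr0 L0 addr0.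
rewrite LD Lu; congr (_ + _).
by rewrite LD !LZ Li Lj.
Qed.

End Form.

(** * Existence of the geometric representation *)

Section BijectionGroup.
Variable T : Type.

Definition bij_group := {f : (T -> T) * (T -> T) | cancel f.1 f.2 /\ cancel f.2 f.1}.

HB.instance Definition _ := gen_eqMixin bij_group.
HB.instance Definition _ := gen_choiceMixin bij_group.

Lemma bij_group_eq (f g : bij_group) : (sval f).1 = (sval g).1 -> f = g.
Proof.
case: f g => [[f f'] [fK f'K]] [[g g'] [gK g'K]] /= e; subst g.
have e' : f' = g' by apply/funext => x; rewrite -{1}(g'K x); exact: fK.
by subst g'; congr exist; exact: Prop_irrelevance.
Qed.

Definition bij1 : bij_group := exist _ (id, id) (conj (fun=> erefl) (fun=> erefl)).

Definition bijV (f : bij_group) : bij_group :=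
  exist _ ((sval f).2, (sval f).1) (conj (svalP f).2 (svalP f).1).

Lemma bijM_subproof (f g : bij_group) :
  cancel ((sval f).1 \o (sval g).1) ((sval g).2 \o (sval f).2) /\
  cancel ((sval g).2 \o (sval f).2) ((sval f).1 \o (sval g).1).
Proof.
have [fK f'K] := svalP f; have [gK g'K] := svalP g.
by split => x /=; rewrite ?fK ?gK ?g'K ?f'K.
Qed.

Definition bijM (f g : bij_group) : bij_group := exist _ (_, _) (bijM_subproof f g).

Lemma bijMA : associative bijM. Proof. by move=> f g h; exact: bij_group_eq. Qed.
Lemma bij1M : left_id bij1 bijM. Proof. by move=> f; exact: bij_group_eq. Qed.
Lemma bijM1 : right_id bij1 bijM. Proof. by move=> f; exact: bij_group_eq. Qed.
Lemma bijVM : left_inverse bij1 bijV bijM.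
Proof. by move=> f; apply: bij_group_eq; apply/funext => x /=; rewrite (svalP f).1. Qed.
Lemma bijMV : right_inverse bij1 bijV bijM.
Proof. by move=> f; apply: bij_group_eq; apply/funext => x /=; rewrite (svalP f).2. Qed.

HB.instance Definition _ := isGroup.Build bij_group bijMA bij1M bijM1 bijVM bijMV.

End BijectionGroup.

Section GeomRep.
Variables (R : realType) (Pi : choiceType) (W : groupType) (gen : Pi -> W).
Hypothesis cs : coxeter_system gen.
Local Notation V := (rootspace R Pi).
Local Notation refl := (@simple_reflection R Pi W gen).

Definition refl_bij i : bij_group V :=
  exist _ (refl i, refl i) (conj (reflK cs i) (reflK cs i)).

(** The reflections satisfy the Coxeter relations in the group of bijections of V, so the universal
    property of the presentation yields the action and [xget] does not take its default. *)
Lemma geom_repP : is_action (@geom_rep R Pi W gen) /\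
  forall i, @geom_rep R Pi W gen (gen i) = refl i.
Proof.
rewrite /geom_rep; case: xgetP => [rho _ [] //|no]; exfalso.
have [_ _ _ univ] := cs.
have pw n (f : bij_group V) : (sval (f ^+ n)%g).1 = iter n (sval f).1.
  elim: n => [|n IH]; first by rewrite expg0.
  by rewrite expgS; apply/funext => x /=; rewrite IH.
have [i j|phi phiP] := univ (bij_group V) refl_bij.
  apply: bij_group_eq; rewrite pw; apply/funext => v; exact: refl_pow.
have phi1 : phi 1%g = 1%g.
  by apply: (mulgI (phi 1%g)); rewrite -gmulfM !mulg1.
apply: (no (fun w => (sval (phi w)).1)); split => [|i]; last by rewrite phiP.
split; first by rewrite phi1.
by move=> x y; rewrite gmulfM.
Qed.

End GeomRep.

(** * Length, positive roots and inversions *)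

Section Roots.
Variables (R : realType) (Pi : choiceType) (W : groupType) (gen : Pi -> W).
Hypothesis cs : coxeter_system gen.
Local Notation V := (rootspace R Pi).
Local Notation "v @_ i" := (monalg.mcoeff i v) (at level 3, i at level 2).
Local Notation sr := (@simple_root R Pi).
Local Notation form := (@Defs.form R Pi W gen).
Local Notation refl := (@simple_reflection R Pi W gen).
Local Notation act := (@geom_rep R Pi W gen).
Implicit Types (u v : V) (i j s t : Pi) (w : W) (p q : seq Pi).

Lemma act1 v : act 1%g v = v.
Proof. by have [[-> _] _] := geom_repP R cs. Qed.

Lemma actM x y v : act (x * y)%g v = act x (act y v).
Proof. by have [[_ ->] _] := geom_repP R cs. Qed.

Lemma act_gen i v : act (gen i) v = refl i v.
Proof. by have [_ ->] := geom_repP R cs. Qed.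

Lemma actKV w v : act w (act w^-1%g v) = v.
Proof. by rewrite -actM mulgV act1. Qed.

Lemma actVK w v : act w^-1%g (act w v) = v.
Proof. by rewrite -actM mulVg act1. Qed.

Definition wd p : W := foldr (fun i w => gen i * w)%g 1%g p.

Lemma wd_cat p q : wd (p ++ q) = (wd p * wd q)%g.
Proof. by elim: p => [|i p IH] /=; rewrite ?mul1g// IH mulgA. Qed.

Lemma wd_rev p : wd (rev p) = (wd p)^-1%g.
Proof.
elim: p => [|i p IH]; first by rewrite invg1.
by rewrite rev_cons -cats1 wd_cat IH /= mulg1 invgM (genV cs).
Qed.

Definition letters (I : set Pi) p := forall i, i \in p -> I i.

Lemma parabolicP (I : set Pi) w :
  parabolic gen I w <-> exists2 p, letters I p & w = wd p.
Proof.
split.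
  move=> /(_ [set w | exists2 p, letters I p & w = wd p]); apply; split; last first.
    move=> _ [i Ii <-]; exists [:: i]; last by rewrite /= mulg1.
    by move=> j; rewrite inE => /eqP ->.
  split; first by rewrite inE; exists [::].
  move=> x y; rewrite !inE => -[p pI ->] [q qI ->]; exists (p ++ rev q).
    by move=> i; rewrite mem_cat mem_rev => /orP[/pI|/qI].
  by rewrite wd_cat wd_rev.
move=> [p pI ->] A [gA AI]; elim: p pI => [|i p IH] pI /=.
  by have [A1 _] := gA; rewrite inE in A1.
have /set_mem : (gen i * wd p)%g \in A; last by [].
apply: (group_closedM gA); rewrite inE; last by apply: IH => j jp; apply: pI; rewrite inE jp orbT.
by apply: AI; exists i => //; apply: pI; rewrite mem_head.
Qed.

Lemma wordP w : exists p, w = wd p.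
Proof.
have [_ _ gT _] := cs.
have : parabolic gen setT w by rewrite /parabolic gT.
by move=> /parabolicP[p _ ->]; exists p.
Qed.

Lemma word_ind (Q : W -> Prop) : Q 1%g -> (forall i w, Q w -> Q (gen i * w)%g) ->
  forall w, Q w.
Proof. by move=> Q1 QS w; have [p ->] := wordP w; elim: p => //= i p; exact: QS. Qed.

Lemma act_linear w : linear (act w).
Proof.
elim/word_ind: w => [|i w IH] a u v; first by rewrite !act1.
by rewrite !actM IH !act_gen refl_linear.
Qed.

Lemma actD w : {morph act w : u v / u + v}.
Proof. by move=> u v; have := act_linear w 1 u v; rewrite !scale1r. Qed.

Lemma act0 w : act w 0 = 0.
Proof. by have := act_linear w (-1) 0 0; rewrite scaler0 addr0 scaleN1r addNr. Qed.

Lemma actZ w a v : act w (a *: v) = a *: act w v.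
Proof. by have := act_linear w a v 0; rewrite !addr0 act0 addr0. Qed.

Lemma actN w : {morph act w : v / - v}.
Proof. by move=> v; rewrite -scaleN1r actZ scaleN1r. Qed.

Lemma act_isom w u v : form (act w u) (act w v) = form u v.
Proof.
elim/word_ind: w u v => [|i w IH] u v; first by rewrite !act1.
by rewrite !actM !act_gen refl_isom// IH.
Qed.

Lemma act_inj w : injective (act w).
Proof. by move=> u v e; rewrite -(actVK w u) e actVK. Qed.

Lemma len_ex w : exists n, `[< exists2 p, size p = n & wd p = w >].
Proof. by have [p ->] := wordP w; exists (size p); apply/asboolP; exists p. Qed.

Definition len w := ex_minn (len_ex w).

Lemma len_word w : exists2 p, size p = len w & wd p = w.
Proof. by rewrite /len; case: ex_minnP => n /asboolP. Qed.

Lemma len_wd p : (len (wd p) <= size p)%N.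
Proof.
rewrite /len; case: ex_minnP => n _; apply; apply/asboolP; by exists p.
Qed.

Lemma lenM w w' : (len (w * w')%g <= len w + len w')%N.
Proof.
have [p <- <-] := len_word w; have [q <- <-] := len_word w'.
by rewrite -wd_cat -size_cat len_wd.
Qed.

Definition pos v : Prop := forall i, 0 <= v@_i.

Lemma pos_sr i : pos (sr i). Proof. by move=> j; rewrite coef_root ler0n. Qed.

Lemma posD u v : pos u -> pos v -> pos (u + v).
Proof. by move=> pu pv i; rewrite monalg.mcoeffD addr_ge0. Qed.

Lemma posZ a v : 0 <= a -> pos v -> pos (a *: v).
Proof. by move=> a0 pv i; rewrite monalg.mcoeffZ mulr_ge0. Qed.

Lemma pos_neg0 v : pos v -> pos (- v) -> v = 0.
Proof.
move=> pv nv; apply/monalg.malgP => i; rewrite monalg.mcoeff0; apply/eqP.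
by rewrite eq_le pv andbT -oppr_ge0 -monalg.mcoeffN.
Qed.

(** The parity test makes every nonempty word end in [t]; such words act on the root of [s] by the
    vectors [dihedral_vec]. *)
Fixpoint altw s t k : seq Pi :=
  if k is k'.+1 then (if odd k' then s else t) :: altw s t k' else [::].

Lemma size_altw s t k : size (altw s t k) = k.
Proof. by elim: k => //= k ->. Qed.

Lemma altw_split s t (n k : nat) : exists2 p, altw s t (n + k) = p ++ altw s t k & size p = n.
Proof.
elim: n => [|n [p e sp]]; first by exists [::].
by exists ((if odd (n + k) then s else t) :: p); rewrite /= ?e ?sp.
Qed.

Lemma altw_rcons s t k : (wd (altw s t k) * gen s)%g = wd (altw t s k.+1).
Proof.
elim: k => [|k IH]; first by rewrite /= mulg1 mul1g.
by rewrite [LHS]/= -mulgA IH /=; case: (odd k).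
Qed.

Lemma altw_even s t (n : nat) : wd (altw s t n.*2) = ((gen s * gen t) ^+ n)%g.
Proof.
elim: n => [|n IH]; first by rewrite expg0.
by rewrite doubleS /= odd_double /= IH expgS mulgA.
Qed.

(** The relation (st)^m = 1 exchanges an alternating word for the complementary one, which turns
    length m+1 into m-1. *)
Lemma altw_relation s t : (0 < cox_m gen s t)%N ->
  exists2 p, size p = (cox_m gen s t).-1 & wd p = wd (altw t s (cox_m gen s t).+1).
Proof.
set m := cox_m gen s t => m0.
have rel : ((gen s * gen t) ^+ m = 1)%g by exact: elt_orderP.
have invst : (gen t * gen s = (gen s * gen t)^-1)%g by rewrite invgM !(genV cs).
have rV (n : nat) : (n <= m)%N -> ((gen t * gen s) ^+ n = (gen s * gen t) ^+ (m - n))%g.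
  move=> jm; rewrite invst expVgn; apply: (mulgI ((gen s * gen t) ^+ n)%g).
  by rewrite mulgV -expgnDr subnKC.
have [om|em] := boolP (odd m).
  have e : m.+1 = (uphalf m).*2 by rewrite -[in LHS](odd_double_half m) om uphalf_half om.
  have le : (uphalf m <= m)%N by rewrite -leq_double -e -addnn; lia.
  exists (altw s t (m - uphalf m).*2); first by rewrite size_altw; lia.
  by rewrite e !altw_even rV.
have e : m = (m./2).*2 by rewrite -[LHS](odd_double_half m) (negbTE em).
set j := m./2 in e; have j0 : (0 < j)%N by lia.
exists (altw s t (j.-1).*2.+1); first by rewrite size_altw; lia.
rewrite e [altw t s _]/= odd_double /= odd_double /= !altw_even rV; last by lia.
have -> : (m - j = j.-1.+1)%N by lia.
by rewrite expgS !mulgA gen2// mul1g.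
Qed.

(** A reduced word in two letters alternates; it cannot end in [s], because multiplying by [s] would
    then shorten it. *)
Lemma altw_reduced s t q : {subset q <= [:: s; t]} ->
  (forall p, wd p = wd q -> (size q <= size p)%N) ->
  (forall p, wd p = (wd q * gen s)%g -> (size q <= size p)%N) ->
  q = altw s t (size q).
Proof.
elim: q => // x q IH sub red nos.
have qE : q = altw s t (size q).
  apply: IH.
  - by move=> y yq; apply: sub; rewrite inE yq orbT.
  - by move=> p e; have := red (x :: p); rewrite /= e ltnS; apply.
  - by move=> p e; have := nos (x :: p); rewrite /= e mulgA ltnS; apply.
have := sub x (mem_head _ _); rewrite [size _]/= [altw _ _ _]/= -qE.
case E: (size q) => [|k] /=.
  have q0 := size0nil E; subst q; rewrite !inE => /orP[] /eqP xe; subst x => //.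
  by have := nos [::]; rewrite /= mulg1 gen2// => /(_ erefl).
rewrite {}E /= in qE; move: red; rewrite qE /= => red.
have nx : x <> (if odd k then s else t).
  move=> xe; have := red (altw s t k); rewrite xe mulgA gen2// mul1g => /(_ erefl).
  by rewrite size_altw; lia.
by rewrite !inE; case: (odd k) nx => /= nx /orP[] /eqP xe; rewrite xe in nx *.
Qed.

Lemma act_altw s t k :
  act (wd (altw s t k)) (sr s) = dihedral_vec (- cox_form R gen s t) s t k.
Proof.
elim: k => [|k IH].
  by rewrite /dihedral_vec /= cheb_0 cheb_1 act1 scale1r scale0r addr0.
by rewrite [wd _]/= actM IH act_gen; exact: dihedral_vecS.
Qed.

Lemma cheb_cox_ge0 s t k : s != t ->
  cox_m gen s t = 0%N \/ (k <= cox_m gen s t)%N -> 0 <= cheb (- cox_form R gen s t) k.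
Proof.
move=> st; rewrite /cox_form; case: eqP => [_ _|/eqP m0 [/eqP|km]].
- by rewrite opprK cheb1 ler0n.
- by rewrite (negbTE m0).
- by rewrite opprK cheb_pidiv_ge0// cox_m_ge2.
Qed.

(** Induction on the length. With [t] the last letter of a reduced word of [w], write [w] as [v]
    times a word [q] in [s] and [t], with lengths adding and [q] as long as possible. Then [v] is
    shorter and keeps the roots of both letters positive, while [q] sends the root of [s] to a
    combination of the two whose Chebyshev coefficients are nonnegative because [q] is short
    enough. *)
Lemma act_pos w s : (len w <= len (w * gen s)%g)%N -> pos (act w (sr s)).
Proof.
have [n] := ubnP (len w); elim: n => // n IH in w s *; rewrite ltnS => wn ws.
have [p sp wp] := len_word w.
case/lastP: p sp wp => [|p t] sp wp; first by rewrite -wp /= act1; exact: pos_sr.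
rewrite size_rcons in sp; rewrite -cats1 wd_cat /= mulg1 in wp.
have wt : (w * gen t)%g = wd p by rewrite -wp -mulgA gen2// mulg1.
have st : s != t by apply/eqP => e; move: ws; rewrite e wt leqNgt -sp ltnS len_wd.
pose A (n : nat) := `[< exists (v : W) q, [/\ w = (v * wd q)%g, {subset q <= [:: s; t]},
  (len v + size q = len w)%N & size q = n] >].
have A1 : A 1%N.
  apply/asboolP; exists (wd p), [:: t]; split => //=; first by rewrite mulg1.
    by move=> x; rewrite !inE => ->; rewrite orbT.
  have h := len_wd p; have := lenM (wd p) (gen t); rewrite wp.
  have := len_wd [:: t]; rewrite /= mulg1; lia.
have Amax k : A k -> (k <= len w)%N by move=> /asboolP[v [q [_ _ e <-]]]; rewrite -e leq_addl.
case: (@ex_maxnP A (len w) (ex_intro (fun n => A n) 1%N A1) Amax) => k /asboolP[v [q [wE sub lv sq]]] kmax.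
have k1 := kmax _ A1.
have vr r : r \in [:: s; t] -> (len v <= len (v * gen r)%g)%N.
  move=> rst; rewrite leqNgt; apply/negP => lt.
  suff /kmax : A k.+1 by rewrite ltnn.
  apply/asboolP; exists (v * gen r)%g, (r :: q); split => /=.
  - by rewrite mulgA -(mulgA v) gen2// mulg1.
  - by move=> x; rewrite inE => /orP[/eqP -> //|/sub].
  - have := lenM (v * gen r)%g (wd (r :: q)); have := len_wd (r :: q).
    by rewrite /= mulgA -(mulgA v) gen2// mulg1 -wE; lia.
  - by rewrite sq.
have lvn : (len v < n)%N by lia.
have ps : pos (act v (sr s)) by apply: IH => //; apply: vr; rewrite mem_head.
have pt : pos (act v (sr t)) by apply: IH => //; apply: vr; rewrite !inE eqxx orbT.
have red p' : (len (v * wd p')%g <= len v + size p')%N.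
  by apply: leq_trans (lenM _ _) _; rewrite leq_add2l len_wd.
have nos p' : wd p' = (wd q * gen s)%g -> (size q <= size p')%N.
  by move=> e; have := red p'; rewrite e mulgA -wE => h; rewrite -(leq_add2l (len v)) lv; exact: leq_trans h.
have qE : q = altw s t (size q).
  apply: altw_reduced => // p' e; have := red p'; rewrite e -wE => h.
  by rewrite -(leq_add2l (len v)) lv.
(* If [q] had length at least m, the word for [q] followed by [s] would contain an alternating tail
   of length m+1, and [altw_relation] would make it shorter than [q]. *)
have km : cox_m gen s t = 0%N \/ (k.+1 <= cox_m gen s t)%N.
  have [->|m0] := posnP (cox_m gen s t); [by left|right; rewrite ltnNge; apply/negP => mk].
  have [p' sp' e] := altw_relation m0.
  have [r e' sr_] := altw_split t s (k - cox_m gen s t) (cox_m gen s t).+1.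
  have := nos (r ++ p'); rewrite wd_cat e -wd_cat -e' addnS subnK// qE sq.
  by rewrite altw_rcons size_altw => /(_ erefl); rewrite size_cat; lia.
have km' : cox_m gen s t = 0%N \/ (k <= cox_m gen s t)%N.
  by case: km => [->|h]; [left|right; exact: ltnW].
have c0 := cheb_cox_ge0 st km; have c1 := cheb_cox_ge0 st km'.
rewrite wE qE actM act_altw sq /dihedral_vec; case: ifP => _;
  by rewrite actD !actZ; apply: posD; apply: posZ.
Qed.

Definition is_root v : Prop := exists w i, v = act w (sr i).

Lemma root_sr i : is_root (sr i). Proof. by exists 1%g, i; rewrite act1. Qed.

Lemma root_act w v : is_root v -> is_root (act w v).
Proof. by move=> [x [i ->]]; exists (w * x)%g, i; rewrite actM. Qed.

Lemma rootN v : is_root v -> is_root (- v).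
Proof.
move=> [w [i ->]]; exists (w * gen i)%g, i.
by rewrite actM act_gen refl_root// actN.
Qed.

Lemma root_refl i v : is_root v -> is_root (refl i v).
Proof. by rewrite -act_gen; exact: root_act. Qed.

Lemma root_form v : is_root v -> form v v = 1.
Proof. by move=> [w [i ->]]; rewrite act_isom form_root1. Qed.

Lemma root_neq0 v : is_root v -> v <> 0.
Proof. by move=> /root_form + v0; rewrite v0 form0l => /eqP; rewrite eq_sym oner_eq0. Qed.

Lemma act_pos_or_neg w s : pos (act w (sr s)) \/
  (len (w * gen s)%g < len w)%N /\ pos (- act w (sr s)).
Proof.
have [|lt] := leqP (len w) (len (w * gen s)%g); first by left; exact: act_pos.
right; split => //; rewrite -actN -(refl_root _ cs) -act_gen -actM; apply: act_pos.
by rewrite -mulgA gen2// mulg1 ltnW.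
Qed.

Lemma root_pos_or_neg v : is_root v -> pos v \/ pos (- v).
Proof. by move=> [w [i ->]]; case: (act_pos_or_neg w i) => [|[]]; [left|right]. Qed.

Lemma root_not_pos_neg v : is_root v -> pos v -> pos (- v) -> False.
Proof. by move=> /root_neq0 v0 pv nv; apply: v0; exact: pos_neg0. Qed.

Lemma descent_ex w : w <> 1%g -> exists s, (len (w * gen s)%g < len w)%N /\ pos (- act w (sr s)).
Proof.
move=> w1; have [p sp wp] := len_word w.
case/lastP: p sp wp => [|p t] sp wp; first by case: w1; rewrite -wp.
exists t; case: (act_pos_or_neg w t) => // pt; exfalso.
have lt : (len (w * gen t)%g < len w)%N.
  rewrite -{1}wp -cats1 wd_cat /= mulg1 -mulgA gen2// mulg1 -sp size_rcons ltnS.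
  exact: len_wd.
have np : pos (act (w * gen t)%g (sr t)).
  by apply: act_pos; rewrite -mulgA gen2// mulg1 ltnW.
rewrite actM act_gen refl_root// actN in np.
by apply: root_not_pos_neg pt np; apply: root_act; exact: root_sr.
Qed.

Lemma act_faithful w : (forall i, pos (act w (sr i))) -> w = 1%g.
Proof.
move=> h; apply: contrapT => /descent_ex[s [_ ns]].
by apply: root_not_pos_neg (h s) ns; apply: root_act; exact: root_sr.
Qed.

Lemma coef_refl i v j : j != i -> (refl i v)@_j = v@_j.
Proof.
move=> ji; rewrite /simple_reflection monalg.mcoeffB monalg.mcoeffZ coef_root.
by rewrite eq_sym (negbTE ji) mulr0 subr0.
Qed.

Lemma root_other i v : is_root v -> pos v -> v <> sr i -> exists2 j, j != i & 0 < v@_j.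
Proof.
move=> rv pv vi; apply: contrapT => no.
have v0 j : j != i -> v@_j = 0.
  move=> ji; apply/eqP; rewrite eq_le pv andbT leNgt; apply/negP => lt.
  by apply: no; exists j.
have vE : v = v@_i *: sr i.
  apply/monalg.malgP => j; rewrite monalg.mcoeffZ coef_root.
  by have [->|ji] := eqVneq i j; rewrite ?mulr1// mulr0 v0// eq_sym.
have := root_form rv; rewrite {1 2}vE !bilinE form_root1// mulr1 => /eqP.
rewrite -expr2 sqrf_eq1 => /orP[] /eqP e; first by apply: vi; rewrite vE e scale1r.
by have := pv i; rewrite e ler0N1.
Qed.

Lemma root_pos_refl i v : is_root v -> pos v -> v <> sr i -> pos (refl i v).
Proof.
move=> rv pv vi; have [j ji vj] := root_other rv pv vi.
case: (root_pos_or_neg (root_refl i rv)) => // /(_ j).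
by rewrite monalg.mcoeffN coef_refl// oppr_ge0 leNgt vj.
Qed.

Definition pos_root v : Prop := is_root v /\ pos v.

Lemma inversions_finite w : finite_set [set v | pos_root v /\ pos (- act w v)].
Proof.
elim/word_ind: w => [|i w IH].
  rewrite (_ : mkset _ = set0); first exact: finite_set0.
  apply/seteqP; split => // v [[rv pv]]; rewrite act1 => nv.
  exact: root_not_pos_neg pv nv.
apply: (@sub_finite_set _ _ ([set v | pos_root v /\ pos (- act w v)] `|` [set act w^-1%g (sr i)])).
  move=> v [[rv pv]]; rewrite actM act_gen => nv.
  have rw := root_act w rv.
  case: (root_pos_or_neg rw) => pw; last by left; split.
  have [e|/eqP ne] := eqVneq (act w v) (sr i); first by right; rewrite /= -e actVK.
  by case: (root_not_pos_neg (root_refl i rw) (root_pos_refl rw pw ne) nv).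
by rewrite finite_setU; split => //; exact: finite_set1.
Qed.

End Roots.

(** * Parabolic subgroups and the Tits cone *)

Section Parabolic.
Variables (R : realType) (Pi : choiceType) (W : groupType) (gen : Pi -> W).
Hypothesis cs : coxeter_system gen.
Local Notation V := (rootspace R Pi).
Local Notation "v @_ i" := (monalg.mcoeff i v) (at level 3, i at level 2).
Local Notation sr := (@simple_root R Pi).
Local Notation form := (@Defs.form R Pi W gen).
Local Notation refl := (@simple_reflection R Pi W gen).
Local Notation act := (@geom_rep R Pi W gen).
Local Notation is_root := (@is_root R Pi W gen).
Local Notation pos_root := (@pos_root R Pi W gen).
Implicit Types (u v : V) (i j s t : Pi) (w : W) (I : set Pi).

Definition inV I v : Prop := forall i, v@_i != 0 -> I i.

Lemma inV_sr I i : I i -> inV I (sr i).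
Proof. by move=> Ii j; rewrite coef_root; have [<-|_] := eqVneq i j; rewrite ?eqxx. Qed.

Lemma inVD I u v : inV I u -> inV I v -> inV I (u + v).
Proof.
move=> uI vI i; rewrite monalg.mcoeffD => h; apply: contrapT => nI; move: h.
have -> : u@_i = 0 by apply/eqP; apply: contrapT => /negP/uI.
have -> : v@_i = 0 by apply/eqP; apply: contrapT => /negP/vI.
by rewrite addr0 eqxx.
Qed.

Lemma inVZ I a v : inV I v -> inV I (a *: v).
Proof. by move=> vI i; rewrite monalg.mcoeffZ mulf_eq0 negb_or => /andP[_ /vI]. Qed.

Lemma inVN I v : inV I v -> inV I (- v).
Proof. by move=> vI; rewrite -scaleN1r; apply: inVZ. Qed.

Lemma inV_coef0 I v i : inV I v -> ~ I i -> v@_i = 0.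
Proof. by move=> vI nI; apply/eqP; apply: contrapT => /negP/vI. Qed.

Lemma inV_refl I i v : I i -> inV I v -> inV I (refl i v).
Proof.
by move=> Ii vI; apply: (inVD vI); apply: inVN; apply: inVZ; exact: inV_sr.
Qed.

Lemma act_parabolic_coef I w v j : parabolic gen I w -> ~ I j -> (act w v)@_j = v@_j.
Proof.
move=> /(parabolicP cs)[p pI ->] nI; elim: p pI => [|i p IH] pI; first by rewrite (act1 cs).
rewrite [wd gen _]/= (actM cs) (act_gen cs) coef_refl; last first.
  by apply/eqP => ji; apply: nI; rewrite ji; apply: pI; rewrite mem_head.
by apply: IH => k kp; apply: pI; rewrite inE kp orbT.
Qed.

Lemma inV_act I w v : parabolic gen I w -> inV I v -> inV I (act w v).
Proof.
move=> wI vI i; rewrite -[I i]notE => + nI; rewrite (act_parabolic_coef _ wI nI).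
by rewrite (inV_coef0 vI nI) eqxx.
Qed.

Lemma parabolic1 I : parabolic gen I 1%g.
Proof. by apply/(parabolicP cs); exists [::]. Qed.

Lemma parabolicM I x y : parabolic gen I x -> parabolic gen I y -> parabolic gen I (x * y)%g.
Proof.
move=> /(parabolicP cs)[p pI ->] /(parabolicP cs)[q qI ->].
apply/(parabolicP cs); exists (p ++ q); last by rewrite wd_cat.
by move=> i; rewrite mem_cat => /orP[/pI|/qI].
Qed.

Lemma parabolicV I x : parabolic gen I x -> parabolic gen I x^-1%g.
Proof.
move=> /(parabolicP cs)[p pI ->]; apply/(parabolicP cs); exists (rev p).
  by move=> i; rewrite mem_rev => /pI.
by rewrite (wd_rev cs).
Qed.

Lemma parabolic_gen I i : I i -> parabolic gen I (gen i).
Proof.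
move=> Ii; apply/(parabolicP cs); exists [:: i]; last by rewrite /= mulg1.
by move=> j; rewrite inE => /eqP ->.
Qed.

Lemma parabolic_sub I I' x : I `<=` I' -> parabolic gen I x -> parabolic gen I' x.
Proof.
move=> sI /(parabolicP cs)[p pI ->]; apply/(parabolicP cs); exists p => //.
by move=> i /pI/sI.
Qed.

Lemma spherical_sub I I' : I `<=` I' -> spherical gen I' -> spherical gen I.
Proof. by move=> sI; apply: sub_finite_set => x; exact: parabolic_sub. Qed.

Lemma spherical_finite I : spherical gen I -> finite_set I.
Proof.
move=> fI; apply: (@sub_finite_set _ _ (gen @^-1` parabolic gen I)).
  by move=> i Ii; exact: parabolic_gen.
by apply: finite_preimage => // i j _ _; exact: gen_inj.
Qed.

(** If some simple root is negative, its reflection permutes the other positive roots, so passing to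
    the reflected functional removes one entry from the finite list [s] of possibly negative
    roots. *)
Lemma descent I (f : V -> R) (s : seq V) : scalar f ->
  (forall v, pos_root v -> inV I v -> f v < 0 -> v \in s) ->
  exists2 w, parabolic gen I w & forall i, I i -> 0 <= f (act w (sr i)).
Proof.
have [n] := ubnP (size s); elim: n => // n IH in f s *; rewrite ltnS => sn fs fI.
have [|] := pselect (forall i, I i -> 0 <= f (sr i)).
  by move=> h; exists 1%g; [exact: parabolic1|move=> i /h; rewrite (act1 cs)].
move=> /existsNP[i /not_implyP[Ii /negP]]; rewrite -ltNge => fi.
have is_ : sr i \in s.
  by apply: fI => //; [split; [exact: root_sr|exact: pos_sr]|exact: inV_sr].
have f's : scalar (f \o refl i) by move=> a u v /=; rewrite refl_linear fs.
have [|v [rv pv] vI /= fv|w wI h] := IH (f \o refl i) [seq refl i v | v <- rem (sr i) s] _ f's.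
- rewrite size_map size_rem//; apply: leq_trans sn.
  by rewrite prednK//; case: (s) is_.
- have vi : v <> sr i.
    by move=> e; move: fv; rewrite e (refl_root _ cs) (scalarN fs) oppr_lt0 ltNge ltW.
  rewrite -(reflK cs i v); apply: map_f.
  have vs : refl i v \in s.
    apply: fI => //; last exact: inV_refl.
    by split; [exact: root_refl|exact: root_pos_refl].
  move: vs; rewrite (perm_mem (perm_to_rem is_)) inE => /orP[/eqP e|//]; exfalso.
  have : v = - sr i by rewrite -(reflK cs i v) e (refl_root _ cs).
  move=> e'; apply: (root_not_pos_neg cs rv pv); rewrite e' opprK; exact: pos_sr.
exists (gen i * w)%g; first by apply: parabolicM => //; exact: parabolic_gen.
by move=> j Ij; have := h j Ij; rewrite /= (actM cs) (act_gen cs).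
Qed.

Lemma seq_min (T : eqType) (s : seq T) (p : T -> Prop) (h : T -> R) :
  (exists2 x, x \in s & p x) ->
  exists x, [/\ x \in s, p x & forall y, y \in s -> p y -> h x <= h y].
Proof.
elim: s => [[]//|a s IH] [x xs px].
have [ex|no] := pselect (exists2 x, x \in s & p x); last first.
  have xa : x = a.
    by move: xs; rewrite inE => /orP[/eqP //|xs]; case: no; exists x.
  exists a; split; rewrite ?mem_head// -?xa// => y; rewrite inE => /orP[/eqP -> _//|ys py].
  by case: no; exists y.
have [y [ys py ymin]] := IH ex.
have [pa|npa] := pselect (p a /\ h a <= h y).
  exists a; split; [exact: mem_head|by case: pa|move=> z].
  rewrite inE => /orP[/eqP -> //|zs pz]; case: pa => _ ay.
  exact: le_trans ay (ymin z zs pz).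
exists y; split => //; first by rewrite inE ys orbT.
move=> z; rewrite inE => /orP[/eqP -> pa|]; last exact: ymin.
by rewrite leNgt; apply/negP => lt; apply: npa; split => //; exact: ltW.
Qed.

(** In the finite orbit take the positive root of least height. Were it not simple, no reflection
    could lower it, so its product with each simple root of its support would be nonpositive, and so
    would its product with itself. *)
Lemma spherical_root_orbit I v : spherical gen I -> pos_root v -> inV I v ->
  exists w i, [/\ parabolic gen I w, I i & v = act w (sr i)].
Proof.
move=> fI [rv pv] vI; pose L := fset_set (parabolic gen I).
have LP w : (w \in L) = `[< parabolic gen I w >].
  by rewrite in_fset_set//; apply/idP/asboolP; rewrite inE.
have [|w [/[!LP] /asboolP wI pw wmin]] := @seq_min _ L (fun w => pos (act w v))
    (fun w => lin (fun=> 1) (act w v)).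
  by exists 1%g; [rewrite LP; apply/asboolP; exact: parabolic1|rewrite (act1 cs)].
set u := act w v in pw wmin.
have ru : is_root u by exact: root_act.
have uI : inV I u by exact: inV_act.
suff [i Ii ui] : exists2 i, I i & u = sr i.
  exists w^-1%g, i; split => //; first exact: parabolicV.
  by rewrite -ui (actVK cs).
apply: contrapT => no.
have le0 i : u@_i != 0 -> form u (sr i) <= 0.
  move=> ui; have Ii := uI i ui; rewrite leNgt; apply/negP => lt.
  have pr : pos (refl i u) by apply: (root_pos_refl cs) => // e; apply: no; exists i.
  have := wmin (gen i * w)%g; rewrite LP (actM cs) (act_gen cs) -/u => /(_ _ pr).
  have -> : lin (fun=> 1) (refl i u) = lin (fun=> 1) u - 2 * form u (sr i).
    rewrite /simple_reflection (scalarB (lin_scalar _)) (scalarZ _ _ (lin_scalar _)).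
    by rewrite lin_root mulr1.
  rewrite lerBrDl gerDr => h; have : (2 * form u (sr i) <= 0) = false.
    by apply/negbTE; rewrite -ltNge mulr_gt0.
  rewrite h//; apply/asboolP; apply: parabolicM => //; exact: parabolic_gen.
have := root_form cs ru; rewrite {2}[u]rootE form_sumr => /eqP; apply/negP.
rewrite lt_eqF//; apply: le_lt_trans ltr01; rewrite big_seq_cond.
apply: sumr_le0 => i; rewrite andbT -monalg.mcoeff_neq0 => ui.
by rewrite formZr mulr_ge0_le0// le0.
Qed.

Lemma spherical_roots_finite I : spherical gen I ->
  finite_set [set v | is_root v /\ inV I v].
Proof.
move=> fI; have fPi := spherical_finite fI.
pose B := [set v | exists w i, [/\ parabolic gen I w, I i & v = act w (sr i)]].
have fB : finite_set B.
  have -> : B = (fun wi => act wi.1 (sr wi.2)) @` (parabolic gen I `*` I).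
    apply/seteqP; split => [v [w [i [wI Ii ->]]]|_ [[w i] /= [wI Ii] <-]].
      by exists (w, i).
    by exists w, i.
  by apply: finite_image; exact: finite_setX.
apply: (@sub_finite_set _ _ (B `|` (fun v => - v) @` B)).
  move=> v [rv vI]; case: (root_pos_or_neg cs rv) => pv.
    by left; exact: spherical_root_orbit.
  right; exists (- v); last by rewrite opprK.
  apply: spherical_root_orbit => //; last exact: inVN.
  by split => //; exact: rootN.
by rewrite finite_setU; split => //; exact: finite_image.
Qed.

Lemma parabolic_faithful I w : parabolic gen I w -> (forall i, I i -> pos (act w (sr i))) ->
  w = 1%g.
Proof.
move=> wI h; apply: (act_faithful cs) => i; have [Ii|nI] := pselect (I i); first exact: h.
have ri : is_root (act w (sr i)) by apply: (root_act cs); exact: root_sr.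
case: (root_pos_or_neg cs ri) => // /(_ i).
by rewrite monalg.mcoeffN (act_parabolic_coef _ wI nI) coef_root eqxx oppr_ge0 ler10.
Qed.

(** An element of the parabolic subgroup is determined by its action on the finite set of roots
    supported in [I]. *)
Lemma finite_roots_spherical I : finite_set [set v | pos_root v /\ inV I v] ->
  spherical gen I.
Proof.
move=> fI.
have fA : finite_set [set v | is_root v /\ inV I v].
  apply: (@sub_finite_set _ _ ([set v | pos_root v /\ inV I v] `|`
      (fun v => - v) @` [set v | pos_root v /\ inV I v])).
    move=> v [rv vI]; case: (root_pos_or_neg cs rv) => pv; first by left.
    right; exists (- v); last by rewrite opprK.
    by split; [split => //; exact: rootN|exact: inVN].
  by rewrite finite_setU; split => //; exact: finite_image.
pose S := fset_set [set v | is_root v /\ inV I v].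
have SP v : (v \in S) = `[< is_root v /\ inV I v >].
  by rewrite in_fset_set//; apply/idP/asboolP; rewrite inE.
pose h w : {ffun S -> option S} := [ffun x => insub (act w (val x))].
pose g (phi : {ffun S -> option S}) : W := xget 1%g [set w | parabolic gen I w /\ h w = phi].
have inj w w' : parabolic gen I w -> parabolic gen I w' -> h w = h w' -> w = w'.
  move=> wI wI' e; apply: (mulgI w'^-1%g); rewrite mulVg.
  apply: (parabolic_faithful (I := I)); first by apply: parabolicM => //; exact: parabolicV.
  move=> i Ii; have siS : sr i \in S.
    by rewrite SP; apply/asboolP; split; [exact: root_sr|exact: inV_sr].
  have wS x : parabolic gen I x -> act x (sr i) \in S.
    move=> xI; rewrite SP; apply/asboolP; split; first by apply: (root_act cs); exact: root_sr.
    by apply: inV_act => //; exact: inV_sr.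
  have := congr1 (fun phi : {ffun S -> option S} => phi [` siS]%fset) e.
  rewrite /h !ffunE /= (insubT (mem S) (wS _ wI)) (insubT (mem S) (wS _ wI')).
  move=> /(congr1 (omap val)) /= ee; have {}ee : act w (sr i) = act w' (sr i).
    by move: ee => /Some_inj.
  by rewrite (actM cs) ee (actVK cs); exact: pos_sr.
apply: (@sub_finite_set _ _ (g @` setT)); last by apply: finite_image; exact: finite_finset.
move=> w wI; exists (h w) => //; rewrite /g; case: xgetP => [x _ [xI e]|/(_ w)[]//].
exact: inj.
Qed.

Lemma dominant_pos (f : V -> R) v : scalar f -> (forall i, 0 <= f (sr i)) -> pos v -> 0 <= f v.
Proof.
move=> fs f0 pv; rewrite (scalar_lin fs); apply: sumr_ge0 => i _ /=.
by apply: mulr_ge0; [exact: pv|exact: f0].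
Qed.

Lemma dominant_eq0 (f : V -> R) v : scalar f -> pos v ->
  (forall i, v@_i != 0 -> 0 <= f (sr i)) -> f v <= 0 ->
  forall i, v@_i != 0 -> f (sr i) = 0.
Proof.
move=> fs pv f0 fv i vi.
have f0' j : 0 <= v@_j * f (sr j).
  by have [->|vj] := eqVneq v@_j 0; rewrite ?mul0r// mulr_ge0// f0.
have : f v = 0.
  by apply/eqP; rewrite eq_le fv /= (scalar_lin fs); apply: sumr_ge0.
rewrite (scalar_lin fs) /lin => /eqP; rewrite psumr_eq0//= => /allP/(_ i).
by rewrite -monalg.mcoeff_neq0 => /(_ vi); rewrite /= mulf_eq0 (negbTE vi) => /eqP.
Qed.

Lemma dual_actE w (f : V -> R) v : dual_act gen w f v = f (act w^-1%g v).
Proof. by []. Qed.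

Lemma scalar_act w (f : V -> R) : scalar f -> scalar (f \o act w).
Proof. by move=> fs a u v /=; rewrite (act_linear cs) fs. Qed.

Lemma finite_nonpos_act w (f : V -> R) : finite_set [set v | pos_root v /\ f v <= 0] ->
  finite_set [set v | pos_root v /\ f (act w v) <= 0].
Proof.
move=> ff; apply: (@sub_finite_set _ _ ([set v | pos_root v /\ pos (- act w v)] `|`
    act w^-1%g @` [set v | pos_root v /\ f v <= 0])).
  move=> v [[rv pv] fv]; have rw := root_act cs w rv.
  case: (root_pos_or_neg cs rw) => pw; last by left.
  by right; exists (act w v); rewrite ?(actVK cs).
rewrite finite_setU; split; first exact: inversions_finite.
exact: finite_image.
Qed.

(** Trades translates of the chamber for a condition that is visibly convex and easy to verify. An
    element of the group changes the sign of only finitely many roots; conversely [descent] moves a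
    functional with finitely many bad roots into the chamber. *)
Lemma tits_coneP (f : functionals R Pi) : tits_cone gen f <->
  scalar (f : V -> R) /\ finite_set [set v | pos_root v /\ (f : V -> R) v <= 0].
Proof.
split=> [[w [f0 [[f0s f0p f0z] ->]]]|[fs ff]].
  split; first exact: (scalar_act w^-1%g f0s).
  have := @finite_nonpos_act w^-1%g f0; apply.
  apply: sub_finite_set (spherical_roots_finite f0z) => v [[rv pv] fv].
  split => // i vi; exact: (dominant_eq0 f0s pv (fun i _ => f0p i) fv).
have [w _ wd_] : exists2 w, parabolic gen setT w & forall i, setT i -> 0 <= (f : V -> R) (act w (sr i)).
  apply: (@descent _ _ (fset_set [set v | pos_root v /\ (f : V -> R) v <= 0])) => //.
  by move=> v pv _ fv; rewrite in_fset_set// inE; split => //; exact: ltW.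
exists w, ((f : V -> R) \o act w); split; last first.
  by apply/funext => v; rewrite dual_actE /= (actKV cs).
split => [|i|]; [exact: scalar_act|exact: wd_|].
apply: finite_roots_spherical; apply: sub_finite_set (finite_nonpos_act w ff) => v [[rv pv] vI].
split => //; rewrite -[X in X <= _]/((f \o act w) v) (scalar_lin (scalar_act w fs)) /lin.
rewrite big_seq_cond big1// => i; rewrite andbT -monalg.mcoeff_neq0 => /vI /= ->.
by rewrite mulr0.
Qed.

End Parabolic.

(** * Positivity of the form on a spherical subset *)

Section PosDef.
Variables (R : realType) (Pi : choiceType) (W : groupType) (gen : Pi -> W).
Hypothesis cs : coxeter_system gen.
Local Notation V := (rootspace R Pi).
Local Notation "v @_ i" := (monalg.mcoeff i v) (at level 3, i at level 2).
Local Notation sr := (@simple_root R Pi).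
Local Notation form := (@Defs.form R Pi W gen).
Local Notation act := (@geom_rep R Pi W gen).
Variable I : set Pi.
Hypothesis sphI : spherical gen I.

Let L : {fset W} := fset_set (parabolic gen I).
Let I_ : {fset Pi} := fset_set I.

Let LP w : (w \in L) = `[< parabolic gen I w >].
Proof. by rewrite in_fset_set//; apply/idP/asboolP; rewrite inE. Qed.

Let IP i : (i \in I_) = `[< I i >].
Proof.
rewrite in_fset_set; last exact: spherical_finite sphI.
by apply/idP/asboolP; rewrite inE.
Qed.

Let dot (u v : V) : R := \sum_(i <- I_) u@_i * v@_i.
Let ip (u v : V) : R := \sum_(w <- L) dot (act w u) (act w v).

Let ip_scalarl v : scalar (ip^~ v).
Proof.
move=> a u u'; rewrite /ip mulr_sumr -big_split; apply: eq_bigr => w _.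
rewrite /dot mulr_sumr -big_split; apply: eq_bigr => i _ /=.
by rewrite (act_linear cs) monalg.mcoeffD monalg.mcoeffZ mulrDl mulrA.
Qed.

Let ip_sym u v : ip u v = ip v u.
Proof. by apply: eq_bigr => w _; apply: eq_bigr => i _; rewrite mulrC. Qed.

Let ip_scalarr u : scalar (ip u).
Proof. by move=> a v v'; rewrite ![ip u _]ip_sym ip_scalarl. Qed.

Let ip_gen i u v : I i -> ip (act (gen i) u) (act (gen i) v) = ip u v.
Proof.
move=> Ii; rewrite /ip.
transitivity (\sum_(w <- [seq (w * gen i)%g | w <- L]) dot (act w u) (act w v)).
  by rewrite big_map; apply: eq_bigr => w _; rewrite !(actM cs).
apply: perm_big; apply: uniq_perm.
- by rewrite map_inj_uniq ?fset_uniq// => x y /mulIg.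
- exact: fset_uniq.
move=> w; apply/mapP/idP => [[x + ->]|].
  rewrite !LP => /asboolP xI; apply/asboolP; apply: (parabolicM cs) => //.
  exact: parabolic_gen.
rewrite LP => /asboolP wI; exists (w * gen i)%g; last by rewrite -mulgA (gen2 cs) mulg1.
by rewrite LP; apply/asboolP; apply: (parabolicM cs) => //; exact: parabolic_gen.
Qed.

Let ip_root i v : I i -> ip v (sr i) = form v (sr i) * ip (sr i) (sr i).
Proof.
move=> Ii; have := ip_gen v (sr i) Ii.
rewrite !(act_gen cs) (refl_root _ cs) (scalarN (ip_scalarr _)).
rewrite /simple_reflection (scalarB (ip_scalarl _)) (scalarZ _ _ (ip_scalarl _)).
lra.
Qed.

Let dot_ge0 u : 0 <= dot u u.
Proof. by apply: sumr_ge0 => i _; rewrite -expr2 sqr_ge0. Qed.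

Let ip_gt0 v i : I i -> v@_i != 0 -> 0 < ip v v.
Proof.
move=> Ii vi; rewrite /ip (big_fsetD1 1%g)/=; last by rewrite LP; apply/asboolP; exact: parabolic1.
rewrite ltr_pwDl//; last by apply: sumr_ge0 => w _.
rewrite (act1 cs) /dot (big_fsetD1 i)/=; last by rewrite IP; exact/asboolP.
rewrite ltr_pwDl//; first by rewrite -expr2 exprn_even_gt0.
by apply: sumr_ge0 => j _; rewrite -expr2 sqr_ge0.
Qed.

(** For the averaged inner product [ip] the reflections are again orthogonal, so [ip v (sr i)] is
    [form v (sr i)] times the squared length of the root. By symmetry roots that are not orthogonal
    have equal length, and rescaling turns one product into the other. *)
Lemma form_posdef v : inV I v -> v != 0 -> 0 < form v v.
Proof.
move=> vI v0; pose a i := ip (sr i) (sr i).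
have a0 i : I i -> 0 < a i by move=> Ii; apply: (ip_gt0 Ii); rewrite coef_root eqxx oner_eq0.
have [i vi] : exists i, v@_i != 0.
  apply: contrapT => no; move/eqP: v0; apply; apply/monalg.malgP => i.
  rewrite monalg.mcoeff0; apply/eqP; apply: contrapT => /negP vi; apply: no; by exists i.
(* Dividing each coordinate by the [ip]-length of its root makes [ip v' v'] agree with [form v v]
   term by term. *)
pose v' : V := \sum_(i <- monalg.msupp v) (v@_i / Num.sqrt (a i)) *: sr i.
have v'i : v'@_i != 0.
  rewrite raddf_sum /= (big_fsetD1 i)/=; last by rewrite -monalg.mcoeff_neq0.
  rewrite big1_fset ?addr0.
    rewrite monalg.mcoeffZ coef_root eqxx mulr1 mulf_neq0// invr_neq0// gt_eqF//.
    by rewrite sqrtr_gt0 a0//; exact: vI.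
  move=> j; rewrite !inE => /andP[ji _] _.
  by rewrite monalg.mcoeffZ coef_root (negbTE ji) mulr0.
suff -> : form v v = ip v' v' by apply: (ip_gt0 (vI i vi)).
have suml (F : Pi -> V) (h : V -> R) r : scalar h -> h (\sum_(i <- r) F i) = \sum_(i <- r) h (F i).
  move=> hs; elim: r => [|j r IH]; first by rewrite !big_nil (scalar0 hs).
  by rewrite !big_cons (scalarD hs) IH.
rewrite {1}[v]rootE form_suml /v' (suml _ (ip^~ _))//; apply: eq_big_seq => j.
rewrite -monalg.mcoeff_neq0 => vj; rewrite {2}[v]rootE form_sumr (suml _ (ip _))//.
apply: eq_big_seq => k; rewrite -monalg.mcoeff_neq0 => vk.
rewrite formZl formZr (scalarZ _ _ (ip_scalarl _)) (scalarZ _ _ (ip_scalarr _)).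
have Ij := vI j vj; have Ik := vI k vk.
rewrite (ip_root _ Ik) -/(a k).
have [->|f0] := eqVneq (form (sr j) (sr k)) 0; first by rewrite !(mul0r, mulr0).
have ajk : a j = a k.
  apply: (mulfI f0); rewrite -{2}/(a k) -(ip_root _ Ik) ip_sym (ip_root _ Ij).
  by rewrite (form_sym cs).
have sE : Num.sqrt (a k) ^+ 2 = a k by rewrite sqr_sqrtr// ltW// a0.
have s0 : Num.sqrt (a k) != 0 by rewrite gt_eqF// sqrtr_gt0 a0.
rewrite ajk; move: (Num.sqrt (a k)) sE s0 => z <- s0; field.
by [].
Qed.

End PosDef.

(** * The chamber of W_min by linear inequalities *)

Section MinChamber.
Variables (R : realType) (Pi : choiceType) (W : groupType) (gen : Pi -> W).
Hypothesis cs : coxeter_system gen.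
Variable J : set Pi.
Local Notation V := (rootspace R Pi).
Local Notation F := (functionals R Pi).
Local Notation sr := (@simple_root R Pi).
Local Notation form := (@Defs.form R Pi W gen).
Local Notation act := (@geom_rep R Pi W gen).
Local Notation is_root := (@is_root R Pi W gen).
Local Notation pos_root := (@pos_root R Pi W gen).
Local Notation cone := (@tits_cone R Pi W gen).
Implicit Types (u v b : V) (w : W) (f g h : V -> R).

Definition perp_root v : Prop := is_root v /\ forall i, J i -> form v (sr i) = 0.

Lemma act_reflection w i v : act (w * gen i * w^-1)%g v =
  v - (2 * form v (act w (sr i))) *: act w (sr i).
Proof.
rewrite !(actM cs) (act_gen cs) /simple_reflection (actD cs) (actN cs) (actZ cs).
rewrite (actKV cs); congr (_ - (_ * _) *: _).
by rewrite -(act_isom cs w) (actKV cs).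
Qed.

Lemma act_reflectionV w i v : act (w * gen i * w^-1)^-1%g v = act (w * gen i * w^-1)%g v.
Proof. by rewrite !invgM invgK (genV cs) mulgA. Qed.

Lemma reflection_fix f w i : scalar f ->
  dual_act gen (w * gen i * w^-1)%g f = f <-> f (act w (sr i)) = 0.
Proof.
move=> fs; split => [/(congr1 (fun h : V -> R => h (act w (sr i))))|f0].
  rewrite dual_actE act_reflectionV act_reflection (scalarB fs) (scalarZ _ _ fs).
  rewrite (act_isom cs) (form_root1 _ cs) mulr1; lra.
apply/funext => v; rewrite dual_actE act_reflectionV act_reflection (scalarB fs).
by rewrite (scalarZ _ _ fs) f0 mulr0 subr0.
Qed.

Lemma reflection_trivial w i : (forall v, V_J J v -> act (w * gen i * w^-1)%g v = v) <->
  perp_root (act w (sr i)).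
Proof.
have rw : is_root (act w (sr i)) by apply: (root_act cs); exact: root_sr.
split => [h|[_ h] v vJ].
  split => // j Jj; have := h (sr j); rewrite act_reflection => /(_ _)/eqP.
  rewrite subr_eq addrC -subr_eq subrr eq_sym scaler_eq0 => e.
  have /orP[] : (2 * form (sr j) (act w (sr i)) == 0) || (act w (sr i) == 0).
    apply: e => k; rewrite -monalg.mcoeff_neq0 coef_root.
    by have [<-|] := eqVneq j k; rewrite ?eqxx.
  - by rewrite mulf_eq0 pnatr_eq0 /= (form_sym cs) => /eqP.
  - by move=> /eqP /(root_neq0 cs rw).
rewrite act_reflection (_ : form v _ = 0) ?mulr0 ?scale0r ?subr0//.
rewrite (scalar_lin (form_scalarl _ _)) /lin big_seq big1// => j /vJ Jj /=.
by rewrite (form_sym cs) h ?mulr0.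
Qed.

Lemma W_min_trivial w : W_min R gen J w -> forall v, V_J J v -> act w v = v.
Proof.
move=> /(_ [set w | forall v, V_J J v -> act w v = v]); apply; split; last by move=> r [].
split; first by rewrite inE => v _; rewrite (act1 cs).
move=> x y; rewrite !inE => hx hy v vJ; rewrite (actM cs).
by rewrite -[X in act y^-1%g X](hy v vJ) (actVK cs) hx.
Qed.

Lemma complementP (f : F) : W_min_complement gen J f <->
  [/\ cone f, forall i, J i -> (f : V -> R) (sr i) = 0 &
      forall v, perp_root v -> (f : V -> R) v <> 0].
Proof.
have genE i : gen i = (1 * gen i * 1^-1)%g by rewrite mul1g invg1 mulg1.
split => [[[fK fJ] fc]|[fK fJ fc]].
  have [fs _] := (tits_coneP cs f).1 fK; split => // [i Ji|v [[w [i ->]] vJ] v0].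
    by have [_] := fJ i Ji; rewrite genE => /(reflection_fix _ _ fs); rewrite (act1 cs).
  apply: fc; exists (w * gen i * w^-1)%g; last by split => //; exact/(reflection_fix _ _ fs).
  split; first by exists w, i.
  move=> A [_ hA]; apply: hA; split; first by exists w, i.
  apply/reflection_trivial; split => //; by apply: (root_act cs); exact: root_sr.
have [fs _] := (tits_coneP cs f).1 fK; split.
  split => // i Ji; split => //; rewrite genE; apply/(reflection_fix _ _ fs).
  by rewrite (act1 cs); exact: fJ.
move=> [r [[w [i ->]] /W_min_trivial/reflection_trivial pw] [_ /(reflection_fix _ _ fs)]].
exact: fc.
Qed.

Variable Co : set F.
Variable f0 : F.
Hypothesis f0C : W_min_complement gen J f0.
Hypothesis CoE : Co = connected_component (W_min_complement gen J) f0.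

Lemma eval_continuous v : continuous (fun h : F => (h : V -> R) v).
Proof. exact: (@proj_continuous _ (fun=> R) v). Qed.

(** On a connected set that misses the mirrors each root orthogonal to [J] has constant sign.
    Conversely, when the signs agree, the segment from [f0] to [f] stays in the cone and off the
    mirrors. *)
Lemma CoP (f : F) : Co f <-> [/\ cone f, forall i, J i -> (f : V -> R) (sr i) = 0 &
      forall v, perp_root v -> 0 < (f0 : V -> R) v * (f : V -> R) v].
Proof.
have [f0K f0J f0p] := (complementP f0).1 f0C.
rewrite CoE; split => [[B [Bf0 BA Bc] Bf]|[fK fJ fp]].
  have [fK fJ fp] := (complementP f).1 (BA f Bf); split => // v pv.
  have cv : connected ((fun h : F => (h : V -> R) v) @` B).
    apply: connected_continuous_connected => //.
    by apply: continuous_subspaceT; exact: eval_continuous.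
  move/connected_intervalP : cv => iv.
  rewrite ltNge; apply/negP => le.
  have h0 : ((fun h : F => (h : V -> R) v) @` B) 0.
    have n0 := f0p v pv; have n1 := fp v pv.
    have [a0|a0|//] := ltrgt0P ((f0 : V -> R) v).
      apply: (iv ((f : V -> R) v) ((f0 : V -> R) v)); [by exists f|by exists f0|].
      by rewrite (ltW a0) andbT; rewrite pmulr_rle0 in le.
    apply: (iv ((f0 : V -> R) v) ((f : V -> R) v)); [by exists f0|by exists f|].
    by rewrite (ltW a0) /=; rewrite nmulr_rle0 in le.
  have [h Bh hv] := h0; have [_ _ hc] := (complementP h).1 (BA h Bh).
  exact: (hc v pv hv).
have [f0s f0f] := (tits_coneP cs f0).1 f0K; have [fs ff] := (tits_coneP cs f).1 fK.
pose seg (t : R) : F := fun v => (1 - t) * (f0 : V -> R) v + t * (f : V -> R) v.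
exists (seg @` `[0, 1]%classic).
  split.
  - exists 0; first by rewrite /= in_itv /= lexx ler01.
    by apply/funext => v; rewrite /seg subr0 mul1r mul0r addr0.
  - move=> _ [t /= + <-]; rewrite in_itv /= => /andP[t0 t1].
    have t1' : 0 <= 1 - t by rewrite subr_ge0.
    apply/complementP; split.
    + apply/(tits_coneP cs); split.
        by move=> a u v; rewrite /seg fs f0s; ring.
      apply: (@sub_finite_set _ _ ([set v | pos_root v /\ (f0 : V -> R) v <= 0] `|`
          [set v | pos_root v /\ (f : V -> R) v <= 0])); last by rewrite finite_setU.
      move=> v [pv sv]; have [a|a] := leP ((f0 : V -> R) v) 0; first by left.
      have [b|b] := leP ((f : V -> R) v) 0; first by right.
      exfalso; move: sv; rewrite /seg leNgt => /negP; apply.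
      have [t00|t00] := eqVneq t 0; first by rewrite t00 subr0 mul1r mul0r addr0.
      apply: ltr_wpDl; first by apply: mulr_ge0 => //; exact: ltW.
      by apply: mulr_gt0 => //; rewrite lt_neqAle eq_sym t00.
    + by move=> i Ji; rewrite /seg f0J// fJ// !mulr0 addr0.
    + move=> v pv; have := fp v pv; have := f0p v pv.
      rewrite /seg; move: ((f0 : V -> R) v) ((f : V -> R) v) => a b a0 ab s0.
      have : a * ((1 - t) * a + t * b) = 0 by rewrite s0 mulr0.
      have a2 : 0 < a * a by rewrite -expr2 exprn_even_gt0//; apply/eqP.
      have -> : a * ((1 - t) * a + t * b) = (1 - t) * (a * a) + t * (a * b) by ring.
      have [t00|t00] := eqVneq t 0.
        by rewrite t00 subr0 mul1r mul0r addr0 => e; rewrite e ltxx in a2.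
      have : 0 < (1 - t) * (a * a) + t * (a * b).
        apply: ltr_wpDl; first by apply: mulr_ge0 => //; exact: ltW.
        by apply: mulr_gt0 => //; rewrite lt_neqAle eq_sym t00.
      by move=> + e; rewrite e ltxx.
  - apply: connected_continuous_connected; first exact: segment_connected.
    apply: continuous_subspaceT; apply: ptws_continuous => v.
    apply: contD; apply: contM; try exact: contC.
      apply: contD; first exact: contC.
      by apply: contN => x; exact: cvg_id.
    by move=> x; exact: cvg_id.
exists 1; first by rewrite /= in_itv /= lexx ler01.
by apply/funext => v; rewrite /seg subrr mul0r add0r mul1r.
Qed.

Lemma cone_act w (f : F) : cone f -> cone (dual_act gen w f).
Proof.
move=> [x [d [dc ->]]]; exists (w * x)%g, d; split => //.
by rewrite (dual_actM gen w x d).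
Qed.

(** The group is only known to preserve the closure, which gives the weak inequalities. They are
    strict because [w] fixes [J] pointwise and therefore permutes the roots orthogonal to [J], none
    of which vanishes at [f]. *)
Lemma gamma_Co w (f : F) : gamma_min_vee gen J Co w -> Co f -> Co (dual_act gen w f).
Proof.
move=> [[_ wC] wJ] Cf.
have wV i : J i -> act w^-1%g (sr i) = sr i by move=> Ji; rewrite -{1}(wJ i Ji) (actVK cs).
have [fK fJ fp] := (CoP f).1 Cf.
have [f0K f0J f0p] := (complementP f0).1 f0C.
have perpV v : perp_root v -> perp_root (act w^-1%g v).
  move=> [rv vp]; split; first exact: root_act.
  by move=> i Ji; rewrite -(wV i Ji) (act_isom cs) vp.
have cl : C_min gen J Co (dual_act gen w f).
  rewrite -wC; exists f => //; split; first exact: subset_closure.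
  split => // i Ji; split => //.
  have [fs _] := (tits_coneP cs f).1 fK.
  have := (reflection_fix 1%g i fs).2; rewrite mul1g invg1 mulg1 (act1 cs).
  by apply; exact: fJ.
apply/CoP; split; first exact: cone_act.
  by move=> i Ji; rewrite dual_actE wV// fJ.
move=> v pv; have [clo _] := cl.
have : 0 <= (f0 : V -> R) v * (dual_act gen w f : V -> R) v.
  have cH : closed [set h : F | 0 <= (f0 : V -> R) v * (h : V -> R) v].
    rewrite (_ : mkset _ = (fun h : F => (f0 : V -> R) v * (h : V -> R) v) @^-1` [set x | 0 <= x])//.
    apply: (iffLR (@continuous_closedP _ _ _)); last exact: closed_ge.
    by apply: contM; [exact: contC|exact: eval_continuous].
  suff sub : closure Co `<=` [set h : F | 0 <= (f0 : V -> R) v * (h : V -> R) v].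
    exact: sub clo.
  rewrite (iffLR (closure_id _) cH); apply: closure_subset => h Ch /=.
  by have [_ _ hp] := (CoP h).1 Ch; exact/ltW/hp.
rewrite le_eqVlt => /orP[|//]; rewrite eq_sym mulf_eq0 => /orP[/eqP e|/eqP e].
  by case: (f0p v pv).
have := fp _ (perpV v pv); rewrite -[X in _ * X]/((dual_act gen w f : V -> R) v) e mulr0.
by rewrite ltxx.
Qed.

End MinChamber.

Section CardFsetSet.
Variables (T : choiceType) (A B : set T).
Hypotheses (fB : finite_set B) (AB : A `<=` B).

Lemma fset_set_subset : (fset_set A `<=` fset_set B)%fset.
Proof.
apply/fsubsetP => x; rewrite !in_fset_set//; last exact: sub_finite_set fB.
by rewrite !inE; exact: AB.
Qed.

Lemma card_fset_set_le : (#|` fset_set A| <= #|` fset_set B|)%N.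
Proof. exact: fsubset_leq_card fset_set_subset. Qed.

Lemma card_fset_set_lt : (exists2 x, B x & ~ A x) -> (#|` fset_set A| < #|` fset_set B|)%N.
Proof.
move=> [x Bx nAx]; apply: fproper_ltn_card; rewrite fproperE fset_set_subset /=.
apply/fsubsetPn; exists x; rewrite in_fset_set ?inE//; last exact: sub_finite_set fB.
by apply/negP; rewrite inE.
Qed.

End CardFsetSet.

(** * Strata of the chamber and their matching *)

Section SignClasses.
Variables (R : realType) (Pi : choiceType) (W : groupType) (gen : Pi -> W).
Hypothesis cs : coxeter_system gen.
Variable J : set Pi.
Local Notation V := (rootspace R Pi).
Local Notation F := (functionals R Pi).
Local Notation "v @_ i" := (monalg.mcoeff i v) (at level 3, i at level 2).
Local Notation sr := (@simple_root R Pi).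
Local Notation form := (@Defs.form R Pi W gen).
Local Notation act := (@geom_rep R Pi W gen).
Local Notation is_root := (@is_root R Pi W gen).
Local Notation pos_root := (@pos_root R Pi W gen).
Local Notation perp_root := (@perp_root R Pi W gen J).
Local Notation cone := (@tits_cone R Pi W gen).
Implicit Types (u v : V) (w : W) (f g h : V -> R).

Variable f0 : V -> R.

Definition in_chamber f : Prop := [/\ cone f, forall i, J i -> f (sr i) = 0 &
  forall v, perp_root v -> 0 < f0 v * f v].

Hypothesis f0C : in_chamber f0.

Lemma chamber_scalar f : in_chamber f -> scalar f.
Proof. by move=> [/(tits_coneP cs)[]]. Qed.

Lemma chamber_finite f : in_chamber f -> finite_set [set v | pos_root v /\ f v <= 0].
Proof. by move=> [/(tits_coneP cs)[]]. Qed.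

(* The stratum of [f] is encoded by the signs of [f] on the roots. *)
Definition sign_of f v : R := if `[< is_root v >] then Num.sg (f v) else 0.

Lemma sign_ofE f v : is_root v -> sign_of f v = Num.sg (f v).
Proof. by move=> rv; rewrite /sign_of asboolT. Qed.

Definition stratum := {s : V -> R | `[< exists2 f, in_chamber f & s = sign_of f >]}.

HB.instance Definition _ := gen_eqMixin stratum.
HB.instance Definition _ := gen_choiceMixin stratum.
Implicit Types (S T G : stratum) (b : option stratum).

Definition sgn S : V -> R := sval S.

Lemma repP S : exists2 f, in_chamber f & sgn S = sign_of f.
Proof. exact: asboolW (svalP S). Qed.

Lemma stratumP f : in_chamber f -> exists S, sgn S = sign_of f.
Proof.
move=> Cf; suff h : `[< exists2 g, in_chamber g & sign_of f = sign_of g >].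
  by exists (exist _ (sign_of f) h).
by apply/asboolP; exists f.
Qed.

Lemma stratum_ext S T : (forall v, is_root v -> sgn S v = sgn T v) -> S = T.
Proof.
move=> h; have e : sgn S = sgn T.
  apply/funext => v; have [rv|nv] := pselect (is_root v); first exact: h.
  have [f _ ->] := repP S; have [g _ ->] := repP T.
  by rewrite /sign_of asboolF.
case: S T e {h} => [s hs] [t ht]; rewrite /sgn /= => e; move: hs ht; rewrite e => hs ht.
by congr exist; exact: Prop_irrelevance.
Qed.

Lemma sgnN S v : is_root v -> sgn S (- v) = - sgn S v.
Proof.
move=> rv; have [f Cf ->] := repP S.
rewrite !sign_ofE//; last exact: rootN.
by rewrite (scalarN (chamber_scalar Cf)) sgrN.
Qed.

Lemma stratum_ext_pos S T : (forall v, pos_root v -> sgn S v = sgn T v) -> S = T.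
Proof.
move=> h; apply: stratum_ext => v rv; case: (root_pos_or_neg cs rv) => pv; first by apply: h.
by apply: oppr_inj; rewrite -!sgnN//; apply: h; split => //; exact: rootN.
Qed.

(** The larger element is the smaller face: [T] arises from [S] by letting more roots vanish. *)
Definition le_stratum S T : bool :=
  `[< forall v, is_root v -> sgn T v <> 0 -> sgn S v = sgn T v >].

Lemma le_stratumP S T : reflect (forall v, is_root v -> sgn T v <> 0 -> sgn S v = sgn T v)
  (le_stratum S T).
Proof. exact: asboolP. Qed.

Lemma le_stratum_refl : reflexive le_stratum.
Proof. by move=> S; apply/le_stratumP. Qed.

Lemma le_stratum_anti : antisymmetric le_stratum.
Proof.
move=> S T /andP[/le_stratumP ST /le_stratumP TS]; apply: stratum_ext => v rv.
have [T0|/eqP T0] := eqVneq (sgn T v) 0; last exact: ST.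
by have [->//|/eqP S0] := eqVneq (sgn S v) 0; rewrite (TS v rv S0).
Qed.

Lemma le_stratum_trans : transitive le_stratum.
Proof.
move=> T S G /le_stratumP ST /le_stratumP TG; apply/le_stratumP => v rv G0.
by rewrite ST ?TG.
Qed.

Lemma le_stratum0 S T v : le_stratum S T -> is_root v -> sgn S v = 0 -> sgn T v = 0.
Proof.
move=> /le_stratumP ST rv S0; apply: contrapT => T0; apply: (T0).
by rewrite -(ST v rv T0).
Qed.

Definition zeros S : set V := [set v | is_root v /\ sgn S v = 0].

Lemma zeros_finite S : finite_set (zeros S).
Proof.
have [f Cf e] := repP S.
apply: (@sub_finite_set _ _ ([set v | pos_root v /\ f v <= 0] `|`
    (fun v => - v) @` [set v | pos_root v /\ f v <= 0])); last first.
  rewrite finite_setU; split; last apply: finite_image; exact: chamber_finite.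
move=> v [rv]; rewrite e sign_ofE// => /eqP; rewrite sgr_eq0 => /eqP fv.
case: (root_pos_or_neg cs rv) => pv; [left|right].
  by split => //; rewrite fv.
exists (- v); last by rewrite opprK.
split; first by split => //; exact: rootN.
by rewrite (scalarN (chamber_scalar Cf)) fv oppr0.
Qed.

Definition zdim S : nat := #|` fset_set (zeros S)|.

Lemma zdim_lt S T : le_stratum S T -> S != T -> (zdim S < zdim T)%N.
Proof.
move=> ST nST; apply: card_fset_set_lt; first exact: zeros_finite.
  by move=> v [rv Sv]; split => //; exact: le_stratum0 ST rv Sv.
apply: contrapT => no; move/eqP: nST; apply; apply: stratum_ext => v rv.
have [T0|/eqP T0] := eqVneq (sgn T v) 0; last by have /le_stratumP := ST; apply.
rewrite T0; have [->//|/eqP S0] := eqVneq (sgn S v) 0; exfalso; apply: no.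
by exists v => //; move=> [_ /S0].
Qed.

Lemma sg_values (x : R) : [\/ Num.sg x = 0, Num.sg x = 1 | Num.sg x = -1].
Proof. by case: sgrP => _; [constructor 1|constructor 2|constructor 3]. Qed.

Lemma chamber_of_sign S f : cone f -> (forall v, is_root v -> sgn S v <> 0 ->
    sign_of f v = sgn S v) -> (forall i, J i -> f (sr i) = 0) -> in_chamber f.
Proof.
move=> fK fS fJ; split => // v pv; have rv := pv.1.
have [g [_ _ gp] e] := repP S; have := gp v pv.
have := fS v rv; rewrite e !sign_ofE// => h gv.
have g0 : g v != 0 by apply/eqP => g0; move: gv; rewrite g0 mulr0 ltxx.
have {}h : Num.sg (f v) = Num.sg (g v) by apply: h; apply/eqP; rewrite sgr_eq0.
have f00 : f0 v != 0 by apply/eqP => e0; move: gv; rewrite e0 mul0r ltxx.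
by rewrite -sgr_gt0 sgrM h -sgrM sgr_gt0.
Qed.

Lemma cone_rep (f : F) : cone f -> exists w d, chamber gen d /\ f = dual_act gen w d.
Proof. by []. Qed.

Lemma dominant_zero (d : V -> R) v : chamber gen d -> pos v ->
  d v = 0 <-> inV [set i | d (sr i) = 0] v.
Proof.
move=> [ds dp _] pv; split => [dv i|vI].
  by apply: (dominant_eq0 ds pv (fun i _ => dp i)); rewrite dv.
rewrite (scalar_lin ds) /lin big_seq big1// => i; rewrite -monalg.mcoeff_neq0 => vi.
by rewrite /= (vI i vi) mulr0.
Qed.

(** Realizes [f] plus an infinitesimal multiple of [g]. In Weyl chamber coordinates the roots
    vanishing at [f] belong to a spherical parabolic subgroup, where [descent] makes [g] dominant; a
    functional with these values there and positive elsewhere has the required signs. *)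
Lemma refine_ex S g : scalar g -> (forall i, J i -> g (sr i) = 0) -> exists U,
  forall v, is_root v -> sgn U v = if sgn S v == 0 then Num.sg (g v) else sgn S v.
Proof.
move=> gs gJ; have [f Cf fE] := repP S.
have [fK fJ _] := Cf.
have [w [d [dc fd]]] := cone_rep fK; have [ds dp dz] := dc.
pose I := [set i | (d : V -> R) (sr i) = 0].
pose g' v := g (act w v).
have g's : scalar g' by move=> a u v; rewrite /g' (act_linear cs) gs.
have [||x xI xp] := @descent R _ _ _ cs I g' (fset_set [set v | is_root v /\ inV I v]) => //.
  move=> v [rv _] vI _; rewrite in_fset_set ?inE; last exact: spherical_roots_finite.
  by split.
(* The value 1 off [I] keeps the positive roots outside the span of [I] positive, since the subgroup
   of [I] does not change their coordinates off [I]. *)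
pose h := lin (fun i => if `[< I i >] then g' (act x (sr i)) else 1).
have hs : scalar h by exact: lin_scalar.
have hsr i : h (sr i) = if `[< I i >] then g' (act x (sr i)) else 1 by rewrite /h lin_root.
have hp i : 0 <= h (sr i) by rewrite hsr; case: asboolP => [/xp|_].
have hc : chamber gen (h : F).
  split => //; apply: spherical_sub dz => // i /=; rewrite hsr; case: asboolP => // _ /eqP.
  by rewrite oner_eq0.
pose k : F := dual_act gen (w * x)%g (h : F).
have kK : cone k by exists (w * x)%g, h.
have kE v : (k : V -> R) v = h (act x^-1%g (act w^-1%g v)).
  by rewrite /k dual_actE invgM (actM cs).
have fvE v : f v = (d : V -> R) (act w^-1%g v) by rewrite fd.
have kpos v : is_root v -> pos (act w^-1%g v) ->
    sign_of (k : V -> R) v = if sgn S v == 0 then Num.sg (g v) else sgn S v.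
  move=> rv pv; have rw := root_act cs w^-1%g rv.
  rewrite fE !sign_ofE// sgr_eq0; set v' := act w^-1%g v in pv rw *.
  have dv0 : 0 <= f v by rewrite fvE; exact: dominant_pos.
  case: eqP => f0v.
    have vI : inV I v' by apply/(dominant_zero dc pv); rewrite -fvE.
    have yI : inV I (act x^-1%g v') by apply: inV_act => //; exact: parabolicV.
    have -> : (k : V -> R) v = g' v'.
      rewrite kE -/v' (scalar_lin hs) -[in RHS](actKV cs x v').
      rewrite -[RHS]/((g' \o act x) (act x^-1%g v')) (scalar_lin (scalar_act cs x g's)).
      apply: eq_big_seq => i; rewrite -monalg.mcoeff_neq0 => /yI Ii /=.
      by rewrite hsr asboolT.
    by rewrite /g' (actKV cs).
  have fv : 0 < f v by rewrite lt_neqAle dv0 andbT eq_sym; exact/eqP.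
  rewrite (gtr0_sg fv).
  have [i vi nI] : exists2 i, v'@_i != 0 & ~ I i.
    apply: contrapT => no; apply: f0v; rewrite fvE; apply/(dominant_zero dc pv) => i vi.
    by apply: contrapT => nI; apply: no; exists i.
  have ci := act_parabolic_coef cs v' (parabolicV cs xI) nI.
  have ry := root_act cs x^-1%g rw.
  have py : pos (act x^-1%g v').
    case: (root_pos_or_neg cs ry) => // /(_ i); rewrite monalg.mcoeffN ci oppr_ge0 => le.
    by move: vi; rewrite eq_le le pv.
  suff : 0 < (k : V -> R) v by move/gtr0_sg.
  rewrite lt_neqAle eq_sym kE -/v' dominant_pos// andbT; apply/eqP => h0.
  have := (dominant_zero hc py).1 h0 i; rewrite ci => /(_ vi) /=; rewrite hsr asboolF//.
  by move/eqP; rewrite oner_eq0.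
have kall v : is_root v ->
    sign_of (k : V -> R) v = if sgn S v == 0 then Num.sg (g v) else sgn S v.
  move=> rv; have rw := root_act cs w^-1%g rv.
  case: (root_pos_or_neg cs rw) => pv; first exact: kpos.
  have rv' := rootN cs rv; have := kpos _ rv'; rewrite (actN cs) => /(_ pv).
  rewrite !sgnN// !sign_ofE// (scalarN ((tits_coneP cs k).1 kK).1) (scalarN gs) !sgrN.
  by rewrite oppr_eq0; case: ifP => _ /oppr_inj.
have Ck : in_chamber (k : V -> R).
  apply: (@chamber_of_sign S) => //.
    by move=> v rv S0; rewrite kall//; case: eqP.
  move=> i Ji; have ri : is_root (sr i) by exact: root_sr.
  have := kall _ ri; rewrite fE !sign_ofE// fJ// gJ// sgr0 eqxx => /eqP.
  by rewrite sgr_eq0 => /eqP.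
have [U UE] := stratumP Ck; exists U => v rv; by rewrite UE kall.
Qed.

(* [S] refined by [T] (or by the opposite of [T]) along the walls containing it;
   the strata form a conditional oriented matroid. *)
Lemma compose_ex S T (e : R) : e = 1 \/ e = -1 -> exists U, forall v, is_root v ->
  sgn U v = if sgn S v == 0 then e * sgn T v else sgn S v.
Proof.
move=> e1; have [g Cg gE] := repP T; have gs := chamber_scalar Cg; have [_ gJ _] := Cg.
have [||U UE] := @refine_ex S (fun v => e * g v).
- by move=> a u v; rewrite gs; ring.
- by move=> i Ji; rewrite gJ// mulr0.
exists U => v rv; rewrite UE// sgrM gE sign_ofE//.
by case: e1 => ->; rewrite ?sgrN1 ?sgr1.
Qed.

Definition comp S T := projT1 (cid (compose_ex S T (or_introl erefl))).
Definition anticomp S T := projT1 (cid (compose_ex S T (or_intror erefl))).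

Lemma compE S T v : is_root v -> sgn (comp S T) v = if sgn S v == 0 then sgn T v else sgn S v.
Proof. by move=> rv; rewrite /comp; case: cid => U /= ->//; rewrite mul1r. Qed.

Lemma anticompE S T v : is_root v ->
  sgn (anticomp S T) v = if sgn S v == 0 then - sgn T v else sgn S v.
Proof. by move=> rv; rewrite /anticomp; case: cid => U /= ->//; rewrite mulN1r. Qed.

Lemma comp_le S T : le_stratum (comp S T) S.
Proof. by apply/le_stratumP => v rv S0; rewrite compE//; case: eqP. Qed.

(** Take a stratum with the least number of vanishing roots: a root vanishing on it but not on [S]
    would no longer vanish on its composition with [S]. *)
Lemma base_ex : exists c, forall S v, is_root v -> sgn c v = 0 -> sgn S v = 0.
Proof.
have [S0 _] := stratumP f0C.
have ex : exists n, `[< exists S, zdim S = n >] by exists (zdim S0); apply/asboolP; exists S0.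
case: (ex_minnP ex) => n /asboolP[c cn] nmin; exists c => S v rv c0.
have := comp_le c S; have [e|ne le] := eqVneq (comp c S) c; last first.
  have := zdim_lt le ne; rewrite cn ltnNge nmin//; apply/asboolP; by exists (comp c S).
by move=> _; have := compE c S rv; rewrite e c0 eqxx.
Qed.

Definition base := projT1 (cid base_ex).

Lemma base_min S v : is_root v -> sgn base v = 0 -> sgn S v = 0.
Proof. by rewrite /base; case: cid => c /= h; exact: h. Qed.

(** A root with a coordinate outside [J] could be made nonzero by refining along that coordinate, a
    functional that vanishes on [J]. *)
Lemma base_zero v : is_root v -> sgn base v = 0 -> inV J v.
Proof.
move=> rv b0 i vi; apply: contrapT => nJ; pose g (u : V) := u@_i.
have [||U UE] := @refine_ex base g.
- by move=> a u u'; rewrite /g monalg.mcoeffD monalg.mcoeffZ.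
- move=> j Jj; rewrite /g coef_root; case: eqP => // e; case: nJ; by rewrite -?e// e.
have := base_min U rv b0; rewrite UE// b0 eqxx => /eqP; rewrite sgr_eq0 /g.
by rewrite (negPf vi).
Qed.

(** A root that vanishes on [S] but not on the base counts as different, so that [level] is the
    gallery distance from the base to the far chamber of [S]. *)
Definition diff S : set V := [set v | pos_root v /\ sgn S v <> sgn base v].

Lemma diff_finite S : finite_set (diff S).
Proof.
have [f Cf e] := repP S; have [g Cg e'] := repP base.
apply: (@sub_finite_set _ _ ([set v | pos_root v /\ f v <= 0] `|`
    [set v | pos_root v /\ g v <= 0])); last first.
  by rewrite finite_setU; split; exact: chamber_finite.
move=> v [pv]; rewrite e e' !sign_ofE; [|by case: pv..] => ne.
have [a|a] := leP (f v) 0; first by left.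
have [a'|a'] := leP (g v) 0; first by right.
by case: ne; rewrite !gtr0_sg.
Qed.

Definition level S : nat := #|` fset_set (diff S)|.

Lemma diff_sub S T : le_stratum S T -> diff S `<=` diff T.
Proof.
move=> /le_stratumP ST v [[rv pv] Sv]; split => // Tv.
have [T0|/eqP T0] := eqVneq (sgn T v) 0; last by apply: Sv; rewrite ST.
by apply: Sv; rewrite -Tv T0; apply: base_min => //; rewrite -Tv.
Qed.

Lemma level_le S T : le_stratum S T -> (level S <= level T)%N.
Proof.
move=> ST; apply: card_fset_set_le; [exact: diff_finite|exact: diff_sub].
Qed.

Lemma sub_diff_eq S T : diff S `<=` diff T -> (level T <= level S)%N -> diff T `<=` diff S.
Proof.
move=> ST le v Tv; apply: contrapT => nSv.
suff : (level S < level T)%N by rewrite ltnNge le.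
by apply: card_fset_set_lt => //; [exact: diff_finite|exists v].
Qed.

Definition far S := anticomp S base.

Lemma farE S v : is_root v -> sgn (far S) v = if sgn S v == 0 then - sgn base v else sgn S v.
Proof. exact: anticompE. Qed.

Lemma far_diff S : diff (far S) = diff S.
Proof.
apply/seteqP; split => v [[rv pv]] nS; split => //; move: nS; rewrite farE//;
    have [S0|//] := eqVneq (sgn S v) 0.
  by rewrite S0 => nS e; apply: nS; rewrite -e oppr0.
rewrite S0 => b0 /eqP; rewrite eq_sym -subr_eq0 opprK -mulr2n mulrn_eq0 /=.
by move=> /eqP e; apply: b0.
Qed.

Lemma far_level S : level (far S) = level S.
Proof. by rewrite /level far_diff. Qed.

(** Equal levels force equal difference sets. Where [T] vanishes and [S] does not, the sign of [S]
    therefore differs from the nonzero sign of the base, hence is its opposite, as for the far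
    chamber of [T]. *)
Lemma far_eq S T : le_stratum S T -> level S = level T -> far S = far T.
Proof.
move=> ST e; have dTS := sub_diff_eq (diff_sub ST) (eq_leq (esym e)).
apply: stratum_ext_pos => v [rv pv]; rewrite !farE//.
case: (eqVneq (sgn T v) 0) => [T0|/eqP T0]; last first.
  by move/le_stratumP: ST => ->//; case: eqP.
have [//|/eqP S0] := eqVneq (sgn S v) 0.
have [b0|/eqP b0] := eqVneq (sgn base v) 0; first by case: S0; exact: base_min.
have [_ Sb] : diff S v by apply: dTS; split => //; rewrite T0 => /esym.
move: S0 Sb b0; have [f _ ->] := repP S; have [g _ ->] := repP base.
rewrite !sign_ofE//; case: (sg_values (f v)) (sg_values (g v)) => -> [] -> //; by rewrite ?opprK.
Qed.

Definition bounded (b : option stratum) S := if b is Some G then le_stratum S G else true.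
Definition vanish (b : option stratum) v := if b is Some G then sgn G v = 0 else True.

Lemma far_zero S v : is_root v -> sgn (far S) v = 0 -> sgn base v = 0.
Proof.
move=> rv; rewrite farE//; case: eqP => [_ /eqP|//]; by rewrite oppr_eq0 => /eqP.
Qed.

(* [w d] is the face of a Weyl chamber carrying the top-dimensional stratum [c];
   the faces of [c] that lie on walls [w s], [s] in [T], all separating [c] from
   the base stratum, are again strata. *)
Lemma face_ex c w (d : F) (T : set Pi) (I := [set i | (d : V -> R) (sr i) = 0]) :
  chamber gen d -> sgn c = sign_of (dual_act gen w d : V -> R) ->
  (forall v, is_root v -> sgn c v = 0 -> sgn base v = 0) ->
  (forall s, T s -> sgn base (act w (sr s)) = -1) ->
  exists S, [/\ forall v, is_root v -> pos v -> sgn S (act w v) = (~~ `[< inV (I `|` T) v >])%:R,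
    le_stratum c S & far S = c].
Proof.
move=> dc cE c0 Tb; have [ds dp dz] := dc.
have [g Cg gE] := repP base; have gs := chamber_scalar Cg.
have cpos v : is_root v -> pos v -> sgn c (act w v) = (~~ `[< inV I v >])%:R.
  move=> rv pv; rewrite cE sign_ofE; last exact: root_act.
  rewrite dual_actE (actVK cs); case: asboolP => h /=.
    by rewrite ((dominant_zero dc pv).2 h) sgr0.
  rewrite gtr0_sg// lt_neqAle dominant_pos// andbT eq_sym; apply/eqP => d0.
  exact: h ((dominant_zero dc pv).1 d0).
have gI i : I i -> g (act w (sr i)) = 0.
  move=> Ii; have ri : is_root (act w (sr i)) by apply: (root_act cs); exact: root_sr.
  have := c0 _ ri; rewrite cpos; [|exact: root_sr|exact: pos_sr].
  rewrite asboolT; last exact: inV_sr.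
  by move=> /(_ erefl) /eqP; rewrite gE sign_ofE// sgr_eq0 => /eqP.
have gT s : T s -> g (act w (sr s)) < 0.
  move=> /Tb; rewrite gE sign_ofE; last by apply: (root_act cs); exact: root_sr.
  by move=> /eqP; rewrite sgr_cp0.
have gIT v : pos v -> inV (I `|` T) v -> g (act w v) <= 0.
  move=> pv vIT; rewrite -[g _]/((g \o act w) v) (scalar_lin (scalar_act cs w gs)) /lin.
  rewrite big_seq; apply: sumr_le0 => i; rewrite -monalg.mcoeff_neq0 => /vIT[Ii|Ti] /=.
    by rewrite gI ?mulr0.
  by rewrite mulr_ge0_le0// ltW// gT.
pose h := lin (fun i => if `[< (I `|` T) i >] then 0 else 1 : R).
have hs : scalar h by exact: lin_scalar.
have hsr i : h (sr i) = if `[< (I `|` T) i >] then 0 else 1 by rewrite /h lin_root.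
have hp i : 0 <= h (sr i) by rewrite hsr; case: ifP.
have hI : [set i | h (sr i) = 0] = I `|` T.
  apply/seteqP; split => i /=; rewrite hsr; case: asboolP => // _ /eqP.
  by rewrite oner_eq0.
have hc : chamber gen (h : F).
  (* Sphericity of the enlarged set: its positive roots are carried by [w] to roots where the base
     is nonpositive, and the Tits cone condition leaves only finitely many of those. *)
  split => //; rewrite [mkset _]hI; apply: (finite_roots_spherical cs).
  apply: sub_finite_set (finite_nonpos_act cs w (chamber_finite Cg)) => v [[rv pv] vIT].
  by split => //; exact: gIT.
pose k : F := dual_act gen w (h : F).
have kK : cone k by exists w, h.
have kpos v : is_root v -> pos v ->
    sign_of (k : V -> R) (act w v) = (~~ `[< inV (I `|` T) v >])%:R.
  move=> rv pv; rewrite sign_ofE; last exact: root_act.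
  rewrite /k dual_actE (actVK cs) -hI; case: asboolP => h0 /=.
    by rewrite ((dominant_zero hc pv).2 h0) sgr0.
  rewrite gtr0_sg// lt_neqAle dominant_pos// andbT eq_sym; apply/eqP => d0.
  exact: h0 ((dominant_zero hc pv).1 d0).
have ks := ((tits_coneP cs k).1 kK).1.
have kN v : is_root v -> sign_of (k : V -> R) (- v) = - sign_of (k : V -> R) v.
  by move=> rv; rewrite !sign_ofE//; [rewrite (scalarN ks) sgrN|exact: rootN].
have byw (Q : V -> Prop) : (forall v, is_root v -> Q v -> Q (- v)) ->
    (forall v, is_root v -> pos v -> Q (act w v)) -> forall v, is_root v -> Q v.
  move=> QN Qp v rv; have rw := root_act cs w^-1%g rv.
  rewrite -(actKV cs w v); case: (root_pos_or_neg cs rw) => pv; first exact: Qp.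
  rewrite -[X in act w X]opprK (actN cs); apply: QN; first by apply: (root_act cs); exact: rootN.
  by apply: Qp => //; exact: rootN.
have cN v : is_root v -> sgn c (- v) = - sgn c v by exact: sgnN.
have ck : forall v, is_root v -> sign_of (k : V -> R) v <> 0 -> sgn c v = sign_of (k : V -> R) v.
  apply: byw => [v rv h0|v rv pv].
    by rewrite kN// cN// => k0; congr (- _); apply: h0 => e; apply: k0; rewrite e oppr0.
  rewrite kpos// cpos//; case: asboolP => //= nIT _; rewrite asboolF// => vI; apply: nIT.
  by move=> i /vI; left.
have ckfar : forall v, is_root v -> sign_of (k : V -> R) v = 0 -> sgn c v = - sgn base v.
  apply: byw => [v rv h0|v rv pv].
    by rewrite kN// cN// sgnN// => /eqP; rewrite oppr_eq0 => /eqP /h0 ->.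
  rewrite kpos// cpos//; case: asboolP => /= vIT; last by move=> /eqP; rewrite oner_eq0.
  move=> _.
  have rw : is_root (act w v) by exact: root_act.
  have le := gIT v pv vIT.
  case: asboolP => vI /=.
    rewrite c0 ?oppr0// cpos// asboolT//.
  have b0 : sgn base (act w v) <> 0.
    by move=> /(base_min c rw); rewrite cpos// asboolF//= => /eqP; rewrite oner_eq0.
  move: b0; rewrite gE sign_ofE// => b0; rewrite ltr0_sg ?opprK// lt_neqAle le andbT.
  by apply/eqP => g0; apply: b0; rewrite g0 sgr0.
have Ck : in_chamber (k : V -> R).
  have [f [_ fJ fp] fE] := repP c; split => //.
    move=> i Ji; have ri : is_root (sr i) by exact: root_sr.
    apply/eqP; rewrite -sgr_eq0 -sign_ofE//; apply/eqP; apply: contrapT => k0.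
    have := ck _ ri k0; rewrite fE sign_ofE// fJ// sgr0 => e; apply: k0; by rewrite -e.
  move=> v pv; have rv := pv.1; have := fp v pv.
  have [k0|/eqP k0] := eqVneq (sign_of (k : V -> R) v) 0; last first.
    have := ck v rv k0; rewrite fE !sign_ofE// => e.
    by rewrite -sgr_gt0 sgrM e -sgrM sgr_gt0.
  have := ckfar v rv k0; have [_ _ gp] := Cg; have := gp v pv.
  rewrite fE gE !sign_ofE// => fg e ff; exfalso.
  move: fg ff; rewrite -sgr_gt0 sgrM -(sgr_gt0 (f0 v * f v)) sgrM e mulrN oppr_gt0.
  by move=> a b; have := lt_trans a b; rewrite ltxx.
have [S SE] := stratumP Ck; exists S; split.
- by move=> v rv pv; rewrite SE kpos.
- by apply/le_stratumP => v rv; rewrite SE; exact: ck.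
- apply: stratum_ext => v rv; rewrite farE// SE; case: eqP => k0.
    by rewrite ckfar.
  by rewrite ck.
Qed.

Lemma root_by_act w (Q : V -> Prop) : (forall v, is_root v -> Q v -> Q (- v)) ->
  (forall v, is_root v -> pos v -> Q (act w v)) -> forall v, is_root v -> Q v.
Proof.
move=> QN Qp v rv; have rw := root_act cs w^-1%g rv.
rewrite -(actKV cs w v); case: (root_pos_or_neg cs rw) => pv; first exact: Qp.
rewrite -[X in act w X]opprK (actN cs); apply: QN.
  by apply: (root_act cs); exact: rootN.
by apply: Qp => //; exact: rootN.
Qed.

Lemma sgn_act_sum S w v : is_root v -> exists2 f, sgn S = sign_of f &
  f (act w v) = \sum_(i <- monalg.msupp v) v@_i * f (act w (sr i)).
Proof.
move=> rv; have [f Cf e] := repP S; exists f => //.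
rewrite -[f _]/((f \o act w) v).
by rewrite (scalar_lin (scalar_act cs w (chamber_scalar Cf))).
Qed.

Lemma rsr i : is_root (sr i). Proof. exact: root_sr. Qed.

Lemma psr i : pos (sr i). Proof. exact: pos_sr. Qed.

Lemma root_act_sr w i : is_root (act w (sr i)).
Proof. by apply: (root_act cs); exact: root_sr. Qed.

Lemma sgn_act_ge0 S w v : is_root v -> pos v ->
    (forall i, v@_i != 0 -> 0 <= sgn S (act w (sr i))) -> 0 <= sgn S (act w v).
Proof.
move=> rv pv; have [f -> fv] := sgn_act_sum S w rv => h.
rewrite sign_ofE ?sgr_ge0 ?fv; last exact: root_act.
rewrite big_seq; apply: sumr_ge0 => i; rewrite -monalg.mcoeff_neq0 => /h.
by rewrite sign_ofE ?sgr_ge0 => [fi|]; [exact: mulr_ge0|exact: root_act_sr].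
Qed.

Lemma sgn_act_eq0 S w v : is_root v -> pos v ->
    (forall i, v@_i != 0 -> 0 <= sgn S (act w (sr i))) -> sgn S (act w v) = 0 ->
  forall i, v@_i != 0 -> sgn S (act w (sr i)) = 0.
Proof.
move=> rv pv; have [f -> fv] := sgn_act_sum S w rv => h.
have rw : is_root (act w v) by exact: root_act.
have h' i : v@_i != 0 -> 0 <= f (act w (sr i)).
  by move=> /h; rewrite sign_ofE ?sgr_ge0//; exact: root_act_sr.
rewrite sign_ofE// => /eqP; rewrite sgr_eq0 fv big_seq psumr_eq0; last first.
  by move=> i; rewrite -monalg.mcoeff_neq0 => /h' fi; exact: mulr_ge0.
move=> /allP z i vi; have := z i; rewrite -monalg.mcoeff_neq0 vi => /(_ isT) /=.
rewrite mulf_eq0 (negPf vi) /= => /eqP e; rewrite sign_ofE ?e ?sgr0//.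
exact: root_act_sr.
Qed.

Lemma sgn_act_zero S w v : is_root v ->
  (forall i, v@_i != 0 -> sgn S (act w (sr i)) = 0) -> sgn S (act w v) = 0.
Proof.
move=> rv; have [f -> fv] := sgn_act_sum S w rv => h.
rewrite sign_ofE ?fv; last exact: root_act.
rewrite big_seq big1 ?sgr0// => i; rewrite -monalg.mcoeff_neq0 => /h.
by rewrite sign_ofE => [/eqP|]; [rewrite sgr_eq0 => /eqP ->; rewrite mulr0|exact: root_act_sr].
Qed.

Lemma bounded_vanish b S v : bounded b S -> is_root v -> sgn S v = 0 -> vanish b v.
Proof. by case: b => //= G le rv; exact: le_stratum0. Qed.

Lemma largest_ex b S : bounded b S -> exists M w,
  [/\ [/\ bounded b M, le_stratum S M & far M = far S],
    forall S', bounded b S' -> far S' = far S -> le_stratum S' M,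
    forall i, sgn base (act w (sr i)) = -1 -> vanish b (act w (sr i)) ->
      sgn M (act w (sr i)) = 0
    & forall v, is_root v -> pos v -> 0 <= sgn (far S) (act w v)].
Proof.
move=> bS; have [f Cf cE] := repP (far S); have [fK _ _] := Cf.
have [w [d [dc fd]]] := cone_rep fK.
pose I := [set i | (d : V -> R) (sr i) = 0].
pose T := [set i | sgn base (act w (sr i)) = -1 /\ vanish b (act w (sr i))].
have [|||M [MT cM farM]] := @face_ex (far S) w d T dc.
- by rewrite cE fd.
- by move=> v; exact: far_zero.
- by move=> s [].
have cpos v : is_root v -> pos v -> sgn (far S) (act w v) = (~~ `[< inV I v >])%:R.
  move=> rv pv; have rw := root_act cs w rv; rewrite cE sign_ofE//.
  rewrite fd dual_actE (actVK cs); have [ds dp dz] := dc; case: asboolP => h /=.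
    by rewrite ((dominant_zero dc pv).2 h) sgr0.
  rewrite gtr0_sg// lt_neqAle dominant_pos// andbT eq_sym; apply/eqP => d0.
  exact: h ((dominant_zero dc pv).1 d0).
have cI i : I i -> sgn base (act w (sr i)) = 0.
  move=> Ii; apply: (@far_zero S); first exact: root_act_sr.
  by rewrite cpos ?asboolT//; [exact: inV_sr|exact: root_sr|exact: pos_sr].
have maxM S' : bounded b S' -> far S' = far S -> le_stratum S' M.
  move=> bS' eS'; apply/le_stratumP; apply: (@root_by_act w) => [v rv h|v rv pv].
    by rewrite !sgnN// => M0; congr (- _); apply: h => e; apply: M0; rewrite e oppr0.
  rewrite MT//; case: asboolP => //= vIT _.
  have S'p i : 0 <= sgn S' (act w (sr i)).
    have := cpos _ (rsr i) (psr i); rewrite -eS' farE; last exact: root_act_sr.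
    by case: eqP => [->|_ ->].
  have rw := root_act cs w rv.
  have := cpos v rv pv; rewrite -eS' farE// asboolF; last first.
    by move=> vI; apply: vIT => i /vI; left.
  case: eqP => // S'0 _; case: vIT => i vi.
  have S'i : sgn S' (act w (sr i)) = 0 by apply: (sgn_act_eq0 rv pv _ S'0).
  have [Ii|nIi] := pselect (I i); [by left|right; split].
    have := cpos _ (rsr i) (psr i); rewrite asboolF => [|/(_ i)]; last first.
      by rewrite /simple_root monalg.mcoeffU eqxx oner_neq0 => /(_ isT).
    rewrite -eS' farE ?S'i ?eqxx; last exact: root_act_sr.
    by move=> /= e; rewrite -[LHS]opprK e.
  by apply: (bounded_vanish bS') S'i; exact: root_act_sr.
exists M, w; split => //; last 2 first.
- move=> i bi vi; rewrite MT ?asboolT//; [|exact: root_sr|exact: pos_sr].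
  by apply: inV_sr; right.
- by move=> v rv pv; rewrite cpos// ler0n.
split => //; last exact: maxM.
have SG v : is_root v -> sgn M v = 0 -> vanish b v.
  move: v; apply: (@root_by_act w) => [v rv h|v rv pv].
    rewrite sgnN// => /eqP; rewrite oppr_eq0 => /eqP /h.
    by case: (b) => //= G G0; rewrite sgnN// G0 oppr0.
  rewrite MT//; case: asboolP => /= vIT; last by move=> /eqP; rewrite oner_eq0.
  move=> _; case E: b => [G|//] /=; apply: sgn_act_zero => // i vi.
  case: (vIT i vi) => [Ii|[_]]; last by rewrite E.
  apply: base_min; last exact: cI.
  exact: root_act_sr.
case E: b => [G|//]; have SlG : le_stratum S G by move: bS; rewrite E.
apply/le_stratumP => v rv G0.
have M0 : sgn M v <> 0 by move=> /(SG v rv); rewrite E.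
have := (le_stratumP _ _ cM) v rv M0; rewrite farE// => <-.
by have /le_stratumP := SlG => /(_ v rv G0) ->; case: eqP.
Qed.

Definition largest b S : stratum :=
  if pselect (bounded b S) is left h then projT1 (cid (largest_ex h)) else S.

Lemma largestP b S : bounded b S -> exists w,
  [/\ [/\ bounded b (largest b S), le_stratum S (largest b S) & far (largest b S) = far S],
    forall S', bounded b S' -> far S' = far S -> le_stratum S' (largest b S),
    forall i, sgn base (act w (sr i)) = -1 -> vanish b (act w (sr i)) ->
      sgn (largest b S) (act w (sr i)) = 0
    & forall v, is_root v -> pos v -> 0 <= sgn (far S) (act w v)].
Proof. by move=> h; rewrite /largest; case: pselect => // h'; case: cid. Qed.

(** The gate of the base in the star of the bounding stratum: its signs, completed by those of the
    base. *)
Definition nearest (b : option stratum) : stratum := if b is Some G then comp G base else base.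

Lemma nearestE b v : is_root v ->
  (vanish b v -> sgn (nearest b) v = sgn base v) /\
  (forall S, bounded b S -> ~ vanish b v -> sgn (nearest b) v = sgn S v).
Proof.
move=> rv; case: b => [G|] /=; last by split => // S _ [].
rewrite compE//; split => [->|S /le_stratumP SG G0]; first by rewrite eqxx.
by case: eqP => // _; rewrite SG.
Qed.

(** A stratum within the bound differs from the base at least wherever the gate does, so equal level
    forces equal signs. *)
Lemma nearest_uniq b S : bounded b S -> (level S <= level (nearest b))%N -> S = nearest b.
Proof.
move=> bS le.
have sub : diff (nearest b) `<=` diff S.
  move=> v [[rv pv] ne]; split => // Sv; apply: ne.
  have [h1 h2] := nearestE b rv; have [/h1//|nv] := pselect (vanish b v).
  by rewrite (h2 S bS nv).
have sub' := sub_diff_eq sub le.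
apply: stratum_ext_pos => v [rv pv].
have [h1 h2] := nearestE b rv; have [bv|nv] := pselect (vanish b v); last by rewrite (h2 S bS).
rewrite (h1 bv); apply: contrapT => ne; have [|_] := sub' v; first by split.
by rewrite h1.
Qed.

(** Otherwise no root vanishes on [S] except where the base vanishes, so [S] is its own far chamber.
    Being largest in its class, it has no wall within the bound that separates it from the base.
    Then the base is nonnegative on those walls and [S] has the signs of the gate. *)
Lemma nearest_below b S : bounded b S -> largest b S = S -> S <> nearest b ->
  (level (nearest (Some S)) < level S)%N.
Proof.
move=> bS mS ne; rewrite ltnNge; apply/negP => le; apply: ne.
have sub := sub_diff_eq (diff_sub (comp_le S base)) le.
have z v : is_root v -> sgn S v = 0 -> sgn base v = 0.
  have zp u : is_root u -> pos u -> sgn S u = 0 -> sgn base u = 0.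
    move=> ru pu S0; apply: contrapT => b0; have [|_] := sub u.
      by split => //; rewrite S0 => /esym.
    by rewrite compE// S0 eqxx.
  move=> rv; case: (root_pos_or_neg cs rv) => pv; first exact: zp.
  move=> S0; apply/eqP; rewrite -oppr_eq0 -sgnN//; apply/eqP; apply: zp => //.
    exact: rootN.
  by rewrite sgnN// S0 oppr0.
have farS : far S = S.
  apply: stratum_ext => v rv; rewrite farE//; case: eqP => // S0.
  by rewrite S0 z ?oppr0.
have [w [_ _]] := largestP bS; rewrite mS farS => T0 Sp.
apply: stratum_ext; apply: (@root_by_act w) => [v rv h|v rv pv]; first by rewrite !sgnN// h.
have rw := root_act cs w rv; have [h1 h2] := nearestE b rw.
have [bv|nv] := pselect (vanish b (act w v)); last by rewrite (h2 S bS).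
rewrite (h1 bv).
have bi i : v@_i != 0 -> vanish b (act w (sr i)).
  case: (b) bv bS => //= G G0 /le_stratumP SG vi; apply: (sgn_act_eq0 rv pv _ G0 vi) => j _.
  have rj := root_act_sr w j; have [->//|/eqP Gj] := eqVneq (sgn G (act w (sr j))) 0.
  by rewrite -SG//; apply: Sp; [exact: root_sr|exact: pos_sr].
have : 0 <= sgn base (act w v).
  apply: sgn_act_ge0 => // i vi; have ri := root_act_sr w i.
  have := T0 i; move: (z _ ri); have [g _ ->] := repP base; rewrite sign_ofE//.
  case: (sg_values (g (act w (sr i)))) => -> //.
  move=> a /(_ erefl (bi i vi)) /a /eqP; rewrite oppr_eq0; by rewrite oner_eq0.
have := Sp v rv pv; have := z _ rw; have := @base_min S _ rw.
have [g _ ->] := repP base; have [f _ ->] := repP S; rewrite !sign_ofE//.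
case: (sg_values (g (act w v))) => ->; case: (sg_values (f (act w v))) => -> //; rewrite ?oppr_ge0 ?ler10//.
- by move=> /(_ erefl) /eqP; rewrite oner_eq0.
- by move=> _ /(_ erefl) /eqP; rewrite oner_eq0.
Qed.

Lemma largest_eq b S S' : bounded b S -> bounded b S' -> far S = far S' ->
  largest b S = largest b S'.
Proof.
move=> bS bS' e; have [w [[b1 l1 f1] m1 _ _]] := largestP bS.
have [w' [[b2 l2 f2] m2 _ _]] := largestP bS'.
apply: le_stratum_anti; rewrite m2//; last by rewrite f1.
by rewrite m1// f2.
Qed.

Lemma stratum_matching :
  exists mu rk, @perfect_matching stratum (comparable_fset le_stratum) mu rk.
Proof.
exists (mu_fset le_stratum level largest nearest).
have bb b S : below le_stratum level b S -> bounded b S by case: b => //= G /andP[].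
apply: (@level_matching _ le_stratum level zdim).
- exact: le_stratum_refl.
- exact: le_stratum_anti.
- exact: le_stratum_trans.
- exact: level_le.
- exact: zdim_lt.
- by move=> b S /bb /largestP[w [[]]].
- move=> b S bS; have [w [[b1 _ f1] _ _ _]] := largestP (bb _ _ bS).
  case: b bS b1 f1 => //= G /andP[_ lG] -> f1.
  by rewrite -far_level f1 far_level.
- move=> b S /bb bS; have [w [[b1 _ f1] _ _ _]] := largestP bS.
  by rewrite -far_level f1 far_level.
- by move=> b S S' /bb bS /bb bS' le e; apply: largest_eq => //; exact: far_eq.
- by move=> b S /bb bS; exact: nearest_uniq.
- by move=> G; exact: comp_le.
- move=> b S /bb bS e ne; rewrite /= comp_le /=; exact: nearest_below bS e ne.
Qed.

End SignClasses.

(** * Pointwise stabilizers *)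

Section Stabilizers.
Variables (R : realType) (Pi : choiceType) (W : groupType) (gen : Pi -> W).
Hypothesis cs : coxeter_system gen.
Local Notation V := (rootspace R Pi).
Local Notation F := (functionals R Pi).
Local Notation "v @_ i" := (monalg.mcoeff i v) (at level 3, i at level 2).
Local Notation sr := (@simple_root R Pi).
Local Notation form := (@Defs.form R Pi W gen).
Local Notation act := (@geom_rep R Pi W gen).
Local Notation is_root := (@is_root R Pi W gen).
Local Notation pos_root := (@pos_root R Pi W gen).
Implicit Types (u v : V) (w x : W) (f g h : V -> R) (I : set Pi).

Lemma scalar_inV_ge0 I f v : scalar f -> (forall i, I i -> 0 <= f (sr i)) ->
  inV I v -> pos v -> 0 <= f v.
Proof.
move=> fs fI vI pv; rewrite (scalar_lin fs) /lin big_seq; apply: sumr_ge0 => i.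
by rewrite -monalg.mcoeff_neq0 => /vI /fI; apply: mulr_ge0.
Qed.

Lemma scalar_inV_eq0 I f v : scalar f -> (forall i, I i -> f (sr i) = 0) ->
  inV I v -> f v = 0.
Proof.
move=> fs fI vI; rewrite (scalar_lin fs) /lin big_seq big1// => i.
by rewrite -monalg.mcoeff_neq0 /= => /vI /fI ->; rewrite mulr0.
Qed.

Lemma parabolicT w : parabolic gen setT w.
Proof. by have [p ->] := wordP cs w; apply/(parabolicP cs); exists p. Qed.

Lemma act_sr_inV I w i : parabolic gen I w -> I i -> inV I (act w (sr i)).
Proof. by move=> wI Ii; apply: inV_act => //; exact: inV_sr. Qed.

(** At a descent [i] of [w] the functional is both nonnegative and nonpositive, so it vanishes
    there; the reflection in [i] can be split off, which shortens [w]. *)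
Lemma fix_dominant I w f : parabolic gen I w -> scalar f ->
  (forall i, I i -> 0 <= f (sr i)) ->
  (forall v, is_root v -> inV I v -> Num.sg (f (act w v)) = Num.sg (f v)) ->
  parabolic gen [set i | I i /\ f (sr i) = 0] w.
Proof.
move=> + fs fI; have [n] := ubnP (len cs w); elim: n w => [w|n IH w]; first by rewrite ltn0.
rewrite ltnS => wn wI h.
have [->|w1] := pselect (w = 1%g); first exact: parabolic1.
have [i [li ni]] := @descent_ex R _ _ _ cs w w1.
have Ii : I i.
  apply: contrapT => nI; have := ni i; rewrite monalg.mcoeffN (act_parabolic_coef cs _ wI nI).
  by rewrite coef_root eqxx oppr_ge0 ler10.
have fi : f (sr i) = 0.
  apply/eqP; rewrite eq_le fI// andbT.
  rewrite -sgr_le0 -(h (sr i) (root_sr R cs i) (inV_sr Ii)) sgr_le0 -oppr_ge0 -(scalarN fs).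
  by apply: (scalar_inV_ge0 fs fI) => //; apply: inVN; exact: act_sr_inV.
have wE : w = (w * gen i * gen i)%g by rewrite -mulgA -{2}(genV cs) mulgV mulg1.
rewrite wE; apply: (parabolicM cs); last exact: parabolic_gen.
apply: (IH (w * gen i)%g); first exact: leq_trans li wn.
  by apply: (parabolicM cs) => //; exact: parabolic_gen.
move=> v rv vI; rewrite (actM cs) (act_gen cs) h.
- by rewrite /simple_reflection (scalarB fs) (scalarZ _ _ fs) fi mulr0 subr0.
- exact: root_refl.
- exact: inV_refl.
Qed.

(** Pairing with the first vector, made dominant by [descent], puts a conjugate of [w] into the
    parabolic subgroup of the simple roots orthogonal to it. When the list is used up no root is
    left. *)
Lemma fix_vectors (L : seq V) I w : spherical gen I -> parabolic gen I w ->
  (forall v, v \in L -> act w v = v) ->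
  (forall b, is_root b -> inV I b -> exists2 v, v \in L & form v b != 0) -> w = 1%g.
Proof.
have [n nE] : exists n, size L = n by exists (size L).
elim: n L I w nE => [|n IH] [|v L]// I w /= nE sI wI wL hL.
  apply: (@parabolic_faithful R _ _ _ cs _ _ wI) => i Ii.
  by have [] := hL (sr i) (root_sr R cs i) (inV_sr Ii).
have fs : scalar (form v) by exact: form_scalarr.
have [||x xI xp] := @descent R _ _ _ cs I (form v) (fset_set [set y | is_root y /\ inV I y]) => //.
  move=> y [ry _] yI _; rewrite in_fset_set ?inE; last exact: spherical_roots_finite.
  by split.
have gs := scalar_act cs x fs.
have u1 : parabolic gen [set i | I i /\ (form v \o act x) (sr i) = 0] (x^-1 * w * x)%g.
  apply: fix_dominant => //.
    by apply: (parabolicM cs) => //; apply: (parabolicM cs) => //; exact: parabolicV.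
  move=> y ry yI /=; congr Num.sg; rewrite !(actM cs) (actKV cs) -{1}(wL v (mem_head _ _)).
  exact: act_isom.
have x1 : (x^-1 * w * x = 1)%g.
  apply: (IH [seq act x^-1%g l | l <- L] _ _ _ _ u1).
  - by rewrite size_map; case: nE.
  - by apply: (spherical_sub cs _ sI) => i [].
  - move=> _ /mapP[l lL ->]; rewrite !(actM cs) (actKV cs) wL//.
    by rewrite inE lL orbT.
  - move=> b rb bI.
    have [|l] := hL (act x b) (root_act cs x rb).
      by apply: (inV_act cs) => // i vi; have [] := bI i vi.
    rewrite inE => /orP[/eqP ->|lL lb].
      rewrite -[form v _]/((form v \o act x) b).
      by rewrite (scalar_inV_eq0 gs _ bI) ?eqxx// => i [].
    exists (act x^-1%g l); first exact: map_f.
    by rewrite -(act_isom cs x) (actKV cs).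
have -> : w = (x * (x^-1 * w * x) * x^-1)%g.
  by rewrite !mulgA mulgV mul1g -mulgA mulgV mulg1.
by rewrite x1 mulg1 mulgV.
Qed.

End Stabilizers.

(** * Freeness of the action and the shape of a chain of strata *)

Section StratumAction.
Variables (R : realType) (Pi : choiceType) (W : groupType) (gen : Pi -> W).
Hypothesis cs : coxeter_system gen.
Variable J : set Pi.
Hypothesis sJ : spherical gen J.
Local Notation V := (rootspace R Pi).
Local Notation F := (functionals R Pi).
Local Notation "v @_ i" := (monalg.mcoeff i v) (at level 3, i at level 2).
Local Notation sr := (@simple_root R Pi).
Local Notation form := (@Defs.form R Pi W gen).
Local Notation act := (@geom_rep R Pi W gen).
Local Notation is_root := (@is_root R Pi W gen).
Local Notation pos_root := (@pos_root R Pi W gen).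
Local Notation perp_root := (@perp_root R Pi W gen J).
Local Notation cone := (@tits_cone R Pi W gen).
Variable f0 : V -> R.
Local Notation in_chamber := (in_chamber gen J f0).
Local Notation stratum := (stratum gen J f0).
Hypothesis f0C : in_chamber f0.
Implicit Types (u v : V) (w x : W) (f g h : V -> R) (I T : set Pi) (S : stratum).

Lemma perp_root_sgn S v : perp_root v -> sgn S v <> 0.
Proof.
move=> pv; have [f [_ _ fp] ->] := repP S; have [rv _] := pv; rewrite sign_ofE// => /eqP.
by rewrite sgr_eq0 => /eqP fv; have := fp v pv; rewrite fv mulr0 ltxx.
Qed.

Lemma move_ex w S : (forall f : F, in_chamber f -> in_chamber (dual_act gen w f)) ->
  exists S', forall v, sgn S' v = sgn S (act w^-1%g v).
Proof.
move=> st; have [f Cf e] := repP S; have [S' e'] := stratumP (st f Cf).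
exists S' => v; rewrite e e' /sign_of dual_actE; congr (if _ then _ else _).
apply: asbool_equiv_eq; split => rv; first exact: root_act.
by rewrite -(actKV cs w v); exact: root_act.
Qed.

Lemma fix_stratum w S : (forall i, J i -> act w (sr i) = sr i) ->
  (forall v, is_root v -> sgn S (act w v) = sgn S v) -> w = 1%g.
Proof.
move=> wJ wS; have [f Cf fE] := repP S; have [fK fJ _] := Cf.
have [x [d [dc fd]]] := cone_rep fK; have [ds dp dz] := dc.
have sd v : is_root v -> sgn S (act x v) = Num.sg ((d : V -> R) v).
  move=> rv; rewrite fE sign_ofE; last exact: root_act.
  by rewrite fd dual_actE (actVK cs).
have u1 : parabolic gen [set i | [set: Pi] i /\ (d : V -> R) (sr i) = 0] (x^-1 * w * x)%g.
  apply: fix_dominant => //; first exact: parabolicT.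
  move=> v rv _; rewrite -!sd//; last by do !apply: root_act.
  by rewrite !(actM cs) (actKV cs) wS//; exact: root_act.
have x1 : (x^-1 * w * x = 1)%g.
  apply: (fix_vectors cs (L := [seq act x^-1%g (sr j) | j <- fset_set J])) u1 _ _.
  - by apply: (spherical_sub cs _ dz) => i [].
  - move=> _ /mapP[j jJ ->]; rewrite !(actM cs) (actKV cs) wJ//.
    by move: jJ; rewrite in_fset_set ?inE//; exact: (spherical_finite cs).
  - move=> b rb bI; apply: contrapT => no.
    suff pb : perp_root (act x b).
      apply: (perp_root_sgn (S := S) pb); rewrite sd// (scalar_inV_eq0 ds _ bI) ?sgr0//.
      by move=> i [].
    split=> [|j Jj]; first exact: root_act.
    apply/eqP; apply: contrapT => /negP ne; apply: no; exists (act x^-1%g (sr j)).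
      by apply: map_f; rewrite in_fset_set ?inE//; exact: (spherical_finite cs).
    by rewrite -(act_isom cs x) (actKV cs) form_sym.
have -> : w = (x * (x^-1 * w * x) * x^-1)%g.
  by rewrite !mulgA mulgV mul1g -mulgA mulgV mulg1.
by rewrite x1 mulg1 mulgV.
Qed.

Lemma height_pos v : is_root v -> 0 <= lin (fun _ => 1) v -> pos v.
Proof.
move=> rv hv; case: (root_pos_or_neg cs rv) => // nv.
have hs : scalar (lin (fun _ : Pi => 1 : R)) by exact: lin_scalar.
have [i vi] : exists i, (- v)@_i != 0.
  apply: contrapT => no; apply: (root_neq0 cs rv); apply/eqP; rewrite -oppr_eq0; apply/eqP.
  apply/monalg.malgP => i; rewrite monalg.mcoeff0; apply/eqP; apply: contrapT => /negP ne.
  by apply: no; exists i.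
have h1 i0 : (- v)@_i0 != 0 -> 0 <= lin (fun _ : Pi => 1 : R) (sr i0).
  by rewrite lin_root ler01.
have h2 : lin (fun _ : Pi => 1 : R) (- v) <= 0 by rewrite (scalarN hs) oppr_le0.
have := dominant_eq0 hs nv h1 h2 vi; rewrite lin_root => /eqP.
by rewrite oner_eq0.
Qed.

Section ChainLength.
Variable s : {fset stratum}.
Hypothesis s_chain : comparable_fset (@le_stratum R Pi W gen J f0) s.
Hypothesis s0 : s != fset0.

Lemma chain_min (h : stratum -> R) : exists2 c, c \in s & forall S, S \in s -> h c <= h S.
Proof.
have [c cs0] : exists c, c \in s.
  by have /fset0Pn[c] := s0; exists c.
have [|x [xs _ xm]] := @seq_min R _ s (fun _ => True) h; first by exists c.
by exists x => // S Ss; exact: xm.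
Qed.

Lemma chain_bottom : exists2 c, c \in s & forall S, S \in s -> le_stratum c S.
Proof.
have [c cs0 cm] := chain_min (fun S => (zdim S)%:R); exists c => // S Ss.
have /orP[//|Sc] := s_chain cs0 Ss.
have [->|ne] := eqVneq S c; first exact: le_stratum_refl.
have := zdim_lt cs Sc ne; rewrite ltnNge -(ler_nat R) cm//.
Qed.

Lemma chain_top : exists2 c, c \in s & forall S, S \in s -> le_stratum S c.
Proof.
have [c cs0 cm] := chain_min (fun S => - (zdim S)%:R); exists c => // S Ss.
have /orP[//|Sc] := s_chain Ss cs0.
have [->|ne] := eqVneq S c; first exact: le_stratum_refl.
have := zdim_lt cs Sc; rewrite eq_sym => /(_ ne); rewrite ltnNge -(ler_nat R) -lerN2 cm//.
Qed.

(* Below the chain there is a stratum on whose zero set only the roots of [V_J]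
   vanish; in the coordinates [w] of its Weyl chamber every stratum of the chain
   becomes a face, determined by the set of simple roots where it vanishes. *)
Lemma chain_data : exists (x : W) T, [/\ spherical gen T,
  forall j, J j -> exists2 i, T i & act x (sr j) = sr i,
  forall b, is_root b -> inV T (act x b) -> ~ perp_root b &
  (#|` s| + #|` fset_set J| <= (#|` fset_set T|).+1)%N].
Proof.
have [c cS cmin] := chain_bottom; have [t tS tmax] := chain_top.
(* Refining the bottom of the chain by the base leaves only roots of V_J vanishing, while every
   member of the chain remains a face of [U]. *)
pose U := comp cs c (base cs f0C).
have UF S : S \in s -> le_stratum U S.
  by move=> /cmin; apply: le_stratum_trans; exact: comp_le.
have UJ v : is_root v -> sgn U v = 0 -> inV J v.
  move=> rv; rewrite (compE cs)//; case: eqP => [_|//]; exact: (@base_zero R Pi W gen cs J f0 f0C).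
have [f Cf fE] := repP U; have [fK fJ _] := Cf.
have [w [d [dc fd]]] := cone_rep fK; have [ds dp dz] := dc.
pose I := [set i | (d : V -> R) (sr i) = 0].
have Uw v : is_root v -> sgn U (act w v) = Num.sg ((d : V -> R) v).
  move=> rv; rewrite fE sign_ofE; last exact: root_act.
  by rewrite fd dual_actE (actVK cs).
have rsr i : is_root (sr i) by exact: root_sr.
have Uwi i : 0 <= sgn U (act w (sr i)) by rewrite Uw// sgr_ge0.
have hs : scalar (lin (fun _ : Pi => 1 : R)) by exact: lin_scalar.
(* The coordinates of [U] are adjusted within the stabilizer of its zero set so that the images of
   the simple roots in [I] have nonnegative height, hence are positive roots of V_J. *)
have [||z zI zp] := @descent R _ _ _ cs I (lin (fun _ => 1) \o act w)
    (fset_set [set y | is_root y /\ inV I y]).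
- exact: scalar_act.
- move=> y [ry _] yI _; rewrite in_fset_set ?inE; last exact: (spherical_roots_finite R cs dz).
  by split.
pose be i := act w (act z (sr i)).
have rb i : is_root (be i) by do !apply: (root_act cs).
have d0 v : inV I v -> (d : V -> R) v = 0 by apply: scalar_inV_eq0.
have bJ i : I i -> inV J (be i) /\ pos (be i).
  move=> Ii; split; last by apply: height_pos => //; exact: zp.
  by apply: UJ => //; rewrite Uw ?d0 ?sgr0//; [exact: act_sr_inV|exact: root_act].
pose g := (w * z)^-1%g.
have gK v : act (w * z)%g (act g v) = v by rewrite /g (actKV cs).
have gI j : J j -> exists2 i, I i & act g (sr j) = sr i.
  move=> Jj; pose y := act g (sr j); have ry : is_root y by exact: root_act.
  have yI : inV I y.
    rewrite /y /g invgM (actM cs); apply: (inV_act cs); first exact: parabolicV.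
    have rj : is_root (act w^-1%g (sr j)) by exact: root_act.
    have dj : (d : V -> R) (act w^-1%g (sr j)) = 0.
      by apply/eqP; rewrite -sgr_eq0 -Uw// (actKV cs) fE sign_ofE// fJ ?sgr0.
    case: (root_pos_or_neg cs rj) => pj; first exact/(dominant_zero dc pj).
    rewrite -[act _ _]opprK; apply: inVN; apply/(dominant_zero dc pj).
    by rewrite (scalarN ds) dj oppr0.
  (* A simple root of [J] is a nonnegative combination of the positive roots [be i]; being extremal
     among positive vectors, it must be one of them. *)
  have ysum k : (k == j)%:R = \sum_(i <- monalg.msupp y) y@_i * (be i)@_k.
    rewrite eq_sym -coef_root -[sr j]gK -/y.
    have ls : scalar (fun v => (act (w * z)%g v)@_k).
      by move=> a u v; rewrite (act_linear cs) monalg.mcoeffD monalg.mcoeffZ.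
    by rewrite (scalar_lin ls) /lin; apply: eq_bigr => i _; rewrite /= (actM cs).
  have yp : pos y.
    case: (root_pos_or_neg cs ry) => // ny; exfalso.
    have := ysum j; rewrite eqxx => e; have : (1 : R) <= 0.
      rewrite [leLHS]e big_seq; apply: sumr_le0 => i.
      rewrite -monalg.mcoeff_neq0 => /yI /bJ [_ pb]; apply: mulr_le0_ge0; last exact: pb.
      by rewrite -oppr_ge0 -monalg.mcoeffN.
    by rewrite ler10.
  have [i yi] : exists i, y@_i != 0.
    apply: contrapT => no; apply: (root_neq0 cs ry); apply/monalg.malgP => i.
    rewrite monalg.mcoeff0; apply/eqP; apply: contrapT => /negP ne; by apply: no; exists i.
  exists i; first exact: yI.
  suff -> : sr j = be i by rewrite /be -[act w _](actM cs) (actVK cs).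
  apply: contrapT => ne; have [k kj] := root_other cs (rb i) (bJ i (yI i yi)).2 (nesym ne).
  rewrite lt_def => /andP[bk _]; have := ysum k; rewrite (negPf kj) => /esym/eqP.
  rewrite big_seq psumr_eq0; last first.
    move=> l; rewrite -monalg.mcoeff_neq0 => /yI /bJ [_ pb]; apply: mulr_ge0; first exact: yp.
    exact: pb.
  move=> /allP /(_ i); rewrite -monalg.mcoeff_neq0 yi => /(_ isT) /=.
  by rewrite mulf_eq0 (negPf yi) (negPf bk).
pose T S := [set i | sgn S (act w (sr i)) = 0].
have IT S : S \in s -> I `<=` T S.
  move=> Ss i Ii; apply: (le_stratum0 (UF S Ss)); first exact: root_act.
  by rewrite Uw// Ii sgr0.
have Fp S i : S \in s -> 0 <= sgn S (act w (sr i)).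
  move=> Ss; have [->//|/eqP Si] := eqVneq (sgn S (act w (sr i))) 0.
  by have /le_stratumP := UF S Ss => <- //; exact: root_act.
have T0 S v : S \in s -> is_root v -> pos v -> sgn S (act w v) = 0 <-> inV (T S) v.
  move=> Ss rv pv; split => [Sv i vi|vT]; last by apply: (sgn_act_zero cs) => // i /vT.
  by apply: (sgn_act_eq0 cs rv pv _ Sv vi) => k _; exact: Fp.
have sT S : S \in s -> spherical gen (T S).
  move=> Ss; apply: (@finite_roots_spherical R _ _ _ cs).
  apply: (@sub_finite_set _ _ (act w^-1%g @` zeros S)); last exact/finite_image/(zeros_finite cs).
  move=> v [[rv pv] vT]; exists (act w v); last exact: (actVK cs).
  by split; [exact: root_act|exact/T0].
have fT S : S \in s -> finite_set (T S) by move=> /sT; exact: spherical_finite.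
have lt S S' : S \in s -> S' \in s -> le_stratum S S' -> S != S' ->
    (#|` fset_set (T S)| < #|` fset_set (T S')|)%N.
  move=> Ss S's le ne; have sub : T S `<=` T S'.
    by move=> i; apply: (le_stratum0 le); exact: root_act.
  apply: card_fset_set_lt => //; first exact: fT.
  apply: contrapT => no; move/eqP: ne; apply; apply: stratum_ext => v rv.
  have [S'v|/eqP S'v] := eqVneq (sgn S' v) 0; last by have /le_stratumP := le; apply.
  rewrite S'v; move: v rv S'v; apply: (root_by_act cs (w := w)) => [v rv h|v rv pv].
    by rewrite !(sgnN cs)// => /eqP; rewrite oppr_eq0 => /eqP /h ->; rewrite oppr0.
  move=> /(T0 S' v S's rv pv) vT; apply/(T0 S v Ss rv pv) => i vi.
  by apply: contrapT => nT; apply: no; exists i => //; exact: vT.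
exists g, (T t); split.
- exact: sT.
- by move=> j /gI[i Ii e]; exists i => //; exact: IT.
- move=> b rb0 bT pb; apply: (perp_root_sgn (S := t) pb).
  have rw : is_root (act w^-1%g b) by exact: root_act.
  have e : act w^-1%g b = act z (act g b) by rewrite /g invgM -(actM cs) mulgA mulgV mul1g.
  have wT : inV (T t) (act w^-1%g b).
    rewrite e; apply: (inV_act cs) => //; apply: parabolic_sub zI => //; exact: IT.
  rewrite -(actKV cs w b); case: (root_pos_or_neg cs rw) => pw; first exact/T0.
  rewrite -[act w^-1%g b]opprK (actN cs) (sgnN cs)//; last by do !apply: (root_act cs); exact: rootN.
  apply/eqP; rewrite oppr_eq0; apply/eqP; apply/T0 => //; first exact: rootN.
  exact: inVN.
pose n S := #|` fset_set (T S)|.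
have nJ S : S \in s -> (#|` fset_set J| <= n S)%N.
  move=> Ss; have fJ' := spherical_finite cs sJ.
  have inj : {in fset_set J &, injective (fun j => xget j [set i | act g (sr j) = sr i])}.
    move=> j k; rewrite !in_fset_set// !inE => /gI[i _ ji] /gI[l _ kl].
    case: xgetP => [i' _ /= ji'|/(_ i)//]; case: xgetP => [l' _ /= kl'|/(_ l)//] e.
    have : act g (sr j) = act g (sr k) by rewrite ji' kl' e.
    move/(@act_inj R _ _ _ cs g)/(congr1 (fun v => v@_j)); rewrite !coef_root eqxx.
    by case: eqP => [->//|_ /eqP]; rewrite oner_eq0.
  rewrite -(size_map (fun j => xget j [set i | act g (sr j) = sr i])).
  apply: uniq_leq_size; first by rewrite map_inj_in_uniq// fset_uniq.
  move=> i /mapP[j /=]; rewrite in_fset_set// inE => /gI[k Ik e] ->.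
  rewrite in_fset_set ?inE; last exact: fT.
  case: xgetP => [l _ /= e'|/(_ k)//]; apply: IT => //.
  have /(congr1 (fun v => v@_k)) : sr l = sr k :> V by rewrite -e -e'.
  by rewrite !coef_root eqxx; case: eqP => [->//|_ /esym/eqP]; rewrite oner_eq0.
have nt S : S \in s -> (n S <= n t)%N.
  move=> Ss; have [->//|ne] := eqVneq S t.
  by apply: ltnW; apply: lt => //; exact: tmax.
have inj : {in s &, injective n}.
  move=> S S' Ss S's e; apply/eqP; apply: contrapT => /negP ne.
  have /orP[le|le] := s_chain Ss S's.
    by have := lt _ _ Ss S's le ne; rewrite -/(n S) -/(n S') e ltnn.
  by rewrite eq_sym in ne; have := lt _ _ S's Ss le ne; rewrite -/(n S) -/(n S') e ltnn.
have : (size [seq n C | C <- s] <= size (iota #|` fset_set J| (n t - #|` fset_set J|).+1))%N.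
  apply: uniq_leq_size; first by rewrite map_inj_in_uniq// fset_uniq.
  move=> _ /mapP[S Ss ->]; rewrite mem_iota nJ//= addnS ltnS subnKC; first exact: nt.
  exact: nJ.
rewrite size_map size_iota => le; apply: leq_trans (leq_add le (leqnn _)) _.
by rewrite addSn subnK// nJ.
Qed.

End ChainLength.

End StratumAction.

(** * The edge labels as real numbers *)

Section CoxeterValues.
Variable R : realType.

Definition sq2 : R := Num.sqrt 2.
Definition sq3 : R := Num.sqrt 3.
Definition golden : R := (1 + Num.sqrt 5) / 2.

Lemma sq2E : sq2 ^+ 2 = 2. Proof. by rewrite sqr_sqrtr. Qed.
Lemma sq3E : sq3 ^+ 2 = 3. Proof. by rewrite sqr_sqrtr. Qed.
Lemma goldenE : golden ^+ 2 = golden + 1.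
Proof.
have h : Num.sqrt 5 ^+ 2 = 5 :> R by rewrite sqr_sqrtr.
rewrite /golden; set r := Num.sqrt 5 in h *.
rewrite (_ : ((1 + r) / 2) ^+ 2 = (1 + 2 * r + r ^+ 2) / 4); last by field.
by rewrite h; field.
Qed.

Lemma sq2_ge : 7 / 5 <= sq2.
Proof. have h : 0 <= sq2 by exact: sqrtr_ge0. by have := sq2E; nra. Qed.
Lemma sq2_le : sq2 <= 3 / 2.
Proof. have h : 0 <= sq2 by exact: sqrtr_ge0. by have := sq2E; nra. Qed.
Lemma sq3_ge : 17 / 10 <= sq3.
Proof. have h : 0 <= sq3 by exact: sqrtr_ge0. by have := sq3E; nra. Qed.
Lemma golden_ge : 8 / 5 <= golden.
Proof.
have := goldenE; have : 0 <= golden by rewrite divr_ge0// addr_ge0// sqrtr_ge0.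
nra.
Qed.
Lemma golden_le : golden <= 33 / 20.
Proof.
have := goldenE; have : 0 <= golden by rewrite divr_ge0// addr_ge0// sqrtr_ge0.
nra.
Qed.

(* The values of [2 * cos (pi / m)]; no distinction is needed for [m >= 6]. *)
Definition cox_value (t : R) : Prop :=
  [\/ t = 0, t = 1, t = sq2 | t = golden \/ sq3 <= t].

Lemma cox_value_ge0 t : cox_value t -> 0 <= t.
Proof.
have := sq2_ge; have := sq3_ge; have := golden_ge.
by move=> h1 h2 h3 [->|->|->|[->|h]]; lra.
Qed.

Lemma cox_value_ge1 t : cox_value t -> t <> 0 -> 1 <= t.
Proof.
have := sq2_ge; have := sq3_ge; have := golden_ge.
by move=> h1 h2 h3 [->|->|->|[->|h]] //; lra.
Qed.

Lemma cox_value_heavy t : cox_value t -> t <> 0 -> t <> 1 -> 2 <= t ^+ 2.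
Proof.
have := sq2E; have := sq3_ge; have := golden_ge.
by move=> h1 h2 h3 [->|->|->|[->|h]] //; rewrite ?h3//; nra.
Qed.

End CoxeterValues.

(** * Configurations of roots with Coxeter angles *)

Section Configuration.
Variables (R : realType) (V : lmodType R) (B : V -> V -> R).
Hypotheses (Bl : forall u, scalar (B^~ u)) (Bs : forall u v, B u v = B v u).
Variables (rt C : V -> Prop).
Hypotheses (rt1 : forall u, rt u -> B u u = 1).
Hypothesis rt_refl : forall u v, rt u -> rt v -> rt (v - (2 * B v u) *: u).
Hypotheses (C0 : C 0) (CD : forall u v, C u -> C v -> C (u + v)).
Hypotheses (CZ : forall a u, 0 <= a -> C u -> C (a *: u)).
Hypothesis C_anti : forall u, C u -> C (- u) -> u = 0.
Hypothesis C_pos : forall u, C u -> u <> 0 -> 0 < B u u.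
Implicit Types (u v x y z : V) (s p X : seq V) (w : seq (R * V)).

Local Notation sq2 := (sq2 R).
Local Notation sq3 := (sq3 R).
Local Notation golden := (golden R).

(** Roots have norm 1, so this is 2 cos (pi/m) on an edge labelled m. On a vertex with itself it is
    -2, hence [adj] is only meaningful for distinct vertices. *)
Definition link u v : R := - (2 * B u v).

Lemma linkC u v : link u v = link v u. Proof. by rewrite /link Bs. Qed.

Lemma BDl u v x : B (u + v) x = B u x + B v x.
Proof. by have := Bl x 1 u v; rewrite scale1r mul1r. Qed.
Lemma B0l x : B 0 x = 0.
Proof. by have := Bl x (-1) 0 0; rewrite scaler0 addr0 mulN1r addNr. Qed.
Lemma BZl a u x : B (a *: u) x = a * B u x.
Proof. by have := Bl x a u 0; rewrite addr0 B0l addr0. Qed.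
Lemma BDr u v x : B x (u + v) = B x u + B x v. Proof. by rewrite !(Bs x) BDl. Qed.
Lemma BZr a u x : B x (a *: u) = a * B x u. Proof. by rewrite !(Bs x) BZl. Qed.

Record config (D : seq V) : Prop := Config {
  config_uniq : uniq D;
  config_node : forall u, u \in D -> rt u /\ C u;
  config_link : forall u v, u \in D -> v \in D -> u <> v -> cox_value (link u v) }.

Definition wsum w : V := \sum_(q <- w) q.1 *: q.2.

Lemma B_wsum w x : B (wsum w) x = \sum_(q <- w) q.1 * B q.2 x.
Proof.
by rewrite /wsum; elim: w => [|q w IH]; rewrite ?big_nil ?B0l// !big_cons BDl BZl IH.
Qed.

Variable D : seq V.
Hypothesis cD : config D.

Definition adj u v : bool := link u v != 0.

Lemma adjC u v : adj u v = adj v u. Proof. by rewrite /adj linkC. Qed.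

Lemma link_ge0 u v : u \in D -> v \in D -> u <> v -> 0 <= link u v.
Proof. by move=> uD vD uv; apply: cox_value_ge0; exact: config_link cD _ _ uD vD uv. Qed.

Lemma link_ge1 u v : u \in D -> v \in D -> u <> v -> adj u v -> 1 <= link u v.
Proof.
move=> uD vD uv /eqP h; apply: cox_value_ge1 h; exact: config_link cD _ _ uD vD uv.
Qed.

Definition weighted w := [/\ uniq (unzip2 w), {subset unzip2 w <= D} &
  forall q, q \in w -> 0 < q.1].

Definition norm w := B (wsum w) (wsum w).

(** In a vanishing sum the vector of the head and its opposite would both lie in the pointed cone.
    So nonempty positive combinations are nonzero, and each exclusion below exhibits one of
    nonpositive norm. *)
Lemma norm_gt0 w : weighted w -> w <> [::] -> 0 < norm w.
Proof.
case: w => // -[c x] w [_ sub wp] _.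
have Cw (w' : seq (R * V)) : {subset w' <= (c, x) :: w} -> C (wsum w').
  move=> sw; rewrite /wsum big_seq; apply: big_ind => // q qw.
  have qw' := sw q qw; apply: CZ; first exact/ltW/wp.
  by have [] := config_node cD (sub q.2 (map_f _ qw')).
apply: C_pos; first exact: Cw.
rewrite /wsum big_cons -/(wsum w) /= => e.
have c0 : 0 < c by apply: (wp (c, x)); rewrite mem_head.
have [rx Cx] := config_node cD (sub x (mem_head _ _)).
have x0 : c *: x = 0.
  apply: C_anti; first by apply: CZ => //; exact: ltW.
  rewrite (_ : - (c *: x) = wsum w); last by apply/esym/eqP; rewrite -addr_eq0 addrC e.
  by apply: Cw => q; rewrite inE => ->; rewrite orbT.
have := rt1 rx; have -> : x = 0 by rewrite -[x](scalerK (lt0r_neq0 c0)) x0 scaler0.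
by rewrite B0l => /esym/eqP; rewrite oner_eq0.
Qed.

Lemma norm_cons c x w : rt x ->
  norm ((c, x) :: w) = norm w + c ^+ 2 - c * \sum_(q <- w) q.1 * link x q.2.
Proof.
move=> rx; rewrite /norm /wsum big_cons -/(wsum w) /= BDl !BDr !BZl !BZr rt1//.
rewrite (Bs (wsum w) x) (Bs x) B_wsum.
have -> : \sum_(q <- w) q.1 * link x q.2 = - 2 * \sum_(q <- w) q.1 * B q.2 x.
  by rewrite mulr_sumr; apply: eq_bigr => q _; rewrite /link (Bs x); ring.
by ring.
Qed.

Lemma weighted_cons c x w : 0 < c -> x \in D -> x \notin unzip2 w -> weighted w ->
  weighted ((c, x) :: w).
Proof.
move=> c0 xD xw [uw sw pw]; split => /=; first by rewrite xw.
  by move=> y; rewrite inE => /orP[/eqP ->//|/sw].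
by move=> q; rewrite inE => /orP[/eqP ->//|/pw].
Qed.

Lemma norm_step c x w y d m : 0 < c -> x \in D -> x \notin unzip2 w -> weighted w ->
  (d, y) \in w -> m <= link x y -> norm ((c, x) :: w) <= norm w + c ^+ 2 - c * (d * m).
Proof.
move=> c0 xD xw [uw sw pw] yw h; rewrite norm_cons; last by have [] := config_node cD xD.
rewrite lerD2l lerN2 ler_pM2l//.
have t0 q : q \in w -> 0 <= q.1 * link x q.2.
  move=> qw; apply: mulr_ge0; first exact/ltW/pw.
  have q2 : q.2 \in unzip2 w by exact: map_f.
  by apply: link_ge0 => //; [exact: sw|move=> e; rewrite e q2 in xw].
rewrite (big_rem _ yw) /= ler_wpDr//; last by apply: ler_wpM2l => //; exact/ltW/(pw _ yw).
by rewrite big_seq; apply: sumr_ge0 => q /mem_rem /t0.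
Qed.

Definition ones s := [seq (1 : R, x) | x <- s].

Lemma unzip2_ones s : unzip2 (ones s) = s.
Proof. by rewrite /unzip2 -map_comp map_id. Qed.

Lemma weighted_ones s : uniq s -> {subset s <= D} -> weighted (ones s).
Proof.
by move=> us sD; split; rewrite ?unzip2_ones// => _ /mapP[x _ ->].
Qed.

(** Each vertex is only asked to have some neighbour further down the list, which expresses
    connectedness; that there are no cycles is proved in [tree_link0]. *)
Fixpoint tree s : Prop := if s is x :: s' then
  if s' is [::] then True else tree s' /\ exists2 y, y \in s' & adj x y else False.

Lemma tree_cons x s : tree s -> (exists2 y, y \in s & adj x y) -> tree (x :: s).
Proof. by case: s => //= y s. Qed.

(** Every vertex contributes 1 and each of the edges, one fewer than the vertices, removes at least
    1. *)
Lemma norm_tree s : tree s -> uniq s -> {subset s <= D} -> norm (ones s) <= 1.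
Proof.
elim: s => // x [|z s] IH.
  move=> _ _ xD; rewrite /= norm_cons ?big_nil /norm /wsum ?big_nil ?B0l; first by lra.
  by have [] := config_node cD (xD x (mem_head _ _)).
move=> [tz [y ys xy]] u sD; have /andP[xs us] : (x \notin z :: s) && uniq (z :: s) by [].
clear u.
have sD' : {subset z :: s <= D} by move=> u us'; apply: sD; rewrite inE us' orbT.
have xD : x \in D by apply: sD; rewrite mem_head.
have ne : x <> y by move=> e; rewrite e ys in xs.
have := @norm_step 1 x (ones (z :: s)) y 1 1 ltr01 xD; rewrite unzip2_ones => /(_ xs).
move=> /(_ (weighted_ones us sD')) /(_ (map_f _ ys)) /(_ (link_ge1 xD (sD' y ys) ne xy)).
by have := IH tz us sD'; rewrite /ones /= ; lra.
Qed.

(* Attaching the vertices of [w] with half the labels as weights. *)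
Lemma excess s w : tree s -> uniq (unzip2 w ++ s) -> {subset unzip2 w ++ s <= D} ->
  (forall q, q \in w -> 0 < q.1 /\ exists2 y, y \in s & q.1 <= link q.2 y) ->
  \sum_(q <- w) q.1 ^+ 2 < 4.
Proof.
move=> ts + + wP.
suff h : uniq (unzip2 w ++ s) -> {subset unzip2 w ++ s <= D} ->
    let w' := [seq (q.1 / 2, q.2) | q <- w] ++ ones s in
    [/\ unzip2 w' = unzip2 w ++ s, weighted w' &
        norm w' <= 1 - (\sum_(q <- w) q.1 ^+ 2) / 4].
  move=> u sub; have [_ ww nw] := h u sub; have := norm_gt0 ww.
  have ne : [seq (q.1 / 2, q.2) | q <- w] ++ ones s <> [::].
    by case: (w) => //; case: (s) ts.
  by move=> /(_ ne); lra.
elim: w wP => [|[c x] w IH] wP u sub /=.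
  rewrite unzip2_ones big_nil; split => //; first exact: weighted_ones.
  by rewrite mul0r subr0; exact: norm_tree.
have [xw u'] := andP u.
have [||e ww nw] := IH _ u'.
- by move=> q qw; apply: wP; rewrite inE qw orbT.
- by move=> y ys; apply: sub; rewrite inE ys orbT.
have xD : x \in D by apply: sub; rewrite mem_head.
have [/= c0 [y ys cy]] := wP (c, x) (mem_head _ _).
have c2 : 0 < c / 2 by lra.
split; first by rewrite -e.
  by apply: weighted_cons => //; rewrite e.
have := @norm_step _ x _ y 1 c c2 xD _ ww _ cy; rewrite e => /(_ xw).
rewrite mem_cat map_f ?orbT// big_cons /= => /(_ isT); lra.
Qed.

(** A second edge from [x] into the tree would lower the norm of the sum of all vertices to 0. *)
Lemma tree_link0 s x y z : tree s -> uniq (x :: s) -> {subset x :: s <= D} ->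
  y \in s -> z \in s -> y != z -> adj x y -> link x z = 0.
Proof.
move=> ts /= /andP[xs us] sub ys zs yz xy; apply/eqP; apply: contrapT => /negP xz.
have sD : {subset s <= D} by move=> u us'; apply: sub; rewrite inE us' orbT.
have xD : x \in D by apply: sub; rewrite mem_head.
have nx u : u \in s -> x <> u by move=> us' e; rewrite e us' in xs.
have ww := weighted_ones us sD.
have : 0 < norm ((1, x) :: ones s).
  by apply: norm_gt0 => //; apply: weighted_cons => //; rewrite unzip2_ones.
rewrite norm_cons; last by have [] := config_node cD xD.
have := norm_tree ts us sD.
suff : 2 <= \sum_(q <- ones s) q.1 * link x q.2 by lra.
rewrite /ones big_map (big_rem y)//= (big_rem z)/=; last first.
  by rewrite mem_rem_uniq// !inE eq_sym yz.
rewrite !mul1r addrA; apply: ler_wpDr.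
  rewrite big_seq; apply: sumr_ge0 => u /mem_rem/mem_rem us'.
  by rewrite mul1r; apply: link_ge0 => //; [exact: sD|exact: nx].
have -> : 2 = 1 + 1 :> R by ring.
by apply: lerD; apply: link_ge1 => //; try exact: sD; try exact: nx.
Qed.

Lemma tree_link1 s x y z : tree s -> uniq (x :: s) -> {subset x :: s <= D} ->
  y \in s -> z \in s -> adj x y -> adj x z -> y = z.
Proof.
move=> ts u sub ys zs xy xz; apply/eqP; apply: contrapT => /negP yz.
by move/eqP: xz; apply; exact: tree_link0 ts u sub ys zs yz xy.
Qed.

(** Squared labels 1 + 1 + 1 + 1 reach the forbidden 4, as in the affine diagrams of type D. The
    next two lemmas are the cases 1 + 1 + 2 and 2 + 2, as in the affine types B and C. *)
Lemma excess1 s n1 n2 n3 n4 : tree s -> uniq [:: n1, n2, n3, n4 & s] ->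
  {subset [:: n1, n2, n3, n4 & s] <= D} ->
  (exists2 y, y \in s & adj n1 y) -> (exists2 y, y \in s & adj n2 y) ->
  (exists2 y, y \in s & adj n3 y) -> (exists2 y, y \in s & adj n4 y) -> False.
Proof.
move=> ts u sub h1 h2 h3 h4.
have := @excess s [:: (1, n1); (1, n2); (1, n3); (1, n4)] ts u sub.
have h n : n \in [:: n1; n2; n3; n4] -> (exists2 y, y \in s & adj n y) ->
    exists2 y, y \in s & 1 <= link n y.
  move=> nN [y ys ny]; exists y => //; apply: link_ge1 => //.
  - by apply: sub; move: nN; rewrite !inE => /or4P[] ->; rewrite ?orbT.
  - by apply: sub; rewrite !inE ys !orbT.
  - move=> e; rewrite -e in ys; have := u; rewrite -[_ :: _]/([:: n1; n2; n3; n4] ++ s) cat_uniq.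
    by move=> /and3P[_ /hasPn /(_ _ ys)]; rewrite nN.
rewrite !big_cons big_nil /= !expr1n addr0 (_ : 1 + (1 + (1 + 1)) = 4 :> R); last by ring.
move=> h'; suff : (4 : R) < 4 by rewrite ltxx.
apply: h' => q; rewrite !inE => /or4P[] /eqP -> /=; split => //; apply: h => //;
  by rewrite !inE eqxx ?orbT.
Qed.

Lemma excess2 s n1 n2 n3 (m : R) : tree s -> uniq [:: n1, n2, n3 & s] ->
  {subset [:: n1, n2, n3 & s] <= D} -> 0 < m -> 2 <= m ^+ 2 ->
  (exists2 y, y \in s & adj n1 y) -> (exists2 y, y \in s & adj n2 y) ->
  (exists2 y, y \in s & m <= link n3 y) -> False.
Proof.
move=> ts u sub m0 m2 h1 h2 h3.
have := @excess s [:: (1, n1); (1, n2); (m, n3)] ts u sub.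
have h n : n \in [:: n1; n2; n3] -> (exists2 y, y \in s & adj n y) ->
    exists2 y, y \in s & 1 <= link n y.
  move=> nN [y ys ny]; exists y => //; apply: link_ge1 => //.
  - by apply: sub; move: nN; rewrite !inE => /or3P[] ->; rewrite ?orbT.
  - by apply: sub; rewrite !inE ys !orbT.
  - move=> e; rewrite -e in ys; have := u; rewrite -[_ :: _]/([:: n1; n2; n3] ++ s) cat_uniq.
    by move=> /and3P[_ /hasPn /(_ _ ys)]; rewrite nN.
rewrite !big_cons big_nil /= !expr1n => h'; have : 1 + (1 + (m ^+ 2 + 0)) < 4; last by lra.
apply: h' => q; rewrite !inE => /or3P[] /eqP -> /=; split => //; apply: h => //;
  by rewrite !inE eqxx ?orbT.
Qed.

Lemma excess3 s n1 n2 (m m' : R) : tree s -> uniq [:: n1, n2 & s] ->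
  {subset [:: n1, n2 & s] <= D} -> 0 < m -> 0 < m' -> 4 <= m ^+ 2 + m' ^+ 2 ->
  (exists2 y, y \in s & m <= link n1 y) -> (exists2 y, y \in s & m' <= link n2 y) -> False.
Proof.
move=> ts u sub m0 m0' m2 h1 h2.
have := @excess s [:: (m, n1); (m', n2)] ts u sub.
rewrite !big_cons big_nil /= => h'; have : m ^+ 2 + (m' ^+ 2 + 0) < 4; last by lra.
by apply: h' => q; rewrite !inE => /orP[] /eqP -> /=; split.
Qed.

(* In [w], a list of weighted vertices, the head is attached to the [k]-th vertex
   of the tail by an edge of label at least [m], where [(k, m)] is the head of [e]. *)
Fixpoint attached w (e : seq (nat * R)) {struct e} : Prop :=
  if e is (k, m) :: e' then
    if w is q :: w' then
      [/\ 0 < q.1, (k < size w')%N, m <= link q.2 (nth (0, 0) w' k).2 & attached w' e']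
    else False
  else if w is [:: q] then 0 < q.1 else False.

Fixpoint norm_bound w (e : seq (nat * R)) {struct e} : R :=
  if e is (k, m) :: e' then
    if w is q :: w' then norm_bound w' e' + q.1 ^+ 2 - q.1 * ((nth (0, 0) w' k).1 * m)
    else 0
  else if w is [:: q] then q.1 ^+ 2 else 0.

Lemma attached_norm w e : uniq (unzip2 w) -> {subset unzip2 w <= D} -> attached w e ->
  [/\ weighted w, w <> [::] & norm w <= norm_bound w e].
Proof.
elim: w e => [|[c x] w IH] [|[k m] e] //=.
  case: w {IH} => // _ sub /= c0; split => //.
    by split => // q; rewrite inE => /eqP ->.
  rewrite norm_cons ?big_nil /norm /wsum ?big_nil ?B0l; first by lra.
  by have [] := config_node cD (sub x (mem_head _ _)).
move=> /andP[xw u] sub [c0 kw xm ae].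
have [|ww _ nw] := IH e u _ ae; first by move=> y yw; apply: sub; rewrite inE yw orbT.
have xD : x \in D by apply: sub; rewrite mem_head.
split => //; first exact: weighted_cons.
have yw : ((nth (0, 0) w k).1, (nth (0, 0) w k).2) \in w.
  by rewrite -surjective_pairing mem_nth.
by have := norm_step c0 xD xw ww yw xm; lra.
Qed.

Lemma bad_tree w e : uniq (unzip2 w) -> {subset unzip2 w <= D} -> attached w e ->
  0 < norm_bound w e.
Proof.
by move=> u sub /(attached_norm u sub)[/norm_gt0 ww /ww]; exact: lt_le_trans.
Qed.

Ltac split_lra := repeat (split => //); lra.

(* The affine diagrams E6~, E7~, E8~, F4~ and some indefinite diagrams. *)
Lemma no_E6 x a1 a2 b1 b2 c1 c2 : uniq [:: c2; c1; b2; b1; a2; a1; x] ->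
  {subset [:: c2; c1; b2; b1; a2; a1; x] <= D} ->
  1 <= link a1 x -> 1 <= link a2 a1 -> 1 <= link b1 x -> 1 <= link b2 b1 ->
  1 <= link c1 x -> 1 <= link c2 c1 -> False.
Proof.
move=> u sub h1 h2 h3 h4 h5 h6.
(* The weights are those of the null vector of the affine diagram, so the bound on the norm is
   exactly 0; the same choice is made for E7~, E8~ and F4~. *)
have := @bad_tree [:: (1, c2); (2, c1); (1, b2); (2, b1); (1, a2); (2, a1); (3, x)]
  [:: (0, 1); (4, 1); (0, 1); (2, 1); (0, 1); (0, 1)] u sub.
by move=> /= h; lapply h; [lra|split_lra].
Qed.

Lemma no_E7 x a1 b1 b2 b3 c1 c2 c3 : uniq [:: c3; c2; c1; b3; b2; b1; a1; x] ->
  {subset [:: c3; c2; c1; b3; b2; b1; a1; x] <= D} ->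
  1 <= link a1 x -> 1 <= link b1 x -> 1 <= link b2 b1 -> 1 <= link b3 b2 ->
  1 <= link c1 x -> 1 <= link c2 c1 -> 1 <= link c3 c2 -> False.
Proof.
move=> u sub h1 h2 h3 h4 h5 h6 h7.
have := @bad_tree [:: (1, c3); (2, c2); (3, c1); (1, b3); (2, b2); (3, b1); (2, a1); (4, x)]
  [:: (0, 1); (0, 1); (4, 1); (0, 1); (0, 1); (1, 1); (0, 1)] u sub.
by move=> /= h; lapply h; [lra|split_lra].
Qed.

Lemma no_E8 x a1 b1 b2 c1 c2 c3 c4 c5 : uniq [:: c5; c4; c3; c2; c1; b2; b1; a1; x] ->
  {subset [:: c5; c4; c3; c2; c1; b2; b1; a1; x] <= D} ->
  1 <= link a1 x -> 1 <= link b1 x -> 1 <= link b2 b1 -> 1 <= link c1 x ->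
  1 <= link c2 c1 -> 1 <= link c3 c2 -> 1 <= link c4 c3 -> 1 <= link c5 c4 -> False.
Proof.
move=> u sub h1 h2 h3 h4 h5 h6 h7 h8.
have := @bad_tree [:: (1, c5); (2, c4); (3, c3); (4, c2); (5, c1); (2, b2); (4, b1);
  (3, a1); (6, x)]
  [:: (0, 1); (0, 1); (0, 1); (0, 1); (3, 1); (0, 1); (1, 1); (0, 1)] u sub.
by move=> /= h; lapply h; [lra|split_lra].
Qed.

Lemma no_F4 a b c d e : uniq [:: a; b; c; d; e] -> {subset [:: a; b; c; d; e] <= D} ->
  1 <= link a b -> 1 <= link b c -> sq2 <= link c d -> 1 <= link d e -> False.
Proof.
move=> u sub h1 h2 h3 h4; have s2 := sq2E R; have s2p := sq2_ge R.
have := @bad_tree [:: (1, a); (2, b); (3, c); (2 * sq2, d); (sq2, e)]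
  [:: (0, 1); (0, 1); (0, sq2); (0, 1)] u sub.
by move=> /= h; lapply h; [nra|split_lra].
Qed.

Lemma no_353 a b c d : uniq [:: a; b; c; d] -> {subset [:: a; b; c; d] <= D} ->
  1 <= link a b -> golden <= link b c -> 1 <= link c d -> False.
Proof.
move=> u sub h1 h2 h3; have s2p := golden_ge R.
(* These weights bound the norm by 6 - 4 [golden], which is negative. *)
have := @bad_tree [:: (1, a); (2, b); (2, c); (1, d)]
  [:: (0, 1); (0, golden); (0, 1)] u sub.
by move=> /= h; lapply h; [lra|split_lra].
Qed.

Lemma no_5333 a b c d e : uniq [:: a; b; c; d; e] -> {subset [:: a; b; c; d; e] <= D} ->
  golden <= link a b -> 1 <= link b c -> 1 <= link c d -> 1 <= link d e -> False.
Proof.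
move=> u sub h1 h2 h3 h4; have s2p := golden_ge R; have s2 := goldenE R.
(* The bound is 10 - 4 [golden ^+ 2], which equals 6 - 4 [golden] and is again negative. *)
have := @bad_tree [:: (2 * golden, a); (4, b); (3, c); (2, d); (1, e)]
  [:: (0, golden); (0, 1); (0, 1); (0, 1)] u sub.
by move=> /= h; lapply h; [nra|split_lra].
Qed.

Lemma linkDl u v x : link (u + v) x = link u x + link v x.
Proof. by rewrite /link BDl; ring. Qed.
Lemma linkZl a u x : link (a *: u) x = a * link u x.
Proof. by rewrite /link BZl; ring. Qed.
Lemma link0l x : link 0 x = 0. Proof. by rewrite /link B0l mulr0 oppr0. Qed.
Lemma linkDr u v x : link x (u + v) = link x u + link x v.
Proof. by rewrite !(linkC x) linkDl. Qed.
Lemma linkZr a u x : link x (a *: u) = a * link x u.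
Proof. by rewrite !(linkC x) linkZl. Qed.
Lemma link_diag u : rt u -> link u u = -2.
Proof. by move=> ru; rewrite /link rt1// mulr1. Qed.

Lemma rt_add u v : rt u -> rt v -> rt (v + link v u *: u).
Proof. by move=> ru rv; rewrite /link scaleNr; exact: rt_refl. Qed.

Definition orth X u : Prop := forall x, x \in X -> link u x = 0.

(** The component [X] is removed at a cost of [n] vertices besides its own. The clause on arbitrary
    [y] keeps the new vertices orthogonal to components removed earlier; the clause on vertices
    orthogonal to [X] keeps the components still to be removed. *)
Definition reduces (X : seq V) (n : nat) : Prop := exists D' : seq V,
  [/\ config D', forall u, u \in D' -> orth X u,
    forall u, u \in D -> u \notin X -> orth X u -> u \in D',
    forall y, (forall u, u \in D -> link u y = 0) -> forall u, u \in D' -> link u y = 0 &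
    (size D <= size D' + size X + n)%N].

Definition nbrs X := [seq u <- D | (u \notin X) && has (adj u) X].
Definition rest X := [seq u <- D | (u \notin X) && ~~ has (adj u) X].

Lemma rest_orth X u : u \in rest X -> [/\ u \in D, u \notin X & orth X u].
Proof.
rewrite mem_filter => /andP[/andP[uX /hasPn h] uD]; split => // x /h.
by rewrite /adj negbK => /eqP.
Qed.

Lemma orth_rest X u : u \in D -> u \notin X -> orth X u -> u \in rest X.
Proof.
move=> uD uX h; rewrite mem_filter uD uX /= andbT; apply/hasPn => x /h e.
by rewrite /adj e eqxx.
Qed.

Lemma nbrsP X u : u \in nbrs X -> [/\ u \in D, u \notin X & exists2 x, x \in X & adj u x].
Proof. by rewrite mem_filter => /andP[/andP[uX /hasP h] uD]. Qed.

(** A root that can take the place of a neighbour of [X]; its angles are controlled only with the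
    vertices that survive. *)
Record extra X e : Prop := Extra {
  extra_rt : rt e; extra_C : C e; extra_orth : orth X e;
  extra_span : forall y, (forall u, u \in D -> link u y = 0) -> link e y = 0;
  extra_link : forall u, u \in rest X -> cox_value (link e u) }.

Lemma extra_notin X e : extra X e -> e \notin rest X.
Proof.
move=> [re _ _ _ le]; apply/negP => /le; rewrite link_diag// => /cox_value_ge0; lra.
Qed.

Lemma reduces_extra X (E : seq V) : uniq E -> (forall e, e \in E -> extra X e) ->
  (forall e e', e \in E -> e' \in E -> e <> e' -> cox_value (link e e')) ->
  reduces X (size (nbrs X) - size E).
Proof.
move=> uE eE lE; exists (E ++ rest X); split.
- split.
  + rewrite cat_uniq uE filter_uniq ?andbT; last exact: config_uniq cD.
    by apply/hasPn => u uR; apply/negP => /eE/extra_notin; rewrite uR.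
  + move=> u; rewrite mem_cat => /orP[/eE[]//|/rest_orth[uD _ _]]; exact: config_node cD _ uD.
  + move=> u v; rewrite !mem_cat => /orP[uE'|uR] /orP[vE|vR] uv.
    * exact: lE.
    * exact: extra_link (eE _ uE') _ vR.
    * by rewrite linkC; exact: extra_link (eE _ vE) _ uR.
    * have [uD _ _] := rest_orth uR; have [vD _ _] := rest_orth vR.
      exact: config_link cD _ _ uD vD uv.
- by move=> u; rewrite mem_cat => /orP[/eE[]//|/rest_orth[]].
- by move=> u uD uX oX; rewrite mem_cat orth_rest ?orbT.
- move=> y hy u; rewrite mem_cat => /orP[/eE e|/rest_orth[uD _ _]]; last exact: hy.
  exact: extra_span e _ hy.
- have -> : size D = (count (fun u => u \in X) D + (size (nbrs X) + size (rest X)))%N.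
    rewrite /nbrs /rest !size_filter; elim: (D) => //= u l ->.
    by case: (u \in X); case: (has _ X) => /=; lia.
  have : (count (fun u => u \in X) D <= size X)%N.
    rewrite -size_filter; apply: uniq_leq_size; first exact/filter_uniq/(config_uniq cD).
    by move=> u; rewrite mem_filter => /andP[].
  rewrite size_cat; set n1 := count _ _; set n2 := size (nbrs X); set n3 := size (rest X).
  move: n1 n2 n3 (size X) (size E); clear; lia.
Qed.

Lemma reduces_le X m n : (m <= n)%N -> reduces X m -> reduces X n.
Proof.
move=> mn [D' [h1 h2 h3 h4 h5]]; exists D'; split => //; apply: leq_trans h5 _.
by rewrite leq_add2l.
Qed.

Lemma reduces_nbrs X n : (size (nbrs X) <= n)%N -> reduces X n.
Proof.
by move=> h; apply: reduces_le (@reduces_extra X [::] _ _ _) => //; rewrite subn0.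
Qed.

Definition vsum s : V := \sum_(x <- s) x.

Lemma link_vsum s y : link (vsum s) y = \sum_(x <- s) link x y.
Proof. by rewrite /vsum; elim: s => [|x s IH]; rewrite ?big_nil ?link0l// !big_cons linkDl IH. Qed.

Fixpoint straight s : Prop := if s is x :: s' then
  straight s' /\ (if s' is y :: s'' then link x y = 1 /\ orth s'' x else True) else True.

Lemma straight_head x s : straight (x :: s) -> link (vsum s) x = (s != [::])%:R.
Proof.
case: s => [_|y s [_ [xy h]]]; first by rewrite /vsum big_nil link0l.
rewrite link_vsum big_cons linkC xy big_seq big1 ?addr0// => z /h.
by rewrite linkC.
Qed.

Lemma straight_mid s x s' : straight (s ++ x :: s') -> rt x ->
  link (vsum (s ++ x :: s')) x = (s != [::])%:R - 2 + (s' != [::])%:R.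
Proof.
move=> + rx; elim: s => [|y s IH] /=.
  move=> h; rewrite /vsum big_cons linkDl -/(vsum s') (straight_head h) (link_diag rx).
  by rewrite mulr0n sub0r.
move=> [h h']; rewrite /vsum big_cons linkDl -/(vsum _) IH//.
case: s h h' {IH} => [|z s] /= h [yz yo]; first by rewrite yz mulr0n; ring.
by rewrite yo ?add0r// mem_cat mem_head orbT.
Qed.

Lemma straight_rt s : s <> [::] -> (forall x, x \in s -> rt x) -> straight s -> rt (vsum s).
Proof.
elim: s => // x [|y s] IH _ rs st; first by rewrite /vsum big_seq1; apply: rs; rewrite mem_head.
have rx : rt x by apply: rs; rewrite mem_head.
have r' : rt (vsum (y :: s)).
  by apply: IH => //; [move=> z zs; apply: rs; rewrite inE zs orbT|case: st].
have := rt_add rx r'; rewrite straight_head// scale1r addrC.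
by rewrite [vsum (x :: _)]/vsum big_cons.
Qed.

Lemma vsum_C s : {subset s <= D} -> C (vsum s).
Proof.
move=> sub; rewrite /vsum big_seq; apply: big_ind => // x /sub xD.
by have [] := config_node cD xD.
Qed.

Lemma rest_value X u v : u \in rest X -> v \in D -> v \notin rest X -> cox_value (link v u).
Proof.
move=> uR vD vR; have [uD _ _] := rest_orth uR; apply: (config_link cD) => // e.
by rewrite e uR in vR.
Qed.

Lemma cox_value_add (a b : R) : cox_value a -> cox_value b -> a = 0 \/ b = 0 ->
  cox_value (a + b).
Proof. by move=> ha hb [->|->]; rewrite ?add0r ?addr0. Qed.

(* The sum of a simply laced path is a root orthogonal to its inner vertices. *)
Lemma path_extra X a p c : straight (a :: rcons p c) -> {subset a :: rcons p c <= D} ->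
  X =i p -> a \notin rest X -> c \notin rest X ->
  (forall u, u \in rest X -> adj a u -> adj c u -> False) ->
  extra X (vsum (a :: rcons p c)).
Proof.
move=> st sub Xp aR cR no.
have rs x : x \in a :: rcons p c -> rt x by move=> /sub /(config_node cD)[].
have aD : a \in D by apply: sub; rewrite mem_head.
have cD' : c \in D by apply: sub; rewrite inE mem_rcons mem_head orbT.
split.
- exact: straight_rt.
- exact: vsum_C.
- move=> x; rewrite Xp => xp; have [p1 [p2 pE]] : exists p1 p2, p = p1 ++ x :: p2.
    by case/splitPr: xp => p1 p2; exists p1, p2.
  have e : a :: rcons p c = (a :: p1) ++ x :: rcons p2 c by rewrite pE rcons_cat.
  rewrite e straight_mid -?e//; last by apply: rs; rewrite e mem_cat mem_head orbT.
  by case: (p2) => [|? ?] /=; ring.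
- move=> y hy; rewrite link_vsum big_seq big1// => u /sub; exact: hy.
- move=> u uR; have [uD uX uo] := rest_orth uR.
  have -> : link (vsum (a :: rcons p c)) u = link a u + link c u.
    rewrite link_vsum big_cons -cats1 big_cat big_seq1 /= big_seq big1 ?add0r// => y yp.
    by rewrite linkC; apply: uo; rewrite Xp.
  apply: cox_value_add; [exact: rest_value uR aD aR|exact: rest_value uR cD' cR|].
  have [->|au] := eqVneq (link a u) 0; first by left.
  by have [->|cu] := eqVneq (link c u) 0; [right|case: (no u uR au cu)].
Qed.

(* Reflecting [x] in the root [vsum q], at the far end of which [a] lies. *)
Lemma heavy_extra X x q a : straight (rcons q a) -> {subset x :: rcons q a <= D} ->
  X =i x :: q -> link x (head a q) = sq2 -> orth (behead (rcons q a)) x -> a \notin rest X ->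
  (forall u, u \in rest X -> link a u = 0 \/ link a u = 1) ->
  extra X (x + sq2 *: vsum (rcons q a)).
Proof.
move=> st sub Xq xh xo aR au; have s2 := sq2E R; have s2p := sq2_ge R.
have aD : a \in D by apply: sub; rewrite inE mem_rcons mem_head orbT.
have [rx Cx] := config_node cD (sub x (mem_head _ _)).
have sub' : {subset rcons q a <= D} by move=> y yq; apply: sub; rewrite inE yq orbT.
have rs y : y \in rcons q a -> rt y by move=> /sub' /(config_node cD)[].
have rq : rt (vsum (rcons q a)) by apply: straight_rt => //; case: (q).
have xq : link x (vsum (rcons q a)) = sq2.
  rewrite linkC link_vsum; move: xh xo; case: (q) => [|y q'] /= xh xo.
    by rewrite big_seq1 linkC.
  rewrite big_cons linkC xh big_seq big1 ?addr0// => z zq.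
  by rewrite linkC; exact: xo.
split.
- by have := rt_add rq rx; rewrite xq.
- by apply: CD => //; apply: CZ; [lra|exact: vsum_C].
- move=> y; rewrite Xq inE => /orP[/eqP ->|yq].
    by rewrite linkDl linkZl link_diag// (linkC _ x) xq -expr2 s2; ring.
  have [q1 [q2 qE]] : exists q1 q2, q = q1 ++ y :: q2.
    by case/splitPr: yq => q1 q2; exists q1, q2.
  have e : rcons q a = q1 ++ y :: rcons q2 a by rewrite qE rcons_cat.
  rewrite linkDl linkZl e straight_mid -?e//; last by apply: rs; rewrite e mem_cat mem_head orbT.
  have -> : (rcons q2 a != [::])%:R = 1 :> R by case: (q2).
  move: xh xo; rewrite qE; case: (q1) => [|z q'] /= xh xo.
    by rewrite xh; ring.
  by rewrite xo; [ring|rewrite mem_rcons inE mem_cat mem_head !orbT].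
- move=> y hy; rewrite linkDl linkZl hy; last by apply: sub; rewrite mem_head.
  by rewrite link_vsum big_seq big1 ?mulr0 ?addr0// => u /sub'; exact: hy.
- move=> u uR; have [uD uX uo] := rest_orth uR.
  have -> : link (x + sq2 *: vsum (rcons q a)) u = sq2 * link a u.
    rewrite linkDl linkZl linkC uo ?Xq ?mem_head// add0r link_vsum -cats1 big_cat big_seq1 /=.
    rewrite big_seq big1 ?add0r// => y yq.
    by rewrite linkC; apply: uo; rewrite Xq inE yq orbT.
  by case: (au u uR) => ->; rewrite ?mulr0 ?mulr1; [apply: Or41|apply: Or43].
Qed.

(** * Roots computed over the ring generated by a quadratic number *)

Section ExplicitRoots.
Variables (tau : R) (st : int * int).
Hypothesis tauE : tau ^+ 2 = st.1%:~R * tau + st.2%:~R.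
Local Notation K := (int * int)%type.

(* The integral linear combinations of 1 and tau. *)
Definition val2 (a : K) : R := a.1%:~R + a.2%:~R * tau.
Definition add2 (a b : K) : K := (a.1 + b.1, a.2 + b.2).
Definition mul2 (a b : K) : K :=
  (a.1 * b.1 + st.2 * a.2 * b.2, a.1 * b.2 + a.2 * b.1 + st.1 * a.2 * b.2).

Lemma val2D a b : val2 (add2 a b) = val2 a + val2 b.
Proof. by rewrite /val2 /= !rmorphD; ring. Qed.

Lemma val2M a b : val2 (mul2 a b) = val2 a * val2 b.
Proof.
rewrite /val2 /= !rmorphD !rmorphM /=; ring: tauE.
Qed.

(* Edges are listed as in [attached]. *)
Definition entry (e : seq (nat * K)) (i j : nat) : K :=
  if i == j then (- 2%:Z, 0)
  else if (i < j)%N then let q := nth (0%N, (0, 0)) e i in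
    if j == (i.+1 + q.1)%N then q.2 else (0, 0)
  else let q := nth (0%N, (0, 0)) e j in
    if i == (j.+1 + q.1)%N then q.2 else (0, 0).

Definition dot (e : seq (nat * K)) (c : seq K) (i : nat) : K :=
  foldr add2 (0, 0) [seq mul2 (nth (0, 0) c j) (entry e j i) | j <- iota 0 (size c)].

Definition bump_at (c : seq K) (i : nat) (a : K) : seq K :=
  set_nth (0, 0) c i (add2 (nth (0, 0) c i) a).

Definition reflect_at e (c : seq K) (i : nat) : seq K := bump_at c i (dot e c i).

Definition eval2 (xs : seq V) (c : seq K) : V :=
  \sum_(j <- iota 0 (size xs)) val2 (nth (0, 0) c j) *: nth 0 xs j.

Lemma eval2_bump xs c i a : (i < size xs)%N ->
  eval2 xs (bump_at c i a) = eval2 xs c + val2 a *: nth 0 xs i.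
Proof.
move=> ix; have ii : i \in iota 0 (size xs) by rewrite mem_iota.
rewrite /eval2 (big_rem _ ii) [in RHS](big_rem _ ii) /=.
rewrite /bump_at nth_set_nth /= eqxx val2D scalerDl addrAC; congr (_ + _ + _).
rewrite big_seq [RHS]big_seq; apply: eq_bigr => j; rewrite mem_rem_uniq ?iota_uniq//.
by rewrite inE nth_set_nth /= => /andP[/negPf ->].
Qed.

Variables (xs : seq V) (e : seq (nat * K)).
Hypothesis gram : forall i j, (i < size xs)%N -> (j < size xs)%N ->
  link (nth 0 xs i) (nth 0 xs j) = val2 (entry e i j).
Hypothesis xs_rt : forall x, x \in xs -> rt x.

Lemma link_eval2 c x : link (eval2 xs c) x =
  \sum_(j <- iota 0 (size xs)) val2 (nth (0, 0) c j) * link (nth 0 xs j) x.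
Proof.
rewrite /eval2; elim: (iota _ _) => [|j l IH]; rewrite ?big_nil ?link0l// !big_cons.
by rewrite linkDl linkZl IH.
Qed.

Lemma link_dot c i : size c = size xs -> (i < size xs)%N ->
  link (eval2 xs c) (nth 0 xs i) = val2 (dot e c i).
Proof.
move=> sc ix; rewrite link_eval2 /dot sc big_seq.
have : forall j, j \in iota 0 (size xs) -> (j < size xs)%N by move=> j; rewrite mem_iota.
elim: (iota _ _) => [|j l IH] jl; first by rewrite big_nil /val2 /= mul0r addr0.
rewrite -big_seq big_cons /= val2D val2M gram//; last by apply: jl; rewrite mem_head.
by rewrite -IH ?[in RHS]big_seq -?big_seq// => k kl; apply: jl; rewrite inE kl orbT.
Qed.

Lemma reflect_at_rt c i : size c = size xs -> (i < size xs)%N -> rt (eval2 xs c) ->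
  rt (eval2 xs (reflect_at e c i)) /\ size (reflect_at e c i) = size xs.
Proof.
move=> sc ix rc; split; last by rewrite size_set_nth sc; apply/maxn_idPr.
rewrite eval2_bump// -link_dot//; apply: rt_add => //.
by apply: xs_rt; exact: mem_nth.
Qed.

(* The root obtained from the first vertex by the reflections listed in [l]. *)
Lemma explicit_rt (l : seq nat) (c : seq K) : xs <> [::] ->
  all (fun i => i < size xs)%N l ->
  foldl (reflect_at e) (bump_at (nseq (size xs) (0, 0)) 0 (1, 0)) l = c ->
  rt (eval2 xs c) /\ size c = size xs.
Proof.
move=> x0 + <-; have xp : (0 < size xs)%N by case: (xs) x0.
have : rt (eval2 xs (bump_at (nseq (size xs) (0, 0)) 0 (1, 0))) /\
    size (bump_at (nseq (size xs) (0 : int, 0 : int)) 0 (1, 0)) = size xs.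
  split; last by rewrite size_set_nth size_nseq; apply/maxn_idPr.
  rewrite eval2_bump// (_ : eval2 _ _ = 0) ?add0r; last first.
    rewrite /eval2 big1_seq// => j _; rewrite nth_nseq if_same /val2 /=.
    by rewrite mul0r addr0 scale0r.
  rewrite /val2 /= mul0r addr0 scale1r; apply: xs_rt; exact: mem_nth.
elim: l (bump_at _ _ _) => [|i l IH] c0 //= [r0 s0] /andP[ix al].
by apply: IH => //; exact: reflect_at_rt.
Qed.

End ExplicitRoots.

Ltac is_nat a := let T := type of a in unify T nat.
Ltac nat_context := repeat match goal with
  | H : ?T |- _ => lazymatch T with
    | is_true (leq _ _) => fail
    | is_true (negb (leq _ _)) => fail
    | is_true (andb _ _) => fail
    | is_true (negb (andb _ _)) => fail
    | (_ /\ _) => fail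
    | (_ \/ _) => fail
    | nat => fail
    | @eq _ ?a _ => tryif is_nat a then fail else clear H
    | not (@eq _ ?a _) => tryif is_nat a then fail else clear H
    | is_true (negb (@eq_op _ ?a _)) => tryif is_nat a then fail else clear H
    | _ => clear H
    end
  end.
Ltac nlia := nat_context; lia.

Fixpoint edges s (e : seq (nat * R)) {struct e} : Prop :=
  if e is (k, m) :: e' then
    if s is x :: s' then [/\ (k < size s')%N, link x (nth 0 s' k) = m, m <> 0 & edges s' e']
    else False
  else size s = 1%N.

Lemma edges_tree s e : edges s e -> tree s.
Proof.
elim: e s => [|[k m] e IH] [|x s] //=; first by case: s.
move=> [ks xk m0 /IH ts]; case: s ks xk ts => // y s ks xk ts; split => //.
by exists (nth 0 (y :: s) k); [exact: mem_nth|rewrite /adj xk; apply/eqP].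
Qed.

Lemma edges_link s e i j : edges s e -> uniq s -> {subset s <= D} -> (i < j < size s)%N ->
  link (nth 0 s i) (nth 0 s j) =
    let q := nth (0%N, 0) e i in if j == (i.+1 + q.1)%N then q.2 else 0.
Proof.
elim: e s i j => [|[k m] e IH] [|x s] i j //=.
  by case: s => // _ _ _ /andP[]; case: j => // j _; rewrite ltnS ltn0.
move=> [ks xk m0 es] /andP[xs us] sub.
case: i => [|i]; case: j => [|j] //=; rewrite ?ltnS; last first.
  by move=> ij; rewrite (IH s i j es us) ?eqSS// => y ys; apply: sub; rewrite inE ys orbT.
move=> js; rewrite add1n eqSS; case: eqP => [->//|/eqP jk].
apply: (@tree_link0 s x (nth 0 s k)) => //; rewrite ?mem_nth//; last first.
- by rewrite /adj xk; apply/eqP.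
- by rewrite nth_uniq// eq_sym.
- by rewrite /= xs.
- exact: edges_tree es.
Qed.

Lemma edges_gram (tau : R) s (e : seq (nat * (int * int))) :
  edges s [seq (q.1, val2 tau q.2) | q <- e] -> uniq s -> {subset s <= D} ->
  forall i j, (i < size s)%N -> (j < size s)%N ->
    link (nth 0 s i) (nth 0 s j) = val2 tau (entry e i j).
Proof.
move=> es us sub.
have h i j : (i < j < size s)%N -> link (nth 0 s i) (nth 0 s j) = val2 tau (entry e i j).
  move=> /andP[ij js]; rewrite /entry (ltn_eqF ij) ij (edges_link es us sub) ?ij//=.
  have -> : nth (0%N, 0) [seq (q.1, val2 tau q.2) | q <- e] i =
      ((nth (0%N, (0, 0)) e i).1, val2 tau (nth (0%N, (0, 0)) e i).2).
    have v0 : val2 tau (0, 0) = 0 by rewrite /val2 /= mul0r addr0.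
    elim: (e) i {ij} => [|q e' IH] [|i] //=; first by rewrite v0.
    by rewrite v0.
  by case: eqP => // _; rewrite /val2 /= mul0r addr0.
move=> i j is_ js; case: (ltngtP i j) => [ij|ji|->].
- by rewrite h ?ij.
- rewrite linkC h ?ji// /entry (ltn_eqF ji) (gtn_eqF ji) ji.
  by rewrite ltnNge (ltnW ji).
- have [rx _] := config_node cD (sub _ (mem_nth 0 js)).
  by rewrite link_diag// /entry eqxx /val2 /= mul0r addr0.
Qed.

(* The root [c] in the coordinates [s]; [k] is the only vertex of [s] that may be
   joined to vertices away from [X]. *)
Lemma explicit_extra (tau : R) st X s (e : seq (nat * (int * int))) l c k :
  tau ^+ 2 = st.1%:~R * tau + st.2%:~R -> 0 <= tau ->
  edges s [seq (q.1, val2 tau q.2) | q <- e] -> uniq s -> {subset s <= D} ->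
  all (fun i => i < size s)%N l ->
  foldl (reflect_at st e) (bump_at (nseq (size s) (0, 0)) 0 (1, 0)) l = c ->
  all (fun a => (0 <= a.1) && (0 <= a.2)) c ->
  (forall x, x \in X -> exists i, [/\ (i < size s)%N, x = nth 0 s i & dot st e c i = (0, 0)]) ->
  (forall u, u \in rest X -> (forall j, (j < size s)%N -> j != k -> link (nth 0 s j) u = 0) /\
     cox_value (val2 tau (nth (0, 0) c k) * link (nth 0 s k) u)) ->
  (k < size s)%N -> extra X (eval2 tau s c).
Proof.
move=> tauE t0 es us sub al ce cp Xs uR ks.
have gr := edges_gram es us sub.
have rs x : x \in s -> rt x by move=> /sub /(config_node cD)[].
have [|rc sc] := explicit_rt tauE gr rs _ al ce; first by case: (s) ks.
split => //.
- rewrite /eval2 big_seq; apply: big_ind => // j; rewrite mem_iota /= add0n => js.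
  apply: CZ; last by have [] := config_node cD (sub _ (mem_nth 0 js)).
  have jc : (j < size c)%N by rewrite sc.
  have /andP[c1 c2] := allP cp _ (mem_nth (0, 0) jc).
  by rewrite /val2 addr_ge0 ?mulr_ge0 ?ler0z.
- move=> x /Xs[i [is_ -> d0]]; rewrite (link_dot tauE gr sc is_) d0.
  by rewrite /val2 /= mul0r addr0.
- move=> y hy; rewrite link_eval2 big_seq big1// => j; rewrite mem_iota /= add0n => js.
  by rewrite hy ?mulr0//; exact/sub/mem_nth.
- move=> u /uR[h hk]; rewrite link_eval2.
  rewrite (big_rem k) ?mem_iota//= big_seq big1 ?addr0// => j.
  rewrite mem_rem_uniq ?iota_uniq// inE mem_iota /= add0n => /andP[jk js].
  by rewrite h ?mulr0.
Qed.

(** * Paths and what may be attached to them *)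

Section Segments.
Variable p : seq V.
Hypotheses (up : uniq p) (pD : {subset p <= D}) (sp : sorted adj p).
Local Notation x := (nth 0 p).
Local Notation k := (size p).

Definition seg i n := [seq x t | t <- iota i n.+1].

Lemma seg_adj i : (i.+1 < k)%N -> adj (x i) (x i.+1).
Proof. by move=> ik; have /(sortedP 0) := sp; apply. Qed.

Lemma mem_seg i n t : (i <= t <= i + n)%N -> x t \in seg i n.
Proof. by move=> h; apply: map_f; rewrite mem_iota addnS ltnS. Qed.

Lemma segP i n u : (i + n < k)%N -> u \in seg i n -> exists2 t, (i <= t <= i + n)%N & u = x t.
Proof. by move=> _ /mapP[t]; rewrite mem_iota addnS ltnS => h ->; exists t. Qed.

Lemma seg_sub i n : (i + n < k)%N -> {subset seg i n <= p}.
Proof.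
by move=> ik u /(segP ik)[t /andP[_ tn] ->]; apply: mem_nth; exact: leq_ltn_trans ik.
Qed.

Lemma notin_seg i n t : (i + n < k)%N -> (t < k)%N -> ~~ (i <= t <= i + n)%N -> x t \notin seg i n.
Proof.
move=> ik tk; apply: contra => /(segP ik)[t' h /eqP].
rewrite nth_uniq//; first by move=> /eqP ->.
by move: h => /andP[_ h]; exact: leq_ltn_trans ik.
Qed.

Lemma out_seg i n u : (i + n < k)%N -> u \notin p -> u \notin seg i n.
Proof. by move=> ik; apply: contra; exact: seg_sub. Qed.

Lemma seg_uniq i n : (i + n < k)%N -> uniq (seg i n).
Proof.
move=> ik; rewrite map_inj_in_uniq ?iota_uniq// => a b; rewrite !mem_iota !addnS !ltnS.
move=> /andP[_ ha] /andP[_ hb] /eqP; rewrite nth_uniq//; try exact: leq_ltn_trans ik.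
by move/eqP.
Qed.

Lemma seg_tree i n : (i + n < k)%N -> tree (seg i n).
Proof.
elim: n i => [|n IH] i ik //; rewrite /seg -[iota i n.+2]/(i :: iota i.+1 n.+1) map_cons.
apply: tree_cons; first by apply: (IH i.+1); rewrite addSnnS.
exists (x i.+1); first by apply: mem_seg; rewrite leqnn leq_addr.
by apply: seg_adj; apply: leq_ltn_trans ik; rewrite addnS ltnS leq_addr.
Qed.

Lemma line_tree : p <> [::] -> tree p /\ seg 0 k.-1 = p.
Proof.
move=> p0; have k0 : (0 < k)%N by case: (p) p0.
have e : seg 0 k.-1 = p.
  apply: (@eq_from_nth _ 0); rewrite size_map size_iota prednK// => i ik.
  by rewrite (nth_map 0%N) ?size_iota ?prednK// nth_iota ?prednK.
by split => //; rewrite -e; apply: seg_tree; rewrite add0n prednK.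
Qed.

Lemma nth_neq i j : (i < k)%N -> (j < k)%N -> i <> j -> x i != x j.
Proof. by move=> ik jk ij; rewrite nth_uniq//; apply/eqP. Qed.

Lemma line_link i j : (i.+1 < j < k)%N -> link (x i) (x j) = 0.
Proof.
move=> /andP[ij jk]; rewrite linkC.
have e : (i + (j.-1 - i) = j.-1)%N by rewrite subnKC//; nlia.
have j1 : (i + (j.-1 - i) < k)%N by rewrite e; nlia.
have nj : x j \notin seg i (j.-1 - i) by apply: notin_seg => //; rewrite e; nlia.
apply: (@tree_link0 (seg i (j.-1 - i)) _ (x j.-1)).
- exact: seg_tree.
- by rewrite cons_uniq nj seg_uniq.
- move=> u; rewrite inE => /orP[/eqP ->|/(seg_sub j1)/pD//]; exact/pD/mem_nth.
- by apply: mem_seg; rewrite e; nlia.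
- by apply: mem_seg; nlia.
- by apply: nth_neq; nlia.
- by rewrite adjC -{2}(prednK (_ : 0 < j)%N); [apply: seg_adj|]; nlia.
Qed.

Definition hangs i n u := [/\ u \in D, u \notin seg i n & exists2 y, y \in seg i n & adj u y].

Lemma hangs_out i n u t : (i <= t <= i + n)%N -> (i + n < k)%N -> u \in D -> u \notin p ->
  adj u (x t) -> hangs i n u.
Proof.
by move=> tn ik uD up' ut; split => //; [exact: out_seg|exists (x t) => //; exact: mem_seg].
Qed.

Lemma hangs_prev i n : (i.+1 + n < k)%N -> hangs i.+1 n (x i).
Proof.
move=> ik; have i1 : (i.+1 < k)%N by apply: leq_ltn_trans ik; exact: leq_addr.
split; first by apply/pD/mem_nth/ltnW.
  by apply: notin_seg => //; [exact: ltnW|rewrite ltnn].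
by exists (x i.+1); [apply: mem_seg; rewrite leqnn leq_addr|exact: seg_adj].
Qed.

Lemma hangs_next i n : ((i + n).+1 < k)%N -> hangs i n (x (i + n).+1).
Proof.
move=> ik; split; first by apply/pD/mem_nth.
  by apply: notin_seg => //; [exact: ltnW|rewrite ltnn andbF].
exists (x (i + n)); first by apply: mem_seg; rewrite leq_addr leqnn.
by rewrite adjC; exact: seg_adj.
Qed.

Lemma seg_excess1 i n n1 n2 n3 n4 : (i + n < k)%N -> uniq [:: n1; n2; n3; n4] ->
  hangs i n n1 -> hangs i n n2 -> hangs i n n3 -> hangs i n n4 -> False.
Proof.
move=> ik u [d1 s1 h1] [d2 s2 h2] [d3 s3 h3] [d4 s4 h4].
apply: (@excess1 (seg i n) n1 n2 n3 n4) => //; first exact: seg_tree.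
  rewrite -[_ :: _]/([:: n1; n2; n3; n4] ++ seg i n) cat_uniq u seg_uniq// andbT.
  apply/hasPn => v vs; rewrite !inE; apply/negP => /or4P[] /eqP e;
    by move: vs; rewrite e; apply/negP.
move=> v; rewrite !inE => /orP[/eqP ->//|/orP[/eqP ->//|/orP[/eqP ->//|/orP[/eqP ->//|]]]].
by move=> /(seg_sub ik)/pD.
Qed.

Lemma seg_excess2 i n n1 n2 n3 (m : R) : (i + n < k)%N -> uniq [:: n1; n2; n3] ->
  hangs i n n1 -> hangs i n n2 -> hangs i n n3 -> 0 < m -> 2 <= m ^+ 2 ->
  (exists2 y, y \in seg i n & m <= link n3 y) -> False.
Proof.
move=> ik u [d1 s1 h1] [d2 s2 h2] [d3 s3 _] m0 m2 h3.
apply: (@excess2 (seg i n) n1 n2 n3 m) => //; first exact: seg_tree.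
  rewrite -[_ :: _]/([:: n1; n2; n3] ++ seg i n) cat_uniq u seg_uniq// andbT.
  apply/hasPn => v vs; rewrite !inE; apply/negP => /or3P[] /eqP e;
    by move: vs; rewrite e; apply/negP.
move=> v; rewrite !inE => /orP[/eqP ->//|/orP[/eqP ->//|/orP[/eqP ->//|]]].
by move=> /(seg_sub ik)/pD.
Qed.

Lemma seg_excess3 i n n1 n2 (m m' : R) : (i + n < k)%N -> n1 != n2 ->
  hangs i n n1 -> hangs i n n2 -> 0 < m -> 0 < m' -> 4 <= m ^+ 2 + m' ^+ 2 ->
  (exists2 y, y \in seg i n & m <= link n1 y) ->
  (exists2 y, y \in seg i n & m' <= link n2 y) -> False.
Proof.
move=> ik u [d1 s1 _] [d2 s2 _] m0 m0' m2 h1 h2.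
apply: (@excess3 (seg i n) n1 n2 m m') => //; first exact: seg_tree.
  by rewrite cons_uniq cons_uniq inE negb_or u s1 s2 seg_uniq.
move=> v; rewrite !inE => /orP[/eqP ->//|/orP[/eqP ->//|]].
by move=> /(seg_sub ik)/pD.
Qed.

Lemma notin_neq i u : (i < k)%N -> u \notin p -> x i != u.
Proof. by move=> ik; apply: contra => /eqP <-; exact: mem_nth. Qed.

(** The segment between the two branch points is met by its two path neighbours and by [u] and [v]:
    four edges, as in affine D. *)
Lemma no_two_forks i j u v : (0 < i)%N -> (i.+1 < k)%N -> (0 < j)%N -> (j.+1 < k)%N ->
  u \in D -> v \in D -> u \notin p -> v \notin p -> u != v ->
  adj u (x i) -> adj v (x j) -> False.
Proof.
move=> i0 ik j0 jk uD vD up' vp' uv ui vj.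
pose a := minn i j; pose b := maxn i j; pose n := (b - a)%N.
have ha : (0 < a /\ a + n = b /\ b.+1 < k /\ a <= i <= b /\ a <= j <= b)%N.
  by rewrite /a /n /b; nlia.
have [a0 [an [bk [ia ja]]]] := ha; rewrite -an in bk ia ja.
have aE : a = a.-1.+1 by rewrite prednK.
have ak : (a.-1 < k)%N by nlia.
apply: (@seg_excess1 a n (x a.-1) (x (a + n).+1) u v); first by nlia.
- rewrite /= !inE !negb_or uv (notin_neq ak up') (notin_neq ak vp') (notin_neq bk up').
  by rewrite (notin_neq bk vp') !andbT; apply: nth_neq; nlia.
- by rewrite {1}aE; apply: hangs_prev; rewrite -aE; nlia.
- exact: hangs_next.
- by apply: hangs_out ui => //; nlia.
- by apply: hangs_out vj => //; nlia.
Qed.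

(** The segment from the branch point to the heavy edge is met by a path neighbour, by [u] and by
    the far end of the heavy edge, as in affine B. *)
Lemma no_fork_heavy i j u : (0 < i)%N -> (i.+1 < k)%N -> (j.+1 < k)%N ->
  u \in D -> u \notin p -> adj u (x i) -> 2 <= link (x j) (x j.+1) ^+ 2 -> False.
Proof.
move=> i0 ik jk uD up' ui hv.
have l0 : 0 < link (x j) (x j.+1).
  have h : x j <> x j.+1 by apply/eqP; apply: nth_neq; nlia.
  have xj : x j \in D by apply/pD/mem_nth/ltnW.
  have xj1 : x j.+1 \in D by exact/pD/mem_nth.
  exact: lt_le_trans ltr01 (link_ge1 xj xj1 h (seg_adj jk)).
have ik' : (i < k)%N by nlia.
have i1 : (i.-1 < k)%N by nlia.
have iE : i = i.-1.+1 by rewrite prednK.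
have [ij|ji] := leqP i j.
  have e : (i + (j - i) = j)%N by nlia.
  apply: (@seg_excess2 i (j - i) (x i.-1) u (x j.+1) _ _ _ _ _ _ l0 hv); rewrite ?e.
  - by nlia.
  - rewrite /= !inE !negb_or (notin_neq i1 up') (eq_sym u) (notin_neq jk up').
    by rewrite !andbT; apply: nth_neq; nlia.
  - by rewrite {1}iE; apply: hangs_prev; rewrite -iE e; nlia.
  - by apply: hangs_out ui => //; nlia.
  - by have := @hangs_next i (j - i); rewrite e; apply.
  - by exists (x j); [apply: mem_seg; nlia|rewrite linkC].
have e : (j.+1 + (i - j.+1) = i)%N by nlia.
apply: (@seg_excess2 j.+1 (i - j.+1) (x i.+1) u (x j) _ _ _ _ _ _ l0 hv); rewrite ?e//.
- rewrite /= !inE !negb_or (notin_neq ik up') (eq_sym u) (notin_neq (ltnW jk) up').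
  by rewrite !andbT; apply: nth_neq; nlia.
- by have := @hangs_next j.+1 (i - j.+1); rewrite e; apply.
- by apply: hangs_out ui => //; nlia.
- by apply: hangs_prev; rewrite e.
- by exists (x j.+1) => //; apply: mem_seg; nlia.
Qed.

Lemma attach_uniq u i t : u \in D -> u \notin p -> (i < k)%N -> (t < k)%N ->
  adj u (x i) -> t != i -> link u (x t) = 0.
Proof.
move=> uD up' ik tk ui ti.
have p0 : p <> [::] by case: (p) ik.
apply: (@tree_link0 p u (x i)) => //.
- by have [] := line_tree p0.
- by rewrite /= up'.
- by move=> v; rewrite inE => /orP[/eqP ->//|/pD].
- exact: mem_nth.
- exact: mem_nth.
- by rewrite nth_uniq// eq_sym.
Qed.

End Segments.

Lemma nth_in p i : (i < size p)%N -> nth 0 p i \in p.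
Proof. exact: mem_nth. Qed.

Ltac ne_tac := first [ assumption | rewrite eq_sym; assumption
  | apply: nth_neq => //; nlia | apply: notin_neq => //; nlia
  | rewrite eq_sym; apply: notin_neq => //; nlia ].
Ltac uniq_tac := rewrite /= ?inE ?negb_or ?andbT; repeat (apply/andP; split); ne_tac.
Ltac sub_tac := let v := fresh "v" in move=> v; rewrite !inE;
  repeat (case/orP; [move/eqP ->; first [assumption | match goal with H : {subset _ <= _} |- _ => apply: H; apply: nth_in; nlia end]|]);
  move/eqP ->; first [assumption | match goal with H : {subset _ <= _} |- _ => apply: H; apply: nth_in; nlia end].

(** * The shape of a connected configuration *)

Definition connected X : Prop := forall S : V -> Prop, (exists2 x, x \in X & S x) ->
  (forall x y, x \in X -> y \in X -> S x -> adj x y -> S y) -> forall x, x \in X -> S x.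

Record longest X p : Prop := Longest {
  lp_uniq : uniq p; lp_sub : {subset p <= X}; lp_sorted : sorted adj p;
  lp_max : forall q, uniq q -> {subset q <= X} -> sorted adj q -> (size q <= size p)%N }.

Lemma longest_ex X : exists p, longest X p.
Proof.
pose P n := `[< exists q, [/\ uniq q, {subset q <= X}, sorted adj q & size q = n] >].
have exP : exists n, P n by exists 0%N; apply/asboolP; exists [::].
have bP n : P n -> (n <= size X)%N.
  by move=> /asboolP[q [uq qX _ <-]]; exact: uniq_leq_size.
case: (ex_maxnP exP bP) => n /asboolP[q [uq qX sq <-]] qmax.
by exists q; split => // q' uq' q'X sq'; apply: qmax; apply/asboolP; exists q'.
Qed.

Lemma longest_rev X p : longest X p -> longest X (rev p).
Proof.
move=> [up pX sp mp]; split; rewrite ?rev_uniq ?size_rev//.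
- by move=> u; rewrite mem_rev; exact: pX.
- by rewrite rev_sorted; rewrite (eq_sorted (e' := adj))// => u v; exact: adjC.
Qed.

Lemma longest_head X p u : longest X p -> u \in X -> u \notin p -> p <> [::] ->
  ~ adj u (nth 0 p 0).
Proof.
move=> [up pX sp mp] uX up'; case: p up pX sp mp up' => // y p up pX sp mp up' _ uy.
have := mp (u :: y :: p); rewrite /= ltnn => h; suff : false by []; apply: h.
- by apply/andP; split.
- by move=> v; rewrite inE => /orP[/eqP ->|/pX].
- by rewrite uy.
Qed.

(** Putting [b] and [z] in place of the first [i] vertices must not lengthen a longest path. *)
Lemma longest_arm X p z b i : longest X p -> z \in X -> b \in X -> z \notin p ->
  b \notin z :: p -> (i < size p)%N -> adj b z -> adj z (nth 0 p i) -> (1 < i)%N.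
Proof.
move=> [up pX sp mp] zX bX zp; rewrite inE negb_or => /andP[bz bp] ip ab az.
have := mp (b :: z :: drop i p); rewrite /= size_drop => h.
suff : ((size p - i).+2 <= size p)%N by move: ip; clear; lia.
have sub : {subset drop i p <= p} by move=> v; exact: mem_drop.
apply: h.
- rewrite inE negb_or bz drop_uniq// andbT; apply/andP; split.
    by apply: contra bp => /sub.
  by apply: contra zp => /sub.
- by move=> v; rewrite !inE => /or3P[/eqP ->//|/eqP ->//|/sub/pX].
- rewrite ab /=; have := drop_sorted i sp; rewrite (drop_nth 0 ip) /= => ->.
  by rewrite az.
Qed.

Lemma link_ge1_sub s u v : {subset s <= D} -> u \in s -> v \in s -> u != v -> adj u v ->
  1 <= link u v.
Proof. by move=> sD us vs /eqP uv; apply: link_ge1 => //; exact: sD. Qed.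

Lemma nth_link p i : uniq p -> {subset p <= D} -> sorted adj p -> (i.+1 < size p)%N ->
  1 <= link (nth 0 p i.+1) (nth 0 p i) /\ 1 <= link (nth 0 p i) (nth 0 p i.+1).
Proof.
move=> up pD sp ip; rewrite linkC; suff h : 1 <= link (nth 0 p i) (nth 0 p i.+1) by [].
apply: (link_ge1_sub pD); [apply: nth_in; nlia|exact: nth_in|apply: nth_neq => //; nlia|].
exact: seg_adj.
Qed.

Definition tripod X p z i : Prop := [/\ uniq p, sorted adj p, z \notin p, X =i z :: p &
  [/\ adj z (nth 0 p i), (0 < i)%N, (i.+1 < size p)%N & (i <= (size p).-1 - i)%N]].

(** Off a longest path, vertices hang only on inner vertices of it. Two of them attached to the path
    are excluded by affine D; an arm with two vertices is excluded by E6~, because maximality makes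
    the other two arms at least as long. So at most one vertex lies off the path. *)
Lemma shape X : {subset X <= D} -> connected X -> X <> [::] ->
  (exists p, [/\ uniq p, sorted adj p, p <> [::] & X =i p]) \/
  exists p z i, tripod X p z i.
Proof.
move=> XD cX X0; have [p lp] := longest_ex X; have [up pX sp mp] := lp.
have pD : {subset p <= D} by move=> u /pX/XD.
have p0 : p <> [::].
  case: (X) X0 mp => // y Y _ mp p0; have := mp [:: y]; rewrite p0 /= => h.
  suff : (0 < 0)%N by []; apply: h => // v; rewrite inE => /eqP ->; exact: mem_head.
have k0 : (0 < size p)%N by case: (p) p0.
have [sub|nsub] := pselect {subset X <= p}.
  by left; exists p; split => // u; apply/idP/idP => [/sub|/pX].
right.
have [z [zX zp [i ip zi]]] : exists z, [/\ z \in X, z \notin p &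
    exists2 i, (i < size p)%N & adj z (nth 0 p i)].
  apply: contrapT => no; apply: nsub => u uX.
  apply: (cX (fun v => v \in p)) => //.
    by exists (nth 0 p 0); [apply: pX|]; exact: nth_in.
  move=> a b aX bX ap ab; apply: contrapT => /negP bp; apply: no; exists b; split => //.
  by exists (index a p); [rewrite index_mem|rewrite nth_index// adjC].
have lpr := longest_rev lp.
have inner u j : u \in X -> u \notin p -> (j < size p)%N -> adj u (nth 0 p j) ->
    (0 < j)%N /\ (j.+1 < size p)%N.
  move=> uX up' jp uj; split.
    by case: j jp uj => // jp /(longest_head lp uX up' p0).
  rewrite ltn_neqAle jp andbT; apply/eqP => e.
  have r0 : rev p <> [::] by move=> /(congr1 size); rewrite size_rev /=; nlia.
  apply: (longest_head lpr uX _ r0); first by rewrite mem_rev.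
  by rewrite nth_rev// subn1 -e.
have [i0 i1] := inner z i zX zp ip zi.
have zD := XD z zX.
have Xp : X =i z :: p.
  move=> u; apply/idP/idP; last by rewrite inE => /orP[/eqP ->//|/pX].
  apply: (cX (fun v => v \in z :: p)); first by exists z; rewrite ?mem_head.
  move=> a b aX bX + ab; apply: contraLR => nb; rewrite inE negb_or.
  have bD := XD b bX; have := nb; rewrite inE negb_or => /andP[bz bp].
  apply/andP; split; apply/negP.
    move/eqP => e; rewrite {a aX}e in ab; have ba : adj b z by rewrite adjC.
    have i2 := longest_arm lp zX bX zp nb ip ba zi.
    have i3 : (1 < size p - i.+1)%N.
      apply: (longest_arm lpr zX bX) => //; rewrite ?mem_rev ?size_rev//.
      - by rewrite inE negb_or bz mem_rev.
      - by nlia.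
      - have ez : (size p - (size p - i.+1).+1 = i)%N by move: ip; clear; lia.
        have e2 : (size p - i.+1 < size p)%N by move: ip; clear; lia.
        by rewrite (nth_rev 0 e2) ez.
    have [i4 i5] : (i.-1.+1 = i)%N /\ (i.-2.+1 = i.-1)%N by nlia.
    have c1 j : (j.+1 < size p)%N -> 1 <= link (nth 0 p j.+1) (nth 0 p j).
      by move=> /(nth_link up pD sp)[].
    have c2 j : (j.+1 < size p)%N -> 1 <= link (nth 0 p j) (nth 0 p j.+1).
      by move=> /(nth_link up pD sp)[].
    have := c2 i.-1; have := c2 i.-2; rewrite i4 i5 => h2 h1.
    apply: (@no_E6 (nth 0 p i) (nth 0 p i.-1) (nth 0 p i.-2) (nth 0 p i.+1) (nth 0 p i.+2) z b).
    - uniq_tac.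
    - sub_tac.
    - by apply: h1; nlia.
    - by apply: h2; nlia.
    - by apply: c1; nlia.
    - by apply: c1; nlia.
    - apply: link_ge1 => //; first by apply/pD/nth_in.
      by apply/eqP; rewrite eq_sym; exact: notin_neq.
    - by apply: link_ge1 => //; exact/eqP.
  move=> ap; have jp : (index a p < size p)%N by rewrite index_mem.
  have bj : adj b (nth 0 p (index a p)) by rewrite nth_index// adjC.
  have [j0 j1] := inner b _ bX bp jp bj.
  by apply: (@no_two_forks p up pD sp i (index a p) z b) => //; rewrite eq_sym.
have [le|gt] := leqP i ((size p).-1 - i); first by exists p, z, i.
exists (rev p), z, ((size p).-1 - i)%N; have [upr pXr spr _] := lpr.
split => //; first by rewrite mem_rev.
  by move=> u; rewrite Xp !inE mem_rev.
split; rewrite ?size_rev; try nlia.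
have e1 : ((size p).-1 - i < size p)%N by nlia.
by rewrite (nth_rev 0 e1) (_ : (size p - ((size p).-1 - i).+1 = i)%N)//; nlia.
Qed.

Definition gram_type X (n : nat) (M : nat -> nat -> R) : Prop := exists q : seq V,
  [/\ size q = n, uniq q, X =i q &
      forall a b, (a < b < n)%N -> link (nth 0 q a) (nth 0 q b) = M a b].

Definition gram_A X m := gram_type X m (fun a b => (b == a.+1)%:R).
Definition gram_D X m := gram_type X m (fun a b =>
  if b == m.-1 then (a == (m - 3)%N)%:R else (b == a.+1)%:R).
Definition gram_E6 X := gram_type X 6 (fun a b =>
  if b == 5%N then (a == 2%N)%:R else (b == a.+1)%:R).
Definition gram_I5 X := gram_type X 2 (fun _ _ => golden).

(** The three possible costs, each positive one together with the types that carry this coefficient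
    in [dim_bound]. *)
Definition reducible X : Prop := [\/ reduces X 0,
  reduces X 1 /\ (gram_A X 1 \/ (exists2 m, (4 < m)%N & gram_D X m) \/ gram_E6 X \/ gram_I5 X) |
  reduces X 2 /\ ((exists2 m, (1 < m)%N & gram_A X m) \/ gram_D X 4)].

Lemma link1 u v : u \in D -> v \in D -> u <> v -> adj u v -> ~ 2 <= link u v ^+ 2 -> link u v = 1.
Proof.
move=> uD vD uv /eqP l0 nh; apply: contrapT => l1; apply: nh.
by apply: cox_value_heavy l0 l1; exact: config_link cD _ _ uD vD uv.
Qed.

Lemma link_gt0 u v : u \in D -> v \in D -> u <> v -> adj u v -> 0 < link u v.
Proof. by move=> uD vD uv h; apply: lt_le_trans (link_ge1 uD vD uv h). Qed.

Lemma size_le1 (T : eqType) (s : seq T) :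
  (forall u v : T, u \in s -> v \in s -> u != v -> False) -> uniq s -> (size s <= 1)%N.
Proof.
case: s => [|a [|b s]] //= h /andP[ab _]; exfalso; apply: (h a b).
- exact: mem_head.
- by rewrite !inE eqxx orbT.
- by move: ab; rewrite inE negb_or => /andP[].
Qed.

Lemma nbrs_uniq X : uniq (nbrs X). Proof. exact/filter_uniq/(config_uniq cD). Qed.

Lemma link_neq1 s u v : {subset s <= D} -> u \in s -> v \in D -> v \notin s -> adj v u ->
  1 <= link v u.
Proof.
move=> sD us vD vs; apply: link_ge1 => //; first exact: sD.
by move=> e; rewrite e us in vs.
Qed.

(** * Diagrams of type E *)

Section TripodStep.
Variables (X p : seq V) (z : V) (i : nat).
Hypothesis XD : {subset X <= D}.
Hypothesis tp : tripod X p z i.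
Local Notation x := (nth 0 p).
Local Notation k := (size p).

Let up : uniq p. Proof. by case: tp. Qed.
Let sp : sorted adj p. Proof. by case: tp. Qed.
Let zp : z \notin p. Proof. by case: tp. Qed.
Let Xp : X =i z :: p. Proof. by case: tp. Qed.
Let zi : adj z (x i). Proof. by case: tp => ? ? ? ? []. Qed.
Let i0 : (0 < i)%N. Proof. by case: tp => ? ? ? ? []. Qed.
Let ik : (i.+1 < k)%N. Proof. by case: tp => ? ? ? ? []. Qed.
Let il : (i <= k.-1 - i)%N. Proof. by case: tp => ? ? ? ? []. Qed.
Let pD : {subset p <= D}. Proof. by move=> u up'; apply: XD; rewrite Xp inE up' orbT. Qed.
Let zD : z \in D. Proof. by apply: XD; rewrite Xp mem_head. Qed.

Lemma tripod_chain j : (j.+1 < k)%N -> link (x j) (x j.+1) = 1.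
Proof.
move=> jk; apply: link1; [apply/pD/nth_in; nlia|exact/pD/nth_in|apply/eqP; ne_tac|exact: seg_adj|].
by move=> h; apply: (no_fork_heavy up pD sp i0 ik jk zD zp zi h).
Qed.

Lemma tripod_leg : link z (x i) = 1.
Proof.
have ik' : (i < k)%N by nlia.
have xi : x i \in D by exact/pD/nth_in.
have nz : z <> x i by apply/eqP; ne_tac.
apply: link1 => // h; have l0 := link_gt0 zD xi nz zi.
have iE : i = i.-1.+1 by rewrite prednK.
apply: (@seg_excess2 p up pD sp i 0 (x i.-1) (x i.+1) z (link z (x i))) => //.
- by rewrite addn0.
- uniq_tac.
- by rewrite {1}iE; apply: hangs_prev => //; rewrite -iE addn0.
- by have := @hangs_next p up pD sp i 0; rewrite addn0; apply.
- by apply: hangs_out zi => //; rewrite ?addn0// leqnn.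
- by exists (x i) => //; apply: mem_seg; rewrite addn0 leqnn.
Qed.

Lemma tripod_other t : (t < k)%N -> t != i -> link z (x t) = 0.
Proof. by move=> tk ti; exact: (attach_uniq up pD sp zD zp (ltnW ik) tk zi ti). Qed.

Lemma tripod_nbr u : u \in nbrs X -> [/\ u \in D, u \notin p, u != z &
  [\/ adj u (x 0), adj u (x k.-1) | adj u z]].
Proof.
move=> /nbrsP[uD uX [y yX uy]]; move: uX; rewrite Xp inE negb_or => /andP[uz up'].
split => //; move: yX uy; rewrite Xp inE => /orP[/eqP ->|yp uy]; first by apply: Or33.
have jk : (index y p < k)%N by rewrite index_mem.
rewrite -(nth_index 0 yp) in uy; set j := index y p in jk uy.
have [j0|j0] := posnP j; first by apply: Or31; rewrite -j0.
have [j1|j1] := leqP k j.+1; first by apply: Or32; rewrite (_ : k.-1 = j)//; nlia.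
by case: (@no_two_forks p up pD sp i j z u) => //; rewrite eq_sym.
Qed.

Lemma chain_ge1 j : (j.+1 < k)%N -> 1 <= link (x j.+1) (x j) /\ 1 <= link (x j) (x j.+1).
Proof. exact: nth_link. Qed.

Lemma leg_ge1 : 1 <= link z (x i). Proof. by rewrite tripod_leg. Qed.

Lemma out_ge1 u t : u \in D -> u \notin p -> (t < k)%N -> adj u (x t) -> 1 <= link u (x t).
Proof. by move=> uD up' tk; apply: (link_neq1 pD) => //; exact: nth_in. Qed.

Hypothesis i2 : (1 < i)%N.

Lemma E_leg u : u \in D -> u \notin p -> u != z -> adj u z -> False.
Proof.
move=> uD up' uz uz'; have ia : (i.-1.+1 = i)%N by nlia. have ib : (i.-2.+1 = i.-1)%N by nlia.
have := @chain_ge1 i.-1; have := @chain_ge1 i.-2; rewrite ia ib => h2 h1.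
have [h1' _] : 1 <= link (x i.-1) (x i) /\ True by split => //; apply: (h1 _).2; nlia.
have [h2' _] : 1 <= link (x i.-2) (x i.-1) /\ True by split => //; apply: (h2 _).2; nlia.
apply: (@no_E6 (x i) (x i.-1) (x i.-2) (x i.+1) (x i.+2) z u) => //.
- uniq_tac.
- sub_tac.
- by have [] := @chain_ge1 i _; nlia.
- by have [] := @chain_ge1 i.+1 _; nlia.
- exact: leg_ge1.
- by apply: link_ge1 => //; exact/eqP.
Qed.

(** Two arms of length three give E7~; arms of lengths two and five beside the single vertex give
    E8~. *)
Lemma E_i2 : i = 2%N /\ (k <= 7)%N.
Proof.
have c1 j : (j.+1 < k)%N -> 1 <= link (x j.+1) (x j) by move=> /chain_ge1[].
have c2 j : (j.+1 < k)%N -> 1 <= link (x j) (x j.+1) by move=> /chain_ge1[].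
have i2' : i = 2%N.
  apply/eqP; rewrite eqn_leq i2 andbT leqNgt; apply/negP => i3.
  have e1 : (i.-1.+1 = i)%N by nlia. have e2 : (i.-2.+1 = i.-1)%N by nlia.
  have e3 : ((i - 3).+1 = i.-2)%N by nlia.
  have := c2 i.-1; have := c2 i.-2; have := c2 (i - 3)%N; rewrite e1 e2 e3 => h3 h2 h1.
  apply: (@no_E7 (x i) z (x i.-1) (x i.-2) (x (i - 3)) (x i.+1) (x i.+2) (x i.+3)).
  - uniq_tac.
  - sub_tac.
  - exact: leg_ge1.
  - by apply: h1; nlia.
  - by apply: h2; nlia.
  - by apply: h3; nlia.
  - by apply: c1; nlia.
  - by apply: c1; nlia.
  - by apply: c1; nlia.
split => //; rewrite leqNgt; apply/negP => k8; have lg := leg_ge1; rewrite i2' in lg.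
apply: (@no_E8 (x 2) z (x 1) (x 0) (x 3) (x 4) (x 5) (x 6) (x 7)) => //; try (uniq_tac || sub_tac).
all: first [apply: c1; nlia | apply: c2; nlia].
Qed.

(** The path of 5, 6 or 7 vertices together with [z] is E_6, E_7 or E_8. E_6 has at most one
    neighbour and pays for it. The neighbour of E_7 completes E_8 and is replaced by a root
    orthogonal to E_7. E_8 has no neighbour because of E8~. *)
Lemma E_step : reducible X.
Proof.
have [iE k7] := E_i2; have lg := leg_ge1; have tc := tripod_chain; have tl := tripod_leg.
have to := tripod_other; have nb := tripod_nbr; have el := E_leg.
have c1 j : (j.+1 < k)%N -> 1 <= link (x j.+1) (x j) by move=> /chain_ge1[].
have c2 j : (j.+1 < k)%N -> 1 <= link (x j) (x j.+1) by move=> /chain_ge1[].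
have og := out_ge1; have ik2 := ik; have il2 := il; rewrite iE in lg tl to ik2 il2.
have zi2 : adj z (x 2) by rewrite -iE.
have k5 : (5 <= k)%N by nlia.
have kk j : (j < 5)%N -> (j < k)%N by move=> h; exact: leq_trans h k5.
have a10 := c1 0%N (kk 1%N isT). have a01 := c2 0%N (kk 1%N isT).
have a21 := c1 1%N (kk 2%N isT). have a12 := c2 1%N (kk 2%N isT).
have a32 := c1 2%N (kk 3%N isT). have a43 := c1 3%N (kk 4%N isT).
have a54 (k6 : (6 <= k)%N) := c1 4%N k6.
have nb0 u : u \in nbrs X -> [/\ u \in D, u \notin p, u != z & adj u (x 0) \/ adj u (x k.-1)].
  by move=> /nb[uD up' uz [h|h|h]]; split => //; [left|right|case: (el u)].
have no0 u v : u \in nbrs X -> v \in nbrs X -> u != v -> adj u (x 0) -> adj v (x 0) -> False.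
  move=> /nb[uD up' uz _] /nb[vD vp vz _] uv u0 v0.
  apply: (@seg_excess1 p up pD sp 0 2 u v (x 3) z) => //; first by nlia.
  - uniq_tac.
  - by apply: hangs_out u0 => //; nlia.
  - by apply: hangs_out v0 => //; nlia.
  - by apply: (@hangs_next p up pD sp 0 2); nlia.
  - by apply: hangs_out zi2 => //; nlia.
have nok u v : u \in nbrs X -> v \in nbrs X -> u != v -> adj u (x k.-1) -> adj v (x k.-1) -> False.
  move=> /nb[uD up' uz _] /nb[vD vp vz _] uv u0 v0.
  have e : (2 + (k.-1 - 2) = k.-1)%N by nlia.
  apply: (@seg_excess1 p up pD sp 2 (k.-1 - 2) u v (x 1) z) => //; rewrite ?e; first by nlia.
  - uniq_tac.
  - by apply: hangs_out u0 => //; nlia.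
  - by apply: hangs_out v0 => //; nlia.
  - by apply: (@hangs_prev p up pD sp 1); nlia.
  - by apply: hangs_out zi2 => //; nlia.
have e7 u v : (6 <= k)%N \/ (k = 5%N /\ v \in nbrs X /\ adj v (x 4) /\ u != v) ->
    u \in nbrs X -> adj u (x 0) -> False.
  move=> kw /nb[uD up' uz _] u0; have h0 := og u 0%N uD up' (kk 0%N isT) u0.
  case: kw => [k6|[k5' [/nb[wD wp wz _] [w4 uw]]]].
    apply: (@no_E7 (x 2) z (x 1) (x 0) u (x 3) (x 4) (x 5)) => //; try (uniq_tac || sub_tac).
    exact: a54.
  have h4 := og v 4%N wD wp (kk 4%N isT) w4.
  apply: (@no_E7 (x 2) z (x 1) (x 0) u (x 3) (x 4) v) => //; try (uniq_tac || sub_tac).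
have n1 : (size (nbrs X) <= 1)%N.
  apply: size_le1; last exact: nbrs_uniq.
  move=> u v uN vN uv; have [uD up' uz uu] := nb0 u uN; have [vD vp vz vv] := nb0 v vN.
  have vu : v != u by rewrite eq_sym.
  case: uu => [u0|uk]; case: vv => [v0|vk].
  - exact: no0 uN vN uv u0 v0.
  - have [k6|k5'] := leqP 6 k; first by apply: (e7 u v) => //; left.
    apply: (e7 u v) => //; right; split; first by nlia.
    by split => //; split => //; move: vk; rewrite (_ : k.-1 = 4)//; nlia.
  - have [k6|k5'] := leqP 6 k; first by apply: (e7 v u) => //; left.
    apply: (e7 v u) => //; right; split; first by nlia.
    by split => //; split => //; move: uk; rewrite (_ : k.-1 = 4)//; nlia.
  - exact: nok uN vN uv uk vk.
have [k6|k5'] := leqP 6 k; last first.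
  have kE : k = 5%N by nlia.
  apply: Or32; split; first exact: reduces_nbrs.
  right; right; left; exists (rcons p z); split.
  - by rewrite size_rcons kE.
  - by rewrite rcons_uniq zp up.
  - by move=> u; rewrite Xp mem_rcons.
  - move=> a b /andP[ab b6]; rewrite !nth_rcons kE (_ : (a < 5)%N); last by nlia.
    have [b5|b5] := ltnP b 5.
      rewrite ltn_eqF//; case: eqP => [->|/eqP ba]; first by apply: tc; nlia.
      by apply: line_link => //; nlia.
    have -> : b = 5%N by nlia.
    rewrite eqxx linkC; case: eqP => [->|/eqP a2]; first by rewrite tl.
    by apply: to => //; nlia.
have nbk u : u \in nbrs X -> adj u (x k.-1).
  by move=> uN; have [uD up' uz [h|//]] := nb0 u uN; case: (e7 u u) => //; left.
have [k7'|kn7] := eqVneq k 7%N.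
  apply: Or31; apply: reduces_nbrs; rewrite leqNgt; apply/negP.
  case E : (nbrs X) => [//|u N] _; have uN : u \in nbrs X by rewrite E mem_head.
  have [uD up' uz _] := nb u uN; have uk := nbk u uN; rewrite (_ : k.-1 = 6%N) in uk; last by nlia.
  have h6 := og u 6%N uD up' (_ : 6 < k)%N uk; rewrite k7' in h6.
  have a54' := a54 k6. have a65 : 1 <= link (x 6) (x 5) by apply: c1; rewrite k7'.
  have {}h6 := h6 isT.
  apply: (@no_E8 (x 2) z (x 1) (x 0) (x 3) (x 4) (x 5) (x 6) u) => //; try (uniq_tac || sub_tac).
have kE : k = 6%N by nlia.
apply: Or31; case E : (nbrs X) => [|n N]; first by apply: reduces_nbrs; rewrite E.
have nN : n \in nbrs X by rewrite E mem_head.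
have [nD np nz _] := nb n nN; have nk := nbk n nN; rewrite kE /= in nk.
have nl : link n (x 5) = 1.
  apply: link1 => //; first by apply/pD/nth_in; nlia.
    by apply/eqP; ne_tac.
  move=> hv; apply: (@seg_excess2 p up pD sp 2 3 (x 1) z n (link n (x 5))) => //; rewrite ?kE//.
  - uniq_tac.
  - by apply: (@hangs_prev p up pD sp 1); rewrite kE.
  - by apply: hangs_out zi2 => //; rewrite kE.
  - by apply: hangs_out nk => //; rewrite kE.
  - by apply: link_gt0 => //; [apply/pD/nth_in; nlia|apply/eqP; ne_tac].
  - by exists (x 5) => //; apply: mem_seg.
have no t : (t < 5)%N -> link n (x t) = 0.
  by move=> t5; apply: (attach_uniq up pD sp nD np _ _ nk); rewrite ?kE; nlia.
have sw : uniq [:: n; x 5; x 4; x 3; z; x 0; x 1; x 2] by uniq_tac.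
have subw : {subset [:: n; x 5; x 4; x 3; z; x 0; x 1; x 2] <= D} by sub_tac.
have v1 : val2 0 (1%:Z, 0%:Z) = 1 :> R by rewrite /val2 /= mul0r addr0.
(* The coefficients of the highest root of E_8, which is orthogonal to the subdiagram E_7; the
   listed reflections carry the vertex [n] to it, and this is checked by computation. *)
apply: reduces_le (@reduces_extra X [:: eval2 0 [:: n; x 5; x 4; x 3; z; x 0; x 1; x 2]
  [:: (2%:Z, 0%:Z); (3%:Z, 0%:Z); (4%:Z, 0%:Z); (5%:Z, 0%:Z); (3%:Z, 0%:Z); (2%:Z, 0%:Z);
      (4%:Z, 0%:Z); (6%:Z, 0%:Z)]] _ _ _) => //; first by rewrite E /=; move: n1; rewrite E /=; nlia.
  move=> _ /[!inE] /eqP ->.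
  apply: (@explicit_extra 0 (0, 0) X _ [:: (0%N, (1%:Z, 0%:Z)); (0%N, (1%:Z, 0%:Z));
    (0%N, (1%:Z, 0%:Z)); (3%N, (1%:Z, 0%:Z)); (2%N, (1%:Z, 0%:Z)); (0%N, (1%:Z, 0%:Z));
    (0%N, (1%:Z, 0%:Z))] [:: 1; 2; 3; 7; 4; 6; 5; 7; 3; 2; 1; 6; 7; 3; 2; 4; 7; 3; 6; 5; 7; 4; 6; 7; 3; 2; 1; 0]%N _ 0) => //.
  - by rewrite expr0n /= mul0r addr0.
  - have h43 := tc 3%N; have h54 := tc 4%N; have h32 := tc 2%N; have h01 := tc 0%N; have h12 := tc 1%N.
    rewrite /= !v1 nl tl h01 ?h12 ?(linkC (x 5)) ?h54 ?(linkC (x 4)) ?h43 ?(linkC (x 3)) ?h32 ?kE//.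
    by repeat (split => //); exact/eqP/oner_neq0.
  - move=> y; rewrite Xp inE => /orP[/eqP ->|/(nthP 0)[t tk <-]]; first by exists 4%N; split.
    rewrite kE in tk; case: t tk => [|[|[|[|[|[|//]]]]]] _;
      [exists 5%N|exists 6%N|exists 7%N|exists 3%N|exists 2%N|exists 1%N]; by split.
  - move=> u uR; have [uD uX uo] := rest_orth uR.
    have uo' y : y \in X -> link y u = 0 by move=> yX; rewrite linkC uo.
    split.
      have xX t : (t < k)%N -> x t \in X by move=> tk; rewrite Xp inE nth_in ?orbT.
      by case=> [|[|[|[|[|[|[|[|//]]]]]]]] _ //= _; apply: uo'; rewrite ?Xp ?mem_head//; rewrite -Xp; apply: xX; nlia.
    suff -> : link n u = 0 by rewrite mulr0; apply: Or41.
    apply/eqP; apply: contrapT => /negP nu.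
    have up' : u \notin p by apply: contra uX; rewrite Xp inE orbC => ->.
    have uz : u != z by apply: contra uX => /eqP ->; rewrite Xp mem_head.
    have un : u != n by apply: contraTneq uR => ->; rewrite mem_filter; move: nN; rewrite mem_filter => /andP[/andP[_ ->]]; rewrite andbF.
    have h5 := og n 5%N nD np k6 nk. have a54' := a54 k6.
    have aun : 1 <= link u n by rewrite linkC; apply: link_ge1 => //; apply/eqP; rewrite eq_sym.
    apply: (@no_E8 (x 2) z (x 1) (x 0) (x 3) (x 4) (x 5) n u) => //; try (uniq_tac || sub_tac).
by move=> e e' /[!inE] /eqP -> /eqP ->.
Qed.

End TripodStep.

(** The edge from [v] to the branch vertex would have four neighbours [a], [b], [v'] and the second
    path vertex. *)
Lemma leaf_twice p v v' a b : uniq p -> {subset p <= D} -> sorted adj p -> (1 < size p)%N ->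
  v \in D -> v' \in D -> v \notin p -> v' \notin p -> v != v' ->
  adj v (nth 0 p 0) -> adj v' (nth 0 p 0) ->
  a \in D -> b \in D -> a \notin p -> b \notin p -> a != b -> a != v -> a != v' ->
  b != v -> b != v' -> adj a v -> adj b v -> False.
Proof.
move=> up pD sp k2 vD vD' vp vp' vv vx vx' aD bD ap bp ab av av' bv bv' aa ba.
have x0D : nth 0 p 0 \in D by exact/pD/nth_in/ltnW.
have x1D : nth 0 p 1 \in D by exact/pD/nth_in.
apply: (@excess1 [:: v; nth 0 p 0] a b v' (nth 0 p 1)).
- by split => //; exists (nth 0 p 0); rewrite ?mem_head.
- have k1 := ltnW k2; by uniq_tac.
- by move=> u; rewrite !inE => /or4P[/eqP ->|/eqP ->|/eqP ->|/or3P[] /eqP ->].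
- by exists v; rewrite ?mem_head.
- by exists v; rewrite ?mem_head.
- by exists (nth 0 p 0); rewrite // !inE eqxx orbT.
- by exists (nth 0 p 0); rewrite ?inE ?eqxx ?orbT//; rewrite adjC; exact: seg_adj.
Qed.

(* The diagram consisting of the path [p] with two leaves [y] and [y'] attached to
   its first vertex. *)
Section ForkStep.
Variables (X p : seq V) (y y' : V).
Hypotheses (XD : {subset X <= D}) (up : uniq p) (sp : sorted adj p).
Hypotheses (yp : y \notin p) (yp' : y' \notin p) (yy : y != y').
Hypothesis Xp : X =i y :: y' :: p.
Local Notation x := (nth 0 p).
Local Notation k := (size p).
Hypotheses (yx : adj y (x 0)) (yx' : adj y' (x 0)) (k2 : (1 < k)%N).

Let pD : {subset p <= D}. Proof. by move=> u up'; apply: XD; rewrite Xp !inE up' !orbT. Qed.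
Let yD : y \in D. Proof. by apply: XD; rewrite Xp mem_head. Qed.
Let yD' : y' \in D. Proof. by apply: XD; rewrite Xp !inE eqxx orbT. Qed.
Let k1 : (0 < k)%N. Proof. exact: ltnW. Qed.
Let x0D : x 0 \in D. Proof. exact/pD/nth_in. Qed.

Lemma fork_chain j : (j.+1 < k)%N -> link (x j) (x j.+1) = 1.
Proof.
move=> jk; have jk' : (j < k)%N by exact: ltnW.
have ne : x j <> x j.+1 by apply/eqP; ne_tac.
have xj : x j \in D by exact/pD/nth_in.
have xj1 : x j.+1 \in D by exact/pD/nth_in.
apply: link1 => //; first exact: seg_adj.
move=> h; have l0 := link_gt0 xj xj1 ne (seg_adj sp jk).
apply: (@seg_excess2 p up pD sp 0 j y y' (x j.+1) (link (x j) (x j.+1))) => //.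
- uniq_tac.
- by apply: hangs_out yx => //; rewrite leq0n.
- by apply: hangs_out yx' => //; rewrite leq0n.
- by apply: (@hangs_next p up pD sp 0 j).
- by exists (x j); [apply: mem_seg; rewrite leq0n add0n leqnn|rewrite linkC].
Qed.

Lemma fork_leaf : [/\ link y (x 0) = 1, link y' (x 0) = 1 & link y y' = 0].
Proof.
have hn : hangs p 0 0 (x 1) by exact: (@hangs_next p up pD sp 0 0).
have ho u : u \in D -> u \notin p -> adj u (x 0) -> hangs p 0 0 u.
  by move=> uD up' ux; apply: hangs_out ux.
have n1 : y <> x 0 by apply/eqP; ne_tac. have n2 : y' <> x 0 by apply/eqP; ne_tac.
split.
- apply: link1 => // h; have l0 := link_gt0 yD x0D n1 yx.
  apply: (@seg_excess2 p up pD sp 0 0 (x 1) y' y (link y (x 0))) => //; try exact: ho.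
  + uniq_tac.
  + by exists (x 0) => //; apply: mem_seg.
- apply: link1 => // h; have l0 := link_gt0 yD' x0D n2 yx'.
  apply: (@seg_excess2 p up pD sp 0 0 (x 1) y y' (link y' (x 0))) => //; try exact: ho.
  + uniq_tac.
  + by exists (x 0) => //; apply: mem_seg.
- apply: (@tree_link0 [:: y'; x 0] y (x 0)) => //.
  + by split => //; exists (x 0); rewrite ?mem_head.
  + uniq_tac.
  + by move=> u; rewrite !inE => /or3P[] /eqP ->.
  + by rewrite !inE eqxx orbT.
  + exact: mem_head.
  + by rewrite eq_sym; ne_tac.
Qed.

Lemma fork_leaf0 t : (0 < t < k)%N -> link y (x t) = 0 /\ link y' (x t) = 0.
Proof.
by move=> /andP[t0 tk]; split;
  [apply: (attach_uniq up pD sp yD yp k1 tk yx)|apply: (attach_uniq up pD sp yD' yp' k1 tk yx')];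
  rewrite -lt0n.
Qed.

Lemma fork_nbr u : u \in nbrs X -> [/\ u \in D, u \notin p, u != y, u != y' &
  [\/ adj u y, adj u y' | adj u (x k.-1)]].
Proof.
move=> /nbrsP[uD uX [v vX uv]]; move: uX; rewrite Xp !inE !negb_or => /and3P[uy uy' up'].
split => //; move: vX uv; rewrite Xp !inE => /or3P[/eqP ->|/eqP ->|vp uv];
  [by apply: Or31|by apply: Or32|].
have jk : (index v p < k)%N by rewrite index_mem.
rewrite -(nth_index 0 vp) in uv; set j := index v p in jk uv.
have [j1|j1] := leqP k j.+1; first by apply: Or33; rewrite (_ : k.-1 = j)//; nlia.
exfalso; apply: (@seg_excess1 p up pD sp 0 j y y' u (x j.+1)) => //.
- uniq_tac.
- by apply: hangs_out yx => //; rewrite leq0n.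
- by apply: hangs_out yx' => //; rewrite leq0n.
- by apply: hangs_out uv => //; rewrite leq0n add0n leqnn.
- exact: (@hangs_next p up pD sp 0 j).
Qed.

Lemma fork_two_leaves a b : (2 < k)%N -> a \in D -> b \in D -> a \notin p -> b \notin p ->
  a != b -> a != y -> a != y' -> b != y -> b != y' -> adj a y -> adj b y' -> False.
Proof.
move=> k3 aD bD ap bp ab ay ay' by_ by' aa bb.
have [l1 l2 _] := fork_leaf; have c0 := fork_chain k2; have c1 := fork_chain k3.
apply: (@no_E6 (x 0) y a y' b (x 1) (x 2)) => //; try (uniq_tac || sub_tac).
all: rewrite ?l1 ?l2 ?(linkC (x 1)) ?c0 ?(linkC (x 2)) ?c1 //.
- by apply: link_ge1 => //; exact/eqP.
- by apply: link_ge1 => //; exact/eqP.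
Qed.

Lemma fork_long a b : a \in nbrs X -> b \in nbrs X -> a != b -> adj a (x k.-1) -> adj b (x k.-1) ->
  False.
Proof.
move=> /fork_nbr[aD ap ay ay' _] /fork_nbr[bD bp by_ by' _] ab aa bb.
have e : (0 + k.-1 < k)%N by rewrite add0n prednK.
have e2 : (0 <= k.-1 <= 0 + k.-1)%N by rewrite leq0n add0n leqnn.
apply: (@seg_excess1 p up pD sp 0 k.-1 y y' a b) => //.
- uniq_tac.
- by apply: hangs_out yx => //; rewrite leq0n.
- by apply: hangs_out yx' => //; rewrite leq0n.
- exact: hangs_out aa.
- exact: hangs_out bb.
Qed.

Lemma fork_gram : gram_D X k.+2.
Proof.
have [l1 l2 l3] := fork_leaf.
(* Reversal puts the branch vertex at position k-1, which is m-3 for m = k+2, as type D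
   prescribes. *)
exists (rev p ++ [:: y; y']); split.
- by rewrite size_cat size_rev /= addn2.
- rewrite cat_uniq rev_uniq up /= !mem_rev (negbTE yp) (negbTE yp') /= inE yy andbT.
  by [].
- by move=> u; rewrite Xp mem_cat mem_rev !inE orbA orbC.
- move=> a b /andP[ab bk]; rewrite !nth_cat size_rev.
  have [ak|ka] := ltnP a k; last first.
    have aE : a = k by nlia. have bE : b = k.+1 by nlia.
    rewrite aE bE subnn subSnn ltnNge leqnSn /= eqxx l3; case: eqP => // h; exfalso.
    by move: h k2; clear; lia.
  rewrite (nth_rev 0 ak); have [bk'|kb] := ltnP b k.
    rewrite (nth_rev 0 bk') ifF; last by apply/eqP; nlia.
    case: eqP => [bE|nb].
      have -> : (k - a.+1 = (k - b.+1).+1)%N by nlia.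
      have h : ((k - b.+1).+1 < k)%N by move: ab bk'; clear; lia.
      by rewrite linkC (fork_chain h).
    have h : ((k - b.+1).+1 < k - a.+1 < k)%N by move: ab nb ak bk'; clear; lia.
    by rewrite linkC (line_link up pD sp h).
  have h0 : (k.+2 - 3 = k.-1)%N by nlia.
  have [bE|bE] : b = k \/ b = k.+1 by nlia.
    rewrite bE subnn /= ifF; last by apply/eqP; nlia.
    case: eqP => [aE|na].
      by rewrite (_ : (k - a.+1 = 0)%N) 1?linkC//; nlia.
    by rewrite linkC; apply: (fork_leaf0 _).1; nlia.
  rewrite bE subSnn /= eqxx h0; case: eqP => [aE|na].
    by rewrite (_ : (k - a.+1 = 0)%N) 1?linkC//; nlia.
  by rewrite linkC; apply: (fork_leaf0 _).2; nlia.
Qed.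

(** The seven listed vertices form E_7, and the root is its highest one, which is orthogonal to
    every vertex of E_7 but [n]. A further vertex attached to [n] would create E7~, so only [t] can
    meet the remaining diagram. *)
Lemma fork_extra n t : (2 < k)%N -> n \in nbrs X -> adj n y -> t \in D -> t \notin rest X ->
  uniq [:: t; x 2; x 1; n; y; y'; x 0] -> link t (x 2) = 1 ->
  (forall v, v \in X -> v \in [:: t; x 2; x 1; n; y; y'; x 0]) -> n \notin X ->
  exists e, extra X e.
Proof.
move=> k3 nN ny tD tR ut tx Xw nX; have [nD np ny1 ny2 _] := fork_nbr nN.
have [l1 l2 l3] := fork_leaf; have c0 := fork_chain k2; have c1 := fork_chain k3.
have x1D : x 1 \in D by exact/pD/nth_in. have x2D : x 2 \in D by exact/pD/nth_in.
have ny' : n <> y by exact/eqP.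
have nl : link n y = 1.
  apply: link1 => // h; have l0 := link_gt0 nD yD ny' ny.
  apply: (@excess2 [:: y; x 0] y' (x 1) n (link n y)) => //.
  - by split => //; exists (x 0); rewrite ?mem_head.
  - by uniq_tac.
  - by move=> u; rewrite !inE => /or4P[/eqP ->|/eqP ->|/eqP ->|/orP[] /eqP ->].
  - by exists (x 0); rewrite // !inE eqxx orbT.
  - by exists (x 0); rewrite ?inE ?eqxx ?orbT//; rewrite adjC; exact: seg_adj.
  - by exists y; rewrite ?mem_head.
have subw : {subset [:: t; x 2; x 1; n; y; y'; x 0] <= D}.
  move=> u; rewrite !inE => /or4P[/eqP ->|/eqP ->|/eqP ->|/or4P[] /eqP ->] //.
have v1 : val2 0 (1%:Z, 0%:Z) = 1 :> R by rewrite /val2 /= mul0r addr0.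
exists (eval2 0 [:: t; x 2; x 1; n; y; y'; x 0] [:: (1%:Z, 0%:Z); (2%:Z, 0%:Z); (3%:Z, 0%:Z);
  (2%:Z, 0%:Z); (3%:Z, 0%:Z); (2%:Z, 0%:Z); (4%:Z, 0%:Z)]).
apply: (@explicit_extra 0 (0, 0) X _ [:: (0%N, (1%:Z, 0%:Z)); (0%N, (1%:Z, 0%:Z));
  (3%N, (1%:Z, 0%:Z)); (0%N, (1%:Z, 0%:Z)); (1%N, (1%:Z, 0%:Z)); (0%N, (1%:Z, 0%:Z))]
  [:: 1; 2; 6; 4; 3; 5; 6; 2; 1; 4; 6; 2; 5; 6; 4; 3]%N _ 0) => //.
- by rewrite expr0n /= mul0r addr0.
- rewrite /= !v1 tx nl l1 l2 (linkC (x 2)) c1 (linkC (x 1)) c0.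
  by repeat (split => //); exact/eqP/oner_neq0.
- move=> v vX; have := Xw v vX; rewrite !inE.
  move=> /or4P[/eqP ->|/eqP ->|/eqP ->|/or4P[/eqP e|/eqP ->|/eqP ->|/eqP ->]];
    [by exists 0%N|by exists 1%N|by exists 2%N| |by exists 4%N|by exists 5%N|by exists 6%N].
  by rewrite e (negPf nX) in vX.
- move=> u uR; have [uD uX uo] := rest_orth uR.
  have uo' v : v \in X -> link v u = 0 by move=> vX; rewrite linkC uo.
  have xX j : (j < k)%N -> x j \in X by move=> jk; rewrite Xp !inE nth_in ?orbT.
  have yX : y \in X by rewrite Xp mem_head. have yX' : y' \in X by rewrite Xp !inE eqxx orbT.
  have up' : u \notin p by apply: contra uX; rewrite Xp !inE => ->; rewrite !orbT.
  have uy : u != y by apply: contraNneq uX => ->.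
  have uy' : u != y' by apply: contraNneq uX => ->.
  have un : u != n.
    by apply: contraTneq uR => ->; rewrite mem_filter; move: nN; rewrite mem_filter => /andP[/andP[_ ->]]; rewrite andbF.
  have ut' : u != t by apply: contraNneq tR => <-.
  have nu0 : link n u = 0.
    apply/eqP; apply: contrapT => /negP nu.
    have aun : 1 <= link u n by rewrite linkC; apply: link_ge1 => //; apply/eqP; rewrite eq_sym.
    apply: (@no_E7 (x 0) y' y n u (x 1) (x 2) t) => //; rewrite ?l1 ?l2 ?nl ?tx ?(linkC (x 1)) ?c0 ?(linkC (x 2)) ?c1 //.
    + move: ut; rewrite /= !inE !negb_or => /and5P[/and5P[t1 t2 t3 t4 /andP[t5 t6]] _ _ _ _].
      by uniq_tac.
    + by move=> v; rewrite !inE => /or4P[/eqP ->|/eqP ->|/eqP ->|/or4P[/eqP ->|/eqP ->|/eqP ->|/orP[] /eqP ->]].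
  split.
    case=> [|[|[|[|[|[|[|//]]]]]]] //= _ _; rewrite ?nu0//; apply: uo' => //; exact: xX.
  by rewrite v1 mul1r; exact: rest_value uR tD tR.
Qed.

(** One neighbour at a short leg and one at the end of the long leg. With at least five path
    vertices there is E8~. With four, D_6 and [n] form E_7; with three, D_5, [n] and [l] do; in both
    cases [fork_extra] applies. *)
Lemma fork_pair n l : (2 < k)%N -> n \in nbrs X -> adj n y -> l \in nbrs X -> adj l (x k.-1) ->
  n != l -> exists e, extra X e.
Proof.
move=> k3 nN ny lN ll nl; have [nD np ny1 ny2 _] := fork_nbr nN.
have [lD lp ly ly' _] := fork_nbr lN.
have [l1 l2 _] := fork_leaf; have c1 j : (j.+1 < k)%N -> 1 <= link (x j.+1) (x j).
  by move=> jk; rewrite linkC fork_chain.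
have any : 1 <= link n y by apply: link_ge1 => //; exact/eqP.
have nX : n \notin X by case: (nbrsP nN). have lX : l \notin X by case: (nbrsP lN).
have lR : l \notin rest X.
  by rewrite mem_filter; move: lN; rewrite mem_filter => /andP[/andP[_ ->]]; rewrite andbF.
have ax1 : 1 <= link y' (x 0) by rewrite l2. have ax2 : 1 <= link y (x 0) by rewrite l1.
have [k5|k5] := leqP 5 k.
  exfalso; have all4 j : (j < 4)%N -> 1 <= link (x j.+1) (x j).
    by move=> j4; apply: c1; apply: leq_trans k5.
  have [a1 a2 a3 a4] : [/\ 1 <= link (x 1) (x 0), 1 <= link (x 2) (x 1),
    1 <= link (x 3) (x 2) & 1 <= link (x 4) (x 3)] by split; apply: all4.
  have [k6|k6] := leqP 6 k.
    have a5 := c1 4%N k6.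
    apply: (@no_E8 (x 0) y' y n (x 1) (x 2) (x 3) (x 4) (x 5)) => //; try (uniq_tac || sub_tac).
  have kE : k.-1 = 4%N by nlia.
  have k4 : (4 < k)%N by nlia.
  rewrite kE in ll; have a5 := link_neq1 pD (nth_in k4) lD lp ll.
  by apply: (@no_E8 (x 0) y' y n (x 1) (x 2) (x 3) (x 4) l) => //; try (uniq_tac || sub_tac).
have [k4|k4] := leqP 4 k.
  have k3' : (3 < k)%N by nlia.
  have x3X : x 3 \in X by rewrite Xp !inE nth_in ?orbT.
  apply: (@fork_extra n (x 3)) => //.
  - exact/pD/nth_in.
  - by apply/negP => /rest_orth[_ /negP].
  - by uniq_tac.
  - by rewrite linkC fork_chain.
  - move=> v; rewrite Xp !inE => /or3P[->|->|/(nthP 0)[t tk <-]]; rewrite ?orbT//.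
    have : (t < 4)%N by apply: leq_trans tk _; rewrite -ltnS.
    by case: t {tk} => [|[|[|[|//]]]] _; rewrite eqxx ?orbT.
have kE : k.-1 = 2%N by nlia.
rewrite kE in ll; have x2D : x 2 \in D by exact/pD/nth_in.
have l2n : l <> x 2 by apply/eqP; ne_tac.
have lx : link l (x 2) = 1.
  apply: link1 => // h; have l0 := link_gt0 lD x2D l2n ll.
  apply: (@seg_excess2 p up pD sp 0 2 y y' l (link l (x 2))) => //.
  - uniq_tac.
  - by apply: hangs_out yx.
  - by apply: hangs_out yx'.
  - by apply: hangs_out ll.
  - by exists (x 2) => //; apply: mem_seg.
apply: (@fork_extra n l) => //.
- by uniq_tac.
- move=> v; rewrite Xp !inE => /or3P[->|->|/(nthP 0)[t tk <-]]; rewrite ?orbT//.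
  have : (t < 3)%N by apply: leq_trans tk _; rewrite -ltnS.
  by case: t {tk} => [|[|[|//]]] _; rewrite eqxx ?orbT.
Qed.

End ForkStep.

(** Beyond D_4 there is at most one neighbour at the short legs and one at the long end; when both
    occur, one orthogonal root is gained. In D_4 each leaf carries at most one neighbour, and three
    together would form E6~. *)
Lemma fork_reducible X p y y' : {subset X <= D} -> uniq p -> sorted adj p -> y \notin p ->
  y' \notin p -> y != y' -> X =i y :: y' :: p -> adj y (nth 0 p 0) -> adj y' (nth 0 p 0) ->
  (1 < size p)%N -> reducible X.
Proof.
move=> XD up sp yp yp' yy Xp yx yx' k2.
have Xp' : X =i y' :: y :: p by move=> u; rewrite Xp !inE orbCA.
have yy' : y' != y by rewrite eq_sym.
have pD : {subset p <= D} by move=> u up'; apply: XD; rewrite Xp !inE up' !orbT.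
have nP u (uN : u \in nbrs X) := fork_nbr XD up sp yp yp' yy Xp yx yx' k2 uN.
have yD : y \in D by apply: XD; rewrite Xp mem_head.
have yD' : y' \in D by apply: XD; rewrite Xp' mem_head.
have tw a b : a \in nbrs X -> b \in nbrs X -> a != b -> adj a y -> adj b y -> False.
  move=> /nP[aD ap ay ay' _] /nP[bD bp by_ by' _] ab.
  by move=> a1 b1; apply: (@leaf_twice p y y' a b) => //; rewrite // eq_sym.
have tw' a b : a \in nbrs X -> b \in nbrs X -> a != b -> adj a y' -> adj b y' -> False.
  move=> /nP[aD ap ay ay' _] /nP[bD bp by_ by' _] ab.
  by move=> a1 b1; apply: (@leaf_twice p y' y a b) => //; rewrite // eq_sym.
have lo a b (aN : a \in nbrs X) (bN : b \in nbrs X) := fork_long XD up sp yp yp' yy Xp yx yx' k2 aN bN.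
have gD := fork_gram XD up sp yp yp' yy Xp yx yx' k2.
have un := nbrs_uniq X.
have [k3|k3] := leqP 3 (size p).
  have tl a b : a \in nbrs X -> b \in nbrs X -> a != b -> adj a y -> adj b y' -> False.
    move=> /nP[aD ap ay ay' _] /nP[bD bp by_ by' _].
    move=> ab a1 b1.
    by apply: (fork_two_leaves XD up sp yp yp' yy Xp yx yx' k2 k3 _ _ _ _ ab _ _ _ _ a1 b1).
  pose short u := adj u y || adj u y'.
  have kind u : u \in nbrs X -> short u \/ adj u (nth 0 p (size p).-1).
    by move=> /nP[_ _ _ _ [h|h|h]]; [left|left|right] => //; rewrite /short h ?orbT.
  have sh a b : a \in nbrs X -> b \in nbrs X -> a != b -> short a -> short b -> False.
    move=> aN bN ab /orP[a1|a1] /orP[b1|b1]; [exact: tw ab a1 b1|exact: tl ab a1 b1| |exact: tw' ab a1 b1].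
    by apply: (tl b a) => //; rewrite eq_sym.
  have D5 : exists2 m, (4 < m)%N & gram_D X m by exists (size p).+2.
  case E : (nbrs X) un => [|a [|b [|c N]]].
  - by move=> _; apply: Or31; apply: reduces_nbrs; rewrite E.
  - by move=> _; apply: Or32; split; [apply: reduces_nbrs; rewrite E|right; left].
  - rewrite /= inE andbT => ab; have aN : a \in nbrs X by rewrite E mem_head.
    have bN : b \in nbrs X by rewrite E !inE eqxx orbT.
    have ba : b != a by rewrite eq_sym.
    suff [e ee] : exists e, extra X e.
      apply: Or32; split; last by right; left.
      apply: reduces_le (@reduces_extra X [:: e] _ _ _) => //; rewrite ?E//.
        by move=> _ /[!inE] /eqP ->.
      by move=> ? ? /[!inE] /eqP -> /eqP ->.
    have fp n l : n \in nbrs X -> l \in nbrs X -> n != l -> short n ->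
        adj l (nth 0 p (size p).-1) -> exists e, extra X e.
      move=> nN lN nl /orP[h|h] hl.
        exact: (fork_pair XD up sp yp yp' yy Xp yx yx' k2 k3 nN h lN hl nl).
      exact: (fork_pair XD up sp yp' yp yy' Xp' yx' yx k2 k3 nN h lN hl nl).
    case: (kind a aN) => ka; case: (kind b bN) => kb.
    + by case: (sh a b aN bN ab ka kb).
    + exact: fp ab ka kb.
    + exact: fp ba kb ka.
    + by case: (lo a b aN bN ab ka kb).
  - rewrite /= !inE !negb_or => /and4P[/and3P[ab ac _] /andP[bc _] _ _]; exfalso.
    have aN : a \in nbrs X by rewrite E mem_head.
    have bN : b \in nbrs X by rewrite E !inE eqxx orbT.
    have cN : c \in nbrs X by rewrite E !inE eqxx !orbT.
    case: (kind a aN) (kind b bN) (kind c cN) => ka [kb|kb] [kc|kc];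
      first [exact: sh ab ka kb | exact: sh ac ka kc | exact: sh bc kb kc |
             exact: lo ab ka kb | exact: lo ac ka kc | exact: lo bc kb kc].
have kE : size p = 2%N by apply/eqP; rewrite eqn_leq k2 andbT -ltnS.
rewrite kE /= in gD lo nP; apply: Or33; split; last by right.
apply: reduces_nbrs; case E : (nbrs X) un => [|a [|b [|c N]]] //.
rewrite /= !inE !negb_or => /and4P[/and3P[ab ac _] /andP[bc _] _ _]; exfalso.
have aN : a \in nbrs X by rewrite E mem_head.
have bN : b \in nbrs X by rewrite E !inE eqxx orbT.
have cN : c \in nbrs X by rewrite E !inE eqxx !orbT.
have x01 : adj (nth 0 p 1) (nth 0 p 0) by rewrite adjC; apply: (seg_adj sp); rewrite kE.
have leaf u : u \in nbrs X -> exists v, [/\ v \in D, v \in X, v != nth 0 p 0, adj v (nth 0 p 0) &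
    adj u v /\ forall u', u' \in nbrs X -> u' != u -> ~ adj u' v].
  move=> uN; have [uD up' uy uy' [h|h|h]] := nP u uN.
  - exists y; split; rewrite ?Xp ?mem_head//; first by ne_tac.
    by split => // v vN vu hv; apply: (tw v u).
  - exists y'; split; rewrite ?Xp' ?mem_head//; first by ne_tac.
    by split => // v vN vu hv; apply: (tw' v u).
  - have x1 : nth 0 p 1 \in p by apply: nth_in; rewrite kE.
    exists (nth 0 p 1); split => //; first exact: pD.
    + by rewrite Xp !inE x1 !orbT.
    + by apply: nth_neq; rewrite ?kE.
    + by split => // v vN vu hv; apply: (lo v u).
have [va [vaD vaX va0 vax [ava nva]]] := leaf a aN.
have [vb [vbD vbX vb0 vbx [avb nvb]]] := leaf b bN.
have [vc [vcD vcX vc0 vcx [avc nvc]]] := leaf c cN.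
have x0p : nth 0 p 0 \in p by apply: nth_in; rewrite kE.
have x0D : nth 0 p 0 \in D by exact: pD.
have nX u v : u \in nbrs X -> v \in X -> u != v.
  by move=> /nbrsP[_ uX _] vX; apply: contraNneq uX => ->.
have x0X : nth 0 p 0 \in X by rewrite Xp !inE x0p !orbT.
have ba : b != a by rewrite eq_sym. have ca : c != a by rewrite eq_sym. have cb : c != b by rewrite eq_sym.
have vab : va != vb by apply/eqP => e; apply: (nva b) => //; rewrite e.
have vac : va != vc by apply/eqP => e; apply: (nva c) => //; rewrite e.
have vbc : vb != vc by apply/eqP => e; apply: (nvb c) => //; rewrite e.
have [aD _ _ _ _] := nP a aN; have [bD _ _ _ _] := nP b bN; have [cD' _ _ _ _] := nP c cN.
apply: (@no_E6 (nth 0 p 0) va a vb b vc c).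
- by rewrite /= !inE !negb_or; repeat (apply/andP; split);
    first [done | assumption | rewrite eq_sym; assumption | by apply: nX | by rewrite eq_sym; apply: nX].
- by move=> u; rewrite !inE => /or4P[/eqP ->|/eqP ->|/eqP ->|/or4P[] /eqP ->].
all: by apply: link_ge1 => //; apply/eqP; first [assumption | by apply: nX].
Qed.

Lemma tripod_reducible X p z i : {subset X <= D} -> tripod X p z i -> reducible X.
Proof.
move=> XD tp; have [up sp zp Xp [zi i0 ik il]] := tp.
have [i2|i1] := ltnP 1 i; first exact: E_step tp i2.
have iE : i = 1%N by apply/eqP; rewrite eqn_leq i1.
case: p up sp zp Xp zi ik il tp => // h q up sp zp Xp zi ik il tp; subst i.
have [hq uq] := andP up.
have sq : sorted adj q by move: sp => /=; case: (q) => //= ? ? /andP[].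
have zq : z \notin q by move: zp; rewrite inE negb_or => /andP[].
have zh : z != h by move: zp; rewrite inE negb_or => /andP[].
apply: (@fork_reducible X q z h) => //.
case: (q) sp ik => //= a q' /andP[ha _] _; exact: ha.
Qed.

Lemma straight_nth s : (forall i j, (i < j < size s)%N ->
  link (nth 0 s i) (nth 0 s j) = (j == i.+1)%:R) -> straight s.
Proof.
elim: s => //= x s IH h; split.
  by apply: IH => i j ij; have := h i.+1 j.+1 ij; rewrite /= eqSS.
case: s h {IH} => // y s h; split; first by have := h 0%N 1%N isT.
move=> z /(nthP 0)[t ts <-]; have := h 0%N t.+2; rewrite /= => -> //.
Qed.

(** * Diagrams that are paths *)

Section LineStep.
Variables (X p : seq V).
Hypotheses (XD : {subset X <= D}) (up : uniq p) (sp : sorted adj p) (Xp : X =i p).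
Hypothesis p0 : p <> [::].
Local Notation x := (nth 0 p).
Local Notation k := (size p).

Let pD : {subset p <= D}. Proof. by move=> u up'; apply: XD; rewrite Xp. Qed.
Let k0 : (0 < k)%N. Proof. by case: (p) p0. Qed.
Let xD t : (t < k)%N -> x t \in D. Proof. by move=> tk; exact/pD/nth_in. Qed.

Lemma line_nbr u : u \in nbrs X -> [/\ u \in D, u \notin p, u \notin rest X &
  exists2 t, (t < k)%N & adj u (x t)].
Proof.
move=> uN; have [uD uX [v vX uv]] := nbrsP uN; rewrite Xp in uX; split => //.
  by rewrite mem_filter; move: uN; rewrite mem_filter => /andP[/andP[_ ->]]; rewrite andbF.
by rewrite Xp in vX; exists (index v p); rewrite ?index_mem// nth_index.
Qed.

Lemma line_hangs u i n : u \in D -> u \notin p -> (i + n < k)%N ->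
  (exists2 t, (i <= t <= i + n)%N & adj u (x t)) -> hangs p i n u.
Proof. by move=> uD up' ik [t ti ut]; exact: hangs_out ut. Qed.

Lemma rest_line u : u \in rest X -> [/\ u \in D, u \notin p & forall t, (t < k)%N -> link (x t) u = 0].
Proof.
move=> /rest_orth[uD uX uo]; rewrite Xp in uX; split => // t tk.
by rewrite linkC uo// Xp nth_in.
Qed.

Lemma no_inner u t j (m : R) : u \in D -> u \notin p -> adj u (x t) -> (0 < t <= j)%N ->
  (j.+1 < k)%N -> 0 < m -> 2 <= m ^+ 2 -> m <= link (x j) (x j.+1) -> False.
Proof.
move=> uD up' ut /andP[t0 tj] jk m0 m2 h.
have e : (t + (j - t) = j)%N by rewrite subnKC.
have tE : t.-1.+1 = t by rewrite prednK.
have t1 : (t.-1 < k)%N by move: tj jk; clear; lia.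
apply: (@seg_excess2 p up pD sp t (j - t) (x t.-1) u (x j.+1) m) => //; rewrite ?e//.
- by apply: ltnW.
- uniq_tac.
- by rewrite -{1}tE; apply: hangs_prev => //; rewrite tE e; exact: ltnW.
- by apply: hangs_out ut => //; rewrite ?e ?leqnn ?tj ?(ltnW jk).
- by have := @hangs_next p up pD sp t (j - t); rewrite e; apply.
- by exists (x j); [apply: mem_seg; rewrite e tj leqnn|rewrite linkC].
Qed.

Lemma no_two_left u v j (m : R) : u \in D -> u \notin p -> v \in D -> v \notin p -> u != v ->
  (exists2 t, (t <= j)%N & adj u (x t)) -> (exists2 t, (t <= j)%N & adj v (x t)) ->
  (j.+1 < k)%N -> 0 < m -> 2 <= m ^+ 2 -> m <= link (x j) (x j.+1) -> False.
Proof.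
move=> uD up' vD vp uv [t tj ut] [t' tj' vt] jk m0 m2 h.
apply: (@seg_excess2 p up pD sp 0 j u v (x j.+1) m) => //.
- exact: ltnW.
- uniq_tac.
- by apply: hangs_out ut => //; exact: ltnW.
- by apply: hangs_out vt => //; exact: ltnW.
- exact: (@hangs_next p up pD sp 0 j).
- by exists (x j); [apply: mem_seg; rewrite leq0n leqnn|rewrite linkC].
Qed.

Lemma left_light u j t (m : R) : u \in D -> u \notin p -> (t <= j)%N -> adj u (x t) ->
  (j.+1 < k)%N -> 0 < m -> 2 <= m ^+ 2 -> m <= link (x j) (x j.+1) -> link u (x t) = 1.
Proof.
move=> uD up' tj ut jk m0 m2 h; have tk : (t < k)%N by move: tj jk; clear; lia.
have ux : u <> x t by apply/eqP; ne_tac.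
apply: link1 => //; first exact: xD.
move=> hv; have l0 := link_gt0 uD (xD tk) ux ut.
apply: (@seg_excess3 p up pD sp 0 j u (x j.+1) (link u (x t)) m) => //.
- exact: ltnW.
- by ne_tac.
- by apply: hangs_out ut => //; exact: ltnW.
- exact: (@hangs_next p up pD sp 0 j).
- by lra.
- by exists (x t) => //; apply: mem_seg; rewrite leq0n.
- by exists (x j); [apply: mem_seg; rewrite leq0n leqnn|rewrite linkC].
Qed.

(** Two heavy edges at the ends of a segment give 2 + 2, as in affine C. *)
Lemma heavy_unique i j : (i < j)%N -> (j.+1 < k)%N -> link (x j) (x j.+1) <> 1 ->
  link (x i) (x i.+1) = 1.
Proof.
move=> ij jk hj; have ik : (i.+1 < k)%N by move: ij jk; clear; lia.
have iD := xD (ltnW ik); have iD1 := xD ik; have jD := xD (ltnW jk); have jD1 := xD jk.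
have ni : x i <> x i.+1 by apply/eqP; apply: (nth_neq up); [exact: ltnW ik|exact: ik|exact: n_Sn].
have nj : x j <> x j.+1 by apply/eqP; apply: (nth_neq up); [exact: ltnW jk|exact: jk|exact: n_Sn].
have ai := seg_adj sp ik; have aj := seg_adj sp jk.
apply: link1 => // hi.
have hj2 : 2 <= link (x j) (x j.+1) ^+ 2.
  apply: cox_value_heavy => //; [exact: (config_link cD)|exact/eqP].
have e : (i.+1 + (j - i.+1) = j)%N by rewrite subnKC.
apply: (@seg_excess3 p up pD sp i.+1 (j - i.+1) (x i) (x j.+1) (link (x i) (x i.+1))
  (link (x j) (x j.+1))) => //; rewrite ?e.
- exact: ltnW.
- by apply: nth_neq => //; [exact: ltnW|move: ij; clear; lia].
- by apply: hangs_prev => //; rewrite e; exact: ltnW.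
- by have := @hangs_next p up pD sp i.+1 (j - i.+1); rewrite e; apply.
- exact: link_gt0.
- exact: link_gt0.
- by lra.
- by exists (x i.+1) => //; apply: mem_seg; rewrite e leqnn.
- by exists (x j); [apply: mem_seg; rewrite e leqnn ij|rewrite linkC].
Qed.

Lemma line_three a b c d : uniq [:: a; b; c; d] -> {subset [:: a; b; c; d] <= nbrs X} -> False.
Proof.
move=> u sub; have e : (0 + k.-1 < k)%N by rewrite add0n prednK.
have hh v : v \in [:: a; b; c; d] -> hangs p 0 k.-1 v.
  move=> /sub /line_nbr[vD vp _ [t tk vt]]; apply: line_hangs => //.
  by exists t => //; rewrite leq0n add0n -ltnS prednK.
by apply: (@seg_excess1 p up pD sp 0 k.-1 a b c d) => //; apply: hh; rewrite !inE eqxx ?orbT.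
Qed.

Lemma nbrs_link0 a c : a \in nbrs X -> c \in nbrs X -> a != c -> link a c = 0.
Proof.
move=> aN cN ac; have [aD ap _ [t tk aa]] := line_nbr aN; have [cD' cp _ [s sk cc]] := line_nbr cN.
have [tp _] := line_tree sp p0.
have tcp : tree (c :: p) by apply: tree_cons => //; exists (x s) => //; exact: nth_in.
have cpD : {subset c :: p <= D} by move=> u; rewrite inE => /orP[/eqP ->//|/pD].
apply: (@tree_link0 (c :: p) a (x t)) => //.
- by rewrite /= inE negb_or ac ap cp.
- by move=> u; rewrite inE => /orP[/eqP ->//|/cpD].
- by rewrite inE nth_in ?orbT.
- exact: mem_head.
- by ne_tac.
Qed.

Lemma reduces_one e (n : nat) : extra X e -> (size (nbrs X) <= n.+1)%N -> reduces X n.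
Proof.
move=> ee h; apply: reduces_le (@reduces_extra X [:: e] _ _ _) => //=.
- by rewrite leq_subLR.
- by move=> _ /[!inE] /eqP ->.
- by move=> ? ? /[!inE] /eqP -> /eqP ->.
Qed.

Section Simple.
Hypothesis simple : forall j, (j.+1 < k)%N -> link (x j) (x j.+1) = 1.

Lemma line_gram : gram_A X k.
Proof.
exists p; split => // a b /andP[ab bk]; case: eqP => [e|ne].
  by rewrite e; apply: simple; rewrite -e.
by apply: (line_link up pD sp); rewrite bk andbT; move: ab ne; clear; lia.
Qed.

Lemma ends_light u v v' t : uniq [:: u; v; v'] -> {subset [:: u; v; v'] <= nbrs X} ->
  (t < k)%N -> adj u (x t) -> link u (x t) = 1.
Proof.
move=> un sub tk ut; have e : (0 + k.-1 < k)%N by rewrite add0n prednK.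
have hh y : y \in [:: u; v; v'] -> hangs p 0 k.-1 y.
  move=> /sub /line_nbr[vD vp _ [s sk vt]]; apply: line_hangs => //.
  by exists s => //; rewrite leq0n add0n -ltnS prednK.
have [uD up' _ _] := line_nbr (sub u (mem_head _ _)).
have ux : u <> x t by apply/eqP; ne_tac.
apply: link1 => //; first exact: xD.
move=> h; have l0 := link_gt0 uD (xD tk) ux ut.
apply: (@seg_excess2 p up pD sp 0 k.-1 v v' u (link u (x t))) => //.
- move: un; rewrite /= !inE !negb_or => /and3P[/andP[h1 h2] h3 _].
  by rewrite h3 (eq_sym v) h1 (eq_sym v') h2.
- by apply: hh; rewrite !inE eqxx orbT.
- by apply: hh; rewrite !inE eqxx !orbT.
- by apply: hh; rewrite mem_head.
- by exists (x t) => //; apply: mem_seg; rewrite leq0n add0n -ltnS prednK.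
Qed.

Lemma ends_extra a c : a \in nbrs X -> c \in nbrs X -> a != c -> link a (x 0) = 1 ->
  link c (x k.-1) = 1 -> extra X (vsum (a :: rcons p c)).
Proof.
move=> aN cN ac ax cx; have [aD ap aR _] := line_nbr aN; have [cD' cp cR _] := line_nbr cN.
have kk : (k.-1 < k)%N by rewrite prednK.
have aa : adj a (x 0) by rewrite /adj ax oner_neq0.
have cc : adj c (x k.-1) by rewrite /adj cx oner_neq0.
have [tp _] := line_tree sp p0.
have tcp : tree (c :: p) by apply: tree_cons => //; exists (x k.-1) => //; exact: nth_in.
have a0 t : (0 < t < k)%N -> link a (x t) = 0.
  by move=> /andP[t0 tk]; apply: (attach_uniq up pD sp aD ap k0 tk aa); rewrite -lt0n.
have c0 t : (t < k.-1)%N -> link (x t) c = 0.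
  move=> tk; have tk' : (t < k)%N by apply: leq_trans tk _; exact: leq_pred.
  by rewrite linkC; apply: (attach_uniq up pD sp cD' cp kk tk' cc); rewrite neq_ltn tk.
have lac : link a c = 0 by exact: nbrs_link0.
apply: path_extra => //.
- apply: straight_nth => i j; rewrite /= size_rcons => /andP[ij jk].
  case: i ij => [|i] ij; case: j ij jk => [|j] //=; rewrite !ltnS eqSS => ij jk.
    rewrite nth_rcons; have [jk'|jk'] := ltnP j k.
      by case: j jk' {ij jk} => [|j] jk' //=; rewrite a0.
    have -> : j = k by apply/eqP; rewrite eqn_leq jk.
    by rewrite eqxx lac; case: eqP k0 => // ->.
  rewrite !nth_rcons; have ik : (i < k)%N by exact: leq_trans ij jk.
  rewrite ik; have [jk'|jk'] := ltnP j k.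
    case: eqP => [->|ne]; first by apply: simple; move: ij jk'; clear; case: ltngtP => //; lia.
    by apply: (line_link up pD sp); rewrite jk' andbT; move: ij ne; clear; lia.
  have jE : j = k by apply/eqP; rewrite eqn_leq jk.
  rewrite jE eqxx; case: eqP => [kE|ne].
    by rewrite linkC (_ : i = k.-1)// kE.
  by apply: c0; move: ik ne; clear; lia.
- by move=> u; rewrite inE mem_rcons inE => /or3P[/eqP ->|/eqP ->|/pD].
- move=> u uR au cu; have [uD up' u0] := rest_line uR.
  have ua : u != a by apply: contraNneq aR => <-.
  have uc : u != c by apply: contraNneq cR => <-.
  move/eqP: (ac); apply.
  apply: (@tree_link1 (a :: c :: p) u a c) => //; rewrite 1?adjC//.
  - by apply: tree_cons => //; exists (x 0) => //; rewrite inE nth_in ?orbT.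
  - by rewrite /= !inE !negb_or ua uc up' ac ap cp.
  - by move=> v; rewrite !inE => /or4P[/eqP ->|/eqP ->|/eqP ->|/pD].
  - exact: mem_head.
  - by rewrite !inE eqxx orbT.
Qed.

(** There are at most three neighbours. If there are three, each end of the path carries one:
    otherwise the path without that end would have the end vertex as a fourth neighbour. The sum of
    the path prolonged by the two end neighbours is the root gained, which leaves a cost of two. *)
Lemma simple_reducible_long : (1 < k)%N -> reducible X.
Proof.
move=> k2; have gA := line_gram; apply: Or33; split; last by left; exists k.
have un := nbrs_uniq X.
have [le|gt] := leqP (size (nbrs X)) 2; first exact: reduces_nbrs.
have [a [b [c E]]] : exists a b c, nbrs X = [:: a; b; c].
  case E : (nbrs X) gt un => [|a [|b [|c [|d N]]]] // _ un; first by exists a, b, c.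
  exfalso; apply: (@line_three a b c d); last first.
    by move=> v; rewrite E !inE => /or4P[] ->; rewrite ?orbT.
  by move: un; rewrite -[_ :: _]/([:: a; b; c; d] ++ N) cat_uniq => /andP[].
rewrite E in un; have mE v : v \in [:: a; b; c] -> v \in nbrs X by rewrite E.
have ends (i0 : nat) (n : nat) (y : V) : (i0 + n < k)%N -> hangs p i0 n y -> y \in p ->
    (exists2 u, u \in [:: a; b; c] & forall t, (i0 <= t <= i0 + n)%N -> ~ adj u (x t)).
  move=> ik hy yp; apply: contrapT => no.
  have hh u : u \in [:: a; b; c] -> hangs p i0 n u.
    move=> uE; have [uD up' _ _] := line_nbr (mE u uE); apply: line_hangs => //.
    by apply: contrapT => no'; apply: no; exists u => // t ti ut; apply: no'; exists t.
  apply: (@seg_excess1 p up pD sp i0 n y a b c) => //; try (by apply: hh; rewrite !inE eqxx ?orbT).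
  rewrite cons_uniq un andbT; apply/negP => /mE /line_nbr[_ /negP] //.
have [u uE u0] : exists2 u, u \in [:: a; b; c] & adj u (x 0).
  have kk : (1 + (k - 2) < k)%N by move: k2; clear; lia.
  have [|u uE hu] := ends 1%N (k - 2)%N (x 0) kk _ (nth_in k0); first exact: hangs_prev.
  exists u => //; have [_ _ _ [t tk ut]] := line_nbr (mE u uE).
  by case: t tk ut => // t tk /hu[]; move: tk k2; clear; lia.
have [v vE vk] : exists2 v, v \in [:: a; b; c] & adj v (x k.-1).
  have kk : (0 + (k - 2)).+1 = k.-1 by move: k2; clear; lia.
  have kk' : (0 + (k - 2) < k)%N by move: k2; clear; lia.
  have kk2 : (k.-1 < k)%N by rewrite prednK.
  have := @hangs_next p up pD sp 0 (k - 2); rewrite kk => /(_ kk2) hn.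
  have [v vE hv] := ends 0%N (k - 2)%N (x k.-1) kk' hn (nth_in kk2).
  exists v => //; have [_ _ _ [t tk vt]] := line_nbr (mE v vE).
  have [tk2|tk2] := leqP t (k - 2); first by case: (hv t).
  by rewrite (_ : k.-1 = t)//; move: tk tk2; clear; lia.
have kk2 : (k.-1 < k)%N by rewrite prednK.
have uv : u != v.
  apply/eqP => e; subst v; have [uD up' _ _] := line_nbr (mE u uE).
  move/eqP: vk; apply; apply: (attach_uniq up pD sp uD up' k0 kk2 u0).
  by move: k2; clear; case: (size p) => [|[]].
have third y : y \in [:: a; b; c] -> exists y1 y2, uniq [:: y; y1; y2] /\
    {subset [:: y; y1; y2] <= nbrs X}.
  have pe l : perm_eq l [:: a; b; c] -> uniq l /\ {subset l <= nbrs X}.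
    by move=> pl; split; [rewrite (perm_uniq pl)|move=> z; rewrite (perm_mem pl); exact: mE].
  rewrite !inE => /or3P[] /eqP ->; [exists b, c|exists a, c|exists a, b]; apply: pe => //.
    by rewrite (perm_catCA [:: b] [:: a] [:: c]).
  by rewrite (perm_catC [:: c] [:: a; b]).
have [u1 [u2 [uu us]]] := third u uE; have [v1 [v2 [vv vs]]] := third v vE.
apply: (@reduces_one (vsum (u :: rcons p v))); last by rewrite E.
by apply: ends_extra => //; [exact: mE|exact: mE|exact: ends_light uu us k0 u0|exact: ends_light vv vs kk2 vk].
Qed.

End Simple.

Section Heavy.
Variable j : nat.
Hypotheses (jk : (j.+1 < k)%N) (h1 : link (x j) (x j.+1) <> 1).

Let c1 t : (t.+1 < k)%N -> 1 <= link (x t.+1) (x t). Proof. by move=> /(nth_link up pD sp)[]. Qed.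
Let c2 t : (t.+1 < k)%N -> 1 <= link (x t) (x t.+1). Proof. by move=> /(nth_link up pD sp)[]. Qed.
Let jk' : (j < k)%N. Proof. exact: ltnW. Qed.

Lemma heavy_value : [\/ link (x j) (x j.+1) = sq2, link (x j) (x j.+1) = golden |
  sq3 <= link (x j) (x j.+1)].
Proof.
have ne : x j <> x j.+1 by apply/eqP; apply: nth_neq => //; exact: n_Sn.
have cv := config_link cD (xD jk') (xD jk) ne; have ge := c2 jk.
case: cv => [e|//|e|[e|e]]; [by move: ge; rewrite e ler10|exact: Or31|exact: Or32|exact: Or33].
Qed.

Lemma heavy_ge : sq2 <= link (x j) (x j.+1).
Proof.
have := golden_ge R; have := sq2_le R; have := sq3_ge R.
by case: heavy_value => [->|->|]; lra.
Qed.

Lemma heavy_sq : 0 < link (x j) (x j.+1) /\ 2 <= link (x j) (x j.+1) ^+ 2.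
Proof. by have := heavy_ge; have := sq2_ge R; have := sq2E R; split; nra. Qed.

Lemma heavy_right u v : u \in D -> u \notin p -> v \in D -> v \notin p -> u != v ->
  adj u (x j.+1) -> adj v (x j.+1) -> False.
Proof.
move=> uD up' vD vp uv au av; have [l0 l2] := heavy_sq.
apply: (@seg_excess2 p up pD sp j.+1 0 u v (x j) (link (x j) (x j.+1))); rewrite ?addn0//.
- by uniq_tac.
- by apply: hangs_out au => //; rewrite ?addn0 ?leqnn.
- by apply: hangs_out av => //; rewrite ?addn0 ?leqnn.
- by apply: hangs_prev => //; rewrite addn0.
- by exists (x j.+1) => //; apply: mem_seg; rewrite addn0 leqnn.
Qed.

(** The segment between the heavy edge and any neighbour would have squared labels 3 + 1. *)
Lemma heavy_sq3 : sq3 <= link (x j) (x j.+1) -> nbrs X = [::].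
Proof.
move=> h; case E : (nbrs X) => [//|u N]; exfalso.
have uN : u \in nbrs X by rewrite E mem_head.
have [uD up' _ [t tk ut]] := line_nbr uN.
have s3 := sq3E R; have s3p := sq3_ge R.
have ux := link_neq1 pD (nth_in tk) uD up' ut.
have [tj|jt] := leqP t j.
  have e : (t + (j - t) = j)%N by rewrite subnKC.
  apply: (@seg_excess3 p up pD sp t (j - t) u (x j.+1) 1 sq3); rewrite ?e ?ltr01//; try lra.
  - by ne_tac.
  - by apply: hangs_out ut => //; rewrite ?e ?leqnn ?tj.
  - by have := @hangs_next p up pD sp t (j - t); rewrite e; apply.
  - by exists (x t) => //; apply: mem_seg; rewrite e leqnn tj.
  - by exists (x j); [apply: mem_seg; rewrite e leqnn tj|rewrite linkC].
have e : (j.+1 + (t - j.+1) = t)%N by rewrite subnKC.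
apply: (@seg_excess3 p up pD sp j.+1 (t - j.+1) u (x j) 1 sq3); rewrite ?e ?ltr01//; try lra.
- by ne_tac.
- by apply: hangs_out ut => //; rewrite ?e ?leqnn ?jt.
- by apply: hangs_prev; rewrite ?e.
- by exists (x t) => //; apply: mem_seg; rewrite e leqnn jt.
- by exists (x j.+1) => //; apply: mem_seg; rewrite e leqnn jt.
Qed.

(** The heavy edge is taken in the right half. If it were neither the last edge nor the middle one
    of four vertices, two vertices before it and one after it would give F4~ or worse. *)
Lemma heavy_middle : (k - j.+2 <= j)%N -> k = j.+2 \/ (j = 1%N /\ k = 4%N).
Proof.
move=> lr; have [kj|kj] := leqP k j.+2.
  by left; apply/eqP; rewrite eqn_leq kj.
have [j2|j2] := leqP 2 j; last by right; move: j2 kj lr; clear; lia.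
exfalso; have [e1 e2] : (j.-1.+1 = j)%N /\ (j.-2.+1 = j.-1)%N by move: j2; clear; lia.
have j1k : (j.-1.+1 < k)%N by rewrite e1.
have j2k : (j.-2.+1 < k)%N by rewrite e2; move: j1k; clear; lia.
have := c2 j1k; have := c2 j2k; rewrite e1 e2 => a1 a2.
apply: (@no_F4 (x j.-2) (x j.-1) (x j) (x j.+1) (x j.+2)) => //; try (uniq_tac || sub_tac).
- exact: heavy_ge.
- exact: c2.
Qed.

Lemma heavy_left_nbr u : k = j.+2 -> u \in nbrs X -> adj u (x 0) \/ adj u (x j.+1).
Proof.
move=> kE uN; have [uD up' _ [t tk ut]] := line_nbr uN; have [l0 l2] := heavy_sq.
have [tj|jt] := leqP t j; last first.
  by right; rewrite (_ : j.+1 = t)//; move: tk jt; rewrite kE; clear; lia.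
have [t0|t0] := posnP t; first by left; rewrite -t0.
by case: (@no_inner u t j _ uD up' ut _ jk l0 l2 (lexx _)); rewrite t0 tj.
Qed.

Lemma heavy_left_two u v : u \in nbrs X -> v \in nbrs X -> u != v -> adj u (x 0) ->
  adj v (x 0) -> False.
Proof.
move=> /line_nbr[uD up' _ _] /line_nbr[vD vp _ _] uv u0 v0; have [l0 l2] := heavy_sq.
by apply: (@no_two_left u v j _ uD up' vD vp uv _ _ jk l0 l2 (lexx _)); exists 0%N.
Qed.

Lemma heavy_left_link u : u \in nbrs X -> adj u (x 0) -> link u (x 0) = 1.
Proof.
move=> /line_nbr[uD up' _ _] u0; have [l0 l2] := heavy_sq.
exact: (@left_light u j 0 _ uD up' (leq0n _) u0 jk l0 l2 (lexx _)).
Qed.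

(** The heavy edge is the last one. I_2(5) has at most one neighbour and pays for it; a neighbour of
    H_3 completes H_4 and is replaced; H_4 has none, and longer paths do not exist. *)
Lemma golden_reducible : link (x j) (x j.+1) = golden -> (k - j.+2 <= j)%N -> reducible X.
Proof.
move=> hg lr; have gl : golden <= link (x j) (x j.+1) by rewrite hg.
have glC : golden <= link (x j.+1) (x j) by rewrite linkC.
have un := nbrs_uniq X.
have [kE|[jE kE]] := heavy_middle lr; last first.
  exfalso; have [k1 k2 k3] : [/\ (1 < k)%N, (2 < k)%N & (3 < k)%N] by rewrite kE.
  have a1 := c2 k1; have a2 := c2 k3; rewrite jE in gl.
  by apply: (@no_353 (x 0) (x 1) (x 2) (x 3)) => //; try (uniq_tac || sub_tac).
have nP u : u \in nbrs X -> [/\ u \in D, u \notin p & adj u (x 0) \/ adj u (x j.+1)].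
  by move=> uN; have [uD up' _ _] := line_nbr uN; split => //; exact: heavy_left_nbr.
have no353 u i : i.+1 = j -> u \in nbrs X -> adj u (x j.+1) -> False.
  move=> iE /nP[uD up' _] ut; have ux := link_neq1 pD (nth_in jk) uD up' ut.
  have ik : (i.+1 < k)%N by rewrite iE. have := c2 ik; rewrite iE => a1.
  have ij : i <> j.+1 by rewrite -iE; clear; lia.
  apply: (@no_353 (x i) (x j) (x j.+1) u) => //; try (uniq_tac || sub_tac).
  by rewrite linkC.
have left_ i u : i.+1 = j -> u \in nbrs X -> adj u (x 0).
  by move=> iE uN; have [_ _ [//|h]] := nP u uN; case: (no353 u i iE uN h).
have [jE|[jE|[jE|[i jE]]]] : j = 0%N \/ j = 1%N \/ j = 2%N \/ exists i, j = i.+3.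
  case: (j) => [|[|[|i]]]; [by left|by right; left|by do 2 right; left|].
  by do 3 right; exists i.
- have k1 : (1 < k)%N by move: jk; rewrite jE. have hg' := hg; rewrite jE in gl glC hg'.
  apply: Or32; split.
    apply: reduces_nbrs; apply: size_le1 => // u v uN vN uv.
    have [uD up' hu] := nP u uN; have [vD vp hv] := nP v vN.
    have mix a b : a \in nbrs X -> b \in nbrs X -> a != b -> adj a (x 0) -> adj b (x j.+1) -> False.
      move=> /nP[aD ap _] /nP[bD bp _] ab aa bb; rewrite jE in bb.
      have l1 := link_neq1 pD (nth_in k0) aD ap aa; have l2 := link_neq1 pD (nth_in k1) bD bp bb.
      apply: (@no_353 a (x 0) (x 1) b) => //; try (uniq_tac || sub_tac).
      by rewrite linkC.
    case: hu hv => [u0|u1] [v0|v1].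
    + exact: heavy_left_two uN vN uv u0 v0.
    + exact: mix uN vN uv u0 v1.
    + by apply: (mix v u) => //; rewrite eq_sym.
    + exact: heavy_right uD up' vD vp uv u1 v1.
  do 3 right; exists p; split => //; first by rewrite kE jE.
  move=> a b /andP[ab b2].
  by have [-> ->] : a = 0%N /\ b = 1%N by move: ab b2; clear; lia.
- apply: Or31; case E : (nbrs X) un => [|n N]; first by move=> _; apply: reduces_nbrs; rewrite E.
  move=> _; have nN : n \in nbrs X by rewrite E mem_head.
  have [nD np _] := nP n nN; have n0 := left_ 0%N n (esym jE) nN.
  have nl := heavy_left_link nN n0; have [_ _ nR _] := line_nbr nN.
  have n1 : (size (nbrs X) <= 1)%N.
    apply: size_le1 (nbrs_uniq X) => u v uN vN uv.
    by apply: (heavy_left_two uN vN uv); apply: (left_ 0%N).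
  rewrite jE in kE; have [k1 k2 k3] : [/\ (0 < k)%N, (1 < k)%N & (2 < k)%N] by rewrite kE.
  have l01 : link (x 0) (x 1) = 1 by apply: (@heavy_unique 0 j) => //; rewrite jE.
  have l12 : link (x 1) (x 2) = golden by move: hg; rewrite jE.
  have g1 := goldenE R; have g2 := golden_ge R.
  have v1 : val2 golden (1%:Z, 0%:Z) = 1 :> R by rewrite /val2 /= mul0r addr0.
  have vg : val2 golden (0%:Z, 1%:Z) = golden :> R by rewrite /val2 /= mul1r add0r.
  have sw : uniq [:: n; x 0; x 1; x 2] by uniq_tac.
  have subw : {subset [:: n; x 0; x 1; x 2] <= D} by sub_tac.
  (* The root of H_4 orthogonal to its subdiagram H_3, with coefficients in the ring of integers
     generated by the golden ratio. *)
  apply: (@reduces_one (eval2 golden [:: n; x 0; x 1; x 2]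
    [:: (0%:Z, 2%:Z); (1%:Z, 3%:Z); (2%:Z, 4%:Z); (2%:Z, 3%:Z)])) => //.
  apply: (@explicit_extra golden (1%:Z, 1%:Z) X _ [:: (0%N, (1%:Z, 0%:Z)); (0%N, (1%:Z, 0%:Z));
    (0%N, (0%:Z, 1%:Z))]
    [:: 1; 2; 3; 2; 1; 0; 3; 2; 1; 3; 2; 1; 0; 3; 2; 1; 3; 2; 3; 2; 1; 0]%N _ 0) => //.
  + by rewrite g1 /= mul1r.
  + by apply: le_trans g2; lra.
  + rewrite /= !v1 vg nl l01 l12; repeat (split => //); try exact/eqP/oner_neq0.
    by apply/eqP; rewrite gt_eqF//; lra.
  + move=> y; rewrite Xp => /(nthP 0)[t tk <-].
    have : (t < 3)%N by apply: leq_trans tk _; rewrite kE.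
    by case: t {tk} => [|[|[|//]]] _; [exists 1%N|exists 2%N|exists 3%N].
  + move=> u uR; have [uD up' u0] := rest_line uR; split.
      by case=> [|[|[|[|//]]]] //= _ _; apply: u0.
    suff -> : link n u = 0 by rewrite mulr0; apply: Or41.
    apply/eqP; apply: contrapT => /negP nu.
    have un' : u != n by apply: contraNneq nR => <-.
    have aun : 1 <= link n u by apply: link_ge1 => //; apply/eqP; rewrite eq_sym.
    apply: (@no_5333 (x 2) (x 1) (x 0) n u) => //; try (uniq_tac || sub_tac).
    * by rewrite linkC l12.
    * by rewrite linkC l01.
    * by rewrite linkC nl.
- apply: Or31; apply: reduces_nbrs; case E : (nbrs X) => [//|u N]; exfalso.
  have uN : u \in nbrs X by rewrite E mem_head.
  have [uD up' _] := nP u uN; have u0 := left_ 1%N u (esym jE) uN.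
  rewrite jE in kE; have [k1 k2 k3 k4] : [/\ (0 < k)%N, (1 < k)%N, (2 < k)%N & (3 < k)%N] by rewrite kE.
  have l0 := link_neq1 pD (nth_in k1) uD up' u0; have a1 := c1 k2; have a2 := c1 k3.
  rewrite jE in glC; apply: (@no_5333 (x 3) (x 2) (x 1) (x 0) u) => //; try (uniq_tac || sub_tac).
  by rewrite linkC.
- exfalso; have [k1 k2 k3 k4] : [/\ (i.+1 < k)%N, (i.+2 < k)%N, (i.+3 < k)%N & (i.+4 < k)%N].
    by rewrite kE jE; clear; split; lia.
  have a1 := c1 k1; have a2 := c1 k2; have a3 := c1 k3; rewrite jE in glC.
  by apply: (@no_5333 (x i.+4) (x i.+3) (x i.+2) (x i.+1) (x i)) => //; try (uniq_tac || sub_tac).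
Qed.

(* The diagram B_(k+1) contains a root orthogonal to the subdiagram B_k. *)
Lemma B_extra n : link (x j) (x j.+1) = sq2 -> k = j.+2 -> n \in nbrs X -> adj n (x 0) ->
  extra X (x j.+1 + sq2 *: vsum (rcons (rev (take j.+1 p)) n)).
Proof.
move=> h2 kE nN n0; have nl := heavy_left_link nN n0.
have [nD np nR _] := line_nbr nN; have [l0 l2] := heavy_sq.
have st : size (take j.+1 p) = j.+1 by rewrite size_takel// ltnW.
have sr_ : size (rev (take j.+1 p)) = j.+1 by rewrite size_rev.
have nr a : (a < j.+1)%N -> nth 0 (rev (take j.+1 p)) a = x (j - a).
  by move=> aj; rewrite nth_rev ?st// subSS nth_take// ltnS leq_subr.
have n0' t : (0 < t < k)%N -> link n (x t) = 0.
  by move=> /andP[t0 tk]; apply: (attach_uniq up pD sp nD np k0 tk n0); rewrite -lt0n.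
have hu t : (t < j)%N -> link (x t) (x t.+1) = 1.
  by move=> tj; apply: (@heavy_unique t j).
apply: heavy_extra => //.
- apply: straight_nth => a b; rewrite size_rcons sr_ => /andP[ab bj].
  rewrite !nth_rcons sr_; have aj : (a < j.+1)%N by apply: leq_trans ab _; rewrite -ltnS.
  rewrite aj nr//; have [bj'|bj'] := ltnP b j.+1.
    rewrite nr// linkC; case: eqP => [e|ne].
      have -> : (j - a = (j - b).+1)%N by rewrite e; move: bj' e; clear; lia.
      by apply: hu; rewrite e; move: bj' e; clear; lia.
    by apply: (line_link up pD sp); rewrite kE; move: ab ne bj'; clear; lia.
  have bE : b = j.+1 by apply/eqP; rewrite eqn_leq bj' andbT -ltnS.
  rewrite bE eqxx linkC eqSS; case: eqP => [e|ne]; first by rewrite -e subnn.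
  by rewrite n0'// kE; move: aj ne; clear; lia.
- move=> u; rewrite inE mem_rcons inE mem_rev => /or3P[/eqP ->|/eqP ->//|/mem_take/pD//].
  exact: xD.
- move=> u; rewrite Xp inE mem_rev -{1}(cat_take_drop j.+1 p) mem_cat orbC.
  by rewrite (drop_nth 0 jk) (_ : drop j.+2 p = [::]) ?mem_seq1// drop_oversize// kE.
- have -> : head n (rev (take j.+1 p)) = nth 0 (rev (take j.+1 p)) 0.
    by move: sr_; case: (rev _).
  by rewrite nr// subn0 linkC.
- move=> u ub.
  have [v vE] : exists v, rcons (rev (take j.+1 p)) n = v :: behead (rcons (rev (take j.+1 p)) n).
    by case: (rev _) => [|v q]; [exists n|exists v].
  have [t tb ut] : exists2 t, (t < j.+1)%N & nth 0 (rcons (rev (take j.+1 p)) n) t.+1 = u.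
    move: ub => /(nthP 0)[t tb <-]; exists t; last by rewrite [in LHS]vE.
    by move: tb; rewrite size_behead size_rcons sr_.
  move: ut; rewrite nth_rcons sr_; case: ltnP => [tj|jt].
    rewrite nr// => <-; rewrite linkC; apply: (line_link up pD sp); rewrite kE.
    by move: tj; clear; lia.
  rewrite (_ : (t.+1 == j.+1)) => [<-|]; last by rewrite eqn_leq jt andbT.
  by rewrite linkC n0'// jk.
- move=> u uR; have [uD up' u0] := rest_line uR.
  have nu : n <> u by move=> e; rewrite e uR in nR.
  have [->|/eqP lu] := eqVneq (link n u) 0; [by left|right].
  have nu' : u != n by apply/eqP => e; apply: nu.
  apply: link1 => //; first exact/eqP.
  move=> hv; have anu : adj n u by exact/eqP.
  have lp := link_gt0 nD uD nu anu.
  have sb : {subset seg p 0 j <= p} by apply: seg_sub.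
  apply: (@excess3 (n :: seg p 0 j) (x j.+1) u (link (x j) (x j.+1)) (link n u)) => //.
  + apply: tree_cons; first exact: seg_tree.
    by exists (x 0) => //; apply: mem_seg.
  + have h1' : x j.+1 \notin seg p 0 j by apply: notin_seg => //; rewrite add0n ltnn andbF.
    have h2' : u \notin seg p 0 j by apply: contra up' => /sb.
    have h3' : n \notin seg p 0 j by apply: contra np => /sb.
    have h4 : x j.+1 != u by ne_tac. have h5 : x j.+1 != n by ne_tac.
    have: uniq (seg p 0 j) by apply: seg_uniq.
    move: (seg p 0 j) h1' h2' h3' => q a1 a2 a3 uq.
    by rewrite !cons_uniq !in_cons !negb_or h4 h5 a1 nu' a2 a3 uq.
  + move: sb; move: (seg p 0 j) => q sb v; rewrite !in_cons => /or4P[/eqP ->|/eqP ->//|/eqP ->//|/sb/pD//].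
    exact: xD.
  + by lra.
  + exists (x j); last by rewrite linkC.
    by rewrite in_cons mem_seg ?orbT// leq0n leqnn.
  + by exists n; rewrite ?mem_head// linkC.
Qed.

(** F_4 admits no neighbour. For type B the single neighbour either prolongs the simple end, which
    [B_extra] compensates, or sits at the heavy end; the latter forces B_3 inside F_4, where again
    an orthogonal root exists. *)
Lemma sq2_reducible_long : link (x j) (x j.+1) = sq2 -> (k - j.+2 <= j)%N -> (2 < k)%N ->
  reducible X.
Proof.
move=> h2 lr k3; have un := nbrs_uniq X; have s2 := sq2E R; have s2p := sq2_ge R.
have gl : sq2 <= link (x j) (x j.+1) by rewrite h2.
have glC : sq2 <= link (x j.+1) (x j) by rewrite linkC.
have [l0 l2] := heavy_sq.
apply: Or31; have [kE|[jE kE]] := heavy_middle lr; last first.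
  apply: reduces_nbrs; case E : (nbrs X) => [//|u N]; exfalso.
  have uN : u \in nbrs X by rewrite E mem_head.
  have [uD up' _ [t tk ut]] := line_nbr uN.
  rewrite jE in gl glC; have [k1 k2 k4] : [/\ (0 < k)%N, (1 < k)%N & (3 < k)%N] by rewrite kE.
  have ux := link_neq1 pD (nth_in tk) uD up' ut.
  have : (t < 4)%N by rewrite -kE.
  case: t tk ut ux => [|[|[|[|//]]]] tk ut ux _.
  - have a1 := c2 k2; have a2 := c2 k4.
    by apply: (@no_F4 u (x 0) (x 1) (x 2) (x 3)) => //; try (uniq_tac || sub_tac).
  - by apply: (@no_inner u 1 j _ uD up' ut _ jk l0 l2 (lexx _)); rewrite jE.
  - apply: (@seg_excess2 p up pD sp 2 0 u (x 3) (x 1) sq2) => //; try lra; rewrite ?addn0.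
    + by uniq_tac.
    + by apply: hangs_out ut => //; rewrite ?addn0.
    + by have := @hangs_next p up pD sp 2 0; rewrite addn0; apply.
    + by apply: hangs_prev => //; rewrite addn0.
    + by exists (x 2) => //; apply: mem_seg.
  - have a1 := c1 k2; have a2 := c1 k4.
    by apply: (@no_F4 u (x 3) (x 2) (x 1) (x 0)) => //; try (uniq_tac || sub_tac).
have jp : (0 < j)%N by move: k3; rewrite kE; case: (j).
have kjE : j.-1.+1 = j by rewrite prednK.
have lp : (j.-1.+1 < k)%N by rewrite kjE.
have side u v : u \in nbrs X -> v \in nbrs X -> u != v -> adj u (x 0) -> adj v (x j.+1) ->
    j = 1%N -> False.
  move=> /line_nbr[uD up' _ _] /line_nbr[vD vp _ _] uv u0 v0 jE; rewrite jE in v0 gl.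
  have [k1 k2] : (0 < k)%N /\ (1 < k)%N by rewrite kE.
  have kk : (2 < k)%N by rewrite kE jE.
  have x1 := link_neq1 pD (nth_in k1) uD up' u0; have x2 := link_neq1 pD (nth_in kk) vD vp v0.
  have a1 := c2 k2; apply: (@no_F4 u (x 0) (x 1) (x 2) v) => //; try (uniq_tac || sub_tac).
  by rewrite linkC.
have right u : u \in nbrs X -> adj u (x j.+1) -> j = 1%N.
  move=> /line_nbr[uD up' _ _] u0; apply: contrapT => j1.
  have [e1 e2] : j.-1.+1 = j /\ j.-2.+1 = j.-1 by move: jp j1; clear; lia.
  have j2k : (j.-2.+1 < k)%N by rewrite e2; exact: leq_ltn_trans (leq_pred j) jk'.
  have := c2 lp; have := c2 j2k; rewrite e1 e2 => a1 a2.
  have ux := link_neq1 pD (nth_in jk) uD up' u0.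
  apply: (@no_F4 (x j.-2) (x j.-1) (x j) (x j.+1) u) => //; try (uniq_tac || sub_tac).
  by rewrite linkC.
have n1 : (size (nbrs X) <= 1)%N.
  apply: size_le1 => // u v uN vN uv.
  have [uD up' _ _] := line_nbr uN; have [vD vp _ _] := line_nbr vN.
  case: (heavy_left_nbr kE uN) (heavy_left_nbr kE vN) => [u0|u1] [v0|v1].
  - exact: heavy_left_two uN vN uv u0 v0.
  - exact: side uN vN uv u0 v1 (right v vN v1).
  - by apply: (side v u) (right u uN u1); rewrite // eq_sym.
  - exact: heavy_right uD up' vD vp uv u1 v1.
case E : (nbrs X) => [|n N]; first by apply: reduces_nbrs; rewrite E.
have nN : n \in nbrs X by rewrite E mem_head.
have [n0|nr] := heavy_left_nbr kE nN; first exact: reduces_one (B_extra h2 kE nN n0) n1.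
have jE := right n nN nr; have [nD np nR _] := line_nbr nN.
rewrite jE in kE nr h2; have [k1 k2] : (0 < k)%N /\ (1 < k)%N by rewrite kE.
have n2 : n <> x 2 by apply/eqP; ne_tac.
have nl : link n (x 2) = 1.
  apply: link1 => //; first exact: xD.
  move=> hv; have lq := link_gt0 nD (xD k3) n2 nr.
  apply: (@seg_excess3 p up pD sp 2 0 n (x 1) (link n (x 2)) sq2) => //; rewrite ?addn0//; try lra.
  - by ne_tac.
  - by apply: hangs_out nr => //; rewrite ?addn0.
  - by apply: hangs_prev => //; rewrite addn0.
  - by exists (x 2) => //; apply: mem_seg.
  - by exists (x 2); [apply: mem_seg|rewrite h2].
have l01 : link (x 0) (x 1) = 1 by apply: (@heavy_unique 0 j) => //; rewrite jE.
have v1 : val2 sq2 (1%:Z, 0%:Z) = 1 :> R by rewrite /val2 /= mul0r addr0.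
have vg : val2 sq2 (0%:Z, 1%:Z) = sq2 :> R by rewrite /val2 /= mul1r add0r.
have sw : uniq [:: n; x 2; x 1; x 0] by uniq_tac.
have subw : {subset [:: n; x 2; x 1; x 0] <= D} by sub_tac.
(* The root of F_4 orthogonal to the three vertices other than [n]. *)
apply: (@reduces_one (eval2 sq2 [:: n; x 2; x 1; x 0]
  [:: (2%:Z, 0%:Z); (3%:Z, 0%:Z); (0%:Z, 2%:Z); (0%:Z, 1%:Z)])) => //.
apply: (@explicit_extra sq2 (0%:Z, 2%:Z) X _ [:: (0%N, (1%:Z, 0%:Z)); (0%N, (0%:Z, 1%:Z));
  (0%N, (1%:Z, 0%:Z))] [:: 1; 2; 1; 3; 2; 1; 0]%N _ 0) => //.
- by rewrite s2 /= mul0r add0r.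
- by lra.
- rewrite /= !v1 vg nl (linkC (x 2)) h2 (linkC (x 1)) l01; repeat (split => //); try exact/eqP/oner_neq0.
  by apply/eqP; rewrite gt_eqF//; lra.
- move=> y; rewrite Xp => /(nthP 0)[t tk <-].
  have : (t < 3)%N by apply: leq_trans tk _; rewrite kE.
  by case: t {tk} => [|[|[|//]]] _; [exists 3%N|exists 2%N|exists 1%N].
- move=> u uR; have [uD up' u0] := rest_line uR; split.
    by case=> [|[|[|[|//]]]] //= _ _; apply: u0.
  suff -> : link n u = 0 by rewrite mulr0; apply: Or41.
  apply/eqP; apply: contrapT => /negP nu.
  have un' : u != n by apply: contraNneq nR => <-.
  have aun : 1 <= link u n by rewrite linkC; apply: link_ge1 => //; apply/eqP; rewrite eq_sym.
  apply: (@no_F4 u n (x 2) (x 1) (x 0)) => //; try (uniq_tac || sub_tac).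
  + by rewrite nl.
  + by rewrite linkC h2.
  + by rewrite linkC l01.
Qed.

End Heavy.

End LineStep.

(** For label 4 the root is the reflection of [h] in [a]; for label 5 it is the root of H_3
    orthogonal to the middle vertex; a larger label is impossible, since the second neighbour would
    bring the sum of squares to 4. *)
Lemma single_heavy X (h a b : V) : {subset X <= D} -> X =i [:: h] -> nbrs X = [:: a; b] \/ nbrs X = [:: b; a] ->
  link a h <> 1 -> exists e, extra X e.
Proof.
move=> XD Xh E la.
have sp : sorted adj [:: h] by []. have up : uniq [:: h] by []. have p0 : [:: h] <> [::] by [].
have nb u (uN : u \in nbrs X) := line_nbr Xh uN.
have [aN bN] : a \in nbrs X /\ b \in nbrs X by case: E => ->; rewrite !inE !eqxx ?orbT.
have un := nbrs_uniq X.
have ab : a != b by case: E un => -> /= /andP[]; rewrite inE // eq_sym.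
have hX : h \in X by rewrite Xh mem_head.
have hD := XD h hX.
have [aD ap aR [ta ta1 aa]] := nb a aN; have [bD bp bR [tb tb1 bb]] := nb b bN.
have {ta ta1}aa : adj a h by case: ta ta1 aa => [|[]].
have {tb tb1}bb : adj b h by case: tb tb1 bb => [|[]].
have ah : a != h by move: ap; rewrite inE. have bh : b != h by move: bp; rewrite inE.
have ah' : a <> h by exact/eqP. have bh' : b <> h by exact/eqP.
have la0 := link_gt0 aD hD ah' aa; have lb0 := link_gt0 bD hD bh' bb.
have lb1 := link_ge1 bD hD bh' bb.
have two m m' : m <= link a h -> m' <= link b h -> 0 < m -> 0 < m' -> 4 <= m ^+ 2 + m' ^+ 2 -> False.
  move=> h1 h2 h3 h4 h5; apply: (@excess3 [:: h] a b m m') => //.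
  - by rewrite /= !inE negb_or ab ah bh.
  - by move=> u; rewrite !inE => /or3P[] /eqP ->.
  - by exists h; rewrite ?mem_head.
  - by exists h; rewrite ?mem_head.
have s2 := sq2E R; have s2p := sq2_ge R; have s3 := sq3E R; have s3p := sq3_ge R.
have g2 := goldenE R; have gp := golden_ge R.
have uu u : u \in rest X -> [/\ u \in D, u != h, u != a, u != b & link h u = 0].
  move=> uR; have [uD uX uo] := rest_orth uR; split => //.
  - by apply: contraNneq uX => ->.
  - by apply: contraNneq aR => <-.
  - by apply: contraNneq bR => <-.
  - by rewrite linkC; exact: uo.
have := config_link cD aD hD ah'; case=> [e|//|e|[e|e]]; first by rewrite e ltxx in la0.
- exists (h + sq2 *: vsum (rcons [::] a)).
  apply: heavy_extra => //; rewrite /= 1?linkC//.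
    by move=> u; rewrite !inE => /orP[] /eqP ->.
  move=> u uR; have [uD uh ua ub _] := uu u uR.
  have [->|/eqP lu] := eqVneq (link a u) 0; [by left|right].
  have au : a <> u by apply/eqP; rewrite eq_sym.
  apply: link1 => //; first exact/eqP.
  move=> hv; have anu : adj a u by exact/eqP.
  have lp := link_gt0 aD uD au anu.
  have h2 : 0 < sq2 by lra.
  have h4 : 4 <= sq2 ^+ 2 + link a u ^+ 2 by lra.
  have h5 : sq2 <= link a h by rewrite e.
  apply: (@excess3 [:: a] h u sq2 (link a u)) => //.
  + by rewrite /= !inE negb_or ua eq_sym uh eq_sym ah.
  + by move=> v; rewrite !inE => /or3P[] /eqP ->.
  + by exists a; rewrite ?mem_head// linkC e.
  + by exists a; rewrite ?mem_head// linkC.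
- have lb : link b h = 1.
    apply: link1 => // hv; apply: (two golden (link b h)) => //; first by rewrite e.
      by lra.
    by rewrite g2; lra.
  have v1 : val2 golden (1%:Z, 0%:Z) = 1 :> R by rewrite /val2 /= mul0r addr0.
  have vg : val2 golden (0%:Z, 1%:Z) = golden :> R by rewrite /val2 /= mul1r add0r.
  exists (eval2 golden [:: b; h; a] [:: (1%:Z, 0%:Z); (1%:Z, 1%:Z); (1%:Z, 1%:Z)]).
  apply: (@explicit_extra golden (1%:Z, 1%:Z) X _ [:: (0%N, (1%:Z, 0%:Z)); (0%N, (0%:Z, 1%:Z))]
    [:: 1; 2; 1; 2]%N _ 0) => //.
  + by rewrite g2 /= mul1r.
  + by lra.
  + rewrite /= v1 vg lb linkC e; repeat (split => //); try exact/eqP/oner_neq0.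
    by apply/eqP; rewrite gt_eqF//; lra.
  + by rewrite /= !inE negb_or bh (eq_sym b) ab eq_sym ah.
  + by move=> v; rewrite !inE => /or3P[] /eqP ->.
  + by move=> v; rewrite Xh inE => /eqP ->; exists 1%N.
  + move=> u uR; have [uD uh ua ub hu] := uu u uR.
    split; last by rewrite v1 mul1r; exact: rest_value uR bD bR.
    case=> [|[|[|//]]] //= _ _.
    apply/eqP; apply: contrapT => /negP au.
    have lau : 1 <= link a u by apply: link_ge1 => //; apply/eqP; rewrite eq_sym.
    apply: (@no_353 b h a u) => //; rewrite ?(linkC h) ?e//.
    * by rewrite /= !inE !negb_or bh (eq_sym b a) ab (eq_sym b u) ub (eq_sym h a) ah (eq_sym h u) uh (eq_sym a u) ua.
    * by move=> v; rewrite !inE => /or4P[] /eqP ->.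
- by exfalso; apply: (two sq3 1) => //; lra.
Qed.

(** A_1 costs one in every case. With two neighbours one orthogonal root is gained. Three neighbours
    are joined by simple edges and form D_4 with [h]; the two sums [a + h + b] and [a + h + c] are
    orthogonal to [h] and to each other. *)
Lemma single_reducible X (h : V) : {subset X <= D} -> X =i [:: h] -> reducible X.
Proof.
move=> XD Xh; have sp : sorted adj [:: h] by []. have up : uniq [:: h] by [].
have p0 : [:: h] <> [::] by [].
have simple j : (j.+1 < size [:: h])%N -> link (nth 0 [:: h] j) (nth 0 [:: h] j.+1) = 1 by [].
have gA : gram_A X 1.
  by exists [:: h]; split => // a b /andP[ab b1]; move: ab b1; clear; case: b => // b; rewrite ltnS ltn0.
have un := nbrs_uniq X.
have ll u v v' : uniq [:: u; v; v'] -> {subset [:: u; v; v'] <= nbrs X} -> link u h = 1.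
  move=> uu sub; have uN := sub u (mem_head _ _).
  have [_ _ _ [t t1 ut]] := line_nbr Xh uN.
  have t0 : t = 0%N by case: t t1 ut => [|[]].
  by rewrite t0 in ut; have := ends_light XD up sp Xh p0 uu sub (isT : (0 < size [:: h])%N) ut.
have xe a c : a \in nbrs X -> c \in nbrs X -> a != c -> link a h = 1 -> link c h = 1 ->
    extra X (vsum [:: a; h; c]).
  by move=> aN cN ac la lc; have := ends_extra XD up sp Xh p0 simple aN cN ac la lc.
apply: Or32; split; last by left.
case E : (nbrs X) un => [|a [|b [|c [|d N]]]].
- by move=> _; apply: reduces_nbrs; rewrite E.
- by move=> _; apply: reduces_nbrs; rewrite E.
- rewrite /= inE andbT => ab.
  suff [e ee] : exists e, extra X e by apply: reduces_one ee _; rewrite E.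
  have [la|la] := pselect (link a h = 1); last by apply: (@single_heavy X h a b) => //; left.
  have [lb|lb] := pselect (link b h = 1); last by apply: (@single_heavy X h b a) => //; right.
  by exists (vsum [:: a; h; b]); apply: xe; rewrite ?E ?inE ?eqxx ?orbT.
- move=> un; have mE v : v \in [:: a; b; c] -> v \in nbrs X by rewrite E.
  have [aN bN cN] : [/\ a \in nbrs X, b \in nbrs X & c \in nbrs X].
    by split; apply: mE; rewrite !inE eqxx ?orbT.
  have [ab ac bc] : [/\ a != b, a != c & b != c].
    by move: un; rewrite /= !inE !negb_or => /and3P[/andP[? ?] ? _].
  have pe l : perm_eq l [:: a; b; c] -> uniq l /\ {subset l <= nbrs X}.
    by move=> pl; split; [rewrite (perm_uniq pl)|move=> z; rewrite (perm_mem pl); exact: mE].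
  have [u1 s1] := pe [:: a; b; c] (perm_refl _).
  have [u2 s2] : uniq [:: b; a; c] /\ {subset [:: b; a; c] <= nbrs X}.
    by apply: pe; rewrite (perm_catCA [:: b] [:: a] [:: c]).
  have [u3 s3] : uniq [:: c; a; b] /\ {subset [:: c; a; b] <= nbrs X}.
    by apply: pe; rewrite (perm_catC [:: c] [:: a; b]).
  have la := ll _ _ _ u1 s1; have lb := ll _ _ _ u2 s2; have lc := ll _ _ _ u3 s3.
  have e1 := xe a b aN bN ab la lb; have e2 := xe a c aN cN ac la lc.
  have l12 : link (vsum [:: a; h; b]) (vsum [:: a; h; c]) = 0.
    have hX : h \in X by rewrite Xh mem_head.
    have e1h := extra_orth e1 hX.
    have lab := nbrs_link0 XD up sp Xh p0 aN bN ab; have lac := nbrs_link0 XD up sp Xh p0 aN cN ac.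
    have lbc := nbrs_link0 XD up sp Xh p0 bN cN bc.
    have [[ra _] [rb _]] : (rt a /\ C a) /\ (rt b /\ C b).
      by split; apply: (config_node cD); [have [] := line_nbr Xh aN|have [] := line_nbr Xh bN].
    have vE (u v w : V) : vsum [:: u; v; w] = u + (v + w) by rewrite /vsum !big_cons big_nil addr0.
    rewrite (vE a h c) !linkDr e1h vE !linkDl link_diag// (linkC h) la (linkC b a) lab lac lbc (linkC h) lc.
    by ring.
  apply: reduces_le (@reduces_extra X [:: vsum [:: a; h; b]; vsum [:: a; h; c]] _ _ _).
  + by rewrite E.
  + rewrite /= inE andbT; apply/eqP => e; move: l12; rewrite -e link_diag; last exact: extra_rt e1.
    by move/eqP; rewrite oppr_eq0 pnatr_eq0.
  + by move=> e; rewrite !inE => /orP[] /eqP ->.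
  + move=> e e'; rewrite !inE => /orP[] /eqP -> /orP[] /eqP -> // _; first [rewrite l12 | rewrite linkC l12]; exact: Or41.
- move=> un; exfalso; apply: (line_three XD up sp Xh p0 (a := a) (b := b) (c := c) (d := d)).
    by move: un; rewrite -[_ :: _]/([:: a; b; c; d] ++ N) cat_uniq => /andP[].
  by move=> v; rewrite E !inE => /or4P[] ->; rewrite ?orbT.
Qed.

(** B_2 has at most one neighbour at each end. Each is replaced by the root that [B_extra] provides,
    and when both occur the two new roots again meet with label 4. *)
Lemma sq2_reducible_short X (h g : V) : {subset X <= D} -> uniq [:: h; g] -> sorted adj [:: h; g] ->
  X =i [:: h; g] -> link h g = sq2 -> reducible X.
Proof.
move=> XD up sp Xp hg; have p0 : [:: h; g] <> [::] by [].
have up' : uniq [:: g; h] by move: up; rewrite /= !inE eq_sym.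
have sp' : sorted adj [:: g; h] by move: sp; rewrite /= !andbT adjC.
have Xp' : X =i [:: g; h] by move=> u; rewrite Xp !inE orbC.
have p0' : [:: g; h] <> [::] by [].
have jk : (1 < size [:: h; g])%N by []. have jk' : (1 < size [:: g; h])%N by [].
have gh : link g h = sq2 by rewrite linkC.
have s2p := sq2_ge R.
have h1 : link (nth 0 [:: h; g] 0) (nth 0 [:: h; g] 1) <> 1 by rewrite /= hg; lra.
have h1' : link (nth 0 [:: g; h] 0) (nth 0 [:: g; h] 1) <> 1 by rewrite /= gh; lra.
have side u : u \in nbrs X -> adj u h \/ adj u g.
  by move=> uN; exact: (heavy_left_nbr XD up sp Xp p0 (j := 0) jk h1 erefl uN).
have tl u v (uN : u \in nbrs X) (vN : v \in nbrs X) (uv : u != v) (a : adj u h) (b : adj v h) :=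
  heavy_left_two XD up sp Xp (j := 0) jk h1 uN vN uv a b.
have tr u v (uN : u \in nbrs X) (vN : v \in nbrs X) (uv : u != v) (a : adj u g) (b : adj v g) :=
  heavy_left_two XD up' sp' Xp' (j := 0) jk' h1' uN vN uv a b.
have el n : n \in nbrs X -> adj n h -> extra X (g + sq2 *: vsum [:: h; n]).
  by move=> nN nh; exact: (B_extra XD up sp Xp p0 (j := 0) jk h1 hg erefl nN nh).
have er n : n \in nbrs X -> adj n g -> extra X (h + sq2 *: vsum [:: g; n]).
  by move=> nN nh; exact: (B_extra XD up' sp' Xp' p0' (j := 0) jk' h1' gh erefl nN nh).
have pair a b : a \in nbrs X -> b \in nbrs X -> a != b -> adj a h -> adj b g ->
    size (nbrs X) = 2%N -> reduces X 0.
  move=> aN bN ab ah bg sN; have e1 := el a aN ah; have e2 := er b bN bg.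
  have lb := heavy_left_link XD up' sp' Xp' (j := 0) jk' h1' bN bg; rewrite /= in lb.
  have lab := nbrs_link0 XD up sp Xp p0 aN bN ab.
  have [bD bp _ _] := line_nbr Xp bN.
  have pD : {subset [:: h; g] <= D} by move=> u; rewrite -Xp => /XD.
  have lbh : link b h = 0.
    exact: (@attach_uniq [:: h; g] up pD sp b 1 0 bD bp isT isT bg isT).
  have o1 : link (g + sq2 *: vsum [:: h; a]) h = 0 by apply: (extra_orth e1); rewrite Xp mem_head.
  have o2 : link (g + sq2 *: vsum [:: h; a]) g = 0.
    by apply: (extra_orth e1); rewrite Xp !inE eqxx orbT.
  have vE (u v : V) : vsum [:: u; v] = u + v by rewrite /vsum !big_cons big_nil addr0.
  have l12 : link (g + sq2 *: vsum [:: h; a]) (h + sq2 *: vsum [:: g; b]) = sq2.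
    rewrite (vE g b) linkDr linkZr linkDr o1 o2 linkDl linkZl vE linkDl (linkC g) lb (linkC h) lbh lab.
    by ring.
  apply: reduces_le (@reduces_extra X [:: g + sq2 *: vsum [:: h; a]; h + sq2 *: vsum [:: g; b]] _ _ _).
  - by rewrite sN.
  - rewrite /= inE andbT; apply/eqP => e; move: l12; rewrite -e link_diag; last exact: extra_rt e1.
    by lra.
  - by move=> e; rewrite !inE => /orP[] /eqP ->.
  - move=> e e'; rewrite !inE => /orP[] /eqP -> /orP[] /eqP -> // _; first [rewrite l12 | rewrite linkC l12]; exact: Or43.
have un := nbrs_uniq X; apply: Or31; case E : (nbrs X) un => [|a [|b [|c N]]].
- by move=> _; apply: reduces_nbrs; rewrite E.
- move=> _; have aN : a \in nbrs X by rewrite E mem_head.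
  by case: (side a aN) => ha; [apply: reduces_one (el a aN ha) _|apply: reduces_one (er a aN ha) _]; rewrite E.
- rewrite /= inE andbT => ab; have aN : a \in nbrs X by rewrite E mem_head.
  have bN : b \in nbrs X by rewrite E !inE eqxx orbT.
  have sN : size (nbrs X) = 2%N by rewrite E.
  case: (side a aN) (side b bN) => ha [hb|hb].
  + by case: (tl a b aN bN ab ha hb).
  + exact: pair aN bN ab ha hb sN.
  + by apply: (pair b a) => //; rewrite eq_sym.
  + by case: (tr a b aN bN ab ha hb).
- rewrite /= !inE !negb_or => /and4P[/and3P[ab ac _] /andP[bc _] _ _]; exfalso.
  have aN : a \in nbrs X by rewrite E mem_head.
  have bN : b \in nbrs X by rewrite E !inE eqxx orbT.
  have cN : c \in nbrs X by rewrite E !inE eqxx !orbT.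
  case: (side a aN) (side b bN) (side c cN) => ka [kb|kb] [kc|kc];
    first [exact: tl ab ka kb | exact: tl ac ka kc | exact: tl bc kb kc |
           exact: tr ab ka kb | exact: tr ac ka kc | exact: tr bc kb kc].
Qed.

Lemma line_reducible X p : {subset X <= D} -> uniq p -> sorted adj p -> p <> [::] -> X =i p ->
  reducible X.
Proof.
move=> XD up sp p0 Xp.
have [simple|ns] := pselect (forall j, (j.+1 < size p)%N -> link (nth 0 p j) (nth 0 p j.+1) = 1).
  have [k1|k1] := leqP (size p) 1; last exact: (simple_reducible_long XD up sp Xp p0 simple k1).
  by case: p up sp p0 Xp simple k1 => [|h [|]] // _ _ _ Xh _ _; exact: single_reducible Xh.
have [j jk hj] : exists2 j, (j.+1 < size p)%N & link (nth 0 p j) (nth 0 p j.+1) <> 1.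
  apply: contrapT => no; apply: ns => j jk; apply: contrapT => hj; by apply: no; exists j.
wlog lr : p up sp p0 Xp ns j jk hj / (size p - j.+2 <= j)%N.
  move=> h; have [le|gt] := leqP (size p - j.+2) j; first exact: (h p up sp p0 Xp ns j).
  have spr : sorted adj (rev p).
    by rewrite rev_sorted (eq_sorted (e' := adj))// => u v; exact: adjC.
  have e1 : (size p - (size p - j.+2).+1 = j.+1)%N by move: jk; clear; lia.
  have e2 : (size p - (size p - j.+2).+2 = j)%N by move: jk; clear; lia.
  have b1 : ((size p - j.+2).+1 < size p)%N by move: jk; clear; lia.
  have n1 : nth 0 (rev p) (size p - j.+2) = nth 0 p j.+1 by rewrite (nth_rev 0 (ltnW b1)) e1.
  have n2 : nth 0 (rev p) (size p - j.+2).+1 = nth 0 p j by rewrite (nth_rev 0 b1) e2.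
  have hl : link (nth 0 (rev p) (size p - j.+2)) (nth 0 (rev p) (size p - j.+2).+1) <> 1.
    by rewrite n1 n2 linkC.
  apply: (h (rev p) _ spr _ _ _ (size p - j.+2)%N); rewrite ?rev_uniq ?size_rev//.
  - by move=> /(congr1 size); rewrite size_rev /=; move: jk; clear; lia.
  - by move=> u; rewrite Xp mem_rev.
  - by move=> /(_ (size p - j.+2)%N b1).
  - by move: gt jk; clear; lia.
case: (heavy_value XD up sp Xp jk hj) => [h2|hg|h3].
- have [k3|k2] := ltnP 2 (size p); first exact: (sq2_reducible_long XD up sp Xp p0 jk hj h2 lr k3).
  case: p up sp p0 Xp ns jk hj lr h2 k2 => [|h [|g [|]]] // up sp p0 Xp _ jk _ _ h2 _.
  by apply: (@sq2_reducible_short X h g) => //; case: (j) jk h2.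
- exact: (golden_reducible XD up sp Xp p0 jk hj hg lr).
- by apply: Or31; apply: reduces_nbrs; rewrite (heavy_sq3 XD up sp Xp jk h3).
Qed.

Lemma all_reducible X : {subset X <= D} -> connected X -> X <> [::] -> reducible X.
Proof.
move=> XD cX X0; case: (shape XD cX X0) => [[p [up sp p0 Xp]]|[p [z [i tp]]]].
  exact: line_reducible Xp.
exact: tripod_reducible tp.
Qed.

End Configuration.

(** * Coxeter labels, diagram types and components *)

Section DiagramLinks.
Variables (R : realType) (Pi : choiceType) (W : groupType) (gen : Pi -> W).
Hypothesis cs : coxeter_system gen.
Local Notation V := (rootspace R Pi).
Local Notation sr := (@simple_root R Pi).
Local Notation form := (@Defs.form R Pi W gen).
Local Notation sq2 := (sq2 R).
Local Notation sq3 := (sq3 R).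
Local Notation golden := (golden R).
Local Notation lk := (link form).

Lemma pos_sqr_eq (t s : R) : 0 < t -> 0 < s -> t ^+ 2 = s ^+ 2 -> t = s.
Proof.
move=> t0 s0 e; have: (t - s) * (t + s) = 0 by rewrite -subr_sqr e subrr.
by move/eqP; rewrite mulf_eq0 subr_eq0 => /orP[/eqP//|/eqP]; lra.
Qed.

Lemma pidiv_mul m : (0 < m)%N -> pi / m%:R * m%:R = pi :> R.
Proof. by move=> m0; rewrite divfK// pnatr_eq0 -lt0n. Qed.

Lemma cos_pidiv_gt0 m : (2 < m)%N -> 0 < cos (pi / m%:R : R).
Proof.
move=> m2; have pg := pi_gt0 R; have m0 : 0 < m%:R :> R by rewrite ltr0n; exact: leq_trans m2.
apply: cos_gt0_pihalf; apply/andP; split.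
  by rewrite (lt_trans (y := 0))// ?oppr_lt0 divr_gt0.
by rewrite ltr_pM2l// ltf_pV2 ?posrE// ltr_nat.
Qed.

Lemma two_cos2 : 2 * cos (pi / 2%:R) = 0 :> R.
Proof. by rewrite cos_pihalf mulr0. Qed.

Lemma two_cos3 : 2 * cos (pi / 3%:R) = 1 :> R.
Proof.
have := @cos_pidiv_gt0 3 isT; have := @pidiv_mul 3 isT; set x : R := pi / 3%:R => hx c0.
have e : x *+ 2 = pi - x by rewrite mulr2n; lra.
have := cos_mulr2n x; rewrite e cosB cospi sinpi mul0r addr0 mulN1r mulr2n expr2 => h.
have: (2 * cos x - 1) * (cos x + 1) = 0.
  by rewrite mulrBl mulrDr mulr1 -!mulrA; move: h; set c := cos x; lra.
by move/eqP; rewrite mulf_eq0 => /orP[]/eqP; lra.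
Qed.

Lemma two_cos4 : 2 * cos (pi / 4%:R) = sq2 :> R.
Proof.
have := @cos_pidiv_gt0 4 isT; have := @pidiv_mul 4 isT; set x : R := pi / 4%:R => hx c0.
have e : x *+ 2 = pi / 2 by rewrite mulr2n; lra.
have := cos_mulr2n x; rewrite e cos_pihalf mulr2n => h.
have s2 := sq2E R; have := sq2_ge R => s2p.
apply: pos_sqr_eq; [lra|lra|rewrite s2 exprMn; lra].
Qed.

(** For x = pi/5 one has cos 3x = - cos 2x, a cubic equation in cos x that factors into a linear and
    a quadratic part; positivity selects the root. *)
Lemma two_cos5 : 2 * cos (pi / 5%:R) = golden :> R.
Proof.
have := @cos_pidiv_gt0 5 isT; have := @pidiv_mul 5 isT; set x : R := pi / 5%:R => hx c0.
have e : x *+ 2 + x = pi - x *+ 2 by rewrite mulr2n; lra.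
have sx := sin2cos2 x.
have := cosD (x *+ 2) x; rewrite e cosB cospi sinpi mul0r addr0 mulN1r cos_mulr2n sin_mulr2n !mulr2n.
move: sx c0; set c := cos x; set s := sin x => sx c0 h.
have h' : (c ^+ 2 + c ^+ 2 - 1) * c - 2 * c * (1 - c ^+ 2) = - (c ^+ 2 + c ^+ 2 - 1).
  by rewrite h -sx; ring.
have: (c + 1) * (4 * c ^+ 2 - 2 * c - 1) = 0.
  have -> : (c + 1) * (4 * c ^+ 2 - 2 * c - 1) =
    (c ^+ 2 + c ^+ 2 - 1) * c - 2 * c * (1 - c ^+ 2) + (c ^+ 2 + c ^+ 2 - 1) by ring.
  by rewrite h' addNr.
move/eqP; rewrite mulf_eq0 => /orP[]/eqP; first by lra.
have ge := goldenE R; have gp := golden_ge R => h5.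
have: (2 * c - golden) * (2 * c + golden - 1) = 0.
  have -> : (2 * c - golden) * (2 * c + golden - 1) =
    4 * c ^+ 2 - 2 * c - 1 - (golden ^+ 2 - golden - 1) by ring.
  by rewrite h5 ge; ring.
by move/eqP; rewrite mulf_eq0 => /orP[]/eqP; lra.
Qed.

Lemma two_cos6 m : (6 <= m)%N -> sq3 <= 2 * cos (pi / m%:R) :> R.
Proof.
move=> m6; have := @cos_pidiv_gt0 6 isT; have := @pidiv_mul 6 isT; have h3 := @pidiv_mul 3 isT.
set x : R := pi / 6%:R => hx c0.
have e : x *+ 2 = pi / 3%:R by rewrite mulr2n; lra.
have := cos_mulr2n x; rewrite e mulr2n => h; have c3 := two_cos3.
have s3 := sq3E R; have s3p := sq3_ge R.
have -> : sq3 = 2 * cos x by apply: pos_sqr_eq; [lra|lra|rewrite s3 exprMn; lra].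
have m0 : 0 < m%:R :> R by rewrite ltr0n (leq_trans _ m6).
have pg := pi_gt0 R.
have le : pi / m%:R <= x by rewrite ler_pM2l// lef_pV2 ?posrE// ler_nat.
have p0 : 0 < pi / m%:R :> R by rewrite divr_gt0.
rewrite ler_pM2l// leNgt ltr_cos -?leNgt// in_itv /=; apply/andP; split; lra.
Qed.

Lemma cox_link i j : i != j -> [/\ cox_value (lk (sr i) (sr j)),
  lk (sr i) (sr j) = 0 <-> cox_m gen i j = 2%N,
  lk (sr i) (sr j) = 1 -> cox_m gen i j = 3%N &
  lk (sr i) (sr j) = golden -> cox_m gen i j = 5%N].
Proof.
move=> ij; rewrite /link form_roots /cox_form.
have s2 := sq2_ge R; have s2' := sq2_le R; have s3 := sq3_ge R; have s3E := sq3E R.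
have g1 := golden_ge R; have g2 := golden_le R.
have s32 : sq3 <= 2.
  rewrite leNgt; apply/negP => h.
  have h2 : 0 < (sq3 - 2) * (sq3 + 2) by apply: mulr_gt0; lra.
  have e : (sq3 - 2) * (sq3 + 2) = sq3 ^+ 2 - 4 by ring.
  by rewrite e s3E in h2; lra.
have m1 := cox_m_neq1 cs ij.
case: eqP => m0.
  have -> : - (2 * -1) = 2 :> R by ring.
  rewrite m0; clear m0 m1; split; first by apply: Or44; right.
  - by split => // h; exfalso; lra.
  - by move=> h; exfalso; lra.
  - by move=> h; exfalso; lra.
rewrite mulrN opprK; case: (cox_m gen i j) m0 m1 => [|[|[|[|[|[|m]]]]]] // _ _.
- by rewrite two_cos2; split => // [|h|h]; [exact: Or41|exfalso; lra|exfalso; lra].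
- rewrite two_cos3; split => //; first exact: Or42.
  + by split => // h; exfalso; lra.
  + by move=> h; exfalso; lra.
- rewrite two_cos4; split; first exact: Or43.
  + by split => // h; exfalso; lra.
  + by move=> h; exfalso; lra.
  + by move=> h; exfalso; lra.
- rewrite two_cos5; split => //; first by apply: Or44; left.
  + by split => // h; exfalso; lra.
  + by move=> h; exfalso; lra.
- have h6 := @two_cos6 m.+4.+2 isT; split; first by apply: Or44; right.
  + by split => // h; exfalso; lra.
  + by move=> h; exfalso; lra.
  + by move=> h; exfalso; lra.
Qed.

Lemma link_edge i j : i != j -> lk (sr i) (sr j) = 0 <-> ~~ cox_edge gen i j.
Proof.
move=> ij; have [_ h0 _ _] := cox_link ij; rewrite h0 /cox_edge.
by have := cox_m_neq1 cs ij; case: (cox_m gen i j) => [|[|[|m]]].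
Qed.

Lemma sr_inj : injective sr.
Proof.
move=> i j /(congr1 (monalg.mcoeff i)); rewrite !coef_root eqxx.
by case: eqP => [->//|_] /eqP; rewrite oner_eq0.
Qed.

Definition node_seq (X : set Pi) : seq V := [seq sr i | i <- fset_set X].

Lemma node_seqP X u : finite_set X -> reflect (exists2 i, X i & u = sr i) (u \in node_seq X).
Proof.
move=> fX; apply: (iffP mapP) => -[i iX ->]; exists i => //.
  by move: iX; rewrite in_fset_set// inE.
by rewrite in_fset_set// inE.
Qed.

Lemma gram_iso X n M (N : nat -> nat -> nat) : finite_set X ->
  (forall a b, N a b = N b a) -> (forall a, N a a = 1%N) ->
  (forall a b i j, (a < b < n)%N -> i != j -> lk (sr i) (sr j) = M a b -> cox_m gen i j = N a b) ->
  gram_type form (node_seq X) n M -> diagram_iso gen n N X.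
Proof.
move=> fX Ns N1 MN [q [sq uq Xq lq]].
have /choice[f fP] : forall k : 'I_n, exists i, X i /\ nth 0 q k = sr i.
  move=> k; have : nth 0 q k \in q by apply: mem_nth; rewrite sq.
  by rewrite -Xq => /(node_seqP _ fX)[i Xi ->]; exists i.
have fi : injective f.
  move=> k l e; apply: ord_inj; apply/eqP; rewrite -(nth_uniq 0 (s := q)) ?sq ?ltn_ord//.
  by rewrite (fP k).2 (fP l).2 e.
exists f; split => //.
  apply/seteqP; split => [i [k _ <-]|i Xi]; first exact: (fP k).1.
  have : sr i \in q by rewrite -Xq; apply/(node_seqP _ fX); exists i.
  move=> iq; have kl : (index (sr i) q < n)%N by rewrite -sq index_mem.
  by exists (Ordinal kl) => //; apply: sr_inj; rewrite -(fP _).2 /= nth_index.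
have lt_case (k l : 'I_n) : (k < l)%N -> cox_m gen (f k) (f l) = N k l.
  move=> kl; apply: MN; first by rewrite kl /=.
    by apply: contraTneq kl => /fi ->; rewrite ltnn.
  by rewrite -(fP k).2 -(fP l).2 lq// kl /=.
move=> k l; case: (ltngtP k l) => [kl|lk|e]; first exact: lt_case.
- by rewrite cox_m_sym// lt_case// Ns.
- by rewrite (val_inj e) cox_m_diag// N1.
Qed.

Lemma gram_iso_simple X n M (e : rel nat) : finite_set X ->
  (forall a b, (a < b < n)%N -> M a b = (e a b || e b a)%:R) ->
  gram_type form (node_seq X) n M -> diagram_iso gen n (labels 3 e) X.
Proof.
move=> fX Me; apply: gram_iso => // [a b|a|a b i j ab ij].
- by rewrite /labels eq_sym orbC.
- by rewrite /labels eqxx.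
have [_ l0 l1 _] := cox_link ij; rewrite Me// /labels ltn_eqF; last by case/andP: ab.
by case: (e a b || e b a) => /= h; [exact: l1|exact: l0.1].
Qed.

Lemma gram_type_A X m : finite_set X -> gram_A form (node_seq X) m -> type_A gen m X.
Proof.
move=> fX; apply: gram_iso_simple => // a b /andP[ab _]; congr (_%:R); rewrite /Defs.chain eq_sym.
by rewrite (_ : (b.+1 == a) = false) ?orbF//; apply/eqP; move: ab; clear; lia.
Qed.

Lemma gram_type_D X m : finite_set X -> gram_D form (node_seq X) m -> type_D gen m X.
Proof.
move=> fX; apply: gram_iso_simple => // a b /andP[ab bm]; rewrite /Defs.chain.
have -> : (b.+1 == a) = false by apply/eqP; move: ab; clear; lia.
have -> : (a == m.-1) = false by apply/eqP; move: ab bm; clear; lia.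
rewrite andbF /= orbF; case: eqP => [->|ne]; first by rewrite ltnn andbF andbT.
have -> : (b < m.-1)%N by move: bm ne; clear; lia.
by rewrite andbT andbF orbF eq_sym.
Qed.

Lemma gram_type_E6 X : finite_set X -> gram_E6 form (node_seq X) -> type_E6 gen X.
Proof.
move=> fX; apply: gram_iso_simple => // a b /andP[ab bm]; rewrite /Defs.chain.
have -> : (b.+1 == a) = false by apply/eqP; move: ab; clear; lia.
have -> : (a == 5)%N = false by apply/eqP; move: ab bm; clear; lia.
rewrite andbF /= orbF; case: eqP => [->|ne]; first by rewrite ltnn andbF andbT.
have -> : (b < 5)%N by move: bm ne; clear; lia.
by rewrite andbT andbF orbF eq_sym.
Qed.

Lemma gram_type_I5 X : finite_set X -> gram_I5 form (node_seq X) -> type_I2_5 gen X.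
Proof.
move=> fX; apply: gram_iso => // [a b|a|a b i j ab ij].
- by rewrite /labels eq_sym orbC.
- by rewrite /labels eqxx.
have [_ _ _ l5] := cox_link ij => /l5 ->; move: ab => /andP[].
by case: a => [|a]; case: b => [|[|b]].
Qed.

Section Components.
Variable J : set Pi.
Local Notation comp := (component_of gen J).

Lemma cox_edgeC i j : cox_edge gen i j = cox_edge gen j i.
Proof. by rewrite /cox_edge cox_m_sym. Qed.

Lemma comp_refl i : comp i i. Proof. by exists [::]. Qed.

Lemma comp_sub i : J i -> comp i `<=` J.
Proof.
move=> Ji j [p [pp <-]]; elim: p i Ji pp => [|a p IH] i Ji //= /andP[/andP[_ aJ] pp].
by apply: IH pp; rewrite inE in aJ.
Qed.

Lemma comp_step i a b : comp i a -> J b -> cox_edge gen a b -> comp i b.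
Proof.
move=> [p [pp <-]] Jb ab; exists (rcons p b); rewrite last_rcons rcons_path pp ab /=.
by split => //; apply/mem_set.
Qed.

Lemma comp_trans i a b : comp i a -> comp a b -> comp i b.
Proof.
by move=> [p [pp <-]] [q [qp <-]]; exists (p ++ q); rewrite cat_path last_cat pp qp.
Qed.

Lemma comp_sym i a : J i -> comp i a -> comp a i.
Proof.
move=> Ji [p [pp <-]]; elim: p i Ji pp => [|b p IH] i Ji /=; first by move=> _; exact: comp_refl.
move=> /andP[/andP[ib bJ] pp]; rewrite inE in bJ.
by apply: comp_step (IH b bJ pp) Ji _; rewrite cox_edgeC.
Qed.

Lemma comp_eq i a : J i -> comp i a -> comp i = comp a.
Proof.
move=> Ji ia; apply/seteqP; split => b.
  exact: comp_trans (comp_sym Ji ia).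
exact: comp_trans ia.
Qed.

Lemma component_eq X i : is_component gen J X -> X i -> X = comp i.
Proof. by move=> [k Jk ->]; exact: comp_eq. Qed.

Lemma component_sub X : is_component gen J X -> X `<=` J.
Proof. by move=> [i Ji ->]; exact: comp_sub. Qed.

Lemma components_orth X Y i j : is_component gen J X -> is_component gen J Y -> X <> Y ->
  X i -> Y j -> i != j /\ lk (sr i) (sr j) = 0.
Proof.
move=> cX cY XY Xi Yj; have ij : i != j.
  by apply/eqP => e; apply: XY; rewrite (component_eq cX Xi) (component_eq cY Yj) e.
split => //; apply/(link_edge ij)/negP => ed; apply: XY.
have Xj : X j.
  have -> := component_eq cX Xi.
  by apply: comp_step (comp_refl i) _ ed; exact: component_sub cY _ Yj.
by rewrite (component_eq cX Xj) (component_eq cY Yj).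
Qed.

Lemma component_connected X : finite_set X -> is_component gen J X -> connected form (node_seq X).
Proof.
move=> fX cX S [x /(node_seqP _ fX)[a Xa ->] Sa] cl _ /(node_seqP _ fX)[b Xb ->].
have := Xb; rewrite {1}(component_eq cX Xa) => -[p [pp <-]].
elim: p a Xa Sa pp => [|c p IH] a Xa Sa //= /andP[/andP[ac cJ] pp]; rewrite inE in cJ.
have Xc : X c by have -> := component_eq cX Xa; exact: comp_step (comp_refl a) cJ ac.
apply: IH pp => //; have [<-//|nac] := eqVneq a c.
apply: (cl (sr a)) => //.
- by apply/(node_seqP _ fX); exists a.
- by apply/(node_seqP _ fX); exists c.
- by apply/eqP => /(link_edge nac); rewrite ac.
Qed.

End Components.
End DiagramLinks.

(** * Removing the components of J one by one *)

Section ConfigurationBound.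
Variables (R : realType) (Pi : choiceType) (W : groupType) (gen : Pi -> W).
Hypothesis cs : coxeter_system gen.
Variable J : set Pi.
Hypothesis sJ : spherical gen J.
Local Notation V := (rootspace R Pi).
Local Notation sr := (@simple_root R Pi).
Local Notation form := (@Defs.form R Pi W gen).
Local Notation act := (@geom_rep R Pi W gen).
Local Notation is_root := (@is_root R Pi W gen).
Local Notation perp_root := (@perp_root R Pi W gen J).
Local Notation component := (is_component gen J).
Local Notation lk := (link form).

Lemma finJ : finite_set J. Proof. by have := spherical_finite cs sJ. Qed.

Lemma component_finite X : component X -> finite_set X.
Proof. by move=> cX; apply: sub_finite_set finJ; exact: component_sub cX. Qed.

Lemma components_finite : finite_set [set X | component X].
Proof.
apply: (sub_finite_set (B := component_of gen J @` J)); last exact/finite_image/finJ.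
by move=> X [i Ji ->]; exists i.
Qed.

Definition has_type (P : set Pi -> Prop) X : nat := `[< P X >].

(** The contribution of a single component to [dim_bound], with truth values read as 0 or 1. *)
Definition weight X : nat :=
  (has_type (type_A gen 1) X + has_type (fun X => exists2 m, (4 < m)%N & type_D gen m X) X
   + has_type (type_E6 gen) X + has_type (type_I2_5 gen) X
   + 2 * (has_type (fun X => exists2 m, (1 < m)%N & type_A gen m X) X
          + has_type (type_D gen 4) X))%N.

Lemma has_typeT (P : set Pi -> Prop) X : P X -> has_type P X = 1%N.
Proof. by rewrite /has_type => /asboolT ->. Qed.

Lemma sum_has_type (L : seq (set Pi)) P : uniq L -> (forall X, X \in L -> component X) ->
  (\sum_(X <- L) has_type P X <= num_components gen J P)%N.
Proof.
move=> uL cL; have -> : (\sum_(X <- L) has_type P X = size [seq X <- L | `[< P X >]])%N.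
  rewrite size_filter -sum1_count [RHS]big_mkcond /=; apply: eq_bigr => X _.
  by rewrite /has_type; case: `[< _ >].
apply: uniq_leq_size; first exact: filter_uniq.
move=> X; rewrite mem_filter => /andP[/asboolP PX XL]; rewrite in_fset_set.
  by rewrite inE; split => //; exact: cL.
by apply: sub_finite_set components_finite => Y [].
Qed.

Lemma sum_weight (L : seq (set Pi)) : uniq L -> (forall X, X \in L -> component X) ->
  (\sum_(X <- L) weight X <= dim_bound gen J)%N.
Proof.
move=> uL cL; have e (F : set Pi -> nat) (l : seq (set Pi)) :
    (\sum_(X <- l) 2 * F X = 2 * \sum_(X <- l) F X)%N.
  by elim: l => [|X l IH]; rewrite ?big_nil// !big_cons IH mulnDr.
rewrite /weight 4!big_split /= e big_split /=.
by rewrite !leq_add ?leq_mul ?leq_add ?sum_has_type.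
Qed.

Lemma sum_card_components (L : seq (set Pi)) : uniq L -> (forall X, X \in L -> component X) ->
  (\sum_(X <- L) #|` fset_set X| <= #|` fset_set J|)%N.
Proof.
move=> uL cL.
have mf X i : X \in L -> (i \in fset_set X) = `[< X i >].
  by move=> XL; rewrite in_fset_set ?inE//; exact/component_finite/cL.
have -> : (\sum_(X <- L) #|` fset_set X| =
    size (flatten [seq enum_fset (fset_set X) | X <- L]))%N.
  elim: (L) => [|X l IH]; first by rewrite big_nil.
  by rewrite big_cons IH /= size_cat.
apply: uniq_leq_size; last first.
  move=> i /flatten_mapP[X XL]; rewrite mf// => /asboolP Xi; rewrite in_fset_set ?inE; last exact: finJ.
  exact: component_sub (cL X XL) i Xi.
elim: L uL cL mf => //= X L IH /andP[XL uL] cL mf; rewrite cat_uniq fset_uniq IH//=.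
- rewrite andbT; apply/hasPn => i /flatten_mapP[Y YL].
  have YL' : Y \in X :: L by rewrite inE YL orbT.
  rewrite mf// => /asboolP Yi; apply/negP => /=.
  rewrite mf ?mem_head// => /asboolP Xi; move/negP: XL; apply.
  have cX : component X by apply: cL; rewrite inE eqxx.
  have cY : component Y by apply: cL; rewrite inE YL orbT.
  by rewrite (component_eq cs cX Xi) -(component_eq cs cY Yi).
- by move=> Y YL; apply: cL; rewrite inE YL orbT.
- by move=> Y i YL; rewrite mf// inE YL orbT.
Qed.

Variable C : V -> Prop.
Hypotheses (C0 : C 0) (CD : forall u v, C u -> C v -> C (u + v)).
Hypotheses (CZ : forall a u, 0 <= a -> C u -> C (a *: u)).
Hypothesis C_anti : forall u, C u -> C (- u) -> u = 0.
Hypothesis C_pos : forall u, C u -> u <> 0 -> 0 < form u u.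
Hypothesis noperp : forall u, is_root u -> C u -> ~ perp_root u.

Lemma component_reduces D X : config form is_root C D -> component X ->
  {subset node_seq R X <= D} ->
  exists2 n, reduces form is_root C D (node_seq R X) n & (n <= weight X)%N.
Proof.
move=> cD cX XD; have fX := component_finite cX.
have Bl u : scalar (form^~ u) by exact: form_scalarl.
have Bs u v : form u v = form v u by exact: form_sym.
have rt1 u : is_root u -> form u u = 1 by exact: root_form.
have rr u v : is_root u -> is_root v -> is_root (v - (2 * form v u) *: u).
  by move=> [w [i ->]] rv; rewrite -act_reflection//; exact: root_act.
have cc := component_connected cs fX cX.
have X0 : node_seq R X <> [::].
  case: cX => i Ji XE; have: sr i \in node_seq R X.
    by apply/(node_seqP _ fX); exists i => //; rewrite XE; exact: comp_refl.
  by case: (node_seq R X).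
have red : reducible form is_root C D (node_seq R X) by apply: all_reducible => //.
rewrite /weight; case: red => [r|[r t]|[r t]].
- by exists 0%N.
- exists 1%N => //; case: t => [|[[m m4]|[|]]].
  + by move=> /(gram_type_A cs fX) /has_typeT ->.
  + move=> /(gram_type_D cs fX) tD; rewrite (has_typeT (P := fun X => exists2 m, _ & _)).
      by clear; lia.
    by exists m.
  + by move=> /(gram_type_E6 cs fX) /has_typeT ->; clear; lia.
  + by move=> /(gram_type_I5 cs fX) /has_typeT ->; clear; lia.
- exists 2%N => //; case: t => [[m m1]|].
  + move=> /(gram_type_A cs fX) tA.
    have -> : has_type (fun X => exists2 m, (1 < m)%N & type_A gen m X) X = 1%N.
      by apply: has_typeT; exists m.
    by clear; lia.
  + by move=> /(gram_type_D cs fX) /has_typeT ->; clear; lia.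
Qed.

(** [L] lists the components still to be removed, and the last hypothesis makes [D] orthogonal to
    those already gone. When [L] is empty, a remaining vertex would be a root of the cone orthogonal
    to [J], which [noperp] excludes. *)
Lemma config_bound (L : seq (set Pi)) D : uniq L -> (forall X, X \in L -> component X) ->
  config form is_root C D -> (forall X i, X \in L -> X i -> sr i \in D) ->
  (forall u i, u \in D -> J i -> (forall X, X \in L -> ~ X i) -> lk u (sr i) = 0) ->
  (size D <= \sum_(X <- L) (#|` fset_set X| + weight X))%N.
Proof.
elim: L D => [|X L IH] D /=.
  move=> _ _ cD _ oD; rewrite big_nil leqn0 size_eq0; apply/eqP.
  case: D cD oD => // u D cD oD; exfalso.
  have [ru Cu] := config_node cD (mem_head u D).
  apply: (noperp ru Cu); split => // i Ji.
  have := oD u i (mem_head u D) Ji; rewrite /link => /(_ (fun X h => False_ind _ (Bool.diff_false_true h))).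
  by lra.
move=> /andP[XL uL] cL cD LD oD.
have cX : component X by apply: cL; rewrite inE eqxx.
have cL' Y : Y \in L -> component Y by move=> YL; apply: cL; rewrite inE YL orbT.
have fX := component_finite cX.
have XD : {subset node_seq R X <= D}.
  by move=> _ /(node_seqP _ fX)[i Xi ->]; apply: (LD X) => //; rewrite inE eqxx.
have [n [D' [cD' oD' kD' sD' size_le]] nw] := component_reduces cD cX XD.
have out Y i : Y \in L -> Y i -> sr i \notin node_seq R X /\ orth form (node_seq R X) (sr i).
  move=> YL Yi; have XY : X <> Y by move=> e; move: XL; rewrite e YL.
  split.
    apply/negP => /(node_seqP _ fX)[k Xk /sr_inj e]; move: Xk; rewrite -e => Xi.
    by have [] := components_orth R cs cX (cL' Y YL) XY Xi Yi; rewrite eqxx.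
  move=> _ /(node_seqP _ fX)[k Xk ->].
  have [_] := components_orth R cs cX (cL' Y YL) XY Xk Yi.
  by rewrite /link form_sym.
rewrite big_cons; have h : (size D' <= \sum_(X <- L) (#|` fset_set X| + weight X))%N.
  apply: IH => //.
  - move=> Y i YL Yi; have [nX oX] := out Y i YL Yi; apply: kD' => //.
    by apply: (LD Y) => //; rewrite inE YL orbT.
  - move=> u i uD' Ji nL; have [Xi|nXi] := pselect (X i).
      by apply: oD' => //; apply/(node_seqP _ fX); exists i.
    apply: sD' uD' => v vD; apply: oD => // Y; rewrite inE => /orP[/eqP ->//|]; exact: nL.
have sX : size (node_seq R X) = #|` fset_set X| by rewrite size_map.
apply: leq_trans size_le _; rewrite sX -addnA addnC; apply: leq_add => //.
by rewrite leq_add2l.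
Qed.

End ConfigurationBound.

(** * The bound on the length of chains *)

Section ChainBound.
Variables (R : realType) (Pi : choiceType) (W : groupType) (gen : Pi -> W).
Hypothesis cs : coxeter_system gen.
Variable J : set Pi.
Hypothesis sJ : spherical gen J.
Variable f0 : rootspace R Pi -> R.
Hypothesis f0C : in_chamber gen J f0 f0.
Local Notation V := (rootspace R Pi).
Local Notation sr := (@simple_root R Pi).
Local Notation form := (@Defs.form R Pi W gen).
Local Notation act := (@geom_rep R Pi W gen).
Local Notation is_root := (@is_root R Pi W gen).
Local Notation perp_root := (@perp_root R Pi W gen J).

(** Pulled back by [x], the simple roots of [T] include those of [J], so the count applies to [J]
    itself. The cone consists of the vectors that [x] turns into nonnegative combinations of [T],
    where sphericity makes the form positive. *)
Lemma spherical_card x T : spherical gen T ->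
  (forall j, J j -> exists2 i, T i & act x (sr j) = sr i) ->
  (forall b, is_root b -> inV T (act x b) -> ~ perp_root b) ->
  (#|` fset_set T| <= #|` fset_set J| + dim_bound gen J)%N.
Proof.
move=> sT JT np; have fT : finite_set T := spherical_finite cs sT.
pose C v := pos (act x v) /\ inV T (act x v).
pose D := [seq act x^-1%g (sr i) | i <- fset_set T].
pose L : seq (set Pi) := enum_fset (fset_set [set X | is_component gen J X]).
have fC := components_finite cs sJ.
have LP X : (X \in L) = `[< is_component gen J X >] by rewrite in_fset_set ?inE.
have cL X : X \in L -> is_component gen J X by rewrite LP => /asboolP.
have uL : uniq L by exact: fset_uniq.
have aK v : act x (act x^-1%g v) = v by exact: actKV.
have C0 : C 0.
  rewrite /C act0//; split => [i|i]; rewrite monalg.mcoeff0// eqxx//.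
have CD u v : C u -> C v -> C (u + v).
  by move=> [pu iu] [pv iv]; rewrite /C actD//; split; [exact: posD|exact: inVD].
have CZ a u : 0 <= a -> C u -> C (a *: u).
  by move=> a0 [pu iu]; rewrite /C actZ//; split; [exact: posZ|exact: inVZ].
have C_anti u : C u -> C (- u) -> u = 0.
  move=> [pu _] [pv _]; rewrite actN// in pv.
  by apply: (act_inj cs (w := x)); rewrite act0//; exact: pos_neg0.
have C_pos u : C u -> u <> 0 -> 0 < form u u.
  move=> [_ iu] u0; rewrite -(act_isom cs x); apply: form_posdef sT _ iu _ => //.
  by apply/eqP => e; apply: u0; apply: (act_inj cs (w := x)); rewrite act0.
have noperp u : is_root u -> C u -> ~ perp_root u by move=> ru [_ iu]; exact: np.
have DP u : u \in D -> exists2 i, T i & u = act x^-1%g (sr i).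
  by move=> /mapP[i iT ->]; exists i => //; move: iT; rewrite in_fset_set// inE.
have cD : config form is_root C D.
  split.
  - rewrite map_inj_uniq ?fset_uniq// => i j /(act_inj cs); exact: sr_inj.
  - move=> u /DP[i Ti ->]; split; first by apply: root_act => //; exact: root_sr.
    by rewrite /C aK; split; [exact: pos_sr|exact: inV_sr].
  - move=> u v /DP[i Ti ->] /DP[j Tj ->] uv.
    have ij : i != j by apply/eqP => e; apply: uv; rewrite e.
    by rewrite /link act_isom//; have [] := cox_link R cs ij.
have -> : #|` fset_set T| = size D by rewrite size_map.
apply: leq_trans (config_bound cs sJ C0 CD CZ C_anti C_pos noperp uL cL cD _ _) _.
- move=> X i XL Xi; have [k Tk e] := JT i (component_sub (cL X XL) Xi).
  apply/mapP; exists k; first by rewrite in_fset_set// inE.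
  by rewrite -e actVK.
- move=> u i _ Ji /(_ (component_of gen J i)) h; exfalso; apply: h; last exact: comp_refl.
  by rewrite LP; apply/asboolP; exists i.
by rewrite big_split leq_add ?(sum_card_components cs sJ)// (sum_weight cs sJ).
Qed.

Lemma chain_card (s : {fset stratum gen J f0}) :
  comparable_fset (@le_stratum R Pi W gen J f0) s -> (#|` s| <= (dim_bound gen J).+1)%N.
Proof.
move=> sc; have [->|s0] := eqVneq s fset0; first by rewrite cardfs0.
have [x [T [sT JT np le]]] := chain_data cs sJ f0C sc s0.
by move: le (spherical_card sT JT np); clear; lia.
Qed.

End ChainBound.

Theorem theorem1 (R : realType) (Pi : choiceType) (W : groupType)
    (gen : Pi -> W) (J : set Pi) (Co : set (functionals R Pi)) :
  coxeter_system gen ->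
  spherical gen J ->
  is_C_min_open gen J Co ->
  (exists (X : topologicalType) (K : cells R X)
      (act : Gamma_min_vee gen J Co -> X -> X),
     [/\ is_cell_complex K,
         contractible R X,
         dim_at_most K (dim_bound gen J),
         is_cellular_action K act
       & acts_freely act])
  /\ cd_at_most (Gamma_min_vee gen J Co) (dim_bound gen J).
Proof.
move=> cs sJ [f0 f0W CoE].
have CP := CoP cs f0W CoE.
have f0C : in_chamber gen J (f0 : rootspace R Pi -> R) f0.
  have [f0K f0J f0p] := (complementP cs J f0).1 f0W; split => // v /f0p/eqP nz.
  by rewrite -expr2 exprn_even_gt0.
set G := Gamma_min_vee gen J Co.
pose w (g : G) : W := sval g.
have gP g : gamma_min_vee gen J Co (w g) by have := svalP g; rewrite inE.
have w1 : w 1%g = 1%g by [].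
have wM g h : w (g * h)%g = (w g * w h)%g by [].
pose P := stratum gen J (f0 : rootspace R Pi -> R).
have mv (g : G) (S : P) : exists S' : P, forall v, sgn S' v = sgn S (geom_rep gen (w g)^-1%g v).
  by apply: move_ex => // f hf; exact/CP/(gamma_Co cs f0W CoE (gP g))/CP.
pose av (g : G) (S : P) : P := projT1 (cid (mv g S)).
have avE g S v : sgn (av g S) v = sgn S (geom_rep gen (w g)^-1%g v).
  exact: projT2 (cid (mv g S)) v.
have av1 S : av 1%g S = S.
  by apply: stratum_ext => v _; rewrite avE w1 invg1 act1.
have avM g h S : av (g * h)%g S = av g (av h S).
  by apply: stratum_ext => v _; rewrite !avE wM invgM actM.
have avI g : injective (av g).
  by apply: (can_inj (g := av g^-1%g)) => S; rewrite -avM mulVg av1.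
have le_av g S T : le_stratum (av g S) (av g T) = le_stratum S T.
  apply/le_stratumP/le_stratumP => h v rv nz.
    have := h (geom_rep gen (w g) v) (root_act cs (w g) rv).
    by rewrite !avE actVK//; exact.
  by rewrite !avE in nz *; apply: h nz; exact: root_act.
pose simp : {fset P} -> Prop := comparable_fset (@le_stratum R Pi W gen J f0).
have [mu [rk pm]] : exists mu rk, perfect_matching simp mu rk by exact: stratum_matching.
have simp0 : simp fset0 by move=> u v; rewrite inE.
have av_simp g s : simp s -> simp [fset av g v | v in s]%fset.
  by move=> ss _ _ /imfsetP[u us ->] /imfsetP[v vs ->]; rewrite !le_av; exact: ss.
have zdim_av g S : zdim (av g S) = zdim S.
  have -> : zdim (av g S) = #|` fset_set (geom_rep gen (w g) @` zeros S)|.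
    congr (#|` fset_set _|); apply/seteqP; split => [v [rv zv]|_ [v [rv zv] <-]].
      exists (geom_rep gen (w g)^-1%g v); last exact: actKV.
      by split; [exact: root_act|rewrite -avE].
    by split; [exact: root_act|rewrite avE actVK].
  by rewrite fset_set_image ?card_imfset//; [exact: act_inj|exact: zeros_finite].
have av_free g s : simp s -> s != fset0 -> [fset av g v | v in s]%fset = s -> g = 1%g.
  move=> ss /fset0Pn[S Ss] e.
  have aS : av g S \in s by rewrite -e in_imfset.
  (* An element that preserves a chain fixes its members: it preserves [zdim], which is strictly
     monotone along the chain. *)
  have fixS : av g S = S.
    apply/eqP; apply: contraT => ne; have := ss _ _ aS Ss.
    by case/orP => /(zdim_lt cs); rewrite ?[S == _]eq_sym => /(_ ne); rewrite zdim_av ltnn.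
  apply: val_inj; apply: (fix_stratum cs sJ (S := S)); first by have [] := gP g.
  by move=> v rv; rewrite -{1}fixS avE actVK.
(* The strict order of strata is invariant and total on each chain, so it orients all simplices
   compatibly with the action. *)
pose lt : rel P := fun S T => le_stratum S T && (S != T).
have tour s : simp s -> {in s &, forall S T, S != T -> lt S T = ~~ lt T S}.
  move=> ss S T Ss Ts ne; rewrite /lt [T == S]eq_sym ne !andbT; have := ss S T Ss Ts.
  case ST : (le_stratum S T); case TS : (le_stratum T S) => // _.
  by move: ne; rewrite (le_stratum_anti (x := S) (y := T)) ?eqxx ?ST.
have av_lt g S T : lt (av g S) (av g T) = lt S T by rewrite /lt le_av (inj_eq (@avI g)).
have dim s : simp s -> (#|` s| <= (dim_bound gen J).+1)%N by exact: chain_card.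
have face := pm_face pm.
split; last exact: (matched_complex_cd pm tour av1 avM av_lt av_simp av_free simp0 dim).
exists (realization R simp), (rcells R simp), (ract av1 avM av_simp); split.
- exact: rcells_complex.
- exact: matched_contractible pm simp0.
- by move=> [s [ss s0]]; change ((#|` s|.-1 <= dim_bound gen J)%N); have := dim s ss; case: (#|` s|).
- exact: ract_cellular.
- exact: ract_free.
Qed.
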